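(* Let $t_+\ge 0$, $f\in C([t_+,\infty)\times\mathbb R^n,\mathbb R^n)$, $\frac{\partial f}{\partial x}\in C([t_+,\infty)\times\mathbb R^n,\mathrm L(\mathbb R^n))$, $A,B\in C^1([t_+,\infty),\mathrm L(\mathbb R^n))$, let the pencil $\lambda A(t)+B(t)$ be regular for each $t\ge t_+$ and suppose there are functions $C_1,C_2\colon[t_+,\infty)\to(0,\infty)$ with $C_2\in C^1([t_+,\infty),(0,\infty))$ such that for each $t\in[t_+,\infty)$, $\|(\lambda A(t)+B(t))^{-1}\|\le C_1(t)$ for all $\lambda$ with $|\lambda|\ge C_2(t)$. With the notation $P_j,Q_j,X_j,Y_j,G,L_{t_+},\Phi$ of the context, suppose: (1) EITHER both of the following hold: (1a) for each $t\in[t_+,\infty)$ and each $x_{p_1}\in X_1(t)$ there exists a unique $x_{p_2}\in X_2(t)$ such that $(t,x_{p_1}+x_{p_2})\in L_{t_+}$; (1b) for each $t_*\in[t_+,\infty)$, $x_{p_1}^*\in X_1(t_* )$, $x_{p_2}^*\in X_2(t_* )$ with $(t_*,x_{p_1}^*+x_{p_2}^* )\in L_{t_+}$, the operator $\Phi_{t_*,x_{p_1}^*}(x_{p_2}^* )\colon X_2(t_* )\to Y_2(t_* )$ is invertible; OR both of the following hold: (1a') for each $t\in[t_+,\infty)$ and each $x_{p_1}\in X_1(t)$ there exists $x_{p_2}\in X_2(t)$ such that $(t,x_{p_1}+x_{p_2})\in L_{t_+}$; (1b') for each $t_*\in[t_+,\infty)$, $x_{p_1}^*\in X_1(t_* )$,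 $x_{p_2}^1,x_{p_2}^2\in X_2(t_* )$ with $(t_*,x_{p_1}^*+x_{p_2}^i)\in L_{t_+}$, $i=1,2$, the operator function $\Phi_{t_*,x_{p_1}^*}\colon X_2(t_* )\to\mathrm L(X_2(t_* ),Y_2(t_* ))$ is basis invertible on the segment $[x_{p_2}^1,x_{p_2}^2]$. (2) There exist $k\in C([t_+,\infty),\mathbb R)$, $U\in C((0,\infty),(0,\infty))$, a number $R>0$ and a positive definite function $V\in C^1([t_+,\infty)\times U_R^c(0),\mathbb R)$, where $U_R^c(0)=\{z\in\mathbb R^n:\|z\|\ge R\}$, such that $\int_{v_0}^\infty \frac{dv}{U(v)}=\infty$ (for some constant $v_0>0$); $V(t,z)\to\infty$ as $\|z\|\to\infty$ uniformly in $t$ on each finite interval $[a,b)\subset[t_+,\infty)$; and for all $t\in[t_+,\infty)$, $x_{p_1}\in X_1(t)$, $x_{p_2}\in X_2(t)$ with $(t,x_{p_1}+x_{p_2})\in L_{t_+}$ and $\|x_{p_1}\|\ge R$, $$\frac{\partial V}{\partial t}(t,x_{p_1})+\Big(\frac{\partial V}{\partial z}(t,x_{p_1}),\,[P_1'(t)-G^{-1}(t)Q_1(t)(A'(t)+B(t))]x_{p_1}+G^{-1}(t)Q_1(t)f(t,x_{p_1}+x_{p_2})\Big)\le k(t)\,U\big(V(t,x_{p_1})\big).$$ Let $t_0\ge t_+$ and $T>t_0$. In addition, let the operator $\Phi_{t_*,P_1(t_* )z_*}(P_2(t_* )u_* )\colon X_2(t_* )\to Y_2(t_* )$ be invertible for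 each point $(t_*,P_1(t_* )z_*+P_2(t_* )u_* )\in[t_0,T]\times\mathbb R^n$. Let $A,B\in C^3([t_0,T],\mathrm L(\mathbb R^n))$, $C_2\in C^3([t_0,T],(0,\infty))$, $f\in C^2([t_0,T]\times\mathbb R^n,\mathbb R^n)$, and let $x_0\in\mathbb R^n$ be chosen so that $(t_0,x_0)\in L_{t_+}$. For $N\in\mathbb N$ put $h=(T-t_0)/N$, $t_i=t_0+ih$ ($i=0,\dots,N$). Then the method $$z_0=P_1(t_0)x_0,\qquad u_0=P_2(t_0)x_0,$$ $$\widetilde z_{i+1}=\Big[I+h\big(P_1'(t_i)-G^{-1}(t_i)Q_1(t_i)[A'(t_i)+B(t_i)]\big)P_1(t_i)\Big]z_i+h\,G^{-1}(t_i)Q_1(t_i)f(t_i,x_i),$$ $$\begin{aligned}\widetilde u_{i+1}=u_i-\Big[I-&G^{-1}(t_{i+1})Q_2(t_{i+1})\tfrac{\partial f}{\partial x}\big(t_{i+1},P_1(t_{i+1})\widetilde z_{i+1}+P_2(t_{i+1})u_i\big)P_2(t_{i+1})\Big]^{-1}\\ &\times\Big[u_i-G^{-1}(t_{i+1})Q_2(t_{i+1})\big[f\big(t_{i+1},P_1(t_{i+1})\widetilde z_{i+1}+P_2(t_{i+1})u_i\big)-A'(t_{i+1})P_1(t_{i+1})\widetilde z_{i+1}\big]\Big],\end{aligned}$$ $$\begin{aligned}z_{i+1}=&\Big[I+\tfrac h2\big(P_1'(t_i)-G^{-1}(t_i)Q_1(t_i)[A'(t_i)+B(t_i)]\big)P_1(t_i)\Big]z_i\\&+\tfrac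 h2\big(P_1'(t_{i+1})-G^{-1}(t_{i+1})Q_1(t_{i+1})[A'(t_{i+1})+B(t_{i+1})]\big)P_1(t_{i+1})\widetilde z_{i+1}\\&+\tfrac h2\Big[G^{-1}(t_i)Q_1(t_i)f(t_i,x_i)+G^{-1}(t_{i+1})Q_1(t_{i+1})f\big(t_{i+1},P_1(t_{i+1})\widetilde z_{i+1}+P_2(t_{i+1})\widetilde u_{i+1}\big)\Big],\end{aligned}$$ $$\begin{aligned}u_{i+1}=u_i-\Big[I-&G^{-1}(t_{i+1})Q_2(t_{i+1})\tfrac{\partial f}{\partial x}\big(t_{i+1},P_1(t_{i+1})z_{i+1}+P_2(t_{i+1})u_i\big)P_2(t_{i+1})\Big]^{-1}\\ &\times\Big[u_i-G^{-1}(t_{i+1})Q_2(t_{i+1})\big[f\big(t_{i+1},P_1(t_{i+1})z_{i+1}+P_2(t_{i+1})u_i\big)-A'(t_{i+1})P_1(t_{i+1})z_{i+1}\big]\Big],\end{aligned}$$ $$x_{i+1}=P_1(t_{i+1})z_{i+1}+P_2(t_{i+1})u_{i+1},\qquad i=0,\dots,N-1,$$ (where $I=I_{\mathbb R^n}$), which approximates on $[t_0,T]$ the initial value problem $\frac{d}{dt}[A(t)x(t)]+B(t)x(t)=f(t,x(t))$, $x(t_0)=x_0$, is convergent of order 2, that is, $$\max_{1\le i\le N}\|x(t_i)-x_i\|=O(h^2),\qquad h\to0,$$ where $x(t)$ is an exact solution of this initial value problem.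
   Context: $\mathrm L(X,Y)$ is the space of (continuous) linear operators from $X$ to $Y$, $\mathrm L(X)=\mathrm L(X,X)$; $(\cdot,\cdot)$ is the inner product and $\|\cdot\|$ the norm on $\mathbb R^n$. The operators $A(t),B(t)$ may be noninvertible. Solution: a function $x\in C([t_0,t_1),\mathbb R^n)$ is a solution of $\frac{d}{dt}[A(t)x]+B(t)x=f(t,x)$ on $[t_0,t_1)$ if $A(t)x(t)$ is continuously differentiable on $[t_0,t_1)$ and $x$ satisfies the equation there; it solves the initial value problem if also $x(t_0)=x_0$. The exact solution considered is the global one, i.e. on $[t_0,\infty)$. Pencil: $\lambda A(t)+B(t)$ ($\lambda$ a complex parameter) is regular for a given $t$ if $(\lambda A(t)+B(t))^{-1}$ exists for some $\lambda$. Spectral projectors: for each $t\ge t_+$, $$P_1(t)=\frac1{2\pi \mathrm i}\oint_{|\lambda|=C_2(t)}(\lambda A(t)+B(t))^{-1}A(t)\,d\lambda,\quad Q_1(t)=\frac1{2\pi \mathrm i}\oint_{|\lambda|=C_2(t)}A(t)(\lambda A(t)+B(t))^{-1}\,d\lambda,$$ $P_2(t)=I_{\mathbb R^n}-P_1(t)$, $Q_2(t)=I_{\mathbb R^n}-Q_1(t)$. These are real projectors; $X_j(t)=P_j(t)\mathbb R^n$, $Y_j(t)=Q_j(t)\mathbb R^n$ ($j=1,2$), so $\mathbb R^n=X_1(t)\dot+X_2(t)=Y_1(t)\dot+Y_2(t)$, and $A(t),B(t)$ map $X_j(t)$ into $Y_j(t)$. The operator $G(t)=A(t)+B(t)P_2(t)\in\mathrm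 L(\mathbb R^n)$ is invertible and $G(t)X_j(t)=Y_j(t)$. The operator functions $P_j,Q_j,G,G^{-1}$ have the same smoothness in $t$ as $A,B,C_2$; primes denote $d/dt$. Consistency manifold: $$L_{t_+}=\{(t,x)\in[t_+,\infty)\times\mathbb R^n: Q_2(t)[A'(t)P_1(t)x+B(t)x-f(t,x)]=0\}.$$ Operator function $\Phi$: for $t_*\in[t_+,\infty)$, $x_{p_1}^*\in X_1(t_* )$, $x_{p_2}\in X_2(t_* )$, $$\Phi_{t_*,x_{p_1}^*}(x_{p_2})=\Big[\frac{\partial}{\partial x}\big[Q_2(t_* )f(t_*,x_{p_1}^*+x_{p_2})\big]-B(t_* )\Big]P_2(t_* )\colon X_2(t_* )\to Y_2(t_* ).$$ Basis invertibility: an additive resolution of the identity in an $s$-dimensional space $Z$ is a system of $s$ projectors $\Theta_k\in \mathrm L(Z)$ with $\Theta_i\Theta_j=\delta_{ij}\Theta_i$ and $\sum_{k=1}^s\Theta_k=I_Z$. For $s$-dimensional spaces $W,Z$ and $D\subset W$, an operator function $\Phi\colon D\to\mathrm L(W,Z)$ is basis invertible on an interval (segment) $J\subset D$ if for some additive resolution of the identity $\{\Theta_k\}_{k=1}^s$ in $Z$ and for any set $\{w^k\}_{k=1}^s\subset J$ the operator $\sum_{k=1}^s\Theta_k\Phi(w^k)\in\mathrm L(W,Z)$ is invertible. Positive definite function: $V$ on $[t_+,\infty)\times U_R^c(0)$ is positive definite in the usual (Lyapunov) sense, i.e. $V(t,z)\ge W(z)$ for some continuous function $W$ with $W(z)>0$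 for $z\in U_R^c(0)$.
   Formalization: In the additive resolution of the identity used for basis invertibility, the s projectors are required to be nonzero (hence one-dimensional); with zero projectors allowed, a global exact solution can fail to exist. *)

(* Defs.v *)
From HB Require Import structures.
From mathcomp Require Export all_boot all_order all_algebra.
From mathcomp Require Export complex.
From mathcomp Require Export all_classical all_reals all_analysis.

Set Implicit Arguments.
Unset Strict Implicit.
Unset Printing Implicit Defensive.

Export Order.TTheory GRing.Theory Num.Theory.
Export numFieldNormedType.Exports.

Global Open Scope classical_set_scope.
Global Open Scope ring_scope.

(* Derivatives relative to a set D, so that C^k makes sense on sets that are
   not open: same as the library's [derivable] and [derive], except that only
   the increments h with a + h v in D are considered.  At an endpoint of an
   interval this is the one-sided derivative, and at an interior point of D
   it is the usual one. *)
Section relative_derivative.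
Context {R : realType} {E F : normedModType R}.
Implicit Types (D dirs : set E) (g : E -> F) (a v : E).

Definition derivable_in D g a v : Prop :=
  cvg ((fun h : R => h^-1 *: (g (h *: v + a) - g a))
         @ within [set h : R | D (h *: v + a)] 0^').

Definition derive_in D g a v : F :=
  lim ((fun h : R => h^-1 *: (g (h *: v + a) - g a))
         @ within [set h : R | D (h *: v + a)] 0^').

(* All iterated partial derivatives of order <= k along the coordinate
   directions [dirs] exist and are continuous on D. *)
Fixpoint Ck_on dirs (k : nat) D g : Prop :=
  {within D, continuous g} /\
  if k is k'.+1 then
    forall v, dirs v ->
      (forall a, D a -> derivable_in D g a v) /\
      Ck_on dirs k' D (fun a => derive_in D g a v)
  else True.

End relative_derivative.

Section smooth_functions.
Context {R : realType} {n : nat} {F : normedModType R}.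

Definition Ck_time (k : nat) (J : set R) (g : R -> F) : Prop :=
  Ck_on [set (1 : R)] k J g.

Definition coord_dirs : set (R * 'cV[R]_n) :=
  [set v | v = (1, 0) \/ exists j, v = (0, delta_mx j 0)].

Definition Ck_time_space (k : nat) (D : set (R * 'cV[R]_n))
    (g : R -> 'cV[R]_n -> F) : Prop :=
  Ck_on coord_dirs k D (fun p => g p.1 p.2).

Definition ddt (J : set R) (g : R -> F) (t : R) : F := derive_in J g t 1.

End smooth_functions.

Section euclidean.
Context {R : realType} {n : nat}.

Definition dotv (x y : 'cV[R]_n) : R := \sum_i x i 0 * y i 0.

(* The library's norm on matrices is the max norm *)
Definition enorm (x : 'cV[R]_n) : R := Num.sqrt (dotv x x).

Definition enormC (x : 'cV[R[i]]_n) : R :=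
  Num.sqrt (\sum_i (complex.Re (x i 0) ^+ 2 + complex.Im (x i 0) ^+ 2)).

Definition opnormC (M : 'M[R[i]]_n) : R :=
  sup [set enormC (M *m x) | x in [set x | enormC x <= 1]].

(* The library's 'J is the jacobian for row vectors *)
Definition Jac (g : 'cV[R]_n -> 'cV[R]_n) (x : 'cV[R]_n) : 'M[R]_n :=
  \matrix_(i, j) ('d g x (delta_mx j 0 : 'cV[R]_n)) i 0.

Definition exterior (rho : R) : set 'cV[R]_n := [set z | rho <= enorm z].

End euclidean.

Section contour.
Context {R : realType}.
Local Open Scope complex_scope.

(* Integral over the positively oriented circle |lambda| = r *)
Definition contour_integral (r : R) (g : R[i] -> R[i]) : R[i] :=
  let lam (th : R) : R[i] := r%:C * (cos th +i* sin th) in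
  let integrand (th : R) : R[i] := g (lam th) * ('i%C * lam th) in
  (\int[@lebesgue_measure R]_(th in `[0%R, (2 * pi)%R]) complex.Re (integrand th))
  +i* (\int[@lebesgue_measure R]_(th in `[0%R, (2 * pi)%R]) complex.Im (integrand th)).

Definition contour_mx (n : nat) (r : R) (M : R[i] -> 'M[R[i]]_n) : 'M[R[i]]_n :=
  \matrix_(i, j) contour_integral r (fun lam => M lam i j).

End contour.

Section basis_invertibility.
Context {R : realType}.

(* Zero projectors have to be excluded: s nonzero projectors with these
   relations in an s-dimensional space are exactly one-dimensional ones.
   With zero projectors allowed one could take Theta = (I, 0, ..., 0), and
   basis invertibility would collapse to pointwise invertibility. *)
Definition additive_resolution (Z : vectType R) (s : nat)
    (Theta : 'I_s -> 'End(Z)) : Prop :=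
  [/\ forall i, Theta i != 0,
      forall i j, (Theta i \o Theta j)%VF = (if i == j then Theta i else 0)
    & \sum_k Theta k = \1%VF].

(* The common dimension s of W and Z is read off Z *)
Definition basis_invertible (W Z : vectType R) (Phi : W -> 'Hom(W, Z))
    (J : set W) : Prop :=
  exists Theta : 'I_(\dim {: Z}) -> 'End(Z),
    additive_resolution Theta /\
    forall w : 'I_(\dim {: Z}) -> W, (forall k, J (w k)) ->
      bijective (\sum_k (Theta k \o Phi (w k))%VF : 'Hom(W, Z)).

Definition segment (W : vectType R) (x y : W) : set W :=
  [set (1 - s) *: x + s *: y | s in `[0, 1]%classic].

End basis_invertibility.

Section dae.
Context {R : realType} {n : nat}.
Variables (A B : R -> 'M[R]_n) (C2 : R -> R) (f : R -> 'cV[R]_n -> 'cV[R]_n).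

Definition pencil (t : R) (lam : R[i]) : 'M[R[i]]_n :=
  lam *: map_mx (real_complex R) (A t) + map_mx (real_complex R) (B t).

Definition regular_pencil (t : R) : Prop :=
  exists lam : R[i], pencil t lam \in unitmx.

Definition spectral_P1 (t : R) : 'M[R[i]]_n :=
  (2 * (pi%:C)%C * ('i)%C)^-1 *:
    contour_mx (C2 t)
      (fun lam => invmx (pencil t lam) *m map_mx (real_complex R) (A t)).

Definition spectral_Q1 (t : R) : 'M[R[i]]_n :=
  (2 * (pi%:C)%C * ('i)%C)^-1 *:
    contour_mx (C2 t)
      (fun lam => map_mx (real_complex R) (A t) *m invmx (pencil t lam)).

(* The complex matrices spectral_P1, spectral_Q1 have real entries *)
Definition P1 (t : R) : 'M[R]_n := map_mx (@complex.Re R) (spectral_P1 t).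
Definition Q1 (t : R) : 'M[R]_n := map_mx (@complex.Re R) (spectral_Q1 t).
Definition P2 (t : R) : 'M[R]_n := 1%:M - P1 t.
Definition Q2 (t : R) : 'M[R]_n := 1%:M - Q1 t.

Definition range_mx (M : 'M[R]_n) : {vspace 'cV[R]_n} :=
  limg (linfun (mulmx M : 'cV[R]_n -> 'cV[R]_n)).

Definition X1 (t : R) : {vspace 'cV[R]_n} := range_mx (P1 t).
Definition X2 (t : R) : {vspace 'cV[R]_n} := range_mx (P2 t).
Definition Y2 (t : R) : {vspace 'cV[R]_n} := range_mx (Q2 t).

Definition G (t : R) : 'M[R]_n := A t + B t *m P2 t.

(* The operator X -> Y induced by a matrix that maps X into Y; on the values
   M x in Y, vsproj Y is just the corestriction *)
Definition restrict_mx (X Y : {vspace 'cV[R]_n}) (M : 'M[R]_n) :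
    'Hom(subvs_of X, subvs_of Y) :=
  linfun (vsproj Y \o (mulmx M : 'cV[R]_n -> 'cV[R]_n) \o vsval).

Definition Phi (t : R) (xp1 : 'cV[R]_n) (xp2 : subvs_of (X2 t)) :
    'Hom(subvs_of (X2 t), subvs_of (Y2 t)) :=
  restrict_mx (X2 t) (Y2 t)
    ((Jac (fun x => Q2 t *m f t x) (xp1 + vsval xp2) - B t) *m P2 t).

Definition consistency_manifold (tp : R) : set (R * 'cV[R]_n) :=
  [set p | tp <= p.1 /\
    Q2 p.1 *m (ddt `[tp, +oo[ A p.1 *m P1 p.1 *m p.2
               + B p.1 *m p.2 - f p.1 p.2) = 0].

Definition is_solution (J : set R) (x : R -> 'cV[R]_n) : Prop :=
  [/\ {within J, continuous x},
      Ck_time 1 J (fun t => A t *m x t)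
    & forall t, J t -> ddt J (fun s => A s *m x s) t + B t *m x t = f t (x t)].

Section method.
Variables (tp t0 T : R) (x0 : 'cV[R]_n) (N : nat).

Definition mesh : R := (T - t0) / N%:R.
Definition node (i : nat) : R := t0 + i%:R * mesh.

Local Notation A' := (ddt `[tp, +oo[ A).
Local Notation P1' := (ddt `[tp, +oo[ P1).

Definition drift (t : R) : 'M[R]_n :=
  (P1' t - invmx (G t) *m Q1 t *m (A' t + B t)) *m P1 t.

Definition forcing (t : R) (x : 'cV[R]_n) : 'cV[R]_n :=
  invmx (G t) *m Q1 t *m f t x.

(* One Newton step from u for the equation
   u = G^-1 Q2 [f(t, P1 z + P2 u) - A' P1 z] *)
Definition newton_step (t : R) (z u : 'cV[R]_n) : 'cV[R]_n :=
  let x := P1 t *m z + P2 t *m u in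
  u - invmx (1%:M - invmx (G t) *m Q2 t *m Jac (f t) x *m P2 t)
      *m (u - invmx (G t) *m Q2 t *m (f t x - A' t *m P1 t *m z)).

(* The states are the triples (z_i, u_i, x_i) *)
Definition method_step (i : nat) (s : 'cV[R]_n * 'cV[R]_n * 'cV[R]_n) :
    'cV[R]_n * 'cV[R]_n * 'cV[R]_n :=
  let: (z, u, x) := s in
  let h := mesh in
  let t := node i in
  let t' := node i.+1 in
  let zt := (1%:M + h *: drift t) *m z + h *: forcing t x in
  let ut := newton_step t' zt u in
  let z' := (1%:M + (h / 2) *: drift t) *m z
            + (h / 2) *: (drift t' *m zt)
            + (h / 2) *: (forcing t x
                          + forcing t' (P1 t' *m zt + P2 t' *m ut)) in
  let u' := newton_step t' z' u in
  (z', u', P1 t' *m z' + P2 t' *m u').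

Fixpoint method_state (i : nat) : 'cV[R]_n * 'cV[R]_n * 'cV[R]_n :=
  if i is i'.+1 then method_step i' (method_state i')
  else (P1 t0 *m x0, P2 t0 *m x0, x0).

Definition method_x (i : nat) : 'cV[R]_n := (method_state i).2.

Definition max_error (x : R -> 'cV[R]_n) : R :=
  \big[Num.max/0]_(1 <= i < N.+1) enorm (x (node i) - method_x i).

End method.
End dae.

(* Main.v *)
(* Since the resolvent is bounded for |lambda| >= C2, the matrix E = (C2 A + B)^-1 A
   has index at most one; averaging a resolvent over the circle identifies P1 with the
   projector on the range of E along its kernel. Hence G is invertible,
   G P1 = A = Q1 G and Q2 B = B P2, and the increments of P1 are expressible through
   those of A and B, so that P1, Q1 and G^-1 are as smooth as A and B. With z = P1 x and
   u = P2 x the equation becomes z' = (drift) z + G^-1 Q1 f(t, z + u) together with the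
   algebraic equation u = G^-1 Q2 [f(t, z + u) - A' z].

   Existence: condition (1) makes the algebraic equation uniquely solvable, u = eta(t, z),
   with an invertible linearisation (in its second form uniqueness is Rolle's theorem in
   each coordinate of the resolution of the identity); eta is continuous and locally
   Lipschitz in z by a contraction argument. The reduced equation is solved by
   truncation and Picard iteration, its range condition P1 z = z is preserved, and the
   Lyapunov function bounds the solutions on bounded time intervals.

   Convergence: the exact z and u have Lipschitz first derivatives on [t0, T], so the
   trapezoidal rule has a local error O(h^3), while one Newton step turns an error O(h)
   in u into O(h^2). A discrete Gronwall argument then gives the global error O(h^2). *)
Require Import Defs.
From mathcomp Require Import ring lra.

Set Implicit Arguments.
Unset Strict Implicit.
Unset Printing Implicit Defensive.

(** The data are smooth only relative to closed time sets, and of a solution only [A x], not [x], is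
    known to be differentiable. Two choices follow. Derivatives relative to a set are kept in
    Caratheodory's form, where the rules of differentiation reduce to the continuity of an explicit
    slope. Taylor expansions are replaced by increments that are O(|s - t|^k) uniformly on the
    interval; such estimates pass through the implicit relation for [u] without differentiating it.

    No residue calculus enters the evaluation of [P1] and [Q1]: the average of (1 - s w H)^-1, with
    w running over the inverses of the points of the circle, does not depend on s in [0, 1] and
    equals 1 at s = 0. Differentiation under the integral sign is avoided as well; the integral over
    the circle only has to be continuous in time.

    Estimates are made in the max norm, the library norm of matrices. The Euclidean norm occurs in
    the Lyapunov data and in the final error, and is compared with the max norm up to a factor n. *)

Section matrix_topology.
Context {R : realType}.

Lemma mx_norm_le {m n} (M : 'M[R]_(m, n)) c :
  0 <= c -> (forall i j, `|M i j| <= c) -> `|M| <= c.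
Proof.
move=> c0 Mc; rewrite [leLHS]/Num.Def.normr/= mx_normrE.
by apply/bigmax_leP; split => // -[i j] _; exact: Mc.
Qed.

Lemma le_mx_norm {m n} (M : 'M[R]_(m, n)) i j : `|M i j| <= `|M|.
Proof.
rewrite [leRHS]/Num.Def.normr/= mx_normrE.
exact: (le_bigmax _ (fun ij : 'I_m * 'I_n => `|M ij.1 ij.2|) (i, j)).
Qed.

(** The norm is the largest entry, hence not submultiplicative: the inner dimension appears, and
    this is the source of the factors [n%:R] in all later estimates. *)
Lemma mulmx_norm {m n p} (M : 'M[R]_(m, n)) (N : 'M[R]_(n, p)) :
  `|M *m N| <= n%:R * `|M| * `|N|.
Proof.
apply: mx_norm_le => [|i j]; first by rewrite !mulr_ge0.
rewrite mxE (le_trans (ler_norm_sum _ _ _))//.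
rewrite -mulrA -[n in n%:R]card_ord -sumr_const mulr_suml.
rewrite ler_sum// => k _; rewrite mul1r normrM.
by rewrite ler_pM// le_mx_norm.
Qed.

(** * Limits of matrix-valued functions *)

Section filter.
Context {T : Type} (F : set_system T) {FF : Filter F}.

Lemma cvg_mxP {m n} (X : T -> 'M[R]_(m, n)) (M : 'M[R]_(m, n)) :
  X @ F --> M <-> forall i j, (fun t => X t i j) @ F --> M i j.
Proof.
split=> [XM i j|XM].
  apply: (@cvg_comp _ _ _ X (fun M : 'M[R]_(m, n) => M i j) F _ _ XM).
  exact: coord_continuous.
move=> U [P MP PU]; rewrite nbhs_filterE /=.
have : F [set t | forall ij : 'I_m * 'I_n, P ij.1 ij.2 (X t ij.1 ij.2)].
  apply: filter_forall => -[i j]; exact: (XM i j _ (MP i j)).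
by apply: filterS => t tP; apply: PU => i j; exact: (tP (i, j)).
Qed.

Lemma cvg_pairl {U V : topologicalType} (f : T -> U) (g : T -> V)
    (x : U) (y : V) :
  f @ F --> x -> g @ F --> y -> (fun t => (f t, g t)) @ F --> (x, y).
Proof. by move=> fx gy; apply: cvg_pair. Qed.

Lemma cvg_sum {I : Type} (r : seq I) (P : pred I) (V : normedModType R)
    (X : I -> T -> V) (M : I -> V) :
  (forall i, P i -> X i @ F --> M i) ->
  (fun t => \sum_(i <- r | P i) X i t) @ F --> \sum_(i <- r | P i) M i.
Proof.
move=> XM; elim: r => [|i r IH].
  rewrite big_nil; under eq_fun do rewrite big_nil; exact: cvg_cst.
rewrite big_cons; under eq_fun do rewrite big_cons.
by case: ifPn => // Pi; apply: cvgD => //; exact: XM.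
Qed.

Lemma cvg_prod {I : Type} (r : seq I) (P : pred I)
    (X : I -> T -> R) (M : I -> R) :
  (forall i, P i -> X i @ F --> M i) ->
  (fun t => \prod_(i <- r | P i) X i t) @ F --> \prod_(i <- r | P i) M i.
Proof.
move=> XM; elim: r => [|i r IH].
  rewrite big_nil; under eq_fun do rewrite big_nil; exact: cvg_cst.
rewrite big_cons; under eq_fun do rewrite big_cons.
by case: ifPn => // Pi; apply: cvgM => //; exact: XM.
Qed.

Lemma cvg_mulmx {m n p} (X : T -> 'M[R]_(m, n)) (Y : T -> 'M[R]_(n, p))
    (M : 'M[R]_(m, n)) (N : 'M[R]_(n, p)) :
  X @ F --> M -> Y @ F --> N -> (fun t => X t *m Y t) @ F --> M *m N.
Proof.
move=> /cvg_mxP XM /cvg_mxP YN; apply/cvg_mxP => i j.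
rewrite mxE; under eq_fun do rewrite mxE.
by apply: cvg_sum => k _; apply: cvgM.
Qed.

Lemma cvg_det {n} (X : T -> 'M[R]_n) (M : 'M[R]_n) :
  X @ F --> M -> (fun t => \det (X t)) @ F --> \det M.
Proof.
move=> /cvg_mxP XM; rewrite /determinant.
apply: cvg_sum => s _; apply: cvgM; first exact: cvg_cst.
exact: cvg_prod.
Qed.

(** The determinant tends to a nonzero limit, so [X] is eventually invertible and its inverse is
    there the adjugate divided by the determinant, a continuous expression in the entries. *)
Lemma cvg_invmx {n} (X : T -> 'M[R]_n) (M : 'M[R]_n) :
  M \in unitmx -> X @ F --> M -> (fun t => invmx (X t)) @ F --> invmx M.
Proof.
move=> Mu XM.
have dM : \det M != 0 by rewrite -unitfE -unitmxE.
have dX := cvg_det XM.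
have Xu : \forall t \near F, X t \in unitmx.
  have dXn := @cvgr_neq0 _ _ _ F FF _ _ dX dM.
  by near=> t; rewrite unitmxE unitfE; near: t.
apply: (@cvg_trans _ ((fun t => (\det (X t))^-1 *: \adj (X t)) @ F)).
  apply: near_eq_cvg; near=> t; rewrite /invmx ifT//; near: t; exact: Xu.
rewrite /invmx Mu; apply: cvgZ; first exact: cvgV.
move/cvg_mxP : XM => XM; apply/cvg_mxP => i j; rewrite mxE.
under eq_fun do rewrite mxE.
rewrite /cofactor; apply: cvgM; first exact: cvg_cst.
apply: cvg_det; apply/cvg_mxP => k l; rewrite !mxE.
under eq_fun do rewrite !mxE; exact: XM.
Unshelve. all: by end_near. Qed.

End filter.
End matrix_topology.

(** * Derivatives relative to a set *)

(* Caratheodory's form of the derivative relative to a set. *)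
Definition der {R : realType} {V : normedModType R} (J : set R) (g : R -> V)
    (t : R) (d : V) : Prop :=
  exists2 sigma : R -> V, (forall s, J s -> g s - g t = (s - t) *: sigma s) &
    sigma s @[s --> within J (nbhs t)] --> d.

Section der.
Context {R : realType}.
Implicit Types (J : set R) (t : R).

Section normed.
Context {V : normedModType R}.
Implicit Types (g : R -> V) (d : V).

Lemma der_cst J t (v : V) : der J (fun=> v) t 0.
Proof. by exists (fun=> 0) => [s _|]; [rewrite subrr scaler0|exact: cvg_cst]. Qed.

Lemma derD J g1 g2 t d1 d2 : der J g1 t d1 -> der J g2 t d2 ->
  der J (fun s => g1 s + g2 s) t (d1 + d2).
Proof.
move=> [s1 E1 c1] [s2 E2 c2]; exists (fun s => s1 s + s2 s) => [s Js|].
  by rewrite scalerDr -E1// -E2// opprD addrACA.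
exact: cvgD.
Qed.

Lemma derN J g t d : der J g t d -> der J (fun s => - g s) t (- d).
Proof.
move=> [s1 E1 c1]; exists (fun s => - s1 s) => [s Js|]; last exact: cvgN.
by rewrite scalerN -E1// opprB addrC opprK.
Qed.

Lemma derB J g1 g2 t d1 d2 : der J g1 t d1 -> der J g2 t d2 ->
  der J (fun s => g1 s - g2 s) t (d1 - d2).
Proof. by move=> D1 /derN; exact: derD. Qed.

Lemma der_subset J J' g t d : J' `<=` J -> der J g t d -> der J' g t d.
Proof.
move=> JJ [s1 E1 c1]; exists s1 => [s /JJ|]; first exact: E1.
apply: cvg_trans c1; apply: cvg_app.
move=> U WU; apply: (@filterS _ (nbhs t) _ _ _ _ WU) => s Us /JJ; exact: Us.
Qed.

Lemma der_eq J g1 g2 t d : J t -> (forall s, J s -> g1 s = g2 s) ->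
  der J g1 t d -> der J g2 t d.
Proof.
by move=> Jt E [s1 E1 c1]; exists s1 => // s Js; rewrite -!E// E1.
Qed.

Lemma der_cvg J g t d : der J g t d -> g s @[s --> within J (nbhs t)] --> g t.
Proof.
move=> [s1 E1 c1].
apply: (@cvg_trans _ ((fun s => g t + (s - t) *: s1 s) @ within J (nbhs t))).
  apply: near_eq_cvg; near=> s.
  rewrite -E1 ?subrKC//; near: s; exact: withinT.
rewrite -{2}[g t]addr0 -(scale0r d) -(subrr t).
apply: cvgD; first exact: cvg_cst.
apply: cvgZ => //; apply: cvgB; last exact: cvg_cst.
exact: cvg_within.
Unshelve. all: by end_near. Qed.

Lemma der_continuous J g (d : R -> V) : (forall t, J t -> der J g t (d t)) ->
  {within J, continuous g}.
Proof.
by move=> D; apply/subspace_continuousP => t Jt; exact: der_cvg (D _ Jt).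
Qed.

Lemma der_quotient J g t d : der J g t d ->
  (fun h : R => h^-1 *: (g (h *: 1 + t) - g t))
         @ within [set h : R | J (h *: 1 + t)] 0^' --> d.
Proof.
move=> [s1 E1 c1].
apply: (@cvg_trans _ ((fun h => s1 (h *: 1 + t)) @
    within [set h : R | J (h *: 1 + t)] 0^')).
  apply: near_eq_cvg; near=> h.
  have h0 : h != 0.
    near: h; rewrite near_withinE; near=> h => _.
    by near: h; exact: nbhs_dnbhs_neq.
  rewrite E1; last by near: h; exact: withinT.
  by rewrite addrK scalerA [h%:A]mulr1 mulVf ?scale1r.
apply: (@cvg_comp _ _ _ (fun h : R => h *: 1 + t) s1 _ (within J (nbhs t)) _ _ c1).
move=> U; rewrite /within/= => /nbhs_ballP[e e0 eU].
apply: filterS (dnbhs0_lt e0) => h he Jh; apply: eU => //.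
by rewrite /ball/= [h%:A]mulr1 opprD addrCA subrr addr0 normrN.
Unshelve. all: by end_near. Qed.

Lemma quotient_der J g t d :
  (fun h : R => h^-1 *: (g (h *: 1 + t) - g t))
         @ within [set h : R | J (h *: 1 + t)] 0^' --> d -> der J g t d.
Proof.
move=> c.
(* The filter [within J (nbhs t)] does not exclude [t], so the slope at [t] itself has to be set to
   [d]. *)
exists (fun s => if s == t then d else (s - t)^-1 *: (g s - g t)) => [s Js|].
  case: eqVneq => [->|st]; first by rewrite !subrr scale0r.
  by rewrite scalerA mulfV ?scale1r// subr_eq0.
move=> U Ud; have := c _ Ud; rewrite /nbhs/= /within/= !near_simpl.
move=> /nbhs_ballP[e e0 eU]; apply/nbhs_ballP; exists e => // s /= ts Js.
case: eqVneq => [_|st]; first exact: nbhs_singleton.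
have := eU (s - t); rewrite /ball/= sub0r normrN distrC subr_eq0 => /(_ _ st).
by rewrite [(_ - _)%:A]mulr1 subrK; apply => //; rewrite distrC.
Qed.

Lemma derivable_in_der J g t : derivable_in J g t 1 -> der J g t (ddt J g t).
Proof. by move=> /quotient_der. Qed.

(** Says that [t] is approached by other points of [J]; this is what makes derivatives relative to
    [J] unique, and [ddt] meaningful. *)
Definition limit_pt J t := ProperFilter (within [set h : R | J (h *: 1 + t)] 0^').

Lemma der_ddt J g t d : limit_pt J t -> der J g t d ->
  derivable_in J g t 1 /\ ddt J g t = d.
Proof.
move=> Jt /der_quotient c; split; first by apply/cvg_ex; exists d.
by apply: cvg_lim => //; exact: norm_hausdorff.
Qed.

Lemma der_is_derive J g t d : nbhs t J -> der J g t d -> is_derive t 1 g d.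
Proof.
move=> Jt D.
have Dn : (fun h : R => h^-1 *: (g (h *: 1 + t) - g t)) @ 0^' --> d.
  have c := der_quotient D.
  move=> U /c; rewrite /= /within/= !near_simpl => H.
  have H2 : \forall h \near 0^', J (h *: 1 + t).
    move: Jt => /nbhs_ballP[e e0 eJ].
    near=> h; apply: eJ.
    rewrite /ball/= [h%:A]mulr1 opprD addrCA subrr addr0 normrN.
    by near: h; exact: dnbhs0_lt.
  near=> h; have Jh : J (h *: 1 + t) by near: h.
  move: Jh; near: h; exact: H.
apply: DeriveDef; first by apply/cvg_ex; exists d.
by apply: cvg_lim => //; exact: norm_hausdorff.
Unshelve. all: by end_near. Qed.

Lemma is_derive_der J g t d : is_derive t 1 g d -> der J g t d.
Proof.
move=> D; apply: quotient_der.
have Dd : (fun h : R => h^-1 *: (g (h *: 1 + t) - g t)) @ 0^' --> d.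
  by rewrite -[d]derive_val; exact: (@ex_derive _ _ _ _ _ _ _ D).
apply: cvg_trans Dd; apply: cvg_app; exact: cvg_within.
Qed.

End normed.

Lemma der_id J t : der J (fun s : R => s) t 1.
Proof. by exists (fun=> 1) => [s _|]; [rewrite [_%:A]mulr1|exact: cvg_cst]. Qed.

Lemma der_scale {V : normedModType R} J (a : R -> R) (g : R -> V) t a' d :
  der J a t a' -> der J g t d ->
  der J (fun s => a s *: g s) t (a' *: g t + a t *: d).
Proof.
move=> [s1 E1 c1] /[dup] /der_cvg cg [s2 E2 c2].
exists (fun s => s1 s *: g s + a t *: s2 s) => [s Js|].
  have -> : (s - t) *: (s1 s *: g s + a t *: s2 s) =
      (a s - a t) *: g s + a t *: (g s - g t).
    by rewrite E1// E2// scalerDr !scalerA [a t * _]mulrC.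
  by rewrite scalerBl scalerBr addrA subrK.
apply: cvgD; first exact: cvgZ.
by apply: cvgZ => //; exact: cvg_cst.
Qed.

Lemma derM J (a b : R -> R) t a' b' : der J a t a' -> der J b t b' ->
  der J (fun s => a s * b s) t (a' * b t + a t * b').
Proof. exact: der_scale. Qed.

Lemma der_mulmx {m n p} J (X : R -> 'M[R]_(m, n)) (Y : R -> 'M[R]_(n, p)) t
    (X' : 'M[R]_(m, n)) (Y' : 'M[R]_(n, p)) :
  der J X t X' -> der J Y t Y' ->
  der J (fun s => X s *m Y s) t (X' *m Y t + X t *m Y').
Proof.
move=> [s1 E1 c1] /[dup] /der_cvg cg [s2 E2 c2].
exists (fun s => s1 s *m Y s + X t *m s2 s) => [s Js|].
  rewrite scalerDr scalemxAl scalemxAr -E1// -E2//.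
  by rewrite mulmxBl mulmxBr addrA subrK.
apply: cvgD; first exact: cvg_mulmx.
by apply: cvg_mulmx => //; exact: cvg_cst.
Qed.

(** The slope comes from X(s)^-1 - X(t)^-1 = - X(s)^-1 (X(s) - X(t)) X(t)^-1. *)
Lemma der_invmx {n} J (X : R -> 'M[R]_n) t (X' : 'M[R]_n) :
  J t -> (forall s, J s -> X s \in unitmx) -> der J X t X' ->
  der J (fun s => invmx (X s)) t (- (invmx (X t) *m X' *m invmx (X t))).
Proof.
move=> Jt Xu /[dup] /der_cvg cX [s1 E1 c1].
exists (fun s => - (invmx (X s) *m s1 s *m invmx (X t))) => [s Js|].
  rewrite scalerN scalemxAl scalemxAr -E1//.
  rewrite mulmxBr mulmxBl mulVmx ?Xu// mul1mx -mulmxA mulmxV ?Xu// mulmx1.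
  by rewrite opprB.
apply: cvgN; apply: cvg_mulmx; last exact: cvg_cst.
by apply: cvg_mulmx => //; apply: cvg_invmx => //; exact: Xu.
Qed.

Lemma der_entry {m n} J (X : R -> 'M[R]_(m, n)) t (X' : 'M[R]_(m, n)) i j :
  der J X t X' -> der J (fun s => X s i j) t (X' i j).
Proof.
move=> [s1 E1 c1]; exists (fun s => s1 s i j) => [s Js|].
  by have := congr1 (fun M : 'M[R]_(m, n) => M i j) (E1 _ Js); rewrite !mxE.
by move/cvg_mxP : c1; exact.
Qed.

Lemma der_mx {m n} J (X : R -> 'M[R]_(m, n)) t (X' : 'M[R]_(m, n)) :
  (forall i j, der J (fun s => X s i j) t (X' i j)) -> der J X t X'.
Proof.
move=> /(_ _ _)/cid2 H.
exists (fun s => \matrix_(i, j) s2val (H i j) s) => [s Js|].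
  apply/matrixP => i j; rewrite !mxE; case: (H i j) => sg /= E _; exact: E.
apply/cvg_mxP => i j; under eq_fun do rewrite mxE.
by case: (H i j).
Qed.

Lemma limit_pt_segment (a b t : R) : a < b -> t \in `[a, b] -> limit_pt `[a, b] t.
Proof.
rewrite in_itv/= => ab /andP[at_ tb]; apply: Build_ProperFilter_ex => U.
rewrite /within/= => /nbhs_ballP[e /= e0 eU].
have [tb'|bt] := ltP t b.
  pose h := Num.min (e / 2) (b - t).
  have h0 : 0 < h by rewrite lt_min divr_gt0//= subr_gt0.
  exists h; apply: eU.
  - by rewrite /ball/= sub0r normrN gtr0_norm// gt_min ltr_pdivrMr// ltr_pMr// ltr1n.
  - by rewrite gt_eqF.
  - rewrite [h%:A]mulr1 in_itv/= -lerBrDr.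
    by rewrite (le_trans at_) ?lerDr ?(ltW h0)//= ge_min lexx orbT.
have {bt tb}tb : t = b by apply/eqP; rewrite eq_le tb bt.
pose h := Num.min (e / 2) (b - a).
have h0 : 0 < h by rewrite lt_min divr_gt0//= subr_gt0.
exists (- h); apply: eU.
- by rewrite /ball/= sub0r opprK gtr0_norm// gt_min ltr_pdivrMr// ltr_pMr// ltr1n.
- by rewrite oppr_eq0 gt_eqF.
- rewrite [_%:A]mulr1 in_itv/= tb addrC lerBrDl -lerBrDr gerBl (ltW h0) andbT.
  by rewrite ge_min lexx orbT.
Qed.

Lemma limit_pt_ray (a t : R) : a <= t -> limit_pt `[a, +oo[ t.
Proof.
move=> at_; apply: Build_ProperFilter_ex => U.
rewrite /within/= => /nbhs_ballP[e /= e0 eU].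
exists (e / 2); apply: eU.
- by rewrite /ball/= sub0r normrN gtr0_norm ?divr_gt0// ltr_pdivrMr// ltr_pMr// ltr1n.
- by rewrite gt_eqF// divr_gt0.
- by rewrite [_%:A]mulr1 in_itv/= andbT (le_trans at_)// lerDr divr_ge0// ltW.
Qed.

Lemma MVT_der (g g' : R -> R) (a b : R) : a < b ->
  (forall t, a < t < b -> der `[a, b] g t (g' t)) ->
  {within `[a, b], continuous g} ->
  exists2 c, a < c < b & g b - g a = g' c * (b - a).
Proof.
move=> ab D cg.
have [|c] := @MVT _ g g' a b ab _ cg; last by rewrite in_itv/=; exists c.
move=> t; rewrite in_itv/= => tab; apply: der_is_derive (D _ tab).
have tab' : t \in `]a, b[ by rewrite in_itv/=.
by apply: filterS (near_in_itvoo tab') => s; exact: subset_itv_oo_cc.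
Qed.

Lemma der_nondecreasing (g g' : R -> R) (a b : R) : a <= b ->
  (forall t, a <= t <= b -> der `[a, b] g t (g' t)) ->
  (forall t, a <= t <= b -> 0 <= g' t) -> g a <= g b.
Proof.
rewrite le_eqVlt => /predU1P[->//|ab] D g0.
have [|//|c /andP[ac cb] E] := @MVT_der g g' a b ab.
- by move=> t /andP[at_ tb]; apply: D; rewrite !ltW.
- by apply: (@der_continuous _ _ g g') => t /=; rewrite in_itv/=; exact: D.
- by rewrite -subr_ge0 E mulr_ge0 ?g0 ?subr_ge0 ?(ltW ab)// !ltW.
Qed.

(** As the norm is the largest entry, it is enough that [mu + g i j] and [mu - g i j] are
    nondecreasing for every entry. This inequality takes the place of integrating the norm of the
    derivative. *)
Lemma mean_value_le {m n} (g g' : R -> 'M[R]_(m, n)) (mu mu' : R -> R) (a b : R) :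
  a <= b ->
  (forall t, a <= t <= b -> der `[a, b] g t (g' t)) ->
  (forall t, a <= t <= b -> der `[a, b] mu t (mu' t)) ->
  (forall t, a <= t <= b -> `|g' t| <= mu' t) -> `|g b - g a| <= mu b - mu a.
Proof.
move=> ab Dg Dmu gmu.
have mono : mu a <= mu b.
  apply: (der_nondecreasing ab Dmu) => t tab.
  by rewrite (le_trans _ (gmu _ tab)).
apply: mx_norm_le => [|i j]; first by rewrite subr_ge0.
rewrite !mxE ler_norml; apply/andP; split.
- have : mu a + g a i j <= mu b + g b i j.
    apply: (@der_nondecreasing (fun t => mu t + g t i j)
      (fun t => mu' t + g' t i j)) => // t tab.
      by apply: derD; [exact: Dmu|apply: der_entry; exact: Dg].
    have := le_trans (le_mx_norm (g' t) i j) (gmu _ tab).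
    by rewrite ler_norml => /andP[]; rewrite -subr_ge0 opprK addrC.
  lra.
- have : mu a - g a i j <= mu b - g b i j.
    apply: (@der_nondecreasing (fun t => mu t - g t i j)
      (fun t => mu' t - g' t i j)) => // t tab.
      by apply: derB; [exact: Dmu|apply: der_entry; exact: Dg].
    have := le_trans (le_mx_norm (g' t) i j) (gmu _ tab).
    by rewrite ler_norml => /andP[_]; rewrite subr_ge0.
  lra.
Qed.

Lemma antiderivative (h : R -> R) (a b : R) : continuous h ->
  exists H : R -> R, forall t, a <= t <= b -> is_derive t 1 H (h t).
Proof.
(* The integral starts at [a - 1] and is considered up to [b + 1], so that the derivative is
   two-sided at both ends of [a, b]. *)
move=> ch; exists (fun x => \int[lebesgue_measure]_(t in `[a - 1, x]) h t)%R.
move=> t /andP[at_ tb].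
have tb1 : t < b + 1 by rewrite (le_lt_trans tb)// ltrDl.
have a1t : a - 1 < t by rewrite (lt_le_trans _ at_)// ltrBlDr ltrDl.
have hint : lebesgue_measure.-integrable `[a - 1, b + 1] (EFin \o h).
  apply: continuous_compact_integrable; first exact: segment_compact.
  exact: continuous_subspaceT.
have := continuous_FTC1_closed tb1 hint a1t (ch t).
move: (fun x => _ : R) => H [D E].
by apply: (DeriveDef D); rewrite -derive1E E.
Qed.

Lemma antiderivative_mx {m n} (h : R -> 'M[R]_(m, n)) (a b : R) : continuous h ->
  exists H : R -> 'M[R]_(m, n), forall J t, a <= t <= b -> der J H t (h t).
Proof.
move=> ch.
have ch' i j : continuous (fun t => h t i j).
  move=> t; apply: (@continuous_comp _ _ _ h (fun M : 'M[R]_(m, n) => M i j)).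
    exact: ch.
  exact: coord_continuous.
pose H i j := cid (antiderivative a b (ch' i j)).
exists (fun t => \matrix_(i, j) sval (H i j) t) => J t tab.
apply: der_mx => i j; under eq_fun do rewrite mxE.
by apply: is_derive_der; case: (H i j) => /= K; exact.
Qed.

End der.

(** * Completeness and fixed points *)

Section completeness.
Context {R : realType}.

Lemma cauchy_half_dist {V : normedModType R} (u : nat -> V) (c : R) :
  (forall k, `|u k.+1 - u k| <= c * 2^-1 ^+ k) ->
  forall k m, `|u (k + m)%N - u k| <= 2 * c * 2^-1 ^+ k.
Proof.
move=> uc k m.
(* The exact geometric sum is what makes the induction on [m] close. *)
have : `|u (k + m)%N - u k| <= 2 * c * (2^-1 ^+ k - 2^-1 ^+ (k + m)).
  elim: m => [|m IH]; first by rewrite addn0 !subrr mulr0 normr0.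
  have := uc (k + m)%N; rewrite addnS => um.
  rewrite -[_ - u k](subrKA (u (k + m)%N)) (le_trans (ler_normD _ _))//.
  rewrite (le_trans (lerD um IH))// exprS; lra.
move=> /le_trans; apply; rewrite mulrBr lerBlDr lerDl.
have c0 : 0 <= c by have := le_trans (normr_ge0 _) (uc 0); rewrite expr0 mulr1.
by rewrite mulr_ge0 ?exprn_ge0 ?mulr_ge0.
Qed.

(** The limit is the supremum of the lower ends of the intervals of radius 2 c 2^-k around [u k];
    every upper end bounds these from above, and the rate of convergence comes with the
    construction. *)
Lemma cauchy_half (u : nat -> R) (c : R) :
  (forall k, `|u k.+1 - u k| <= c * 2^-1 ^+ k) ->
  exists l, forall k, `|l - u k| <= 2 * c * 2^-1 ^+ k.
Proof.
move=> uc; have ucd := cauchy_half_dist uc.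
have c0 : 0 <= c by have := le_trans (normr_ge0 _) (uc 0); rewrite expr0 mulr1.
pose S := [set u k - 2 * c * 2^-1 ^+ k | k in [set: nat]].
have Sub m : ubound S (u m + 2 * c * 2^-1 ^+ m).
  move=> _ [k _ <-]; have k0 : 0 <= 2 * c * 2^-1 ^+ k by rewrite ?mulr_ge0 ?exprn_ge0.
  have m0 : 0 <= 2 * c * 2^-1 ^+ m by rewrite ?mulr_ge0 ?exprn_ge0.
  have [km|mk] := leP k m.
    have := ucd k (m - k)%N; rewrite subnKC// ler_norml => /andP[]; lra.
  have := ucd m (k - m)%N; rewrite subnKC 1?ltnW// ler_norml => /andP[_]; lra.
have S0 : S !=set0 by exists (u 0 - 2 * c * 2^-1 ^+ 0); exists 0%N.
exists (sup S) => k; rewrite ler_norml; apply/andP; split.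
  rewrite lerBrDl; apply: ub_le_sup; last by exists k.
  by exists (u 0 + 2 * c * 2^-1 ^+ 0); exact: Sub.
by rewrite lerBlDl; apply: ge_sup.
Qed.

Lemma cauchy_half_mx {m n} (u : nat -> 'M[R]_(m, n)) (c : R) :
  (forall k, `|u k.+1 - u k| <= c * 2^-1 ^+ k) ->
  exists l, forall k, `|l - u k| <= 2 * c * 2^-1 ^+ k.
Proof.
move=> uc.
have c0 : 0 <= c by have := le_trans (normr_ge0 _) (uc 0); rewrite expr0 mulr1.
have uij i j k : `|u k.+1 i j - u k i j| <= c * 2^-1 ^+ k.
  by have := le_trans (le_mx_norm _ i j) (uc k); rewrite !mxE.
pose H i j := cid (cauchy_half (uij i j)).
exists (\matrix_(i, j) sval (H i j)) => k; apply: mx_norm_le => [|i j].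
  by rewrite !mulr_ge0 ?exprn_ge0.
by rewrite !mxE; case: (H i j) => l /=; exact.
Qed.

Lemma half_expn_small (c e : R) : 0 < e -> exists k : nat, c * 2^-1 ^+ k < e.
Proof.
move=> e0; have : (fun k : nat => c * 2^-1 ^+ k) @ \oo --> 0.
  by apply: cvg_geometric; rewrite ger0_norm ?invr_ge0// invf_lt1// ltr1n.
move/cvgr0_norm_lt => /(_ _ e0)[N _ /(_ N (leqnn N))] H; exists N.
exact: le_lt_trans (ler_norm _) H.
Qed.

(** The contraction is assumed on the ball only. The bound on [T a - a] keeps the ball invariant,
    since r / 2 + r / 2 = r, and the iterates from [a] are Cauchy with ratio 1/2. *)
Lemma contraction_fixed_point {m n} (T : 'M[R]_(m, n) -> 'M[R]_(m, n))
    (a : 'M[R]_(m, n)) (r : R) :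
  (forall x y, `|x - a| <= r -> `|y - a| <= r ->
    `|T x - T y| <= 2^-1 * `|x - y|) ->
  `|T a - a| <= r / 2 -> exists2 x, `|x - a| <= r & T x = x.
Proof.
move=> Tc Ta.
have r0 : 0 <= r by have := le_trans (normr_ge0 _) Ta; rewrite pmulr_lge0// invr_gt0.
have Tball x : `|x - a| <= r -> `|T x - a| <= r.
  move=> xr; rewrite -[_ - a](subrKA (T a)) (le_trans (ler_normD _ _))//.
  have := Tc x a xr; rewrite subrr normr0 => /(_ r0).
  move: xr Ta; set A := `|x - a|; lra.
pose u k := iter k T a.
have ub k : `|u k - a| <= r.
  by elim: k => [|k IH]; [rewrite subrr normr0|exact: Tball].
have uc k : `|u k.+1 - u k| <= r / 2 * 2^-1 ^+ k.
  elim: k => [|k IH]; first by rewrite expr0 mulr1.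
  rewrite (le_trans (Tc _ _ (ub k.+1) (ub k)))// exprS.
  move: IH; set A := `|u k.+1 - u k|; set B := 2^-1 ^+ k; lra.
have [x xu] := cauchy_half_mx uc.
have xr : `|x - a| <= r.
  by have := xu 0%N; rewrite expr0 /u/=; set A := `|_|; lra.
exists x => //; apply/eqP; rewrite -subr_eq0 -normr_le0; apply/ler_addgt0Pl => e e0.
have [k ke] := half_expn_small (2 * r) e0.
rewrite addr0 -[_ - x](subrKA (u k.+1)) (le_trans (ler_normD _ _))//.
have := Tc x (u k) xr (ub k); have := xu k; have := xu k.+1.
rewrite exprS /= [`|u k.+1 - x|]distrC /u/= -/(u k); move: ke.
set A := `|_ - u k|; set B := `|T x - _|; set C := `|x - T _|; set D := 2^-1 ^+ k; lra.
Qed.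

End completeness.

(** * Compactness and uniformity *)

Section compactness.
Context {R : realType}.

Lemma cvg_trmx {T : Type} (F : set_system T) {FF : Filter F} {m n}
    (X : T -> 'M[R]_(m, n)) (M : 'M[R]_(m, n)) :
  X @ F --> M -> (fun t => (X t)^T) @ F --> M^T.
Proof.
move=> /cvg_mxP XM; apply/cvg_mxP => i j; rewrite mxE.
under eq_fun do rewrite mxE; exact: XM.
Qed.

Lemma compact_ball_mx n (M : R) : compact [set v : 'cV[R]_n | `|v| <= M].
Proof.
have -> : [set v : 'cV[R]_n | `|v| <= M] = trmx @` [set v : 'rV[R]_n | `|v| <= M].
  have tr_norm p q (v : 'M[R]_(p, q)) : `|v^T| <= `|v|.
    by apply: mx_norm_le => // i j; rewrite mxE le_mx_norm.
  apply/seteqP; split => [v /= vM|_ [v /= vM <-]].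
    by exists v^T; rewrite ?trmxK// (le_trans (tr_norm _ _ _)).
  by rewrite /= (le_trans (tr_norm _ _ _)).
apply: continuous_compact.
  by apply: continuous_subspaceT => v; exact: (@cvg_trmx _ (nbhs v) _ _ _ id).
apply: bounded_closed_compact.
  exists M; split; first exact: num_real.
  by move=> x Mx v /= /le_trans; apply; exact: ltW.
rewrite (_ : [set _ | _] = (fun v : 'rV[R]_n => `|v|) @^-1` [set x | x <= M])//.
apply: preimage_closed; last exact: closed_le.
by move=> v _; exact: norm_continuous.
Qed.

(** Turns local uniformity into uniformity over a compact set. The filter [F] carries the parameter:
    a time, a distance tending to 0, or a Lipschitz constant tending to infinity. *)
Lemma compact_forall_near {X : topologicalType} {I : Type} (F : set_system I)
    {FF : Filter F} (K : set X) (P : I -> X -> Prop) : compact K ->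
  (forall x, K x -> \forall x' \near x & i \near F, P i x') ->
  \forall i \near F, forall x, K x -> P i x.
Proof. by move=> /compact_near_coveringP cov H; exact: cov. Qed.

Lemma compact_continuous_bounded {T : topologicalType} {V : normedModType R}
    (K : set T) (f : T -> V) : compact K -> {within K, continuous f} ->
  exists2 M, 0 < M & forall x, K x -> `|f x| <= M.
Proof.
move=> cK cf; have [M [_ HM]] := compact_bounded (continuous_compact cf cK).
exists (`|M| + 1); first by rewrite ltr_wpDl.
by move=> x Kx; apply: (HM (`|M| + 1)); [rewrite ltr_pwDr ?ler_norm//|exists x].
Qed.

End compactness.

(** * Existence and uniqueness for Lipschitz equations *)

Section clamp.
Context {R : realType}.

(** The nearest-point retraction onto [a, b]; composition with it extends functions that are
    continuous on the segment to the whole line. *)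
Definition clamp (a b t : R) : R := Num.max a (Num.min b t).

Lemma clamp_in a b t : a <= b -> a <= clamp a b t <= b.
Proof. by move=> ab; rewrite /clamp le_max lexx/= ge_max ab ge_min lexx. Qed.

Lemma clamp_id a b t : a <= t <= b -> clamp a b t = t.
Proof. by move=> /andP[at_ tb]; rewrite /clamp min_r// max_r. Qed.

Lemma clamp_lipschitz a b s t : `|clamp a b s - clamp a b t| <= `|s - t|.
Proof.
have Hmax x y : `|Num.max a x - Num.max a y| <= `|x - y|.
  have := ler_norm (x - y); have := ler_norm (y - x); rewrite [`|y - x|]distrC.
  case: (leP a x) => ax; case: (leP a y) => ay H1 H2;
    by rewrite ler_norml; apply/andP; split; lra.
have Hmin x y : `|Num.min b x - Num.min b y| <= `|x - y|.
  have := ler_norm (x - y); have := ler_norm (y - x); rewrite [`|y - x|]distrC.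
  case: (leP b x) => ax; case: (leP b y) => ay H1 H2;
    by rewrite ler_norml; apply/andP; split; lra.
exact: le_trans (Hmax _ _) (Hmin _ _).
Qed.

Lemma clamp_continuous a b : continuous (clamp a b).
Proof.
move=> t; apply/cvgrPdist_lt => e e0; apply/nbhs_ballP; exists e => //= s.
exact: le_lt_trans (clamp_lipschitz _ _ _ _).
Qed.

Lemma within_clamp {T : topologicalType} (a b : R) (h : R -> T) : a <= b ->
  {within `[a, b], continuous h} -> continuous (fun t => h (clamp a b t)).
Proof.
move=> ab /subspace_continuousP ch t.
have cab : `[a, b]%classic (clamp a b t) by rewrite /= in_itv/= clamp_in.
apply: (@cvg_comp _ _ _ (clamp a b) h _ (within `[a, b] (nbhs (clamp a b t)))).
  move=> U WU; have WU' : nbhs (clamp a b t) [set s | `[a, b]%classic s -> U s] := WU.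
  have := clamp_continuous WU'.
  apply: (@filterS _ _ _
    [set s | `[a, b]%classic (clamp a b s) -> U (clamp a b s)]) => s; apply.
  by rewrite /= in_itv/= clamp_in.
exact: ch.
Qed.

End clamp.

Section picard.
Context {R : realType}.

Lemma der_expR (J : set R) (k a t : R) :
  der J (fun s => expR (k * (s - a))) t (k * expR (k * (t - a))).
Proof.
apply: is_derive_der; rewrite mulrC.
apply: (@is_derive1_comp _ expR (fun s => k * (s - a))).
rewrite [X in is_derive _ _ _ X](_ : k = k *: (1 - 0)); last by rewrite subr0 [RHS]mulr1.
exact: is_deriveZ.
Qed.

(** Integrating L K exp(2 L (t - a)) gives at most (K / 2) exp(2 L (t - a)). In this weighted norm
    integration is a half-contraction on the whole interval, so no subdivision into short intervals
    is needed. *)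
Lemma weighted_growth {m n} (D D' : R -> 'M[R]_(m, n)) (a b L K : R) : 0 < L ->
  (forall t, a <= t <= b -> der `[a, b] D t (D' t)) -> D a = 0 -> 0 <= K ->
  (forall t, a <= t <= b -> `|D' t| <= L * (K * expR (2 * L * (t - a)))) ->
  forall t, a <= t <= b -> `|D t| <= K / 2 * expR (2 * L * (t - a)).
Proof.
move=> L0 dD Da K0 D'le t /andP[at_ tb].
have sub : `[a, t] `<=` `[a, b].
  by apply: subset_itvl; rewrite bnd_simp.
have -> : `|D t| = `|D t - D a| by rewrite Da subr0.
have := @mean_value_le _ _ _ D D' (fun s => K / 2 * expR (2 * L * (s - a)))
  (fun s => L * (K * expR (2 * L * (s - a)))) a t at_.
move=> /(_ _ _ _)/le_trans; apply.
- move=> s /andP[as_ st]; apply: der_subset sub _; apply: dD.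
  by rewrite as_ (le_trans st).
- move=> s _; have := derM (der_cst _ s (K / 2)) (der_expR `[a, t] (2 * L) a s).
  by congr (der _ _ _ _); rewrite mul0r add0r; field.
- by move=> s /andP[as_ st]; apply: D'le; rewrite as_ (le_trans st).
- by rewrite gerBl mulr_ge0 ?expR_ge0// divr_ge0.
Qed.

(** The bound M 2^-k exp(2 L' (t - a)) gains a factor 1/2 each time it is fed back into the
    differential inequality. *)
Lemma gronwall_zero {m n} (D D' : R -> 'M[R]_(m, n)) (a b L : R) :
  (forall t, a <= t <= b -> der `[a, b] D t (D' t)) -> D a = 0 ->
  (forall t, a <= t <= b -> `|D' t| <= L * `|D t|) ->
  forall t, a <= t <= b -> D t = 0.
Proof.
move=> dD Da D'le t0 t0ab.
pose L' := `|L| + 1; have L'0 : 0 < L' by rewrite ltr_wpDl.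
have D'le' t : a <= t <= b -> `|D' t| <= L' * `|D t|.
  move=> /D'le /le_trans; apply; rewrite ler_wpM2r//.
  by rewrite /L' (le_trans (ler_norm _))// lerDl.
have [M M0 HM] : exists2 M, 0 < M & forall t, `[a, b]%classic t -> `|D t| <= M.
  apply: compact_continuous_bounded; first exact: segment_compact.
  by apply: (@der_continuous _ _ _ _ D') => t /=; rewrite in_itv/=; exact: dD.
have key k t : a <= t <= b -> `|D t| <= M * 2^-1 ^+ k * expR (2 * L' * (t - a)).
  elim: k t => [|k IH] t tab.
    rewrite expr0 mulr1 (le_trans (HM t _))//= ?in_itv//=.
    rewrite ler_peMr ?(ltW M0)// -expR0 ler_expR mulr_ge0 ?subr_ge0//.
      by rewrite mulr_ge0// ltW.
    by case/andP: tab.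
  have := @weighted_growth _ _ D D' a b L' (M * 2^-1 ^+ k) L'0 dD Da.
  rewrite exprS [2^-1 * _]mulrC mulrA; apply => //.
    by rewrite mulr_ge0 ?exprn_ge0// ltW.
  by move=> s sab; rewrite (le_trans (D'le' _ sab))// ler_wpM2l ?IH// ltW.
apply/eqP; rewrite -normr_le0; apply/ler_addgt0Pl => e e0; rewrite addr0.
have [k ke] := half_expn_small (M * expR (2 * L' * (t0 - a))) e0.
rewrite (le_trans (key k _ t0ab))// (le_trans _ (ltW ke))//.
by rewrite -!mulrA [expR _ * _]mulrC.
Qed.

(** The Picard operator is obtained by choice from the existence of antiderivatives. By
    [weighted_growth] the bound on the difference of successive iterates is halved at each step. *)
Theorem picard_lindelof {n} (g : R -> 'cV[R]_n -> 'cV[R]_n) (a b L : R)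
    (z0 : 'cV[R]_n) : a <= b ->
  continuous (fun p : R * 'cV[R]_n => g p.1 p.2) ->
  (forall t y z, `|g t y - g t z| <= L * `|y - z|) ->
  exists z : R -> 'cV[R]_n, [/\ continuous z, z a = z0 &
    forall t, a <= t <= b -> der `[a, b] z t (g t (z t))].
Proof.
move=> ab gc gL0.
pose L' := `|L| + 1; have L'0 : 0 < L' by rewrite ltr_wpDl.
have gL t y z : `|g t y - g t z| <= L' * `|y - z|.
  rewrite (le_trans (gL0 _ _ _))// ler_wpM2r//.
  by rewrite /L' (le_trans (ler_norm _))// lerDl.
have gzc (z : R -> 'cV[R]_n) : continuous z -> continuous (fun t => g t (z t)).
  move=> cz t.
  apply: (@continuous_comp _ _ _ (fun s => (s, z s)) (fun p => g p.1 p.2)).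
    by apply: (cvg_pairl (F := nbhs t)); [exact: cvg_id|exact: cz].
  exact: gc.
have Tex (z : R -> 'cV[R]_n) : exists w : R -> 'cV[R]_n, continuous z ->
    [/\ continuous w, w a = z0, (forall t, w t = w (clamp a b t)) &
      forall t, a <= t <= b -> der `[a, b] w t (g t (z t))].
  have [cz|] := pselect (continuous z); last by exists z.
  have [H HE] := antiderivative_mx a b (gzc _ cz).
  have aab : a <= a <= b by rewrite lexx ab.
  (* Clamping the time makes the iterate continuous on all of R, as the next iteration requires, and
     turns estimates on [a, b] into estimates everywhere. *)
  exists (fun t => z0 + (H (clamp a b t) - H a)) => _; split.
  - move=> t; apply: cvgD; first exact: cvg_cst.
    apply: cvgB; last exact: cvg_cst.
    apply: within_clamp => //; apply: der_continuous => s /=.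
    rewrite in_itv/=; exact: HE.
  - by rewrite clamp_id// subrr addr0.
  - by move=> t; congr (_ + (H _ - _)); rewrite (clamp_id (clamp_in _ ab)).
  - move=> t tab; apply: (@der_eq _ _ _ (fun s => z0 + (H s - H a))).
    + by rewrite /= in_itv.
    + by move=> s /=; rewrite in_itv/= => sab; rewrite clamp_id.
    + rewrite -[g _ _]add0r -[g _ _]subr0.
      apply: derD; first exact: der_cst.
      by apply: derB; [exact: HE|exact: der_cst].
pose T z := sval (cid (Tex z)).
have TP z : continuous z -> [/\ continuous (T z), T z a = z0,
    (forall t, T z t = T z (clamp a b t)) &
    forall t, a <= t <= b -> der `[a, b] (T z) t (g t (z t))].
  exact: (svalP (cid (Tex z))).
pose u k : R -> 'cV[R]_n := iter k.+1 T (fun=> z0).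
have cz0 : continuous (fun _ : R => z0) by move=> s; exact: cvg_cst.
have uc k : continuous (u k).
  elim: k => [|k IH]; last by case: (TP _ IH).
  by case: (TP _ cz0).
have u0 k : u k a = z0.
  case: k => [|k]; last by case: (TP _ (uc k)).
  by case: (TP _ cz0).
have ucl k t : u k t = u k (clamp a b t).
  case: k => [|k]; last by case: (TP _ (uc k)) => _ _ + _; exact.
  by case: (TP _ cz0) => _ _ + _; exact.
have du k t : a <= t <= b -> der `[a, b] (u k.+1) t (g t (u k t)).
  by case: (TP _ (uc k)) => _ _ _; exact.
have [M M0 HM] : exists2 M, 0 < M &
    forall t, `[a, b]%classic t -> `|u 1%N t - u 0%N t| <= M.
  apply: compact_continuous_bounded; first exact: segment_compact.
  by apply: continuous_subspaceT => t; apply: cvgB; exact: uc.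
have key k t : a <= t <= b ->
    `|u k.+1 t - u k t| <= M * 2^-1 ^+ k * expR (2 * L' * (t - a)).
  elim: k t => [|k IH] t tab.
    rewrite expr0 mulr1 (le_trans (HM t _))//= ?in_itv//=.
    rewrite ler_peMr ?(ltW M0)// -expR0 ler_expR mulr_ge0 ?subr_ge0//.
      by rewrite mulr_ge0// ltW.
    by case/andP: tab.
  have := @weighted_growth _ _ (fun t => u k.+2 t - u k.+1 t)
    (fun t => g t (u k.+1 t) - g t (u k t)) a b L' (M * 2^-1 ^+ k) L'0.
  rewrite exprS [2^-1 * _]mulrC mulrA; apply => //.
  - by move=> s sab; apply: derB; exact: du.
  - by rewrite !u0 subrr.
  - by rewrite mulr_ge0 ?exprn_ge0// ltW.
  - by move=> s sab; rewrite (le_trans (gL _ _ _))// ler_wpM2l ?IH// ltW.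
pose C := M * expR (2 * L' * (b - a)).
have C0 : 0 < C by rewrite mulr_gt0 ?expR_gt0.
have uC k t : `|u k.+1 t - u k t| <= C * 2^-1 ^+ k.
  rewrite !(ucl _ t); have cab := clamp_in t ab.
  rewrite (le_trans (key _ _ cab))// /C -!mulrA [expR _ * _]mulrC.
  rewrite ler_pM2l// ler_wpM2l ?exprn_ge0// ler_expR !ler_pM2l//.
  by rewrite lerD2r; case/andP: cab.
pose z t := sval (cid (cauchy_half_mx (fun k => uC k t))).
have zu t k : `|z t - u k t| <= 2 * C * 2^-1 ^+ k.
  exact: (svalP (cid (cauchy_half_mx (fun k => uC k t)))).
have cz : continuous z.
  move=> t; apply/cvgrPdist_lt => e e0.
  have e30 : 0 < e / 3 by rewrite divr_gt0.
  have [k ke] := half_expn_small (2 * C) e30.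
  have := uc k t; move/cvgrPdist_lt => /(_ _ e30); apply: filterS => s us.
  rewrite -[z t - z s](subrKA (u k t)) (le_lt_trans (ler_normD _ _))//.
  have := zu t k; have := zu s k.
  have : `|u k t - z s| <= `|u k t - u k s| + `|z s - u k s|.
    by rewrite -[_ - z s](subrKA (u k s)) [X in _ <= _ + X]distrC ler_normD.
  move: ke us; set A := `|z t - _|; lra.
have za : z a = z0.
  apply/eqP; rewrite -subr_eq0 -normr_le0; apply/ler_addgt0Pl => e e0; rewrite addr0.
  have [k ke] := half_expn_small (2 * C) e0.
  by rewrite -(u0 k) (le_trans (zu _ _))// ltW.
have [cw wa _ dw] := TP _ cz.
suff zw t : a <= t <= b -> z t = T z t.
  exists z; split => // t tab.
  apply: (@der_eq _ _ _ (T z)); rewrite /= ?in_itv//=; last exact: dw.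
  by move=> s; rewrite in_itv/= => /zw.
move=> tab; apply/eqP; rewrite -subr_eq0 -normr_le0.
apply/ler_addgt0Pl => e e0; rewrite addr0.
have [k ke] := half_expn_small (2 * C * (1 + L' * (b - a))) e0.
(* [T z] and [u k.+1] have the same initial value and the derivatives [g t (z t)] and [g t (u k t)],
   which are close; hence [z] and [T z] are limits of the same iterates. *)
have w_u : `|T z t - u k.+1 t| <= L' * (2 * C * 2^-1 ^+ k) * (b - a).
  have at_ : a <= t by case/andP: tab.
  have tb : t <= b by case/andP: tab.
  have := @mean_value_le _ _ _ (fun t => T z t - u k.+1 t)
    (fun t => g t (z t) - g t (u k t)) (fun s => L' * (2 * C * 2^-1 ^+ k) * s)
    (fun=> L' * (2 * C * 2^-1 ^+ k)) a t at_.
  have sub : `[a, t] `<=` `[a, b] by apply: subset_itvl; rewrite bnd_simp.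
  rewrite wa u0 subrr subr0 => H; apply: le_trans (H _ _ _) _.
  - move=> s /andP[as_ st]; have sab : a <= s <= b by rewrite as_ (le_trans st).
    by apply: der_subset sub _; apply: derB; [exact: dw|exact: du].
  - move=> s _; have := derM (der_cst _ s (L' * (2 * C * 2^-1 ^+ k))) (der_id `[a, t] s).
    by rewrite mul0r add0r mulr1.
  - by move=> s _; rewrite (le_trans (gL _ _ _))// ler_pM2l.
  - rewrite -mulrBr ler_wpM2l ?lerD2r// !mulr_ge0 ?exprn_ge0// ltW//.
rewrite -[z t - _](subrKA (u k.+1 t)) (le_trans (ler_normD _ _))//.
have := zu t k.+1; rewrite [`|u _ _ - _|]distrC exprS.
move: ke w_u; set A := `|T z t - _|; set B := `|z t - _|; set E := 2^-1 ^+ k.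
have : 0 <= C * E by rewrite mulr_ge0 ?exprn_ge0// ltW.
lra.
Qed.

End picard.

(** * Spectral projectors of the pencil *)

Section index_one.
Context {F : fieldType} {n : nat}.
Implicit Types (E D P H : 'M[F]_n).

(** E and E E have the same rank, hence the same row space and the same column space: E = X E E = E
    E Y. Then E Y = X E is the projector on the range of E along its kernel, and E Y Y is the group
    inverse of E. *)
Lemma index_one_group_inverse E :
  (forall v : 'cV[F]_n, E *m (E *m v) = 0 -> E *m v = 0) ->
  exists D P, [/\ E *m D = P, D *m E = P, P *m E = E, E *m P = E & P *m D = D].
Proof.
move=> kerE.
have rankEE : \rank (E *m E) = \rank E.
  apply/eqP; rewrite eqn_leq mxrankM_maxl/=.
  have : (kermx (E^T *m E^T) <= kermx E^T)%MS.
    apply/rV_subP => v /sub_kermxP vE; apply/sub_kermxP.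
    apply: trmx_inj; rewrite trmx_mul trmxK trmx0; apply: kerE.
    by rewrite -[RHS]trmx0 -vE !trmx_mul !trmxK mulmxA.
  move/mxrankS; rewrite !mxrank_ker -trmx_mul !mxrank_tr.
  by rewrite leq_sub2lE ?rank_leq_row.
have /submxP[X EX] : (E <= E *m E)%MS.
  by rewrite -(geq_leqif (mxrank_leqif_sup (submxMl E E))) rankEE.
have /submxP[Y0 EY0] : (E^T <= E^T *m E^T)%MS.
  rewrite -(geq_leqif (mxrank_leqif_sup (submxMl E^T E^T))).
  by rewrite -trmx_mul !mxrank_tr rankEE.
pose Y := Y0^T.
have EY : E = E *m E *m Y.
  by apply: trmx_inj; rewrite !trmx_mul trmxK {1}EY0 mulmxA.
have XE : X *m E = E *m Y by rewrite [in LHS]EY mulmxA -EX.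
have EYE : E *m Y *m E = E by rewrite -XE -mulmxA -EX.
exists (E *m Y *m Y), (E *m Y); split => //.
- by rewrite !mulmxA -EY.
- by rewrite -[E *m Y]XE -2!mulmxA [E *m (Y *m E)]mulmxA EYE.
- by rewrite mulmxA -EY.
- by rewrite !mulmxA EYE.
Qed.

(** On the range of P the matrix E has the inverse D, so that 1 + (lam - c) E = E (lam - H) there;
    on the kernel of P both sides of the identity vanish. The resolvent of the pencil thus becomes
    that of a fixed matrix H. *)
Lemma index_one_resolvent E D P (c lam : F) :
  E *m D = P -> D *m E = P -> P *m E = E -> E *m P = E -> P *m D = D ->
  lam != 0 -> 1%:M + (lam - c) *: E \in unitmx ->
  let H := c *: P - D in
  lam%:M - H \in unitmx /\
  invmx (1%:M + (lam - c) *: E) *m E = invmx (lam%:M - H) *m P.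
Proof.
move=> ED DE PE EP PD lam0 Ku H.
set K := 1%:M + _ in Ku *.
have DP : D *m P = D by rewrite -ED mulmxA DE.
have PP : P *m P = P by rewrite -{2}ED mulmxA PE ED.
have KE : K *m E = E *m K.
  by rewrite /K mulmxDl mulmxDr mul1mx mulmx1 -scalemxAl scalemxAr.
have EKi : E *m invmx K = invmx K *m E.
  by rewrite -[E in LHS](mulKmx Ku) KE -!mulmxA mulmxV// mulmx1.
have DK : D *m K = lam *: P - H.
  by rewrite /K mulmxDr mulmx1 -scalemxAr DE /H scalerBl opprB addrCA addrA.
have HP : H *m P = H by rewrite /H mulmxBl -scalemxAl PP DP.
clearbody H.
have HE : (lam%:M - H) *m (E *m invmx K) = P.
  have -> : (lam%:M - H) *m (E *m invmx K) = D *m K *m E *m invmx K.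
    rewrite mulmxA DK; congr (_ *m _).
    by rewrite !mulmxBl -scalemxAl PE mul_scalar_mx.
  by rewrite -(mulmxA D) KE mulmxA -mulmxA mulmxV// mulmx1.
(* The inverse is E K^-1 on the range of P and lam^-1 on its kernel, where H vanishes. *)
have HU : (lam%:M - H) *m (E *m invmx K + lam^-1 *: (1%:M - P)) = 1%:M.
  rewrite mulmxDr HE -scalemxAr mulmxBr mulmx1 [_ *m P]mulmxBl HP mul_scalar_mx.
  rewrite [X in _ *: X](_ : _ = lam *: (1%:M - P)).
    by rewrite scalerA mulVf// scale1r subrKC.
  by rewrite opprD opprK addrACA addNr addr0 scalerBr scalemx1.
have [Hu _] := mulmx1_unit HU; split => //.
by rewrite -EKi -[LHS](mulKmx Hu) HE.
Qed.

End index_one.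

(** * Averages of resolvents over a period *)

Section integrals.
Context {R : realType}.

Lemma Rintegral_antiderivative (h H : R -> R) (a b : R) : a < b -> continuous h ->
  (forall t, a <= t <= b -> der setT H t (h t)) ->
  (\int[@lebesgue_measure R]_(t in `[a, b]) h t)%R = H b - H a.
Proof.
move=> ab ch dH.
have dH' t : a <= t <= b -> is_derive t 1 H (h t).
  by move=> tab; apply: der_is_derive (dH _ tab); exact: filterT.
have cH t : a <= t <= b -> {for t, continuous H}.
  move=> tab; have [d _] := dH' _ tab.
  exact/differentiable_continuous/derivable1_diffP.
rewrite /Rintegral (continuous_FTC2 (F := H) ab)//.
- exact: continuous_subspaceT.
- split=> [t||].
  + by rewrite in_itv/= => /andP[at_ tb]; have [|] := dH' t; rewrite ?(ltW at_) ?(ltW tb).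
  + by apply: cvg_at_right_filter; apply: cH; rewrite lexx ltW.
  + by apply: cvg_at_left_filter; apply: cH; rewrite lexx ltW.
- move=> t; rewrite in_itv/= => /andP[at_ tb]; rewrite derive1E.
  by have [|_ ->] := dH' t; rewrite ?(ltW at_) ?(ltW tb).
Qed.

(** Over N equal pieces of [0, 1] the increments add up to at most C / N. This shows that an
    integral does not depend on a parameter without differentiating under the integral sign. *)
Lemma eq_of_quadratic_dist {m n} (I : R -> 'M[R]_(m, n)) (C : R) :
  (forall s s', 0 <= s' -> s' < s -> s <= 1 -> `|I s - I s'| <= C * (s - s') ^+ 2) ->
  I 1 = I 0.
Proof.
move=> IC; apply/eqP; rewrite -subr_eq0 -normr_le0.
apply/ler_addgt0Pl => e e0; rewrite addr0.
have C0 : 0 <= C.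
  by have := IC 1 0 (lexx _) ltr01 (lexx _); rewrite subr0 expr1n mulr1; exact: le_trans.
pose N := (Num.truncn (C / e)).+1.
have N0 : 0 < N%:R :> R by rewrite ltr0n.
have key k : (k <= N)%N -> `|I (k%:R / N%:R) - I 0| <= k%:R * (C / N%:R ^+ 2).
  elim: k => [_|k IH kN]; first by rewrite !mul0r subrr normr0.
  rewrite -[_ - I 0](subrKA (I (k%:R / N%:R))) (le_trans (ler_normD _ _))//.
  rewrite -[k.+1]add1n [in leRHS]natrD mulrDl lerD ?IH 1?ltnW// mul1r.
  rewrite (le_trans (IC _ _ _ _ _))//.
  - by rewrite ltr_pM2r ?invr_gt0// ltr_nat.
  - by rewrite ler_pdivrMr// mul1r ler_nat add1n.
  - by rewrite -mulrBl natrD addrK mul1r exprVn.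
have := key N (leqnn _); rewrite divff ?gt_eqF// => /le_trans; apply.
have -> : N%:R * (C / N%:R ^+ 2) = C / N%:R by field; rewrite gt_eqF.
by rewrite ler_pdivrMr// mulrC -ler_pdivrMr// ltW// truncnS_gt.
Qed.

(* With K s th = (1 - s N th)^-1, the derivative d/ds of the integral of K s over a
   period is the integral of K N K = d/dth (s^-1 J^-1 K), hence zero. *)
Lemma mean_resolvent {m} (N : R -> 'M[R]_m) (J J' : 'M[R]_m) (p : R) : 0 < p ->
  (forall t, der setT N t (J *m N t)) -> (forall t, J *m N t = N t *m J) ->
  J' *m J = 1%:M -> N p = N 0 ->
  (forall s t, 0 <= s <= 1 -> 1%:M - s *: N t \in unitmx) ->
  exists F : R -> 'M[R]_m,
    (forall t, 0 <= t <= p -> der setT F t (invmx (1%:M - N t))) /\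
    F p - F 0 = p%:M.
Proof.
move=> p0 dN JN JJ Np Nu.
have cN : continuous N.
  move=> t; have := der_cvg (dN t); apply: cvg_trans.
  apply: cvg_app => U WU.
  by apply: (@filterS _ (nbhs t) _ _ _ _ WU) => s; exact.
pose K s t := invmx (1%:M - s *: N t).
have cK s t : 0 <= s <= 1 -> (fun q : R * R => K q.1 q.2) @ nbhs ((s, t) : R * R) --> K s t.
  move=> s01; apply: cvg_invmx; first exact: Nu.
  apply: cvgB; first exact: cvg_cst.
  apply: cvgZ; first exact: cvg_fst.
  apply: (@cvg_comp _ _ _ snd N _ (nbhs t)); [exact: cvg_snd|exact: cN].
have cKs s : 0 <= s <= 1 -> continuous (K s).
  move=> s01 t; apply: cvg_invmx; first exact: Nu.
  apply: cvgB; first exact: cvg_cst.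
  by apply: cvgZ; [exact: cvg_cst|exact: cN].
have [C0 C00 HC0] : exists2 C, 0 < C & forall q, (`[0, 1] `*` `[0, p])%classic q -> `|K q.1 q.2| <= C.
  apply: compact_continuous_bounded.
    by apply: compact_setX; exact: segment_compact.
  apply/subspace_continuousP => -[s t] /= [s01 _]; move: s01; rewrite in_itv/= => s01.
  by apply: cvg_trans (cK s t s01); apply: cvg_app; exact: cvg_within.
have [C1 C10 HC1] : exists2 C, 0 < C & forall t, `[0, p]%classic t -> `|N t| <= C.
  apply: compact_continuous_bounded; first exact: segment_compact.
  exact: continuous_subspaceT.
have Aex s : exists A : R -> 'M[R]_m, 0 <= s <= 1 ->
    forall D t, 0 <= t <= p -> der D A t (K s t).
  have [s01|] := boolP (0 <= s <= 1); last by exists N.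
  by have [A HA] := antiderivative_mx 0 p (cKs _ s01); exists A.
pose A s := sval (cid (Aex s)).
have dA s D t : 0 <= s <= 1 -> 0 <= t <= p -> der D (A s) t (K s t).
  by move=> s01; apply: (svalP (cid (Aex s))).
pose C := m%:R ^+ 4 * C0 ^+ 3 * C1 ^+ 2.
have quad s s' : 0 <= s' -> s' < s -> s <= 1 ->
    `|(A s p - A s 0) - (A s' p - A s' 0)| <= p * C * (s - s') ^+ 2.
  move=> s'0 ss s1; have s0 : 0 < s by exact: le_lt_trans ss.
  have s01 : 0 <= s <= 1 by rewrite ltW.
  have s'01 : 0 <= s' <= 1 by rewrite s'0 (le_trans (ltW ss)).
  have KD t : K s t - K s' t = (s - s') *: (K s t *m N t *m K s' t).
    rewrite scalemxAl scalemxAr.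
    have -> : (s - s') *: N t = (1%:M - s' *: N t) - (1%:M - s *: N t).
      by rewrite opprB addrCA addrAC subrr add0r scalerBl addrC.
    by rewrite mulmxBr mulmxBl mulVmx ?Nu// mul1mx -mulmxA mulmxV ?Nu// mulmx1.
  have JK t : J *m K s t = K s t *m J.
    have JX : J *m (1%:M - s *: N t) = (1%:M - s *: N t) *m J.
      by rewrite mulmxBl mulmxBr mulmx1 mul1mx -scalemxAl -scalemxAr JN.
    rewrite -[LHS](mulKmx (Nu s t s01)) (mulmxA _ J) -JX -(mulmxA J).
    by rewrite mulmxV ?Nu// mulmx1.
  (* As N' = J N and J commutes with K, the derivative of K is s J K N K; the factor s^-1 J' removes
     s J. *)
  have dK t : der `[0, p] (fun t => s^-1 *: (J' *m K s t)) t (K s t *m N t *m K s t) .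
    have dX : der setT (fun t => 1%:M - s *: N t) t (0 - (0 *: N t + s *: (J *m N t))).
      by apply: derB; [exact: der_cst|apply: der_scale; [exact: der_cst|exact: dN]].
    have := der_invmx (I : setT t) (fun t _ => Nu s t s01) dX.
    move/(der_mulmx (der_cst setT t J'))/(der_scale (der_cst setT t s^-1)).
    move/(der_subset (@subsetT _ `[0, p])).
    congr (der _ _ _ _); rewrite !scale0r !add0r mul0mx add0r -/(K s t).
    rewrite !mulmxN mulNmx mulmxN opprK -scalemxAr -scalemxAl -scalemxAr scalerA mulVf ?gt_eqF//.
    by rewrite scale1r (mulmxA (K s t)) -JK !mulmxA JJ mul1mx.
  (* The subtracted term is periodic, so it does not change [E p - E 0]; its derivative is the
     first-order part of K s - K s'. What is left of the derivative is O((s - s')^2). *)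
  pose E t := A s t - A s' t - (s - s') *: (s^-1 *: (J' *m K s t)).
  have -> : (A s p - A s 0) - (A s' p - A s' 0) = E p - E 0.
    have zid (a b c d e : 'M[R]_m) : a - b - (c - d) = a - c - e - (b - d - e).
      rewrite [- (b - d - e)]opprB addrA subrK !opprB addrACA [RHS]addrACA.
      by rewrite [- b - c]addrC.
    by rewrite /E /K Np; exact: zid.
  have E'E t : K s t - K s' t - (s - s') *: (K s t *m N t *m K s t) =
      - ((s - s') ^+ 2 *: (K s t *m N t *m (K s t *m N t *m K s' t))).
    rewrite KD -scalerBr -mulmxBr -[K s' t - K s t]opprB KD mulmxN scalerN -scalemxAr scalerA -expr2.
    by [].
  have := @mean_value_le _ _ _ E
    (fun t => K s t - K s' t - (s - s') *: (K s t *m N t *m K s t))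
    (fun t => C * (s - s') ^+ 2 * t) (fun=> C * (s - s') ^+ 2) 0 p (ltW p0).
  have -> : p * C * (s - s') ^+ 2 = C * (s - s') ^+ 2 * p - C * (s - s') ^+ 2 * 0 by ring.
  apply.
  - move=> t t0p; apply: derB; first by apply: derB; exact: dA.
    have := der_scale (der_cst `[0, p] t (s - s')) (dK t).
    by rewrite scale0r add0r.
  - move=> t _; have := derM (der_cst `[0, p] t (C * (s - s') ^+ 2)) (der_id `[0, p] t).
    by rewrite mul0r add0r mulr1.
  - move=> t t0p; rewrite E'E normrN normrZ ger0_norm ?sqr_ge0// mulrC ler_wpM2r ?sqr_ge0//.
    have Ks : `|K s t| <= C0 by apply: (HC0 (s, t)); rewrite /= !in_itv.
    have Ks' : `|K s' t| <= C0 by apply: (HC0 (s', t)); rewrite /= !in_itv.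
    have Nt : `|N t| <= C1 by apply: HC1; rewrite /= in_itv.
    have KN : `|K s t *m N t| <= m%:R * C0 * C1.
      by rewrite (le_trans (mulmx_norm _ _))// ler_pM// ?mulr_ge0// ler_wpM2l.
    rewrite (le_trans (mulmx_norm _ _))//.
    have -> : C = m%:R * (m%:R * C0 * C1) * (m%:R * (m%:R * C0 * C1) * C0).
      by rewrite /C; ring.
    have KNK : `|K s t *m N t *m K s' t| <= m%:R * (m%:R * C0 * C1) * C0.
      by rewrite (le_trans (mulmx_norm _ _))// ler_pM// ?mulr_ge0// ler_wpM2l.
    by rewrite ler_pM// ?mulr_ge0// ler_wpM2l.
have := eq_of_quadratic_dist quad => I10.
exists (A 1); split=> [t t0p|].
  by have := dA 1 setT t; rewrite ler01 lexx /K scale1r; apply.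
(* At s = 0 the resolvent is the identity, and a primitive of it grows by p over the period. *)
rewrite I10.
have B : `|(A 0 p - p%:M) - (A 0 0 - 0%:M)| <= 0 - 0.
  apply: (@mean_value_le _ _ _ (fun t => A 0 t - t%:M) (fun t => K 0 t - 1%:M)
    (fun=> 0) (fun=> 0) 0 p (ltW p0)).
  - move=> t t0p; apply: derB; first by apply: dA; rewrite ?lexx ?ler01.
    apply: der_mx => i j; rewrite mxE.
    rewrite (_ : (fun s => _) = (fun s : R => s *+ (i == j))); last first.
      by apply/funext => s; rewrite mxE.
    case: (i == j) => /=; rewrite ?mulr1n ?mulr0n; first exact: der_id.
    exact: der_cst.
  - by move=> t _; exact: der_cst.
  - by move=> t _; rewrite /K scale0r subr0 invmx1 subrr normr0.
move: B; rewrite subrr normr_le0 subr_eq0 raddf0 subr0 => /eqP <-.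
by rewrite opprB addrC subrK.
Qed.

End integrals.

(** * Real form of complex matrices and the contour integral of a resolvent *)

Section complex_matrices.
Context {R : realType}.
Local Open Scope complex_scope.
Local Notation C := R[i].
Local Notation Re := (@complex.Re R).
Local Notation Im := (@complex.Im R).
Local Notation toC := (map_mx (real_complex R)).

Lemma ReD (x y : C) : Re (x + y) = Re x + Re y. Proof. by case: x y => ? ? []. Qed.
Lemma ImD (x y : C) : Im (x + y) = Im x + Im y. Proof. by case: x y => ? ? []. Qed.
Lemma ReM (x y : C) : Re (x * y) = Re x * Re y - Im x * Im y.
Proof. by case: x y => ? ? []. Qed.
Lemma ImM (x y : C) : Im (x * y) = Re x * Im y + Im x * Re y.
Proof. by case: x y => ? ? []. Qed.

Lemma Re_sum (I : Type) (s : seq I) (P : pred I) (X : I -> C) :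
  Re (\sum_(i <- s | P i) X i) = \sum_(i <- s | P i) Re (X i).
Proof. by apply: (big_morph _ ReD). Qed.

Lemma Im_sum (I : Type) (s : seq I) (P : pred I) (X : I -> C) :
  Im (\sum_(i <- s | P i) X i) = \sum_(i <- s | P i) Im (X i).
Proof. by apply: (big_morph _ ImD). Qed.

(** The action of a complex matrix on R^n + R^n, real parts before imaginary parts. It is a ring
    homomorphism, so that complex resolvents fall under the calculus of real matrices. *)
Definition cblock {n} (Z : 'M[C]_n) : 'M[R]_(n + n) :=
  block_mx (map_mx Re Z) (- map_mx Im Z) (map_mx Im Z) (map_mx Re Z).

Lemma Re_mulmx {m n p} (Z : 'M[C]_(m, n)) (W : 'M[C]_(n, p)) :
  map_mx Re (Z *m W) = map_mx Re Z *m map_mx Re W - map_mx Im Z *m map_mx Im W.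
Proof.
apply/matrixP => i j; rewrite !mxE Re_sum -sumrB.
by apply: eq_bigr => k _; rewrite ReM !mxE.
Qed.

Lemma Im_mulmx {m n p} (Z : 'M[C]_(m, n)) (W : 'M[C]_(n, p)) :
  map_mx Im (Z *m W) = map_mx Re Z *m map_mx Im W + map_mx Im Z *m map_mx Re W.
Proof.
apply/matrixP => i j; rewrite !mxE Im_sum -big_split/=.
by apply: eq_bigr => k _; rewrite ImM !mxE.
Qed.

Lemma Re_toC {m n} (X : 'M[R]_(m, n)) : map_mx Re (toC X) = X.
Proof. by apply/matrixP => i j; rewrite !mxE. Qed.

Lemma Im_toC {m n} (X : 'M[R]_(m, n)) : map_mx Im (toC X) = 0.
Proof. by apply/matrixP => i j; rewrite !mxE. Qed.

Lemma cblockM {n} (Z W : 'M[C]_n) : cblock (Z *m W) = cblock Z *m cblock W.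
Proof.
rewrite /cblock mulmx_block Re_mulmx Im_mulmx !mulmxN !mulNmx.
by congr block_mx; rewrite ?opprD 1?addrC// addrC.
Qed.

Lemma cblockD {n} (Z W : 'M[C]_n) : cblock (Z + W) = cblock Z + cblock W.
Proof.
rewrite /cblock add_block_mx; congr block_mx; apply/matrixP => i j; rewrite !mxE;
  by rewrite ?ReD ?ImD ?opprD.
Qed.

Lemma cblockZ {n} (a : R) (Z : 'M[C]_n) : cblock (a%:C *: Z) = a *: cblock Z.
Proof.
rewrite /cblock scale_block_mx; congr block_mx; apply/matrixP => i j; rewrite !mxE;
  by rewrite ?ReM ?ImM/= mul0r ?subr0 ?addr0 ?mulrN.
Qed.

Lemma cblock1 n : cblock (1%:M : 'M[C]_n) = 1%:M.
Proof.
rewrite /cblock scalar_mx_block -(map_mx1 (real_complex R)) Re_toC Im_toC.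
by rewrite oppr0.
Qed.

Lemma cblockN {n} (Z : 'M[C]_n) : cblock (- Z) = - cblock Z.
Proof.
by rewrite -scaleN1r -[RHS]scaleN1r -cblockZ rmorphN rmorph1.
Qed.

Lemma cblock_invmx {n} (Z : 'M[C]_n) : Z \in unitmx ->
  cblock Z \in unitmx /\ cblock (invmx Z) = invmx (cblock Z).
Proof.
move=> Zu; have E : cblock Z *m cblock (invmx Z) = 1%:M.
  by rewrite -cblockM mulmxV// cblock1.
have [Zu' _] := mulmx1_unit E; split => //.
by rewrite -[LHS](mulKmx Zu') E mulmx1.
Qed.

Lemma norm_polar (r th : R) : 0 <= r ->
  `|r%:C * (cos th +i* sin th)| = r%:C :> C.
Proof.
move=> r0; rewrite normrM !normc_def/= expr0n/= addr0 sqrtr_sqr ger0_norm//.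
by rewrite cos2Dsin2 sqrtr1 mulr1.
Qed.

(** With w = 1 / lam the integrand (lam - H)^-1 i lam is i (1 - w H)^-1. The real form N of w H is
    periodic with N' = J N, where J is the real form of -i, so the average of (1 - w H)^-1 is 1 by
    [mean_resolvent]. *)
Theorem contour_resolvent {n} (r : R) (H L Q : 'M[R]_n) : 0 < r ->
  (forall lam : C, r%:C <= `|lam| -> lam%:M - toC H \in unitmx) ->
  (2 * pi%:C * 'i)^-1 *:
    contour_mx r (fun lam => toC L *m invmx (lam%:M - toC H) *m toC Q) =
  toC (L *m Q).
Proof.
move=> r0 Hu.
pose lam th : C := r%:C * (cos th +i* sin th).
pose w th : C := (r^-1)%:C * (cos th -i* sin th).
have r0C : r%:C != 0 :> C by rewrite eq_complex/= negb_and gt_eqF.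
have lamw th : lam th * w th = 1.
  rewrite /lam /w mulrACA -rmorphM/= mulfV ?gt_eqF// mul1r.
  apply/eqP; rewrite eq_complex/=; apply/andP; split; apply/eqP; last by ring.
  by rewrite mulrN opprK -!expr2 cos2Dsin2.
have normw s th : 0 < s -> `|s^-1%:C * lam th| = (r / s)%:C.
  move=> s0; rewrite normrM norm_polar ?(ltW r0)// normc_def/= expr0n/= addr0.
  by rewrite sqrtr_sqr ger0_norm ?invr_ge0 ?(ltW s0)// -rmorphM/= mulrC.
pose N1 := cblock (r^-1%:C *: toC H).
pose J := cblock ((-'i)%:M : 'M[C]_n).
pose J' := cblock ('i%:M : 'M[C]_n).
pose N th := cos th *: N1 + sin th *: (J *m N1).
have NE th : N th = cblock (w th *: toC H).
  rewrite /N /N1 /J -cblockM -!cblockZ -cblockD; congr cblock.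
  rewrite mul_scalar_mx !scalerA -scalerDl; congr (_ *: _).
  by apply/eqP; rewrite eq_complex/=; apply/andP; split; apply/eqP; ring.
have ii : 'i * 'i = -1 :> C by rewrite -expr2 sqr_i.
have JJ2 : J *m (J *m N1) = - N1.
  rewrite mulmxA /J -cblockM mul_scalar_mx scale_scalar_mx mulrNN ii.
  by rewrite raddfN cblockN cblock1 mulNmx mul1mx.
have JN th : J *m N th = N th *m J.
  by rewrite NE /J -!cblockM mul_scalar_mx mul_mx_scalar.
(* For 0 < s <= 1 the matrix is s w (lam / s - H) with |lam / s| = r / s >= r. The hypothesis
   outside the circle is thus what permits the deformation to s = 0. *)
have Nu s th : 0 <= s <= 1 -> 1%:M - (s%:C * w th) *: toC H \in unitmx.
  move=> /andP[]; rewrite le_eqVlt => /predU1P[<- _|s0 s1].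
    by rewrite mul0r scale0r subr0 unitmx1.
  have w0 : s%:C * w th != 0.
    apply: mulf_neq0; first by rewrite eq_complex/= negb_and gt_eqF.
    by apply/eqP => w0; have /eqP := lamw th; rewrite w0 mulr0 eq_sym oner_eq0.
  have -> : 1%:M - (s%:C * w th) *: toC H =
      (s%:C * w th) *: ((s^-1%:C * lam th)%:M - toC H).
    rewrite scalerBr scale_scalar_mx mulrACA [w th * _]mulrC lamw mulr1 -rmorphM/=.
    by rewrite mulfV ?gt_eqF.
  rewrite unitmxZ ?unitfE//; apply: Hu; rewrite normw// lecR ler_pdivlMr//.
  by rewrite ler_piMr// ltW.
have Nu' s th : 0 <= s <= 1 -> 1%:M - s *: N th \in unitmx.
  move=> /(Nu s th) /cblock_invmx[+ _].
  by rewrite cblockD cblockN cblock1 -scalerA cblockZ NE.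
have dN th : der setT N th (J *m N th).
  have := derD (der_scale (is_derive_der setT (is_derive_cos th)) (der_cst setT th N1))
    (der_scale (is_derive_der setT (is_derive_sin th)) (der_cst setT th (J *m N1))).
  congr (der _ _ _ _); rewrite /N !scaler0 !addr0 mulmxDr -!scalemxAr JJ2 scaleNr scalerN.
  by rewrite addrC.
have pi0 : 0 < 2 * pi :> R by rewrite mulr_gt0// pi_gt0.
have J'J : J' *m J = 1%:M.
  by rewrite /J /J' -cblockM mul_scalar_mx scale_scalar_mx mulrN ii opprK cblock1.
have Np : N (2 * pi) = N 0.
  by rewrite /N -[2 * pi]add0r [2 * pi]mulrC mulr_natr cosD2pi sinD2pi.
have [F [dF Fp]] := mean_resolvent pi0 dN JN J'J Np Nu'.
pose K th := invmx (1%:M - w th *: toC H).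
have one01 : 0 <= (1 : R) <= 1 by rewrite lexx ler01.
have KE th : cblock (K th) = invmx (1%:M - N th).
  have := Nu 1 th one01; rewrite mul1r => /cblock_invmx[_ ->].
  by rewrite cblockD cblockN cblock1 NE.
have cF : continuous (fun th => invmx (1%:M - N th)).
  move=> th; apply: cvg_invmx; first by have := Nu' 1 th one01; rewrite scale1r.
  apply: cvgB; first exact: cvg_cst.
  have := der_cvg (dN th); apply: cvg_trans.
  apply: cvg_app => U WU.
  by apply: (@filterS _ (nbhs th) _ _ _ _ WU) => s; exact.
(* [Y] selects a block of the real form: the upper left one carries the real parts, the upper right
   one the imaginary parts with a minus sign. The upper right block of 2 pi times the identity is
   zero, hence the real part of the contour integral vanishes. *)
have intY (f g : 'I_n -> 'I_(n + n)) i j :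
    let Y (X : 'M[R]_(n + n)) := \matrix_(a, b) X (f a) (g b) in
    (\int[@lebesgue_measure R]_(th in `[0, 2 * pi]%classic)
      (L *m Y (invmx (1%:M - N th)) *m Q) i j)%R = (L *m Y (2 * pi)%:M *m Q) i j.
  move=> Y; rewrite (Rintegral_antiderivative
    (H := fun th => (L *m Y (F th) *m Q) i j) pi0).
  - transitivity ((L *m (Y (F (2 * pi)) - Y (F 0)) *m Q) i j).
      by rewrite mulmxBr mulmxBl !mxE.
    rewrite (_ : Y _ - Y _ = Y (2 * pi)%:M)//; apply/matrixP => a b.
    by rewrite -Fp !mxE.
  - move=> th; have := cF th; move=> /cvg_mxP c.
    have : (fun th => L *m Y (invmx (1%:M - N th)) *m Q) @ th -->
        L *m Y (invmx (1%:M - N th)) *m Q.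
      apply: cvg_mulmx; last exact: cvg_cst.
      apply: cvg_mulmx; first exact: cvg_cst.
      apply/cvg_mxP => a b; rewrite mxE; under eq_fun do rewrite mxE; exact: c.
    by move=> /cvg_mxP; exact.
  - move=> th th2pi.
    have dY : der setT (fun th => Y (F th)) th (Y (invmx (1%:M - N th))).
      apply: der_mx => a b; rewrite mxE; under eq_fun do rewrite mxE.
      by apply: der_entry; exact: dF.
    have := der_entry i j (der_mulmx (der_mulmx (der_cst setT th L) dY) (der_cst setT th Q)).
    by rewrite mulmx0 addr0 mul0mx add0r.
have integrandE th i j :
    (toC L *m invmx ((lam th)%:M - toC H) *m toC Q) i j * ('i * lam th) =
    (toC L *m K th *m toC Q) i j * 'i.
  have lam0 : lam th != 0.
    by apply/eqP => l0; have /eqP := lamw th; rewrite l0 mul0r eq_sym oner_eq0.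
  have -> : (lam th)%:M - toC H = lam th *: (1%:M - w th *: toC H).
    by rewrite scalerBr scalerA lamw scale1r scalemx1.
  have Ku : 1%:M - w th *: toC H \in unitmx.
    by have := Nu 1 th one01; rewrite mul1r.
  rewrite invmxZ ?unitmxZ ?unitfE// -scalemxAr -scalemxAl mxE.
  by rewrite -/(K th) ['i * _]mulrC mulrACA mulVf// mul1r.
have ReK th : map_mx Re (K th) =
    \matrix_(a, b) invmx (1%:M - N th) (lshift n a) (lshift n b).
  by apply/matrixP => a b; rewrite -KE [RHS]mxE /cblock block_mxEul.
have ImK th : - map_mx Im (K th) =
    \matrix_(a, b) invmx (1%:M - N th) (lshift n a) (rshift n b).
  by apply/matrixP => a b; rewrite -KE [RHS]mxE /cblock block_mxEur.
have LKQ_Re th : map_mx Re (toC L *m K th *m toC Q) = L *m map_mx Re (K th) *m Q.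
  by rewrite !Re_mulmx !Re_toC !Im_toC !mulmx0 !mul0mx !subr0.
have LKQ_Im th : map_mx Im (toC L *m K th *m toC Q) = L *m map_mx Im (K th) *m Q.
  by rewrite !Im_mulmx !Re_mulmx !Re_toC !Im_toC !mulmx0 !mul0mx !addr0 !add0r.
apply/matrixP => i j; rewrite mxE [contour_mx _ _ _ _]mxE [RHS]mxE.
have -> : contour_integral r
    (fun lam => (toC L *m invmx (lam%:M - toC H) *m toC Q) i j) =
    0 +i* (2 * pi * (L *m Q) i j).
  rewrite /contour_integral; congr (_ +i* _).
    rewrite [RHS](_ : _ = (L *m (\matrix_(a, b)
        (2 * pi)%:M (lshift n a) (rshift n b)) *m Q) i j); last first.
      rewrite (_ : \matrix_(a, b) _ = 0) ?mulmx0 ?mul0mx ?mxE//.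
      by apply/matrixP => a b; rewrite !mxE eq_lrshift mulr0n.
    rewrite -intY; apply: eq_Rintegral => th _.
    rewrite -/(lam th) integrandE ReiNIm -ImK mulmxN mulNmx -LKQ_Im [RHS]mxE.
    by rewrite [in RHS]mxE.
  rewrite [RHS](_ : _ = (L *m (\matrix_(a, b)
      (2 * pi)%:M (lshift n a) (lshift n b)) *m Q) i j); last first.
    rewrite (_ : \matrix_(a, b) _ = (2 * pi)%:M); last first.
      by apply/matrixP => a b; rewrite !mxE (inj_eq (@lshift_inj _ _)).
    by rewrite mul_mx_scalar -scalemxAl [RHS]mxE.
  rewrite -intY; apply: eq_Rintegral => th _.
  by rewrite -/(lam th) integrandE ImiRe -ReK -LKQ_Re [RHS]mxE.
have pi0' : pi != 0 :> R by rewrite gt_eqF// pi_gt0.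
have -> : 0 +i* (2 * pi * (L *m Q) i j) = (2 * pi%:C * 'i) * ((L *m Q) i j)%:C :> C.
  have -> : 2 = 2%:C :> C by rewrite rmorph_nat.
  by apply/eqP; rewrite eq_complex/=; apply/andP; split; apply/eqP; ring.
rewrite mulrA mulVf ?mul1r//.
apply: mulf_neq0; first apply: mulf_neq0.
- by rewrite pnatr_eq0.
- by rewrite eq_complex/= negb_and pi0'.
- by rewrite eq_complex/= negb_and oner_eq0 orbT.
Qed.

End complex_matrices.

(** * The spectral projectors at a fixed time *)

Section spectral_projectors.
Context {R : realType} {n : nat}.
Local Open Scope complex_scope.
Local Notation C := R[i].
Local Notation toC := (map_mx (real_complex R)).

Lemma contour_mx_eq (r : R) (M M' : C -> 'M[C]_n) : 0 <= r ->
  (forall lam, `|lam| = r%:C -> M lam = M' lam) -> contour_mx r M = contour_mx r M'.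
Proof.
move=> r0 MM; apply/matrixP => i j; rewrite !mxE /contour_integral.
by congr (_ +i* _); apply: eq_Rintegral => th _; rewrite MM// norm_polar.
Qed.

Lemma normr_Re_le (z : C) : `|complex.Re z| <= Num.sqrt (complex.Re z ^+ 2 + complex.Im z ^+ 2).
Proof. by rewrite -sqrtr_sqr ler_wsqrtr// lerDl sqr_ge0. Qed.

Lemma normr_Im_le (z : C) : `|complex.Im z| <= Num.sqrt (complex.Re z ^+ 2 + complex.Im z ^+ 2).
Proof. by rewrite -sqrtr_sqr ler_wsqrtr// lerDr sqr_ge0. Qed.

Lemma le_enormC (x : 'cV[C]_n) i :
  `|complex.Re (x i 0)| <= enormC x /\ `|complex.Im (x i 0)| <= enormC x.
Proof.
have H : complex.Re (x i 0) ^+ 2 + complex.Im (x i 0) ^+ 2 <=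
    \sum_i (complex.Re (x i 0) ^+ 2 + complex.Im (x i 0) ^+ 2).
  rewrite (bigD1 i)//= lerDl sumr_ge0// => j _.
  by rewrite addr_ge0// sqr_ge0.
by split; [apply: le_trans (normr_Re_le _) _|apply: le_trans (normr_Im_le _) _];
  rewrite ler_wsqrtr.
Qed.

Lemma enormC_toC (x : 'cV[R]_n) : enormC (toC x) = enorm x.
Proof.
rewrite /enormC /enorm /dotv; congr Num.sqrt; apply: eq_bigr => i _.
by rewrite !mxE/= expr0n/= addr0 expr2.
Qed.

Lemma enormZ (a : R) (x : 'cV[R]_n) : enorm (a *: x) = `|a| * enorm x.
Proof.
rewrite /enorm /dotv; under eq_bigr do rewrite !mxE mulrACA.
by rewrite -mulr_sumr sqrtrM -?expr2 ?sqr_ge0// sqrtr_sqr.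
Qed.

(** A supremum dominates its set only if the set is bounded above; a crude bound on the unit ball
    comes from the sum of the absolute values of all real and imaginary parts of entries. *)
Lemma le_opnormC (M : 'M[C]_n) x : enormC x <= 1 -> enormC (M *m x) <= opnormC M.
Proof.
move=> x1; apply: ub_le_sup; last by exists x.
pose K := \sum_i \sum_j (`|complex.Re (M i j)| + `|complex.Im (M i j)|).
have K_ge i : \sum_j (`|complex.Re (M i j)| + `|complex.Im (M i j)|) <= K.
  rewrite /K [leRHS](bigD1 i)//= lerDl sumr_ge0// => k _.
  by rewrite sumr_ge0// => j _; rewrite addr_ge0.
exists (Num.sqrt (\sum_(i < n) (K ^+ 2 + K ^+ 2))) => _ [y /= y1 <-].
rewrite ler_wsqrtr// ler_sum// => i _.
have Rey j : `|complex.Re (y j 0)| <= 1 by case: (le_enormC y j) => /le_trans + _; apply.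
have Imy j : `|complex.Im (y j 0)| <= 1 by case: (le_enormC y j) => _ /le_trans; apply.
have sq a : `|a| <= K -> a ^+ 2 <= K ^+ 2.
  by move=> aK; rewrite -real_normK ?num_real// ler_sqr ?nnegrE// (le_trans _ aK).
rewrite mxE lerD// sq// ?Re_sum ?Im_sum (le_trans (ler_norm_sum _ _ _))//;
  rewrite (le_trans _ (K_ge i))// ler_sum// => j _.
- rewrite ReM (le_trans (ler_normB _ _))// !normrM lerD//;
  by rewrite -[leRHS]mulr1 ler_wpM2l.
- rewrite ImM (le_trans (ler_normD _ _))// !normrM lerD//;
  by rewrite -[leRHS]mulr1 ler_wpM2l.
Qed.

Lemma bounded_affine_const (a b K : R) :
  (forall s, 0 <= s -> `|a - s * b| <= K) -> b = 0.
Proof.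
move=> H; apply/eqP; apply/negPn/negP => b0.
have K0 : 0 <= K by have := H 0 (lexx _); apply: le_trans.
have s0 : 0 <= (K + `|a| + 1) / `|b| by rewrite divr_ge0// !addr_ge0.
have := H _ s0.
have : `|(K + `|a| + 1) / `|b| * b| = K + `|a| + 1.
  rewrite normrM normrM normfV normr_id mulfVK ?normr_eq0//.
  by rewrite ger0_norm// !addr_ge0.
have := ler_normD (a - (K + `|a| + 1) / `|b| * b) (- a).
rewrite addrAC subrr add0r !normrN; lra.
Qed.

Lemma invmx_mul {F : fieldType} (X Y : 'M[F]_n) : X \in unitmx -> Y \in unitmx ->
  invmx (X *m Y) = invmx Y *m invmx X.
Proof.
move=> Xu Yu; have XYu : X *m Y \in unitmx by rewrite unitmx_mul Xu.
by rewrite -[RHS](mulKmx XYu) -mulmxA (mulmxA Y) mulmxV// mul1mx mulmxV// mulmx1.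
Qed.

Context (A B : R -> 'M[R]_n) (C2 : R -> R) (t C1 : R).
Hypothesis C2_gt0 : 0 < C2 t.
Hypothesis resolvent_bound : forall lam : C, (C2 t)%:C <= `|lam| ->
  pencil A B t lam \in unitmx /\ opnormC (invmx (pencil A B t lam)) <= C1.

Let c := C2 t.
Let M := c *: A t + B t.
Let E := invmx M *m A t.

Let pencil_real s : pencil A B t s%:C = toC (s *: A t + B t).
Proof. by rewrite /pencil map_mxD map_mxZ. Qed.

Let real_unit s : c <= s -> s *: A t + B t \in unitmx.
Proof.
move=> cs; have [|+ _] := @resolvent_bound s%:C.
  by rewrite normc_def/= expr0n/= addr0 sqrtr_sqr lecR (le_trans cs)// ler_norm.
by rewrite pencil_real map_unitmx.
Qed.

Let Mu : M \in unitmx. Proof. exact: real_unit. Qed.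
Let AE : A t = M *m E. Proof. by rewrite /E mulKVmx. Qed.
Let BE : B t = M *m (1%:M - c *: E).
Proof. by rewrite mulmxBr mulmx1 -scalemxAr -AE /M addrC addKr. Qed.

(** If E (E v) = 0, the inverse of the pencil at the real point c + s maps M v to v - s E v. The
    resolvent bound does not depend on s, so these vectors stay bounded as s grows, and E v = 0. *)
Let index_one (v : 'cV[R]_n) : E *m (E *m v) = 0 -> E *m v = 0.
Proof.
move=> EEv.
(* [d] scales [u] into the unit ball, over which [opnormC] is a supremum. *)
pose u := M *m v; pose d := (1 + enorm u)^-1.
have u0 : 0 < 1 + enorm u by rewrite ltr_pwDl// sqrtr_ge0.
have d0 : 0 < d by rewrite invr_gt0.
have du : enormC (toC (d *: u)) <= 1.
  by rewrite enormC_toC enormZ gtr0_norm// mulrC ler_pdivrMr// mul1r lerDr.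
have key s i : 0 <= s -> `|d * v i 0 - s * (d * (E *m v) i 0)| <= C1.
  move=> s0; have cs : c <= c + s by rewrite lerDl.
  have [|_ bd] := @resolvent_bound (c + s)%:C.
    by rewrite normc_def/= expr0n/= addr0 sqrtr_sqr lecR (le_trans cs)// ler_norm.
  have := le_trans (le_opnormC (invmx (pencil A B t (c + s)%:C)) du) bd.
  rewrite pencil_real -map_invmx -map_mxM.
  have -> : invmx ((c + s) *: A t + B t) *m (d *: u) = d *: (v - s *: (E *m v)).
    apply: (canLR (mulKmx (real_unit cs))).
    have -> : (c + s) *: A t + B t = M *m (1%:M + s *: E).
      by rewrite mulmxDr mulmx1 -scalemxAr -AE scalerDl addrAC.
    rewrite -scalemxAr /u -mulmxA; congr (_ *: (_ *m _)).
    rewrite mulmxBr !mulmxDl !mul1mx -!scalemxAl -!scalemxAr EEv !scaler0 addr0.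
    by rewrite addrK.
  move=> H; have [+ _] := le_enormC (toC (d *: (v - s *: (E *m v)))) i.
  by move=> /le_trans /(_ H); rewrite !mxE/= mulrBr mulrCA.
apply/matrixP => i j; rewrite (ord1 j) [RHS]mxE.
have /eqP := bounded_affine_const (fun s s0 => key s i s0).
by rewrite mulf_eq0 gt_eqF//= => /eqP.
Qed.

(** With M = c A + B one has A = M E and B = M (1 - c E), so the pencil is M (1 + (lam - c) E). For
    D and P from the group inverse of E this gives P1 = P, Q1 = M P M^-1 and G = M (E + 1 - P),
    where the second factor has the inverse D + 1 - P. *)
Theorem spectral_projectorsP :
  let P := P1 A B C2 t in let Q := Q1 A B C2 t in
  [/\ P *m P = P, A t *m P = A t, Q *m A t = A t, B t *m P = Q *m B t &
      G A B C2 t \in unitmx].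
Proof.
have [D [P [ED DE PE EP PD]]] := index_one_group_inverse index_one.
have DP : D *m P = D by rewrite -ED mulmxA DE.
have PP : P *m P = P by rewrite -{2}ED mulmxA PE ED.
have toCM m1 m2 m3 (X : 'M[R]_(m1, m2)) (Y : 'M[R]_(m2, m3)) :
  toC (X *m Y) = toC X *m toC Y by rewrite map_mxM.
have res (lam : C) : c%:C <= `|lam| ->
    lam%:M - toC (c *: P - D) \in unitmx /\
    [/\ pencil A B t lam = toC M *m (1%:M + (lam - c%:C) *: toC E),
      1%:M + (lam - c%:C) *: toC E \in unitmx &
      invmx (1%:M + (lam - c%:C) *: toC E) *m toC E =
      invmx (lam%:M - toC (c *: P - D)) *m toC P].
  move=> clam; have [pu _] := resolvent_bound clam.
  have pE : pencil A B t lam = toC M *m (1%:M + (lam - c%:C) *: toC E).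
    rewrite mulmxDr mulmx1 -scalemxAr -toCM -AE /pencil scalerBl addrCA.
    by rewrite /M map_mxD map_mxZ [_%:C *: _ + _]addrC addrK.
  have Ku : 1%:M + (lam - c%:C) *: toC E \in unitmx.
    by move: pu; rewrite pE unitmx_mul => /andP[].
  have lam0 : lam != 0.
    rewrite -normr_eq0 gt_eqF//; apply: lt_le_trans clam.
    by rewrite ltcR.
  have := @index_one_resolvent _ _ (toC E) (toC D) (toC P) c%:C lam.
  rewrite -!toCM ED DE PE EP PD => /(_ erefl erefl erefl erefl erefl lam0 Ku)/=.
  by rewrite -map_mxZ -map_mxB => -[Hu HE].
have Hu lam : c%:C <= `|lam| -> lam%:M - toC (c *: P - D) \in unitmx.
  by move=> /res[].
have Mu' : toC M \in unitmx by rewrite map_unitmx.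
have P1E : P1 A B C2 t = P.
  rewrite /P1 /spectral_P1 -/c.
  rewrite (@contour_mx_eq _ _ (fun lam => toC 1%:M *m invmx (lam%:M - toC (c *: P - D)) *m toC P)).
  - by rewrite contour_resolvent// mul1mx Re_toC.
  - exact: ltW.
  - move=> lam lamc; have [|Hlam [pE Ku KE]] := res lam; first by rewrite lamc.
    by rewrite map_mx1 mul1mx -KE pE AE toCM (invmx_mul Mu' Ku) -mulmxA (mulKmx Mu').
have Q1E : Q1 A B C2 t = M *m P *m invmx M.
  rewrite /Q1 /spectral_Q1 -/c.
  rewrite (@contour_mx_eq _ _ (fun lam => toC M *m invmx (lam%:M - toC (c *: P - D)) *m toC (P *m invmx M))).
  - by rewrite contour_resolvent// Re_toC mulmxA.
  - exact: ltW.
  - move=> lam lamc; have [|Hlam [pE Ku KE]] := res lam; first by rewrite lamc.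
    rewrite toCM pE AE toCM (invmx_mul Mu' Ku) map_invmx !mulmxA; congr (_ *m _).
    rewrite -!mulmxA -KE; congr (_ *m _).
    set K := 1%:M + _ in Ku *.
    have KEc : K *m toC E = toC E *m K.
      by rewrite /K mulmxDl mulmxDr mul1mx mulmx1 -scalemxAl scalemxAr.
    by rewrite -[toC E in LHS](mulKmx Ku) KEc -!mulmxA (mulmxV Ku) mulmx1.
rewrite /= P1E Q1E; split => //.
- by rewrite AE -mulmxA EP.
- by rewrite AE !mulmxA mulmxKV// -!mulmxA PE.
- rewrite BE !mulmxA mulmxKV// -!mulmxA; congr (_ *m _).
  by rewrite mulmxBl mulmxBr mul1mx mulmx1 -scalemxAl -scalemxAr EP PE.
- have GE : G A B C2 t = M *m (E + (1%:M - P)).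
    rewrite /G /P2 P1E BE [M *m (E + _)]mulmxDr -AE; congr (_ + _).
    rewrite -mulmxA; congr (_ *m _).
    by rewrite mulmxBl mul1mx -scalemxAl mulmxBr EP mulmx1 subrr scaler0 subr0.
  rewrite GE unitmx_mul Mu/=.
  suff /mulmx1_unit[] : (E + (1%:M - P)) *m (D + (1%:M - P)) = 1%:M by [].
  rewrite mulmxDl mulmxDr ED mulmxBr EP mulmx1 subrr addr0 mulmxBl mul1mx.
  rewrite [P *m (D + _)]mulmxDr PD mulmxBr mulmx1 PP subrr addr0.
  by rewrite [D + _ - D]addrAC subrr add0r subrKC.
Qed.

End spectral_projectors.

(** * The canonical splitting of the pencil *)

Section splitting.
Context {R : realType} {n : nat}.
Implicit Types A B P Q : 'M[R]_n.

(** The relations through which the projectors are used from here on; the contour integrals return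
    only in the proof that [P1] is continuous. *)
Definition splitting A B P Q := [/\ P *m P = P, A *m P = A, Q *m A = A,
  B *m P = Q *m B & A + B *m (1%:M - P) \in unitmx].

Section one_splitting.
Variables A B P Q : 'M[R]_n.
Hypothesis S : splitting A B P Q.
Let G := A + B *m (1%:M - P).
Let Gu : G \in unitmx. Proof. by case: S. Qed.

Lemma split_PP2 : P *m (1%:M - P) = 0.
Proof. by case: S => PP _ _ _ _; rewrite mulmxBr mulmx1 PP subrr. Qed.

Lemma split_P2P : (1%:M - P) *m P = 0.
Proof. by case: S => PP _ _ _ _; rewrite mulmxBl mul1mx PP subrr. Qed.

Lemma split_P2P2 : (1%:M - P) *m (1%:M - P) = 1%:M - P.
Proof. by rewrite mulmxBl mul1mx split_PP2 subr0. Qed.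

Lemma split_AP2 : A *m (1%:M - P) = 0.
Proof. by case: S => _ AP _ _ _; rewrite mulmxBr mulmx1 AP subrr. Qed.

Lemma split_Q2A : (1%:M - Q) *m A = 0.
Proof. by case: S => _ _ QA _ _; rewrite mulmxBl mul1mx QA subrr. Qed.

Lemma split_BP2 : B *m (1%:M - P) = (1%:M - Q) *m B.
Proof. by case: S => _ _ _ BP _; rewrite mulmxBl mulmxBr mul1mx mulmx1 BP. Qed.

Lemma split_GP : G *m P = A.
Proof. by case: S => _ AP _ _ _; rewrite mulmxDl AP -mulmxA split_P2P mulmx0 addr0. Qed.

Lemma split_QG : Q *m G = A.
Proof.
case: S => _ _ QA BP _; rewrite mulmxDr QA mulmxA -BP -mulmxA split_PP2.
by rewrite mulmx0 addr0.
Qed.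

Lemma split_GiA : invmx G *m A = P.
Proof. by rewrite -split_GP mulKmx. Qed.

Lemma split_AGi : A *m invmx G = Q.
Proof. by rewrite -split_QG mulmxK. Qed.

Lemma split_QQ : Q *m Q = Q.
Proof. by case: S => _ _ QA _ _; rewrite -{2}split_AGi mulmxA QA split_AGi. Qed.

Lemma split_QQ2 : Q *m (1%:M - Q) = 0.
Proof. by rewrite mulmxBr mulmx1 split_QQ subrr. Qed.

Lemma split_Q2Q2 : (1%:M - Q) *m (1%:M - Q) = 1%:M - Q.
Proof. by rewrite mulmxBl mul1mx split_QQ2 subr0. Qed.

Lemma split_PGi : P *m invmx G = invmx G *m Q.
Proof. by rewrite -split_AGi mulmxA split_GiA. Qed.

Lemma split_P2Gi : (1%:M - P) *m invmx G = invmx G *m (1%:M - Q).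
Proof. by rewrite mulmxBl mulmxBr mul1mx mulmx1 split_PGi. Qed.

Lemma split_GP2 : G *m (1%:M - P) = B *m (1%:M - P).
Proof. by rewrite mulmxDl split_AP2 add0r -mulmxA split_P2P2. Qed.

Lemma split_GiBP2 : invmx G *m B *m (1%:M - P) = 1%:M - P.
Proof. by rewrite -mulmxA -split_GP2 mulKmx. Qed.

Lemma split_GiQ2B : invmx G *m (1%:M - Q) *m B = 1%:M - P.
Proof. by rewrite -mulmxA -split_BP2 mulmxA split_GiBP2. Qed.

End one_splitting.

(** P - P0 = (1 - P0) P - P0 (1 - P). Insert 1 - P0 = G0^-1 (1 - Q0) B0 and P0 = G0^-1 A0, then use
    A (1 - P) = 0 and (1 - Q0) A0 = 0: each term acquires a factor A - A0 or B - B0. No increment of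
    P remains on the right, so continuity of P is enough to differentiate it. *)
Lemma splitting_increment A0 B0 P0 Q0 A B P Q :
  splitting A0 B0 P0 Q0 -> splitting A B P Q ->
  let G0 := A0 + B0 *m (1%:M - P0) in let G := A + B *m (1%:M - P) in
  P - P0 = invmx G0 *m (1%:M - Q0) *m ((A - A0) *m invmx G *m B - (B - B0)) *m P
           + invmx G0 *m (A - A0) *m (1%:M - P).
Proof.
move=> S0 S G0 G; have [PP AP QA BP Gu] := S.
have -> : P - P0 = (1%:M - P0) *m P - P0 *m (1%:M - P).
  by rewrite mulmxBl mulmxBr mul1mx mulmx1 opprB addrA subrK.
congr (_ + _); last first.
  rewrite [invmx G0 *m (A - A0)]mulmxBr [RHS]mulmxBl -(mulmxA _ A) (split_AP2 S) mulmx0 sub0r.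
  by rewrite (split_GiA S0).
have E1 : (1%:M - Q0) *m (A - A0) = (1%:M - Q0) *m A.
  by rewrite mulmxBr (split_Q2A S0) subr0.
have E2 : (1%:M - Q0) *m ((A - A0) *m invmx G *m B) = (1%:M - Q0) *m (B *m P).
  by rewrite !mulmxA E1 -(mulmxA _ A) (split_AGi S) -mulmxA -BP mulmxA.
rewrite -[invmx G0 *m (1%:M - Q0) *m (_ - _)]mulmxA.
rewrite [(1%:M - Q0) *m (_ - (B - B0))]mulmxBr E2 -mulmxBr mulmxA -(mulmxA _ _ P).
have -> : (B *m P - (B - B0)) *m P = B0 *m P.
  by rewrite !mulmxBl -mulmxA PP opprB addrC subrK.
by rewrite mulmxA (split_GiQ2B S0).
Qed.

End splitting.

Section projector_derivative.
Context {R : realType} {n : nat} (J : set R) (A B P Q A' B' : R -> 'M[R]_n).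
Hypothesis S : forall t, J t -> splitting (A t) (B t) (P t) (Q t).
Hypothesis dA : forall t, J t -> der J A t (A' t).
Hypothesis dB : forall t, J t -> der J B t (B' t).
Hypothesis cP : {within J, continuous P}.
Let G t := A t + B t *m (1%:M - P t).

Let Gu t : J t -> G t \in unitmx. Proof. by move=> /S[]. Qed.

(** The limit of [splitting_increment] after division by s - t; that formula is already in
    Caratheodory's form. *)
Definition proj_der t :=
  invmx (G t) *m (1%:M - Q t) *m (A' t *m invmx (G t) *m B t - B' t) *m P t
  + invmx (G t) *m A' t *m (1%:M - P t).

Lemma der_projector t : J t -> der J P t (proj_der t).
Proof.
move=> Jt; have [sA EA cA] := dA Jt; have [sB EB cB] := dB Jt.
have cPt : P s @[s --> within J (nbhs t)] --> P t by move/subspace_continuousP : cP; exact.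
have cAt := der_cvg (dA Jt); have cBt := der_cvg (dB Jt).
have cGi : invmx (G s) @[s --> within J (nbhs t)] --> invmx (G t).
  apply: cvg_invmx; first exact: Gu.
  apply: cvgD => //; apply: cvg_mulmx => //.
  by apply: cvgB => //; exact: cvg_cst.
exists (fun s => invmx (G t) *m (1%:M - Q t) *m (sA s *m invmx (G s) *m B s - sB s) *m P s
  + invmx (G t) *m sA s *m (1%:M - P s)) => [s Js|].
  rewrite (splitting_increment (S Jt) (S Js)) -/(G t) -/(G s) EA// EB//.
  by rewrite scalerDr -!scalemxAl -scalerBr -!(scalemxAr, scalemxAl).
apply: cvgD.
  apply: cvg_mulmx => //; apply: cvg_mulmx; first exact: cvg_cst.
  by apply: cvgB => //; apply: cvg_mulmx => //; exact: cvg_mulmx.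
apply: cvg_mulmx; first by apply: cvg_mulmx => //; exact: cvg_cst.
by apply: cvgB => //; exact: cvg_cst.
Qed.

End projector_derivative.

(** * Continuity of the spectral projector in time *)

Section parameter_integral.
Context {R : realType}.

(** By compactness of the period the integrands are uniformly close for close parameters; the
    integrals are then compared through their primitives. *)
Lemma continuous_parameter_integral (psi : R -> R -> R) (p : R) : 0 < p ->
  continuous (fun q : R * R => psi q.1 q.2) ->
  continuous (fun t => (\int[@lebesgue_measure R]_(th in `[0, p]) psi t th)%R).
Proof.
move=> p0 cpsi t0.
have cth t : continuous (psi t).
  move=> th; apply: (@continuous_comp _ _ _ (fun th : R => (t, th))
    (fun q : R * R => psi q.1 q.2)).
    by apply: (cvg_pairl (F := nbhs th)); [exact: cvg_cst|exact: cvg_id].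
  exact: cpsi.
apply/cvgrPdist_le => e e0.
have ep0 : 0 < e / p / 2 by rewrite !divr_gt0.
have : \forall t \near t0, forall th, `[0, p]%classic th ->
    `|psi t0 th - psi t th| <= e / p.
  apply: (@compact_forall_near _ _ (nbhs t0) _ _
    (fun t th => `|psi t0 th - psi t th| <= e / p) (@segment_compact _ 0 p)) => th _.
  have := cpsi (t0, th); move/cvgrPdist_le => /(_ _ ep0) /= c1.
  have := cth t0 th; move/cvgrPdist_le => /(_ _ ep0) /= c2.
  have [[/= U1 U2] [U1t U2th] U12] := c1.
  exists (U2 `&` [set th' | `|psi t0 th - psi t0 th'| <= e / p / 2], U1).
    by split => //=; apply: filterI.
  move=> [th' t] /= [[U2th' H] U1t'].
  have := U12 (t, th'); move=> /(_ (conj U1t' U2th'))/= H'.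
  rewrite -[psi t0 th' - _](subrKA (psi t0 th)) (le_trans (ler_normD _ _))//.
  by rewrite [e / p]splitr lerD// distrC.
apply: filterS => t tp.
have [H1 dH1] := antiderivative 0 p (cth t0).
have [H2 dH2] := antiderivative 0 p (cth t).
rewrite (@Rintegral_antiderivative _ (psi t0) H1)//; last first.
  by move=> th thp; apply: is_derive_der; exact: dH1.
rewrite (@Rintegral_antiderivative _ (psi t) H2)//; last first.
  by move=> th thp; apply: is_derive_der; exact: dH2.
(* Scalars are viewed as 1 x 1 matrices, for which the mean value inequality is stated. *)
pose m1 (x : R) : 'M[R]_1 := x%:M.
have dm (g : R -> R) g' D (s : R) : der D g s g' -> der D (fun s => m1 (g s)) s (m1 g').
  move=> dg; apply: der_mx => i j; rewrite !ord1 mxE.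
  rewrite (_ : (fun s => _) = g)//; by apply/funext => x; rewrite mxE.
have nm (x : R) : `|m1 x| = `|x|.
  apply/eqP; rewrite eq_le; apply/andP; split.
    by apply: mx_norm_le => // i j; rewrite !ord1 mxE.
  by rewrite (le_trans _ (le_mx_norm _ 0 0))// mxE.
have := @mean_value_le _ _ _ (fun s => m1 (H1 s - H2 s)) (fun s => m1 (psi t0 s - psi t s))
  (fun s => e / p * s) (fun=> e / p) 0 p (ltW p0).
rewrite -raddfB/= -/(m1 _) nm mulr0 subr0 mulfVK ?gt_eqF//.
have -> : H1 p - H2 p - (H1 0 - H2 0) = H1 p - H1 0 - (H2 p - H2 0) by ring.
apply.
- by move=> s sp; apply: dm; apply: derB; apply: is_derive_der; [exact: dH1|exact: dH2].
- move=> s _; have := derM (der_cst `[0, p] s (e / p)) (der_id `[0, p] s).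
  by rewrite mul0r add0r mulr1.
- by move=> s sp; rewrite nm; apply: tp; rewrite /= in_itv.
Qed.

Lemma cvg_block_mx {T : Type} (F : set_system T) {FF : Filter F} {m1 m2 n1 n2}
    (X1 : T -> 'M[R]_(m1, n1)) (X2 : T -> 'M[R]_(m1, n2))
    (X3 : T -> 'M[R]_(m2, n1)) (X4 : T -> 'M[R]_(m2, n2))
    (Y1 : 'M[R]_(m1, n1)) (Y2 : 'M[R]_(m1, n2))
    (Y3 : 'M[R]_(m2, n1)) (Y4 : 'M[R]_(m2, n2)) :
  X1 @ F --> Y1 -> X2 @ F --> Y2 -> X3 @ F --> Y3 -> X4 @ F --> Y4 ->
  (fun t => block_mx (X1 t) (X2 t) (X3 t) (X4 t)) @ F --> block_mx Y1 Y2 Y3 Y4.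
Proof.
move=> /cvg_mxP c1 /cvg_mxP c2 /cvg_mxP c3 /cvg_mxP c4; apply/cvg_mxP => i j.
rewrite -(splitK i) -(splitK j).
case: (fintype.split i) => i'; case: (fintype.split j) => j' /=;
 [rewrite block_mxEul; under eq_fun do rewrite block_mxEul; exact: c1
 |rewrite block_mxEur; under eq_fun do rewrite block_mxEur; exact: c2
 |rewrite block_mxEdl; under eq_fun do rewrite block_mxEdl; exact: c3
 |rewrite block_mxEdr; under eq_fun do rewrite block_mxEdr; exact: c4].
Qed.

End parameter_integral.

Section projector_continuity.
Context {R : realType} {n : nat}.
Local Open Scope complex_scope.
Local Notation C := R[i].
Local Notation toC := (map_mx (real_complex R)).
Variables (A B : R -> 'M[R]_n) (C2 : R -> R).

Let lam t th : C := (C2 t)%:C * (cos th +i* sin th).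

(** The real form of lam (lam A + B)^-1 A at lam = C2 (cos th + i sin th). Since d lam = i lam d th,
    its average over a period is [P1]. *)
Definition contour_density (t th : R) : 'M[R]_(n + n) :=
  ((C2 t * cos th) *: 1%:M + (C2 t * sin th) *: cblock 'i%:M) *m
  invmx ((C2 t * cos th) *: cblock (toC (A t))
    + (C2 t * sin th) *: (cblock 'i%:M *m cblock (toC (A t))) + cblock (toC (B t)))
  *m cblock (toC (A t)).

Lemma P1_contour_density t : 
  (forall th, pencil A B t (lam t th) \in unitmx) ->
  P1 A B C2 t = \matrix_(i, j) ((2 * pi)^-1 *
    (\int[@lebesgue_measure R]_(th in `[0%R, (2 * pi)%R])
       contour_density t th (lshift n i) (lshift n j))%R).
Proof.
move=> pu; apply/matrixP => i j; rewrite [RHS]mxE /P1 /spectral_P1 mxE mxE.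
rewrite [contour_mx _ _ _ _]mxE /contour_integral.
have pi0 : pi != 0 :> R by rewrite gt_eqF// pi_gt0.
have re_div (p x y : R) : p != 0 ->
    complex.Re ((2 * p%:C * 'i)^-1 * (x +i* y)) = (2 * p)^-1 * y.
  move=> p0.
  have -> : x +i* y = (2 * p%:C * 'i) * ((2 * p)^-1 * y +i* (- ((2 * p)^-1 * x))) :> C.
    have -> : 2 = 2%:C :> C by rewrite rmorph_nat.
    apply/eqP; rewrite eq_complex/=; apply/andP.
    by split; apply/eqP; field.
  rewrite mulKf//; apply: mulf_neq0; first apply: mulf_neq0.
  - by rewrite pnatr_eq0.
  - by rewrite eq_complex/= negb_and p0.
  - by rewrite eq_complex/= negb_and oner_eq0 orbT.
rewrite re_div//.
congr (_ * _); apply: eq_Rintegral => th _; rewrite -/(lam t th).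
set X := invmx _ *m toC _.
have -> : contour_density t th = cblock (lam t th *: X).
  have lamE : lam t th *: X = (lam t th)%:M *m X by rewrite mul_scalar_mx.
  have lamE2 : (lam t th)%:M = (C2 t * cos th)%:C *: 1%:M + (C2 t * sin th)%:C *: 'i%:M :> 'M[C]_n.
    rewrite !scale_scalar_mx -raddfD/=; congr (_%:M).
    by apply/eqP; rewrite eq_complex/=; apply/andP; split; apply/eqP; ring.
  have -> : cblock (lam t th *: X) = cblock (lam t th)%:M *m
      invmx (cblock (pencil A B t (lam t th))) *m cblock (toC (A t)).
    by rewrite lamE cblockM /X cblockM (cblock_invmx (pu th)).2 mulmxA.
  rewrite /contour_density /pencil lamE2 cblockD !cblockZ cblock1.
  congr (_ *m invmx _ *m _).
  rewrite cblockD; congr (_ + _); rewrite -[lam t th *: toC _]mul_scalar_mx lamE2 mulmxDl cblockD.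
  by rewrite -!scalemxAl mul1mx !cblockZ cblockM.
rewrite /cblock block_mxEul; transitivity (complex.Re (lam t th * X i j)).
  by rewrite mulrCA mulrC ImiRe [X i j * _]mulrC.
by rewrite !mxE.
Qed.

Lemma contour_density_continuous :
  continuous A -> continuous B -> continuous C2 ->
  (forall t th, pencil A B t (lam t th) \in unitmx) ->
  continuous (fun q : R * R => contour_density q.1 q.2).
Proof.
move=> cA cB cC pu q.
have cfst (V : topologicalType) (g : R -> V) : continuous g ->
    g p.1 @[p --> nbhs q] --> g q.1.
  by move=> cg; apply: (@cvg_comp _ _ _ fst g _ (nbhs q.1)); [exact: cvg_fst|exact: cg].
have csnd (V : topologicalType) (g : R -> V) : continuous g ->
    g p.2 @[p --> nbhs q] --> g q.2.
  by move=> cg; apply: (@cvg_comp _ _ _ snd g _ (nbhs q.2)); [exact: cvg_snd|exact: cg].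
have cc : C2 p.1 * cos p.2 @[p --> nbhs q] --> C2 q.1 * cos q.2.
  by apply: cvgM; [exact: cfst|apply: csnd; exact: continuous_cos].
have cs : C2 p.1 * sin p.2 @[p --> nbhs q] --> C2 q.1 * sin q.2.
  by apply: cvgM; [exact: cfst|apply: csnd; exact: continuous_sin].
have cb (X : R -> 'M[R]_n) : continuous X ->
    cblock (toC (X p.1)) @[p --> nbhs q] --> cblock (toC (X q.1)).
  move=> cX; rewrite /cblock !Re_toC !Im_toC.
  under eq_fun do rewrite !Re_toC !Im_toC.
  by apply: cvg_block_mx; (try exact: cfst); exact: cvg_cst.
have cX : (C2 p.1 * cos p.2) *: cblock (toC (A p.1))
    + (C2 p.1 * sin p.2) *: (cblock 'i%:M *m cblock (toC (A p.1)))
    + cblock (toC (B p.1)) @[p --> nbhs q] -->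
    (C2 q.1 * cos q.2) *: cblock (toC (A q.1))
    + (C2 q.1 * sin q.2) *: (cblock 'i%:M *m cblock (toC (A q.1)))
    + cblock (toC (B q.1)).
  apply: cvgD; last exact: cb.
  apply: cvgD; apply: cvgZ => //; first exact: cb.
  by apply: cvg_mulmx; [exact: cvg_cst|exact: cb].
have cY : (C2 p.1 * cos p.2) *: 1%:M + (C2 p.1 * sin p.2) *: cblock 'i%:M @[p --> nbhs q]
    --> (C2 q.1 * cos q.2) *: 1%:M + (C2 q.1 * sin q.2) *: cblock ('i%:M : 'M[C]_n).
  by apply: cvgD; apply: cvgZ => //; exact: cvg_cst.
apply: cvg_mulmx; last exact: cb.
apply: cvg_mulmx; first exact: cY.
apply: cvg_invmx; last exact: cX.
have [+ _] := cblock_invmx (pu q.1 q.2).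
rewrite /pencil cblockD /lam.
have -> : (C2 q.1)%:C * (cos q.2 +i* sin q.2) =
    (C2 q.1 * cos q.2)%:C + (C2 q.1 * sin q.2)%:C * 'i :> C.
  by apply/eqP; rewrite eq_complex/=; apply/andP; split; apply/eqP; ring.
rewrite scalerDl cblockD cblockZ -[(_ * 'i) *: toC _]scalerA cblockZ.
by rewrite -['i *: toC _]mul_scalar_mx cblockM.
Qed.

End projector_continuity.

Section projector_facts.
Context {R : realType} {n : nat}.
Local Open Scope complex_scope.
Variables (A B : R -> 'M[R]_n) (C1 C2 : R -> R) (tp : R).
Hypothesis C2_gt0 : forall t, tp <= t -> 0 < C2 t.
Hypothesis resolvent_bound : forall t (lam : R[i]), tp <= t ->
     (C2 t)%:C <= `|lam| ->
     pencil A B t lam \in unitmx /\ opnormC (invmx (pencil A B t lam)) <= C1 t.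

Lemma spectral_splitting t : tp <= t ->
  splitting (A t) (B t) (P1 A B C2 t) (Q1 A B C2 t).
Proof.
move=> tpt; have [PP AP QA BP Gu] := spectral_projectorsP (C2_gt0 tpt)
  (fun lam => @resolvent_bound t lam tpt).
by split.
Qed.

Hypothesis cA : {within `[tp, +oo[, continuous A}.
Hypothesis cB : {within `[tp, +oo[, continuous B}.
Hypothesis cC : {within `[tp, +oo[, continuous C2}.

Lemma within_max {T : topologicalType} (h : R -> T) :
  {within `[tp, +oo[, continuous h} -> continuous (fun t => h (Num.max tp t)).
Proof.
move=> /subspace_continuousP ch t.
have ctp s : `[tp, +oo[%classic (Num.max tp s) by rewrite /= in_itv/= andbT le_max lexx.
apply: (@cvg_comp _ _ _ (Num.max tp) h _ (within `[tp, +oo[ (nbhs (Num.max tp t)))).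
  move=> U WU.
  have WU' : nbhs (Num.max tp t) [set s | `[tp, +oo[%classic s -> U s] := WU.
  have cmax : {for t, continuous (Num.max tp)}.
    apply/cvgrPdist_lt => e e0; apply/nbhs_ballP; exists e => //= s.
    apply: le_lt_trans; have := ler_norm (t - s); have := ler_norm (s - t).
    rewrite [`|s - t|]distrC.
    by case: (leP tp t) => ax; case: (leP tp s) => ay H1 H2;
      rewrite ler_norml; apply/andP; split; lra.
  have := cmax _ WU'.
  apply: (@filterS _ _ _
    [set s | `[tp, +oo[%classic (Num.max tp s) -> U (Num.max tp s)]) => s; apply.
  exact: ctp.
exact: ch.
Qed.

(** For times before [tp] the coefficients are frozen at their values at [tp]; they become
    continuous on the whole line, where the result on parameter integrals applies. *)
Lemma P1_continuous : {within `[tp, +oo[, continuous (P1 A B C2)}.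
Proof.
pose cl t := Num.max tp t.
have clE t : tp <= t -> cl t = t by move=> tpt; rewrite /cl max_r.
have tpcl t : tp <= cl t by rewrite le_max lexx.
have pu t th : pencil (A \o cl) (B \o cl) t
    (((C2 \o cl) t)%:C * (cos th +i* sin th)) \in unitmx.
  have [|+ _] := @resolvent_bound (cl t) ((C2 (cl t))%:C * (cos th +i* sin th)) (tpcl t); last by [].
  by rewrite norm_polar// ltW// C2_gt0.
have cW := contour_density_continuous (within_max cA) (within_max cB) (within_max cC) pu.
have pi0 : 0 < 2 * pi :> R by rewrite mulr_gt0// pi_gt0.
have cP : continuous (P1 (A \o cl) (B \o cl) (C2 \o cl)).
  move=> t; apply/cvg_mxP => i j.
  rewrite P1_contour_density// mxE.
  under eq_fun do rewrite P1_contour_density// mxE.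
  apply: cvgM; first exact: cvg_cst.
  apply: (@continuous_parameter_integral _ (fun t th =>
    contour_density (A \o cl) (B \o cl) (C2 \o cl) t th (lshift n i) (lshift n j)) _ pi0).
  move=> q; have := cW q; move/cvg_mxP; exact.
have PE t : tp <= t -> P1 (A \o cl) (B \o cl) (C2 \o cl) t = P1 A B C2 t.
  by move=> tpt; rewrite /P1 /spectral_P1 /pencil /= !clE.
apply: (@subspace_eq_continuous _ _ _ (P1 (A \o cl) (B \o cl) (C2 \o cl))).
  by move=> t; rewrite inE/= in_itv/= andbT; exact: PE.
exact: continuous_subspaceT.
Qed.

End projector_facts.

(** * Taylor estimates *)

Section jacobian.
Context {R : realType} {n : nat}.
Implicit Types (g : 'cV[R]_n -> 'cV[R]_n) (x y w d : 'cV[R]_n).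

Lemma diff_Jac g x d : differentiable g x -> 'd g x d = Jac g x *m d.
Proof.
move=> dg; have -> : d = \sum_j d j 0 *: (delta_mx j 0 : 'cV[R]_n).
  apply/matrixP => i j; rewrite summxE (bigD1 i)//= big1 ?addr0 => [|k ki].
    by rewrite !mxE (ord1 j) !eqxx mulr1.
  by rewrite !mxE eq_sym (negbTE ki) mulr0.
rewrite linear_sum mulmx_sumr; apply: eq_bigr => k _.
rewrite linearZ/= -scalemxAr; congr (_ *: _); apply/matrixP => i j.
rewrite mxE (bigD1 k)//= big1 ?addr0 => [|l lk]; rewrite !mxE (ord1 j) ?eqxx ?mulr1//.
by rewrite (negbTE lk) mulr0.
Qed.

Lemma der_along g y d (J : set R) s : differentiable g (s *: d + y) ->
  der J (fun r => g (r *: d + y)) s (Jac g (s *: d + y) *m d).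
Proof.
move=> dg; apply: (der_subset (@subsetT _ J)); apply: quotient_der.
have := @diff_derivable _ _ _ g (s *: d + y) d dg.
have := deriveE d dg; rewrite /derivable /derive (diff_Jac _ dg) => <- c.
apply: cvg_trans c; apply: (@cvg_trans _ ((fun h : R =>
  h^-1 *: (g (h *: d + (s *: d + y)) - g (s *: d + y))) @
  within [set h | [set: R] (h *: 1 + s)] 0^')).
  apply: near_eq_cvg; near=> h.
  by rewrite [h%:A]mulr1 scalerDl addrA.
by apply: cvg_app; exact: cvg_within.
Unshelve. all: by end_near. Qed.

(** The mean value inequality for s |-> g (y + s (x - y)) - s J0 (x - y). With J0 = 0 it gives a
    Lipschitz bound, with J0 the Jacobian at a centre it measures the deviation from the
    linearisation. *)
Lemma jacobian_mean_value g (J0 : 'M[R]_n) x y (e : R) :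
  (forall w, differentiable g w) ->
  (forall s, 0 <= s <= 1 -> `|Jac g (s *: (x - y) + y) - J0| <= e) ->
  `|g x - g y - J0 *m (x - y)| <= n%:R * e * `|x - y|.
Proof.
move=> dg Je; pose d := x - y.
have := @mean_value_le _ _ _ (fun s : R => g (s *: d + y) - s *: (J0 *m d))
  (fun s => Jac g (s *: d + y) *m d - J0 *m d)
  (fun s => n%:R * e * `|d| * s) (fun=> n%:R * e * `|d|) 0 1 ler01.
have -> : g (1 *: d + y) - 1 *: (J0 *m d) - (g (0 *: d + y) - 0 *: (J0 *m d)) =
    g x - g y - J0 *m d.
  by rewrite !scale1r !scale0r subrK add0r subr0 addrAC.
rewrite mulr1 mulr0 subr0; apply.
- move=> s _; apply: derB; first exact: der_along.
  have := der_scale (der_id `[0, 1] s) (der_cst `[0, 1] s (J0 *m d)).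
  by rewrite scale1r scaler0 addr0.
- move=> s _; have := derM (der_cst `[0, 1] s (n%:R * e * `|d|)) (der_id `[0, 1] s).
  by rewrite mul0r add0r mulr1.
- move=> s s01; rewrite -mulmxBl (le_trans (mulmx_norm _ _))//.
  by rewrite ler_wpM2r// ler_wpM2l// Je.
Qed.

Lemma enorm_le (x : 'cV[R]_n) : enorm x <= n%:R * `|x|.
Proof.
rewrite /enorm /dotv -[leRHS]ger0_norm ?mulr_ge0// -sqrtr_sqr ler_wsqrtr//.
case: n x => [|m] x; first by rewrite big_ord0 sqr_ge0.
have xi i : x i 0 * x i 0 <= `|x| ^+ 2.
  by rewrite -expr2 -real_normK ?num_real// ler_sqr ?nnegrE// le_mx_norm.
rewrite (le_trans (ler_sum _ (fun i _ => xi i)))// sumr_const card_ord exprMn.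
rewrite -[_ *+ _]mulr_natl ler_wpM2r ?sqr_ge0// -natrX ler_nat.
by rewrite -{1}[m.+1]expn1 leq_pexp2l.
Qed.

Lemma norm_le_enorm (x : 'cV[R]_n) : `|x| <= enorm x.
Proof.
apply: mx_norm_le; first exact: sqrtr_ge0.
move=> i j; rewrite (ord1 j) -sqrtr_sqr /enorm /dotv ler_wsqrtr//.
rewrite (bigD1 i)//= -expr2 lerDl sumr_ge0// => k _.
by rewrite -expr2 sqr_ge0.
Qed.

Lemma enorm_continuous : continuous (@enorm R n).
Proof.
move=> x; rewrite /enorm /dotv.
apply: (@continuous_comp _ _ _ (fun x : 'cV[R]_n => \sum_i x i 0 * x i 0) Num.sqrt).
  apply: (@cvg_sum _ _ (nbhs x)) => i _.
  by apply: cvgM; exact: coord_continuous.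
exact: sqrt_continuous.
Qed.

End jacobian.


(** * Convergence of the Heun and Newton scheme *)

Section heun_newton.
Context {R : realType} {n : nat}.
Local Notation V := 'cV[R]_n.

(* In the invariant, e + h^2 is multiplied by at most 1 + C' h at each step and
   the error d of the algebraic component is dominated by e + h^2: one Newton
   step squares an error that is O(h) at worst. *)
Lemma heun_newton_convergence (z u phi : R -> V) (g Nw : R -> V -> V -> V)
    (t0 T C : R) : t0 < T -> 1 <= C ->
  (forall t y v, t0 <= t <= T -> `|y - z t| <= 1 -> `|v - u t| <= 1 ->
    `|g t y v - phi t| <= C * (`|y - z t| + `|v - u t|)) ->
  (forall t y v, t0 <= t <= T -> `|y - z t| <= 1 -> `|v - u t| <= 1 ->
    `|Nw t y v - u t| <= C * (`|y - z t| + `|v - u t| ^+ 2)) ->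
  (forall s t, t0 <= s <= T -> t0 <= t <= T -> `|u s - u t| <= C * `|s - t|) ->
  (forall s t, t0 <= s <= T -> t0 <= t <= T ->
    `|z s - z t - (s - t) *: phi t| <= C * `|s - t| ^+ 2) ->
  (forall s t, t0 <= s <= T -> t0 <= t <= T ->
    `|z s - z t - ((s - t) / 2) *: (phi t + phi s)| <= C * `|s - t| ^+ 3) ->
  exists K h0, 0 < h0 /\ forall N, (0 < N)%N -> let h := (T - t0) / N%:R in
    h <= h0 -> forall zs us : nat -> V,
    let node (i : nat) := t0 + i%:R * h in
    zs 0%N = z t0 -> us 0%N = u t0 ->
    (forall i, (i < N)%N ->
      let zt := zs i + h *: g (node i) (zs i) (us i) in
      let ut := Nw (node i.+1) zt (us i) in
      zs i.+1 = zs i + (h / 2) *: (g (node i) (zs i) (us i) + g (node i.+1) zt ut) /\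
      us i.+1 = Nw (node i.+1) (zs i.+1) (us i)) ->
    forall i, (i <= N)%N ->
      `|zs i - z (node i)| <= K * h ^+ 2 /\ `|us i - u (node i)| <= K * h ^+ 2.
Proof.
move=> t0T C1 Hg HN Hu Hz1 Hz2.
have C0 : 0 < C by exact: lt_le_trans C1.
(* With q = e + h^2: [M q] bounds the algebraic error, [a1 q] the error of the Euler predictor,
   [b1 q] that of the Newton step made at the predictor, 1 + C' h the growth of q in one step, and
   [E] its total growth. The condition h <= 1 / W keeps all these errors below 1, where the
   hypotheses apply. *)
pose M := C * (2 + 2 * C ^+ 2).
pose a1 := 1 + 2 * C + C * M.
pose b1 := C * a1 + M.
pose C' := C * (1 + M + a1 + b1) + C.
have M0 : 0 < M by rewrite mulr_gt0// ltr_pwDl// mulr_ge0// sqr_ge0.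
have CM0 : 0 < C * M by rewrite mulr_gt0.
have a10 : 0 < a1 by rewrite /a1; move: C0 CM0; clear; lra.
have b10 : 0 < b1 by rewrite /b1 addr_gt0// mulr_gt0.
have S0 : 0 < 1 + M + a1 + b1 by move: M0 a10 b10; clear; lra.
have C'0 : 0 < C' by rewrite /C' addr_gt0// mulr_gt0.
pose E := expR (C' * (T - t0)).
have E0 : 0 < E by exact: expR_gt0.
have Tt0 : 0 < T - t0 by rewrite subr_gt0.
pose W := 1 + C + E + M * E + a1 * E + b1 * E.
have ME0 : 0 < M * E by rewrite mulr_gt0.
have aE0 : 0 < a1 * E by rewrite mulr_gt0.
have bE0 : 0 < b1 * E by rewrite mulr_gt0.
have W0 : 0 < W by rewrite /W; move: C0 E0 ME0 aE0 bE0; clear; lra.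
exists (E + M * E), W^-1; split; first by rewrite invr_gt0.
move=> N N0 h hh0 zs us node zs0 us0 step.
have N0' : 0 < N%:R :> R by rewrite ltr0n.
have h0 : 0 < h by rewrite divr_gt0.
have Wh : W * h <= 1 by rewrite mulrC -ler_pdivlMr// mul1r.
have nodeE i : node i.+1 - node i = h.
  by rewrite /node opprD addrACA subrr add0r -mulrBl -natr1 addrAC subrr add0r mul1r.
have node_in i : (i <= N)%N -> t0 <= node i <= T.
  move=> iN; rewrite /node lerDl mulr_ge0 ?(ltW h0)//=.
  rewrite -lerBrDl /h mulrCA ger_pMr// ler_pdivrMr// mul1r ler_nat//.
have h1 : h <= 1.
  rewrite (le_trans _ Wh)// ler_peMl ?(ltW h0)// /W.
  by move: C0 E0 ME0 aE0 bE0; clear; lra.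
have hh : h ^+ 2 <= h by rewrite expr2 ger_pMr.
have growth i : (i <= N)%N -> (1 + C' * h) ^+ i <= E.
  move=> iN; have p0 : 0 <= 1 + C' * h by rewrite addr_ge0// mulr_ge0// ltW.
  have e1 : 1 + C' * h <= expR (C' * h) by exact: expR_ge1Dx.
  rewrite (le_trans (lerXn2r _ _ _ e1)) ?nnegrE ?expR_ge0//.
  rewrite -expRM_natl ler_expR mulrCA ler_pM2l//.
  by rewrite /h mulrCA ger_pMr// ler_pdivrMr// mul1r ler_nat.
have inv i : (i <= N)%N ->
    `|zs i - z (node i)| + h ^+ 2 <= (1 + C' * h) ^+ i * h ^+ 2 /\
    `|us i - u (node i)| <= M * (`|zs i - z (node i)| + h ^+ 2).
  elim: i => [_|i IH iN].
    rewrite /node mul0r addr0 zs0 us0 !subrr !normr0 add0r expr0 mul1r; split => //.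
    by rewrite mulr_ge0 ?sqr_ge0// ltW.
  have {IH} [IHe IHd] := IH (ltnW iN).
  have ti := node_in _ (ltnW iN); have tj := node_in _ iN.
  have [zE uE] := step i iN; move: zE uE.
  set t := node i in ti IHe IHd *; set t' := node i.+1 in tj *.
  set zt := zs i + h *: g t (zs i) (us i); set ut := Nw t' zt _ => zE uE.
  have t't : t' - t = h by exact: nodeE.
  set e := `|zs i - z t| in IHe IHd; set d := `|us i - u t| in IHd.
  have e0 : 0 <= e by exact: normr_ge0.
  have d0 : 0 <= d by exact: normr_ge0.
  set q := e + h ^+ 2 in IHe IHd.
  have q0 : 0 <= q by rewrite addr_ge0// sqr_ge0.
  have eq_ : e <= q by rewrite lerDl sqr_ge0.
  have hq : h ^+ 2 <= q by rewrite lerDr.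
  have qE : q <= E * h ^+ 2.
    by rewrite (le_trans IHe)// ler_wpM2r ?sqr_ge0// growth// ltnW.
  have qEh : q <= E * h by rewrite (le_trans qE)// ler_pM2l.
  have small c : c * E <= W -> 0 <= c -> c * q <= 1.
    move=> cW c0; rewrite (le_trans _ Wh)// (@le_trans _ _ (c * (E * h)))//.
      by rewrite ler_wpM2l.
    by rewrite mulrA ler_pM2r.
  have dh : d + C * h <= 1.
    rewrite (le_trans _ Wh)// (@le_trans _ _ (M * E * h + C * h))//.
      by rewrite lerD2r (le_trans IHd)// -mulrA ler_pM2l.
    by rewrite -mulrDl ler_pM2r// /W; move: E0 aE0 bE0; clear; lra.
  have Ch0 : 0 < C * h by rewrite mulr_gt0.
  have d1 : d <= 1 by rewrite (le_trans _ dh)// lerDl ltW.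
  have e1 : e <= 1.
    by rewrite (le_trans eq_)// -[q]mul1r small//; rewrite /W; move: C0 ME0 aE0 bE0; clear; lra.
  (* As d <= M q <= M E h^2 <= h, the Newton step starts with an error d + C h = O(h), where C h
     accounts for the motion of [u] during the step. *)
  have dq : (d + C * h) ^+ 2 <= (2 + 2 * C ^+ 2) * h ^+ 2.
    have dhh : d <= h.
      rewrite (le_trans IHd)// (@le_trans _ _ (M * (E * h ^+ 2)))// ?ler_pM2l//.
      rewrite mulrA expr2 mulrA ger_pMl// (le_trans _ Wh)// ler_pM2r//.
      by rewrite /W; move: C0 E0 aE0 bE0; clear; lra.
    have : d ^+ 2 <= h ^+ 2 by rewrite ler_sqr ?nnegrE// ltW.
    have := sqr_ge0 (d - C * h); clear; rewrite !expr2; lra.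
  have g1 : `|g t (zs i) (us i) - phi t| <= C * (e + d) by exact: Hg.
  have gd : C * (e + d) <= C * (q + M * q) by rewrite ler_pM2l// lerD.
  pose a := `|zt - z t'|.
  have ab : a <= a1 * q.
    have -> : a = `|(zs i - z t) + h *: (g t (zs i) (us i) - phi t)
        - (z t' - z t - (t' - t) *: phi t)|.
      by rewrite /a /zt t't; congr (`|_|); apply/matrixP => k l; rewrite !mxE; ring.
    rewrite (le_trans (ler_normB _ _))// (le_trans (lerD (ler_normD _ _) (lexx _)))//.
    rewrite normrZ gtr0_norm//.
    have := Hz1 t' t tj ti; rewrite t't gtr0_norm// => Hz.
    have : h * `|g t (zs i) (us i) - phi t| <= C * (q + M * q).
      by rewrite (le_trans _ gd)// (le_trans _ g1)// ler_piMl.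
    have : C * h ^+ 2 <= C * q by rewrite ler_pM2l.
    rewrite /a1; move: Hz eq_; rewrite -/e; clear; lra.
  have a1' : a <= 1.
    by rewrite (le_trans ab)// small// ?ltW// /W; move: C0 E0 ME0 bE0; clear; lra.
  pose v := `|us i - u t'|.
  have vd : v <= d + C * h.
    rewrite /v -[us i - u t'](subrKA (u t)) (le_trans (ler_normD _ _))// lerD2l.
    by rewrite distrC (le_trans (Hu _ _ _ _))// t't gtr0_norm.
  have v1 : v <= 1 by exact: le_trans dh.
  have v2 : v ^+ 2 <= (2 + 2 * C ^+ 2) * h ^+ 2.
    rewrite (le_trans _ dq)// lerXn2r// nnegrE; first exact: normr_ge0.
    by rewrite addr_ge0// ltW.
  have v2M : C * v ^+ 2 <= M * h ^+ 2 by rewrite /M -mulrA ler_pM2l.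
  have Mhq : M * h ^+ 2 <= M * q by rewrite ler_pM2l.
  pose b := `|ut - u t'|.
  have bb : b <= b1 * q.
    rewrite /b /ut (le_trans (HN _ _ _ tj a1' v1))// -/a -/v mulrDr.
    rewrite /b1 mulrDl lerD// ?(le_trans v2M)// -mulrA ler_pM2l//.
  have b1' : b <= 1.
    by rewrite (le_trans bb)// small// ?ltW// /W; move: C0 E0 ME0 aE0; clear; lra.
  have g2 : `|g t' zt ut - phi t'| <= C * (a + b) by exact: Hg.
  have e'q : `|zs i.+1 - z t'| + h ^+ 2 <= (1 + C' * h) * q.
    (* The trapezoidal relation of the exact solution is subtracted; the last bracket is its defect,
       of order h^3. *)
    have -> : zs i.+1 - z t' = (zs i - z t) + (h / 2) *: (g t (zs i) (us i) - phi t)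
       + (h / 2) *: (g t' zt ut - phi t')
       - (z t' - z t - ((t' - t) / 2) *: (phi t + phi t')).
      by rewrite zE t't; apply/matrixP => k l; rewrite !mxE; field.
    have Hz := Hz2 t' t tj ti; rewrite t't gtr0_norm// in Hz.
    have -> : (1 + C' * h) * q = e + h ^+ 2 + h * (C * (1 + M + a1 + b1) * q) + h * (C * q).
      by rewrite /C' /q; ring.
    have h20 : 0 < h / 2 by rewrite divr_gt0.
    have F1 : `|(h / 2) *: (g t (zs i) (us i) - phi t)| <= h / 2 * (C * (q + M * q)).
      by rewrite normrZ gtr0_norm// ler_pM2l// (le_trans g1).
    have F2 : `|(h / 2) *: (g t' zt ut - phi t')| <= h / 2 * (C * (a1 * q + b1 * q)).
      by rewrite normrZ gtr0_norm// ler_pM2l// (le_trans g2)// ler_pM2l// lerD.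
    have F3 : C * h ^+ 3 <= h * (C * q) by rewrite exprS mulrCA ler_pM2l// ler_pM2l.
    have F4 : 0 <= h * (C * ((1 + M + a1 + b1) * q)).
      by rewrite mulr_ge0 ?(ltW h0)// mulr_ge0 ?(ltW C0)// mulr_ge0// (ltW S0).
    rewrite t't; set X := (h / 2) *: (g t _ _ - _) in F1 *; set Y := (h / 2) *: (g t' _ _ - _) in F2 *.
    set Z := z t' - _ - _ in Hz *.
    have : `|zs i - z t + X + Y - Z| <= e + `|X| + `|Y| + `|Z|.
      rewrite (le_trans (ler_normB _ _))// lerD2r (le_trans (ler_normD _ _))// lerD2r.
      exact: ler_normD.
    move: F1 F2 F3 F4 Hz; clear; lra.
  have e'E : `|zs i.+1 - z t'| + h ^+ 2 <= (1 + C' * h) ^+ i.+1 * h ^+ 2.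
    rewrite (le_trans e'q)// exprS -mulrA ler_wpM2l// addr_ge0// mulr_ge0// ltW//.
  split=> //.
  have e'1 : `|zs i.+1 - z t'| <= 1.
    have : `|zs i.+1 - z t'| + h ^+ 2 <= E * h.
      rewrite (le_trans e'E)// (@le_trans _ _ (E * h ^+ 2))//; last by rewrite ler_pM2l.
      by rewrite ler_wpM2r ?sqr_ge0// growth.
    have : E * h <= W * h.
      by rewrite ler_pM2r// /W; move: C0 ME0 aE0 bE0; clear; lra.
    by move: Wh (sqr_ge0 h); clear; lra.
  rewrite uE (le_trans (HN _ _ _ tj e'1 v1))// -/v mulrDr mulrDr.
  rewrite lerD// ler_wpM2r// /M mulrDr ler_wpDr//; last by move: C0; clear; lra.
  by rewrite mulr_ge0 ?(ltW C0)// mulr_ge0// sqr_ge0.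
move=> i iN; have [e_ d_] := inv i iN; have gr := growth i iN.
have e2 : `|zs i - z (node i)| + h ^+ 2 <= E * h ^+ 2.
  by rewrite (le_trans e_)// ler_wpM2r ?sqr_ge0.
have := sqr_ge0 h => h2; have ME := mulr_ge0 (mulr_ge0 (ltW M0) (ltW E0)) h2.
split; first by rewrite mulrDl; move: e2 ME h2; clear; lra.
have : M * (`|zs i - z (node i)| + h ^+ 2) <= M * (E * h ^+ 2) by rewrite ler_pM2l.
have := mulr_ge0 (ltW E0) h2; rewrite mulrDl -mulrA; move: d_; clear; lra.
Qed.

End heun_newton.

(** * Partial derivatives relative to a set *)

Section partial_derivatives.
Context {R : realType}.

Lemma der_shift {V : normedModType R} (J J' : set R) (g : R -> V) (r : R) d :
  (forall s, J s -> J' (s - r)) ->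
  der J' (fun h => g (h + r)) 0 d -> der J g r d.
Proof.
move=> JJ [sg E c]; exists (fun s => sg (s - r)) => [s Js|].
  by have := E _ (JJ _ Js); rewrite subr0 subrK add0r.
apply: (@cvg_comp _ _ _ (fun s => s - r) sg _ (within J' (nbhs 0))) => //.
move=> U WU; have WU' : nbhs (0 : R) [set s | J' s -> U s] := WU.
have cs : (fun s : R => s - r) @ r --> (0 : R).
  by rewrite -(subrr r); apply: cvgB; [exact: cvg_id|exact: cvg_cst].
have := cs _ WU'.
by apply: (@filterS _ (nbhs r) _ [set s | J' (s - r) -> U (s - r)]) => s H /JJ.
Qed.

Definition pder {E V : normedModType R} (D : set E) (F : E -> V) (a v : E) (d : V) :=
  der [set h : R | D (h *: v + a)] (fun h => F (h *: v + a)) 0 d.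

Lemma pder_quotient {E V : normedModType R} (D : set E) (F : E -> V) (a v : E) d :
  pder D F a v d -> (fun h : R => h^-1 *: (F (h *: v + a) - F a))
         @ within [set h : R | D (h *: v + a)] 0^' --> d.
Proof.
move=> /der_quotient.
rewrite (_ : [set h : R | _] = [set h : R | D (h *: v + a)]); last first.
  by apply/seteqP; split => h /=; rewrite addr0 [h%:A]mulr1.
rewrite (_ : (fun h : R => _) = (fun h : R => h^-1 *: (F (h *: v + a) - F a)))//.
by apply/funext => h; rewrite !addr0 [h%:A]mulr1 scale0r add0r.
Qed.

Lemma derivable_in_pder {E V : normedModType R} (D : set E) (F : E -> V) (a v : E) :
  derivable_in D F a v -> pder D F a v (derive_in D F a v).
Proof.
rewrite /derivable_in -/(derive_in D F a v) => c; apply: quotient_der.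
rewrite (_ : [set h : R | _] = [set h : R | D (h *: v + a)]); last first.
  by apply/seteqP; split => h /=; rewrite addr0 [h%:A]mulr1.
rewrite (_ : (fun h : R => _) = (fun h : R => h^-1 *: (F (h *: v + a) - F a)))//.
by apply/funext => h; rewrite !addr0 [h%:A]mulr1 scale0r add0r.
Qed.

Lemma pder_derive_in {E V : normedModType R} (D : set E) (F : E -> V) (a v : E) d :
  ProperFilter (within [set h : R | D (h *: v + a)] 0^') ->
  pder D F a v d -> derive_in D F a v = d.
Proof. by move=> PF /pder_quotient c; apply: cvg_lim => //; exact: norm_hausdorff. Qed.

(** The mean value theorem on the line through [a] along [v]. The step [r] may be negative, since
    the coordinate path between two points runs in either direction. *)
Lemma pder_segment {E : normedModType R} (D : set E) (F : E -> R) (a v : E)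
    (dF : R -> R) (r L e : R) :
  (forall s, (0 <= s <= r) || (r <= s <= 0) ->
    [/\ D (s *: v + a), pder D F (s *: v + a) v (dF s) & `|dF s - L| <= e]) ->
  `|F (r *: v + a) - F a - r * L| <= e * `|r|.
Proof.
move=> H; pose g s := F (s *: v + a).
have key p q : p < q -> (forall s, p <= s <= q -> (0 <= s <= r) || (r <= s <= 0)) ->
    exists2 c, (0 <= c <= r) || (r <= c <= 0) & g q - g p = dF c * (q - p).
  move=> pq pqr.
  have dg s : p <= s <= q -> der `[p, q] g s (dF s).
    move=> spq; have [_ dFs _] := H _ (pqr _ spq).
    apply: (@der_shift _ _ [set h : R | D (h *: v + (s *: v + a))]).
      move=> s'; rewrite /= in_itv/= => s'pq.
      by rewrite addrA -scalerDl subrK; case: (H _ (pqr _ s'pq)).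
    move: dFs; rewrite /pder /g; congr (der _ _ _ _).
    by apply/funext => h; rewrite scalerDl addrA.
  have [|//|c /andP[pc cq] E1] := @MVT_der _ g dF p q pq.
  - by move=> t /andP[pt tq]; apply: dg; rewrite !ltW.
  - by apply: (@der_continuous _ _ _ g dF) => t /=; rewrite in_itv/=; exact: dg.
  by exists c => //; apply: pqr; rewrite !ltW.
have -> : F a = g 0 by rewrite /g scale0r add0r.
rewrite -/(g r); have [r0|r0|<-] := ltgtP 0 r.
- have [s sr|c cr E1] := key 0 r r0; first by rewrite sr.
  have [_ _ ce] := H _ cr; rewrite E1 subr0 [r * L]mulrC -mulrBl normrM.
  by rewrite ler_wpM2r.
- have [s sr|c cr E1] := key r 0 r0; first by rewrite sr orbT.
  have [_ _ ce] := H _ cr.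
  have -> : g r - g 0 - r * L = (dF c - L) * r.
    by move: E1; rewrite sub0r => E1; lra.
  by rewrite normrM ler_wpM2r.
- by rewrite subrr mul0r subr0 normr0 mulr0.
Qed.

Definition btw (a b c : R) := (a <= c <= b) || (b <= c <= a).

Lemma btw_l a b : btw a b a. Proof. by rewrite /btw !lexx ?andbT ?andTb le_total. Qed.
Lemma btw_r a b : btw a b b. Proof. by rewrite /btw !lexx ?andbT ?andTb le_total. Qed.

Lemma btw_shift a b s : (0 <= s <= b - a) || (b - a <= s <= 0) -> btw a b (s + a).
Proof.
by rewrite /btw => /orP[]/andP[H1 H2]; apply/orP; [left|right]; apply/andP; split; lra.
Qed.

Context {n : nat}.
Local Notation V := 'cV[R]_n.
Local Notation E := (R * V)%type.

(* Moving from q to p one coordinate at a time, all intermediate points stay in the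
   box spanned by p and q. *)
Lemma coordinate_increment (D : set E) (F : E -> R) (Ft : E -> R) (Fx : 'I_n -> E -> R)
    (s t : R) (y x : V) (Lt : R) (L : 'I_n -> R) (e : R) :
  (forall (s' : R) (y' : V), btw t s s' -> (forall j, btw (x j 0) (y j 0) (y' j 0)) ->
    [/\ D (s', y'), pder D F (s', y') (1, 0) (Ft (s', y')),
      forall j, pder D F (s', y') (0, delta_mx j 0) (Fx j (s', y')),
      `|Ft (s', y') - Lt| <= e & forall j, `|Fx j (s', y') - L j| <= e]) ->
  `|F (s, y) - F (t, x) - ((s - t) * Lt + \sum_j (y j 0 - x j 0) * L j)| <=
  e * (`|s - t| + \sum_j `|y j 0 - x j 0|).
Proof.
move=> H; pose mix k : V := \col_j (if (j < k)%N then y j 0 else x j 0).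
have mix_btw k j : btw (x j 0) (y j 0) (mix k j 0).
  by rewrite mxE; case: ifP => _; [exact: btw_r|exact: btw_l].
have mixn : mix n = y by apply/matrixP => i j; rewrite mxE ltn_ord (ord1 j).
have mix0 : mix 0%N = x by apply/matrixP => i j; rewrite mxE (ord1 j).
have space k : (k <= n)%N ->
    `|F (t, mix k) - F (t, x) - \sum_(j < n | (j < k)%N) (y j 0 - x j 0) * L j| <=
    e * \sum_(j < n | (j < k)%N) `|y j 0 - x j 0|.
  elim: k => [_|k IH kn].
    by rewrite !big_pred0_eq mix0 subrr subr0 normr0 mulr0.
  pose j := Ordinal kn.
  have sumS (G : 'I_n -> R) :
      \sum_(i < n | (i < k.+1)%N) G i = G j + \sum_(i < n | (i < k)%N) G i.
    rewrite (bigD1 j)//=; congr (_ + _); apply: eq_bigl => i.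
    by rewrite ltnS [in RHS]ltn_neqAle andbC.
  have mixS r : (t, r *: delta_mx j 0 + mix k) = r *: (0, delta_mx j 0) + (t, mix k) :> E.
    by congr (_, _); rewrite /= scaler0 add0r.
  have mixk : mix k.+1 = (y j 0 - x j 0) *: delta_mx j 0 + mix k.
    apply/matrixP => i l; rewrite (ord1 l) !mxE ltnS [(i <= k)%N]leq_eqVlt.
    rewrite -[i == k :> nat]/(i == j) eqxx andbT.
    have [->|ij] := eqVneq i j; first by rewrite ltnn mulr1 subrK.
    by rewrite mulr0 add0r.
  have step : `|F (t, mix k.+1) - F (t, mix k) - (y j 0 - x j 0) * L j| <=
      e * `|y j 0 - x j 0|.
    rewrite mixk mixS; apply: (@pder_segment _ D F (t, mix k) (0, delta_mx j 0)
      (fun r => Fx j (r *: (0, delta_mx j 0) + (t, mix k)))) => r /btw_shift rb.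
    rewrite -mixS.
    have [|i|h1 _ h2 _ h3] := H t (r *: delta_mx j 0 + mix k).
    - exact: btw_l.
    - rewrite !mxE eqxx andbT; have [->|ij] := eqVneq i j.
        by rewrite /= ltnn mulr1.
      by rewrite mulr0 add0r; have := mix_btw k i; rewrite mxE.
    by split.
  rewrite !sumS mulrDr.
  have := IH (ltnW kn); move: step.
  set S := \sum_(i < n | _) _ * _; set S' := \sum_(i < n | _) `|_|.
  move=> h1 h2.
  rewrite [X in `|X|](_ : _ = (F (t, mix k.+1) - F (t, mix k) - (y j 0 - x j 0) * L j)
     + (F (t, mix k) - F (t, x) - S)); last by ring.
  by rewrite (le_trans (ler_normD _ _))// lerD.
have := space n (leqnn n); rewrite mixn.
under eq_bigl do rewrite ltn_ord; under [X in _ <= e * X]eq_bigl do rewrite ltn_ord.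
have tE r : (r + t, y) = r *: (1, 0) + (t, y) :> E.
  by congr (_, _); rewrite /= ?[r%:A]mulr1// scaler0 add0r.
have h1 : `|F (s, y) - F (t, y) - (s - t) * Lt| <= e * `|s - t|.
  rewrite -[s in F (s, y)](subrK t) tE.
  apply: (@pder_segment _ D F (t, y) (1, 0) (fun r => Ft (r *: (1, 0) + (t, y)))).
  move=> r /btw_shift rb; rewrite -tE.
  have [|k1 k2 _ k3 _] := H (r + t) y rb; last by split.
  by move=> j; exact: btw_r.
move=> h2; rewrite mulrDr.
set S := \sum_j _ * _ in h2 *.
rewrite [X in `|X|](_ : _ = (F (s, y) - F (t, y) - (s - t) * Lt)
    + (F (t, y) - F (t, x) - S)); last by ring.
by rewrite (le_trans (ler_normD _ _))// lerD.
Qed.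

End partial_derivatives.

(** * The second-order Taylor estimate for the right-hand side *)

Section taylor.
Context {R : realType} {n : nat}.
Local Notation V := 'cV[R]_n.
Local Notation E := (R * V)%type.

Lemma finite_bound {I : finType} {T : Type} (K : set T) (h : I -> T -> R) :
  (forall i, exists2 M, 0 < M & forall x, K x -> h i x <= M) ->
  exists2 M, 0 < M & forall i x, K x -> h i x <= M.
Proof.
move=> H; pose B i := s2val (cid2 (H i)).
have B0 i : 0 < B i by rewrite /B; case: (cid2 (H i)).
exists (1 + \sum_i B i); first by rewrite ltr_pwDl// sumr_ge0// => i _; exact: ltW.
move=> i x Kx; apply: (@le_trans _ _ (B i)).
  by rewrite /B; case: (cid2 (H i)) => /= M _; exact.
rewrite (bigD1 i)//= addrCA lerDl addr_ge0// sumr_ge0// => j _; exact: ltW.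
Qed.

(** Time is the index [None]: the coordinate directions form a finite type, and all partial
    derivatives can be bounded at once. *)
Definition cdir (o : option 'I_n) : E :=
  if o is Some j then (0, delta_mx j 0) else (1, 0).

Lemma cdirP o : coord_dirs (cdir o).
Proof. by case: o => [j|]; [right; exists j|left]. Qed.

Lemma btw_dist (a b c : R) : btw a b c -> `|c - a| <= `|b - a|.
Proof.
by case/orP => /andP[H1 H2]; [rewrite !ger0_norm ?subr_ge0 ?(le_trans H1)//; lra|
  rewrite !ler0_norm ?subr_le0 ?(le_trans H1)//; lra].
Qed.

Lemma btw_trans (a b c d : R) : btw a b c -> btw a c d -> btw a b d.
Proof.
by move=> /orP[]/andP[? ?] /orP[]/andP[? ?]; rewrite /btw;
  apply/orP; first [by left; apply/andP; split; lra|by right; apply/andP; split; lra].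
Qed.

Lemma btw_norm_le (a b c M : R) : btw a b c -> `|a| <= M -> `|b| <= M -> `|c| <= M.
Proof.
by case/orP => /andP[H1 H2]; rewrite !ler_norml => /andP[? ?] /andP[? ?];
  apply/andP; split; lra.
Qed.

Lemma btw_in (a b c l r : R) : btw a b c -> l <= a <= r -> l <= b <= r -> l <= c <= r.
Proof. by case/orP => /andP[H1 H2] /andP[? ?] /andP[? ?]; apply/andP; split; lra. Qed.

Lemma sum_norm_le (x : V) : \sum_j `|x j 0| <= n%:R * `|x|.
Proof.
rewrite -[n in n%:R]card_ord -sum1_card natr_sum mulr_suml ler_sum// => j _.
by rewrite mul1r le_mx_norm.
Qed.

Lemma mx_distance_le (X Y : 'M[R]_n) (c : R) : 0 <= c ->
  (forall i j, `|X i j - Y i j| <= c) -> `|X - Y| <= c.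
Proof. by move=> c0 H; apply: mx_norm_le => // i j; rewrite !mxE. Qed.

Section C2.
Variables (f : R -> V -> V) (t0 T : R).
Hypothesis f_diff : forall t x, t0 <= t <= T -> differentiable (f t) x.
Local Notation D := (`[t0, T] `*` [set: V])%classic.
Hypothesis f_C2 : Ck_time_space 2 D f.
Let g (p : E) := f p.1 p.2.
Let dF v (a : E) : V := derive_in D g a v.
Let ddF v w (a : E) : V := derive_in D (dF v) a w.
Let K M : set E := (`[t0, T] `*` [set x | `|x| <= M])%classic.

Definition time_der (t : R) (x : V) : V := derive_in D g (t, x) (1, 0).

Let KD M p : K M p -> D p. Proof. by move=> [? _]; split. Qed.

Let compactK M : compact (K M).
Proof. by apply: compact_setX; [exact: segment_compact|exact: compact_ball_mx]. Qed.

Let bounded_on_K {U : normedModType R} (h : E -> U) M :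
  {within D, continuous h} -> exists2 B, 0 < B & forall p, K M p -> `|h p| <= B.
Proof.
move=> ch; apply: (compact_continuous_bounded (@compactK M)).
exact: (continuous_subspaceW (@KD M)).
Qed.

(** In the space directions [D] contains whole lines, so the partial derivatives relative to [D] are
    the ordinary ones and give the entries of the Jacobian. *)
Let Jac_dF t x i j : t0 <= t <= T -> Jac (f t) x i j = dF (cdir (Some j)) (t, x) i 0.
Proof.
move=> tT; have DE (h : R) : D (h *: cdir (Some j) + (t, x)).
  by split => //=; rewrite scaler0 add0r in_itv.
have setE : [set h : R | D (h *: cdir (Some j) + (t, x))] = setT.
  by apply/seteqP; split => // h _; exact: DE.
have PF : ProperFilter (within [set h : R | D (h *: cdir (Some j) + (t, x))] 0^').
  rewrite setE (_ : within setT _ = 0^'); first exact: Proper_dnbhs_numFieldType.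
  apply/seteqP; split => U HU; apply: (@filterS _ 0^' _ _ _ _ HU) => h //.
  exact.
rewrite /dF (@pder_derive_in _ _ _ _ _ _ _ ('d (f t) x (delta_mx j 0)) PF).
- by rewrite mxE.
- rewrite /pder setE (diff_Jac _ (f_diff x tT)).
  have := @der_along _ _ (f t) x (delta_mx j 0) setT 0.
  rewrite scale0r add0r => /(_ (f_diff x tT)).
  by congr (der _ _ _ _); apply/funext => h; rewrite /g /= scaler0 add0r.
Qed.

(** The second partial derivatives are bounded on a compact set, so the first ones are Lipschitz
    over the box spanned by the two points. Fed into [coordinate_increment] once more, this gives
    the quadratic remainder. *)
Lemma C2_taylor (M : R) : exists2 C, 0 < C &
  forall s t x y, t0 <= s <= T -> t0 <= t <= T -> `|x| <= M -> `|y| <= M ->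
  [/\ `|f s y - f t x - ((s - t) *: time_der t x + Jac (f t) x *m (y - x))| <=
        C * (`|s - t| + `|y - x|) ^+ 2,
      `|Jac (f s) y - Jac (f t) x| <= C * (`|s - t| + `|y - x|),
      `|time_der t x| <= C, `|Jac (f t) x| <= C & `|f t x| <= C].
Proof.
have [gcont H1] := f_C2.
have dg o a : D a -> derivable_in D g a (cdir o) by case: (H1 _ (cdirP o)) => + _; exact.
have dcont o : {within D, continuous (dF (cdir o))}.
  by case: (H1 _ (cdirP o)) => _ [+ _]; exact.
have ddg o o' a : D a -> derivable_in D (dF (cdir o)) a (cdir o').
  by case: (H1 _ (cdirP o)) => _ [_ /(_ _ (cdirP o'))[+ _]]; exact.
have ddcont o o' : {within D, continuous (ddF (cdir o) (cdir o'))}.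
  by case: (H1 _ (cdirP o)) => _ [_ /(_ _ (cdirP o'))[_ [+ _]]]; exact.
have [B B0 HB] : exists2 B, 0 < B & forall (oo : option 'I_n * option 'I_n) p,
    K M p -> `|ddF (cdir oo.1) (cdir oo.2) p| <= B.
  by apply: finite_bound => oo; exact: bounded_on_K.
have [B1 B10 HB1] : exists2 B, 0 < B & forall (o : option 'I_n) p,
    K M p -> `|dF (cdir o) p| <= B.
  by apply: finite_bound => o; exact: bounded_on_K.
have [B2 B20 HB2] := @bounded_on_K _ g M gcont.
(* [N1] converts the length of the coordinate path, |s - t| plus the sum of the n coordinate
   distances, into |s - t| + |y - x|. *)
pose N1 : R := 1 + n%:R.
have N10 : 0 < N1 by rewrite ltr_pwDl.
pose W := B * N1 ^+ 2 + B1 + B2.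
have BN0 : 0 < B * N1 ^+ 2 by rewrite mulr_gt0// exprn_gt0.
have W0 : 0 < W by rewrite !addr_gt0.
exists W => //.
move=> s t x y sT tT xM yM; move: x y xM yM => x y xM yM.
have inK (s' : R) (y' : V) : btw t s s' -> (forall j, btw (x j 0) (y j 0) (y' j 0)) ->
    K M (s', y') /\ `|s' - t| <= `|s - t| /\ `|y' - x| <= `|y - x|.
  move=> bs by_; split; last split.
  - split=> /=; first by rewrite in_itv/=; exact: (btw_in bs).
    apply: mx_norm_le; first exact: le_trans xM.
    move=> i j; rewrite (ord1 j); apply: (btw_norm_le (by_ i)).
      exact: le_trans (le_mx_norm _ _ _) xM.
    exact: le_trans (le_mx_norm _ _ _) yM.
  - exact: btw_dist.
  - apply: mx_norm_le => // i j; rewrite (ord1 j) !mxE.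
    rewrite (le_trans (btw_dist (by_ i)))//.
    by have := le_mx_norm (y - x) i 0; rewrite !mxE.
have sums (s' : R) (y' : V) : `|s' - t| <= `|s - t| -> `|y' - x| <= `|y - x| ->
    `|s' - t| + \sum_j `|y' j 0 - x j 0| <= N1 * (`|s - t| + `|y - x|).
  move=> h1 h2; have := sum_norm_le (y' - x); under eq_bigr do rewrite !mxE.
  have h3 : n%:R * `|y' - x| <= n%:R * `|y - x| by rewrite ler_wpM2l.
  have h4 : 0 <= n%:R * `|s - t| by rewrite mulr_ge0.
  have h5 := normr_ge0 (y - x).
  by rewrite /N1; move: h1 h3 h4 h5; clear - f_C2 f_diff Jac_dF bounded_on_K compactK KD; lra.
have lip o i (s' : R) (y' : V) : btw t s s' -> (forall j, btw (x j 0) (y j 0) (y' j 0)) ->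
    `|dF (cdir o) (s', y') i 0 - dF (cdir o) (t, x) i 0| <= B * N1 * (`|s - t| + `|y - x|).
  move=> bs by_.
  have := @coordinate_increment _ _ D (fun p => dF (cdir o) p i 0)
    (fun p => ddF (cdir o) (cdir None) p i 0)
    (fun j p => ddF (cdir o) (cdir (Some j)) p i 0) s' t y' x 0 (fun=> 0) B.
  rewrite mulr0 add0r big1 ?subr0 => [H|j _]; last by rewrite mulr0.
  apply: le_trans (H _) _.
    move=> s2 y2 b2 by2.
    have [K2 _] := inK s2 y2 (btw_trans bs b2) (fun j => btw_trans (by_ j) (by2 j)).
    have D2 := KD K2.
    split => //.
    - by apply: der_entry; exact: derivable_in_pder (ddg _ None _ D2).
    - by move=> j; apply: der_entry; exact: derivable_in_pder (ddg _ (Some j) _ D2).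
    - by rewrite subr0 (le_trans (le_mx_norm _ _ _))// (HB (o, None)).
    - by move=> j; rewrite subr0 (le_trans (le_mx_norm _ _ _))// (HB (o, Some j)).
  have [_ [s't y'x]] := inK s' y' bs by_.
  rewrite -mulrA ler_pM2l//.
  exact: sums.
have e0 : 0 <= B * N1 * (`|s - t| + `|y - x|).
  by rewrite mulr_ge0 ?addr_ge0// mulr_ge0// ltW.
have N11 : 1 <= N1 by rewrite /N1 lerDl.
have yy j : btw (x j 0) (y j 0) (y j 0) by exact: btw_r.
have BN1W : B * N1 <= W.
  have : B * N1 <= B * N1 ^+ 2 by rewrite ler_pM2l// expr2 ler_peMr// ltW.
  by rewrite /W; move: B10 B20; clear - f_C2 f_diff Jac_dF bounded_on_K compactK KD; lra.
have [Kt _] : K M (t, x) /\ True by split => //; split; rewrite //= in_itv.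
have B1W : B1 <= W by rewrite /W; move: BN0 B20; clear - f_C2 f_diff Jac_dF bounded_on_K compactK KD; lra.
have B2W : B2 <= W by rewrite /W; move: BN0 B10; clear - f_C2 f_diff Jac_dF bounded_on_K compactK KD; lra.
split.
- have tdE : dF (cdir None) (t, x) = time_der t x by [].
  apply: mx_norm_le => [|i j].
    by rewrite mulr_ge0 ?exprn_ge0 ?addr_ge0// ltW.
  have mxid (a b td d : V) (c : R) (Jm : 'M[R]_n) :
      (a - b - (c *: td + Jm *m d)) i 0 =
      a i 0 - b i 0 - (c * td i 0 + \sum_k Jm i k * d k 0) by rewrite !mxE.
  have := @coordinate_increment _ _ D (fun p => g p i 0)
    (fun p => dF (cdir None) p i 0) (fun j p => dF (cdir (Some j)) p i 0)
    s t y x (dF (cdir None) (t, x) i 0) (fun j => dF (cdir (Some j)) (t, x) i 0)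
    (B * N1 * (`|s - t| + `|y - x|)).
  move=> H; rewrite (ord1 j) [X in `|X|](_ : _ = g (s, y) i 0 - g (t, x) i 0 -
      ((s - t) * dF (cdir None) (t, x) i 0
      + \sum_k (y k 0 - x k 0) * dF (cdir (Some k)) (t, x) i 0)).
    apply: le_trans (H _) _.
      move=> s' y' bs by_; have [K2 _] := inK _ _ bs by_; have D2 := KD K2.
      split => //.
      - by apply: der_entry; exact: derivable_in_pder (dg None _ D2).
      - by move=> k; apply: der_entry; exact: derivable_in_pder (dg (Some k) _ D2).
      - exact: lip.
      - by move=> k; exact: lip.
    have := sums s y (lexx _) (lexx _) => S1.
    rewrite (le_trans (ler_wpM2l e0 S1))//.
    rewrite [leLHS](_ : _ = B * N1 ^+ 2 * (`|s - t| + `|y - x|) ^+ 2); last by ring.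
    by rewrite ler_wpM2r ?sqr_ge0// /W; move: B10 B20; clear - f_C2 f_diff Jac_dF bounded_on_K compactK KD; lra.
  rewrite mxid tdE; congr (_ - (_ + _)); apply: eq_bigr => k _.
  by rewrite (Jac_dF x i k tT) mulrC [(y - x) k 0]mxE [(- x) k 0]mxE.
- apply: mx_distance_le => [|i j]; first by rewrite mulr_ge0 ?addr_ge0// ltW.
  rewrite (congr2 (fun a b => a - b) (Jac_dF y i j sT) (Jac_dF x i j tT)).
  apply: le_trans (lip (Some j) i s y (btw_r _ _) yy) _.
  by rewrite ler_wpM2r// addr_ge0.
- exact: le_trans (HB1 None _ Kt) B1W.
- apply: mx_norm_le => [|i j]; first by rewrite ltW.
  rewrite (Jac_dF x i j tT) (le_trans (le_mx_norm _ _ _))//.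
  exact: le_trans (HB1 (Some j) _ Kt) B1W.
- exact: le_trans (HB2 _ Kt) B2W.
Qed.

End C2.
End taylor.

(** * Uniform increments on an interval *)

Section increments.
Context {R : realType}.
Variables a b : R.

Definition order {m p} (k : nat) (X : R -> R -> 'M[R]_(m, p)) :=
  exists2 C, 0 <= C & forall s t, a <= s <= b -> a <= t <= b ->
    `|X s t| <= C * `|s - t| ^+ k.

Definition bounded_on {m p} (phi : R -> 'M[R]_(m, p)) := order 0 (fun _ t => phi t).

Definition lipschitz_on {m p} (phi : R -> 'M[R]_(m, p)) :=
  bounded_on phi /\ order 1 (fun s t => phi s - phi t).

(** A first-order expansion in s - t with a uniform quadratic remainder. With [smooth_on] it plays
    the role of C^1 with Lipschitz derivative, but is also available for functions that are only
    known through an implicit relation. *)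
Definition linear_increment {m p} (X : R -> R -> 'M[R]_(m, p)) :=
  exists2 psi : R -> 'M[R]_(m, p), bounded_on psi &
    order 2 (fun s t => X s t - (s - t) *: psi t).

Definition smooth_on {m p} (phi : R -> 'M[R]_(m, p)) :=
  bounded_on phi /\ linear_increment (fun s t => phi s - phi t).

Section additive.
Context {m p : nat}.
Implicit Types (X Y : R -> R -> 'M[R]_(m, p)) (phi psi : R -> 'M[R]_(m, p)).

Lemma order_eq k X Y : order k X ->
  (forall s t, a <= s <= b -> a <= t <= b -> Y s t = X s t) -> order k Y.
Proof. by move=> [C C0 H] E; exists C => // s t sI tI; rewrite E//; exact: H. Qed.

Lemma orderD k X Y : order k X -> order k Y -> order k (fun s t => X s t + Y s t).
Proof.
move=> [C C0 H] [C' C'0 H']; exists (C + C') => [|s t sI tI]; first exact: addr_ge0.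
by rewrite (le_trans (ler_normD _ _))// mulrDl lerD ?H ?H'.
Qed.

Lemma orderN k X : order k X -> order k (fun s t => - X s t).
Proof. by move=> [C C0 H]; exists C => // s t sI tI; rewrite normrN H. Qed.

Lemma orderB k X Y : order k X -> order k Y -> order k (fun s t => X s t - Y s t).
Proof. by move=> ? ?; apply: orderD => //; exact: orderN. Qed.

Lemma order_weaken j k X : (j <= k)%N -> order k X -> order j X.
Proof.
move=> jk [C C0 H]; exists (C * `|b - a| ^+ (k - j)) => [|s t sI tI].
  by rewrite mulr_ge0// exprn_ge0.
rewrite (le_trans (H _ _ sI tI))// -{1}(subnK jk) exprD mulrA.
rewrite ler_wpM2r ?exprn_ge0// ler_wpM2l// lerXn2r ?nnegrE//.
rewrite [leRHS]ger0_norm; first by rewrite ler_norml; move: sI tI => /andP[? ?] /andP[? ?]; apply/andP; split; lra.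
by move: sI => /andP[? ?]; lra.
Qed.

Lemma order_scale k X : order k X -> order k.+1 (fun s t => (s - t) *: X s t).
Proof.
move=> [C C0 H]; exists C => // s t sI tI.
by rewrite normrZ exprS mulrCA ler_wpM2l// H.
Qed.

Lemma orderZ (c : R) k X : order k X -> order k (fun s t => c *: X s t).
Proof.
move=> [C C0 H]; exists (`|c| * C) => [|s t sI tI]; first exact: mulr_ge0.
by rewrite normrZ -mulrA ler_wpM2l// H.
Qed.

Lemma order_swap k X : order k X -> order k (fun s t => X t s).
Proof. by move=> [C C0 H]; exists C => // s t sI tI; rewrite distrC H. Qed.

End additive.

Lemma order_mul {m p q} k l (X : R -> R -> 'M[R]_(m, p)) (Y : R -> R -> 'M[R]_(p, q)) :
  order k X -> order l Y -> order (k + l) (fun s t => X s t *m Y s t).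
Proof.
move=> [C C0 H] [C' C'0 H']; exists (p%:R * C * C') => [|s t sI tI].
  by rewrite !mulr_ge0.
rewrite (le_trans (mulmx_norm _ _))// -!mulrA ler_wpM2l// exprD.
rewrite [leRHS](_ : _ = (C * `|s - t| ^+ k) * (C' * `|s - t| ^+ l)); last by ring.
by rewrite ler_pM ?H ?H'.
Qed.

Lemma bounded_swap {m p} (phi : R -> 'M[R]_(m, p)) :
  bounded_on phi -> order 0 (fun s _ => phi s).
Proof. exact: order_swap. Qed.

Lemma bounded_bound {m p} (phi : R -> 'M[R]_(m, p)) (C : R) :
  (forall t, a <= t <= b -> `|phi t| <= C) -> bounded_on phi.
Proof.
move=> H; exists `|C| => // s t sI tI; rewrite mulr1.
exact: le_trans (H _ tI) (ler_norm _).
Qed.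

Section classes.
Context {m p : nat}.
Implicit Types (X Y : R -> R -> 'M[R]_(m, p)) (phi psi : R -> 'M[R]_(m, p)).

Lemma bounded_continuous phi : {within `[a, b], continuous phi} -> bounded_on phi.
Proof.
move=> cphi; have [C C0 H] := compact_continuous_bounded (@segment_compact _ a b) cphi.
by apply: (bounded_bound (C := C)) => t tI; apply: H; rewrite /= in_itv.
Qed.

Lemma lipschitzD phi psi :
  lipschitz_on phi -> lipschitz_on psi -> lipschitz_on (fun t => phi t + psi t).
Proof.
move=> [b1 o1] [b2 o2]; split; first exact: (orderD b1).
by apply: order_eq (orderD o1 o2) _ => s t _ _; rewrite opprD addrACA.
Qed.

Lemma lipschitzN phi : lipschitz_on phi -> lipschitz_on (fun t => - phi t).
Proof.
move=> [b1 o1]; split; first exact: (orderN b1).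
by apply: order_eq (orderN o1) _ => s t _ _; rewrite opprB opprK addrC.
Qed.

Lemma lipschitzB phi psi :
  lipschitz_on phi -> lipschitz_on psi -> lipschitz_on (fun t => phi t - psi t).
Proof. by move=> ? ?; apply: lipschitzD => //; exact: lipschitzN. Qed.

Lemma lipschitz_eq phi psi : (forall t, a <= t <= b -> psi t = phi t) ->
  lipschitz_on phi -> lipschitz_on psi.
Proof.
by move=> E [b1 o1]; split; [apply: order_eq b1 _|apply: order_eq o1 _] => s t sI tI;
  rewrite !E.
Qed.

Lemma linear_increment_eq X Y : linear_increment X ->
  (forall s t, a <= s <= b -> a <= t <= b -> Y s t = X s t) -> linear_increment Y.
Proof.
move=> [psi b1 o1] E; exists psi => //.
by apply: order_eq o1 _ => s t sI tI; rewrite E.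
Qed.

Lemma linear_incrementD X Y : linear_increment X -> linear_increment Y ->
  linear_increment (fun s t => X s t + Y s t).
Proof.
move=> [x' b1 o1] [y' b2 o2]; exists (fun t => x' t + y' t); first exact: (orderD b1).
apply: order_eq (orderD o1 o2) _ => s t _ _.
by rewrite scalerDr opprD addrACA.
Qed.

Lemma linear_incrementN X : linear_increment X -> linear_increment (fun s t => - X s t).
Proof.
move=> [x' b1 o1]; exists (fun t => - x' t); first exact: (orderN b1).
by apply: order_eq (orderN o1) _ => s t _ _; rewrite scalerN -opprD.
Qed.

Lemma linear_incrementB X Y : linear_increment X -> linear_increment Y ->
  linear_increment (fun s t => X s t - Y s t).
Proof. by move=> ? ?; apply: linear_incrementD => //; exact: linear_incrementN. Qed.

Lemma order2_linear X : order 2 X -> linear_increment X.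
Proof.
move=> o2; exists (fun=> 0).
  by apply: (bounded_bound (C := 0)) => t _; rewrite normr0.
by apply: order_eq o2 _ => s t _ _; rewrite scaler0 subr0.
Qed.

Lemma scale_linear psi : bounded_on psi -> linear_increment (fun s t => (s - t) *: psi t).
Proof.
move=> b1; exists psi => //; apply: (@order_eq _ _ _ (fun _ _ => 0)).
  by exists 0 => // s t _ _; rewrite normr0 mul0r.
by move=> s t _ _; rewrite subrr.
Qed.

Lemma linear_increment_order1 X : linear_increment X -> order 1 X.
Proof.
move=> [psi b1 o2].
have o1 := orderD (order_weaken (isT : (1 <= 2)%N) o2) (order_scale b1).
by apply: order_eq o1 _ => s t _ _; rewrite subrK.
Qed.

Lemma smooth_lipschitz phi : smooth_on phi -> lipschitz_on phi.
Proof. by move=> [b1 l1]; split => //; exact: linear_increment_order1. Qed.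

Lemma smoothD phi psi : smooth_on phi -> smooth_on psi -> smooth_on (fun t => phi t + psi t).
Proof.
move=> [b1 o1] [b2 o2]; split; first exact: (orderD b1).
by apply: linear_increment_eq (linear_incrementD o1 o2) _ => s t _ _; rewrite opprD addrACA.
Qed.

Lemma smoothN phi : smooth_on phi -> smooth_on (fun t => - phi t).
Proof.
move=> [b1 o1]; split; first exact: (orderN b1).
by apply: linear_increment_eq (linear_incrementN o1) _ => s t _ _; rewrite opprB opprK addrC.
Qed.

Lemma smoothB phi psi : smooth_on phi -> smooth_on psi -> smooth_on (fun t => phi t - psi t).
Proof. by move=> ? ?; apply: smoothD => //; exact: smoothN. Qed.

Lemma smooth_cst (M : 'M[R]_(m, p)) : smooth_on (fun=> M).
Proof.
split; first exact: (bounded_bound (C := `|M|)).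
apply: order2_linear; exists 0 => // s t _ _.
by rewrite subrr normr0 mul0r.
Qed.

Lemma smooth_eq phi psi : (forall t, a <= t <= b -> psi t = phi t) ->
  smooth_on phi -> smooth_on psi.
Proof.
move=> E [b1 o1]; split; first by apply: order_eq b1 _ => s t sI tI; rewrite !E.
by apply: linear_increment_eq o1 _ => s t sI tI; rewrite !E.
Qed.

Lemma der_lipschitz phi psi : bounded_on psi ->
  (forall t, a <= t <= b -> der `[a, b] phi t (psi t)) -> lipschitz_on phi.
Proof.
move=> [C C0 H] dphi; split.
  by apply: bounded_continuous; apply: der_continuous => t; rewrite /= in_itv; exact: dphi.
exists C => // s t sI tI; rewrite expr1.
have ord s' t' : a <= s' <= b -> a <= t' <= b -> s' <= t' ->
    `|phi t' - phi s'| <= C * (t' - s').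
  move=> /andP[as' s'b] /andP[at' t'b] st.
  have sub r : s' <= r <= t' -> a <= r <= b.
    by move=> /andP[? ?]; apply/andP; split; lra.
  have := @mean_value_le R m p phi psi (fun r => C * r) (fun=> C) s' t' st.
  rewrite mulrBr; apply.
  - move=> r /sub rI; apply: der_subset (dphi _ rI) => x /=; rewrite !in_itv/=; exact: sub.
  - move=> r _; have := derM (der_cst `[s', t'] r (C : R)) (der_id `[s', t'] r).
    by rewrite mul0r add0r mulr1.
  - by move=> r /sub rI; have := H _ _ rI rI; rewrite mulr1.
have [st|ts] := leP s t; first by rewrite distrC [`|s - t|]distrC [`|t - s|]ger0_norm ?subr_ge0// ord.
by rewrite [`|s - t|]ger0_norm ?subr_ge0 ?(ltW ts)// ord// ltW.
Qed.

(* The derivative of phi r - (r - t) *: psi t is psi r - psi t = O(|r - t|). *)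
Lemma der_smooth phi psi : lipschitz_on psi ->
  (forall t, a <= t <= b -> der `[a, b] phi t (psi t)) -> smooth_on phi.
Proof.
move=> [bpsi [C C0 H]] dphi.
have [bphi _] := der_lipschitz bpsi dphi; split => //; exists psi => //.
exists C => // s t sI tI.
pose g r := phi r - r *: psi t.
have dg r : a <= r <= b -> der `[a, b] g r (psi r - psi t).
  move=> rI; apply: derB (dphi _ rI) _.
  have := der_scale (der_id `[a, b] r) (der_cst `[a, b] r (psi t)).
  by rewrite scaler0 addr0 scale1r.
have gE : phi s - phi t - (s - t) *: psi t = g s - g t.
  by rewrite /g; apply/matrixP => i j; rewrite !mxE; ring.
rewrite gE.
have ord c d : a <= c <= b -> a <= d <= b -> c <= d ->
    (forall r, c <= r <= d -> `|r - t| <= d - c) -> `|g d - g c| <= C * (d - c) ^+ 2.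
  move=> /andP[ac cb] /andP[ad db] cd rt.
  have sub r : c <= r <= d -> a <= r <= b by move=> /andP[? ?]; apply/andP; split; lra.
  have := @mean_value_le R m p g (fun r => psi r - psi t)
    (fun r => C * (d - c) * r) (fun=> C * (d - c)) c d cd.
  rewrite -mulrBr -mulrA -expr2; apply.
  - move=> r /sub rI; apply: der_subset (dg _ rI) => x /=; rewrite !in_itv/=; exact: sub.
  - move=> r _; have := derM (der_cst `[c, d] r (C * (d - c) : R)) (der_id `[c, d] r).
    by rewrite mul0r add0r mulr1.
  - move=> r rI; rewrite (le_trans (H _ _ (sub _ rI) tI))// ler_wpM2l//.
    by rewrite expr1 rt.
have [st|ts] := leP s t.
  rewrite distrC [`|s - t|]distrC [`|t - s|]ger0_norm ?subr_ge0// ord// => r /andP[? ?].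
  by rewrite ler_norml; apply/andP; split; lra.
rewrite [`|s - t|]ger0_norm ?subr_ge0 ?(ltW ts)// ord// ?(ltW ts)// => r /andP[? ?].
by rewrite ler_norml; apply/andP; split; lra.
Qed.

(** The second-order expansion of [phi] at t has the remainder psi r - psi t - (r - t) chi t = O((r
    - t)^2) as derivative. Adding half of (s - t) times the same remainder at s turns the expansion
    into the trapezoidal rule. *)
Lemma smooth_trapezoid phi psi : smooth_on psi ->
  (forall t, a <= t <= b -> der `[a, b] phi t (psi t)) ->
  order 3 (fun s t => phi s - phi t - ((s - t) / 2) *: (psi t + psi s)).
Proof.
move=> spsi dphi; have [bpsi [chi bchi [C C0 H]]] := spsi.
suff main : order 3 (fun s t => phi s - phi t -
    ((s - t) *: psi t + ((s - t) ^+ 2 / 2) *: chi t)).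
  have o3 : order 3 (fun s t => 2^-1 *: ((s - t) *: (psi s - psi t - (s - t) *: chi t))).
    by apply: orderZ; apply: order_scale; exists C.
  apply: order_eq (orderB main o3) _ => s t sI tI.
  by apply/matrixP => i j; rewrite !mxE; field.
exists C => // s t sI tI.
pose g r := phi r - (r *: psi t + ((r - t) ^+ 2 / 2) *: chi t).
have dg r : a <= r <= b -> der `[a, b] g r (psi r - psi t - (r - t) *: chi t).
  move=> rI; rewrite -addrA -opprD; apply: derB (dphi _ rI) _; apply: derD.
    have := der_scale (der_id `[a, b] r) (der_cst `[a, b] r (psi t)).
    by rewrite scaler0 addr0 scale1r.
  have d1 : der `[a, b] (fun r => r - t) r (1 - 0) by apply: derB; [exact: der_id|exact: der_cst].
  have := der_scale (derM (derM d1 d1) (der_cst `[a, b] r (2^-1 : R))) (der_cst `[a, b] r (chi t)).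
  by congr (der _ _ _ _); apply/matrixP => i j; rewrite !mxE; field.
have gE : phi s - phi t - ((s - t) *: psi t + ((s - t) ^+ 2 / 2) *: chi t) = g s - g t.
  by rewrite /g; apply/matrixP => i j; rewrite !mxE; field.
rewrite gE.
have ord c d : a <= c <= b -> a <= d <= b -> c <= d ->
    (forall r, c <= r <= d -> `|r - t| <= d - c) -> `|g d - g c| <= C * (d - c) ^+ 3.
  move=> /andP[ac cb] /andP[ad db] cd rt.
  have sub r : c <= r <= d -> a <= r <= b by move=> /andP[? ?]; apply/andP; split; lra.
  have := @mean_value_le R m p g (fun r => psi r - psi t - (r - t) *: chi t)
    (fun r => C * (d - c) ^+ 2 * r) (fun=> C * (d - c) ^+ 2) c d cd.
  rewrite -mulrBr -mulrA -exprSr; apply.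
  - move=> r /sub rI; apply: der_subset (dg _ rI) => x /=; rewrite !in_itv/=; exact: sub.
  - move=> r _; have := derM (der_cst `[c, d] r (C * (d - c) ^+ 2 : R)) (der_id `[c, d] r).
    by rewrite mul0r add0r mulr1.
  - move=> r rI; rewrite (le_trans (H _ _ (sub _ rI) tI))// ler_wpM2l//.
    by rewrite lerXn2r ?nnegrE ?subr_ge0// rt.
have [st|ts] := leP s t.
  rewrite distrC [`|s - t|]distrC [`|t - s|]ger0_norm ?subr_ge0// ord// => r /andP[? ?].
  by rewrite ler_norml; apply/andP; split; lra.
rewrite [`|s - t|]ger0_norm ?subr_ge0 ?(ltW ts)// ord// ?(ltW ts)// => r /andP[? ?].
by rewrite ler_norml; apply/andP; split; lra.
Qed.

End classes.

Section products.
Context {m p q : nat}.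

Lemma boundedM (phi : R -> 'M[R]_(m, p)) (psi : R -> 'M[R]_(p, q)) :
  bounded_on phi -> bounded_on psi -> bounded_on (fun t => phi t *m psi t).
Proof. exact: order_mul. Qed.

Lemma linear_incrementMl (phi : R -> 'M[R]_(m, p)) (X : R -> R -> 'M[R]_(p, q)) :
  bounded_on phi -> linear_increment X -> linear_increment (fun s t => phi t *m X s t).
Proof.
move=> b1 [psi b2 o2]; exists (fun t => phi t *m psi t); first exact: boundedM.
apply: order_eq (order_mul b1 o2) _ => s t _ _.
by rewrite mulmxBr scalemxAr.
Qed.

(** The factor is taken at [s]; replacing it by its value at [t] costs a product of two increments,
    which is of second order. *)
Lemma linear_incrementMr (X : R -> R -> 'M[R]_(m, p)) (phi : R -> 'M[R]_(p, q)) :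
  lipschitz_on phi -> linear_increment X -> linear_increment (fun s t => X s t *m phi s).
Proof.
move=> [b1 o1] l1; have o1' := linear_increment_order1 l1; case: l1 => psi b2 o2.
exists (fun t => psi t *m phi t); first exact: boundedM.
apply: order_eq (orderD (order_mul o2 b1) (order_mul o1' o1)) _ => s t _ _.
by rewrite mulmxBr mulmxBl scalemxAl [RHS]addrC addrA subrK.
Qed.

Lemma lipschitzM (phi : R -> 'M[R]_(m, p)) (psi : R -> 'M[R]_(p, q)) :
  lipschitz_on phi -> lipschitz_on psi -> lipschitz_on (fun t => phi t *m psi t).
Proof.
move=> [b1 o1] [b2 o2]; split; first exact: boundedM.
apply: order_eq (orderD (order_mul o1 (bounded_swap b2)) (order_mul b1 o2)) _ => s t _ _.
by rewrite mulmxBl mulmxBr addrA subrK.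
Qed.

Lemma smoothM (phi : R -> 'M[R]_(m, p)) (psi : R -> 'M[R]_(p, q)) :
  smooth_on phi -> smooth_on psi -> smooth_on (fun t => phi t *m psi t).
Proof.
move=> [b1 o1] s2; have [b2 o2] := s2; split; first exact: boundedM.
have L1 := linear_incrementMr (smooth_lipschitz s2) o1.
apply: linear_increment_eq (linear_incrementD L1 (linear_incrementMl b1 o2)) _ => s t _ _.
by rewrite mulmxBl mulmxBr addrA subrK.
Qed.

End products.

Section inverse.
Context {m : nat} (X : R -> 'M[R]_m).
Hypothesis Xu : forall t, a <= t <= b -> X t \in unitmx.
Hypothesis bX : bounded_on (fun t => invmx (X t)).

Let invB s t : a <= s <= b -> a <= t <= b ->
  invmx (X s) - invmx (X t) = - (invmx (X t) *m ((X s - X t) *m invmx (X s))).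
Proof.
move=> sI tI; rewrite mulmxBl mulmxBr mulmxV ?Xu// mulmx1 mulmxA mulVmx ?Xu// mul1mx.
by rewrite opprB.
Qed.

Lemma lipschitzV : lipschitz_on X -> lipschitz_on (fun t => invmx (X t)).
Proof.
move=> [_ o1]; split => //.
apply: order_eq (orderN (order_mul bX (order_mul o1 (bounded_swap bX)))) _ => s t sI tI.
exact: invB.
Qed.

Lemma smoothV : smooth_on X -> smooth_on (fun t => invmx (X t)).
Proof.
move=> sX; have lX := lipschitzV (smooth_lipschitz sX); have [_ l1] := sX; split => //.
have := linear_incrementN (linear_incrementMl bX (linear_incrementMr lX l1)).
move=> /linear_increment_eq; apply => s t sI tI; exact: invB.
Qed.

End inverse.
End increments.

(** * Reduction of the equation *)

Section time_regularity.
Context {R : realType}.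

Lemma within_cvg {U : topologicalType} (J : set R) (g : R -> U) t : {within J, continuous g} ->
  J t -> g s @[s --> within J (nbhs t)] --> g t.
Proof. by move=> /subspace_continuousP H Jt; exact: H. Qed.

Lemma within_continuous_cvg {U : topologicalType} (J : set R) (g : R -> U) :
  (forall t, J t -> g s @[s --> within J (nbhs t)] --> g t) -> {within J, continuous g}.
Proof. by move=> H; apply/subspace_continuousP. Qed.

Lemma within_cvg_eq {U : topologicalType} (J : set R) (g h : R -> U) (t : R) (l : U) :
  (forall s, J s -> h s = g s) ->
  g s @[s --> within J (nbhs t)] --> l -> h s @[s --> within J (nbhs t)] --> l.
Proof.
move=> E H; apply: cvg_trans H; apply: near_eq_cvg.
have Hn : nbhs t [set s | J s -> g s = h s] by apply: filterE => s Js; rewrite E.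
exact: Hn.
Qed.

Lemma Ck_time_der {V : normedModType R} k (J : set R) (g : R -> V) : Ck_time k.+1 J g ->
  (forall t, J t -> der J g t (ddt J g t)) /\ Ck_time k J (ddt J g).
Proof.
move=> [_ /(_ 1 erefl) [dg Cg]]; split=> [t Jt|]; last exact: Cg.
exact: derivable_in_der (dg t Jt).
Qed.

Lemma Ck_time_continuous {V : normedModType R} k (J : set R) (g : R -> V) : Ck_time k J g ->
  {within J, continuous g}.
Proof. by case: k => [|k] []. Qed.

Lemma Ck_time_smooth {m p} (a b : R) (g : R -> 'M[R]_(m, p)) : Ck_time 2 `[a, b] g ->
  smooth_on a b g.
Proof.
move=> /Ck_time_der[d1 /Ck_time_der[d2 /Ck_time_continuous c2]].
apply: (der_smooth (psi := ddt `[a, b] g)).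
  apply: (der_lipschitz (psi := ddt `[a, b] (ddt `[a, b] g))).
    exact: bounded_continuous.
  by move=> t tI; apply: d2; rewrite /= in_itv.
by move=> t tI; apply: d1; rewrite /= in_itv.
Qed.

Lemma der_unique {V : normedModType R} (J : set R) (g : R -> V) t d d' :
  limit_pt J t -> der J g t d -> der J g t d' -> d = d'.
Proof. by move=> L /(der_ddt L)[_ <-] /(der_ddt L)[_ <-]. Qed.

Lemma segment_ray (tp t0 T : R) : tp <= t0 -> `[t0, T]%classic `<=` `[tp, +oo[%classic.
Proof. by move=> tt t; rewrite /= !in_itv/= andbT => /andP[? _]; exact: le_trans tt _. Qed.

(** Reconciles the smoothness hypotheses, stated relative to [t0, T], with the derivatives in the
    method, taken relative to [tp, oo). *)
Lemma ddt_segment {V : normedModType R} (tp t0 T : R) (g : R -> V) t : tp <= t0 -> t0 < T ->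
  t0 <= t <= T -> der `[tp, +oo[ g t (ddt `[tp, +oo[ g t) -> ddt `[t0, T] g t = ddt `[tp, +oo[ g t.
Proof.
move=> tt tT tI d1; have L := @limit_pt_segment R t0 T t tT.
have {}L : limit_pt `[t0, T] t by apply: L; rewrite in_itv.
by case: (der_ddt L (der_subset (@segment_ray tp t0 T tt) d1)).
Qed.

End time_regularity.

Section splitting_family.
Context {R : realType} {n : nat}.
Variables (A B A' B' P Q P' : R -> 'M[R]_n) (tp : R).
Local Notation J := (`[tp, +oo[%classic).
Hypothesis S : forall t, tp <= t -> splitting (A t) (B t) (P t) (Q t).
Hypothesis dA : forall t, tp <= t -> der J A t (A' t).
Hypothesis dB : forall t, tp <= t -> der J B t (B' t).
Hypothesis cA' : {within J, continuous A'}.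
Hypothesis cB' : {within J, continuous B'}.
Hypothesis cP : {within J, continuous P}.
Hypothesis P'E : forall t, tp <= t -> P' t = proj_der A B P Q A' B' t.

Let JE t : J t -> tp <= t. Proof. by rewrite /= in_itv/= andbT. Qed.
Let G t := A t + B t *m (1%:M - P t).
Let Gi t := invmx (G t).

(** The coefficients of the reduced system: G^-1 Q1 for the differential part, G^-1 Q2 for the
    algebraic part. [drift_of] is the [drift] of the method with the projectors as parameters. *)
Definition drift_of t := (P' t - Gi t *m Q t *m (A' t + B t)) *m P t.
Definition forcing_of t := Gi t *m Q t.
Definition algebraic_of t := Gi t *m (1%:M - Q t).

Let Gu t : tp <= t -> G t \in unitmx. Proof. by move=> /S[]. Qed.

Lemma derP t : tp <= t -> der J P t (P' t).
Proof.
move=> tt; rewrite P'E//; apply: (@der_projector _ _ J A B P Q A' B').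
- by move=> s /JE /S.
- by move=> s /JE /dA.
- by move=> s /JE /dB.
- exact: cP.
- by rewrite /= in_itv/= andbT.
Qed.

Lemma der_Gi t : tp <= t -> exists d, der J Gi t d.
Proof.
move=> tt; eexists; apply: der_invmx.
- by rewrite /= in_itv/= andbT.
- by move=> s /JE /Gu.
- apply: derD; first exact: dA.
  apply: der_mulmx; first exact: dB.
  by apply: derB; [exact: der_cst|exact: derP].
Qed.

Let cvA t : tp <= t -> A s @[s --> within J (nbhs t)] --> A t.
Proof. by move=> /dA; exact: der_cvg. Qed.
Let cvB t : tp <= t -> B s @[s --> within J (nbhs t)] --> B t.
Proof. by move=> /dB; exact: der_cvg. Qed.

Let cvGi t : tp <= t -> Gi s @[s --> within J (nbhs t)] --> Gi t.
Proof. by move=> /der_Gi[d]; exact: der_cvg. Qed.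

Let cvP t : tp <= t -> P s @[s --> within J (nbhs t)] --> P t.
Proof. by move=> /derP; exact: der_cvg. Qed.

Let cvQ t : tp <= t -> Q s @[s --> within J (nbhs t)] --> Q t.
Proof.
move=> tt; rewrite -(split_AGi (S tt)).
have H : (fun s => A s *m Gi s) s @[s --> within J (nbhs t)] --> A t *m Gi t.
  by apply: cvg_mulmx; [exact: cvA|exact: cvGi].
by apply: within_cvg_eq H => s /JE ts; rewrite (split_AGi (S ts)).
Qed.

Let cvA' t : tp <= t -> A' s @[s --> within J (nbhs t)] --> A' t.
Proof. by move=> tt; apply: within_cvg => //; rewrite /= in_itv/= andbT. Qed.

Let cvB' t : tp <= t -> B' s @[s --> within J (nbhs t)] --> B' t.
Proof. by move=> tt; apply: within_cvg => //; rewrite /= in_itv/= andbT. Qed.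

Let cv1B (X : R -> 'M[R]_n) t : X s @[s --> within J (nbhs t)] --> X t ->
  (1%:M - X s) @[s --> within J (nbhs t)] --> 1%:M - X t.
Proof. by move=> H; apply: cvgB => //; exact: cvg_cst. Qed.

Lemma cvg_P' t : tp <= t -> P' s @[s --> within J (nbhs t)] --> P' t.
Proof.
move=> tt; rewrite P'E//.
have H : proj_der A B P Q A' B' s @[s --> within J (nbhs t)] --> proj_der A B P Q A' B' t.
  rewrite /proj_der; apply: cvgD.
    apply: cvg_mulmx (cvP tt); apply: cvg_mulmx.
      by apply: cvg_mulmx; [exact: cvGi|exact: cv1B (cvQ tt)].
    apply: cvgB (cvB' tt); apply: cvg_mulmx (cvB tt).
    by apply: cvg_mulmx; [exact: cvA'|exact: cvGi].
  apply: cvg_mulmx; last exact: cv1B (cvP tt).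
  by apply: cvg_mulmx; [exact: cvGi|exact: cvA'].
by apply: within_cvg_eq H => s /JE; exact: P'E.
Qed.

Lemma cvg_forcing_of t : tp <= t -> forcing_of s @[s --> within J (nbhs t)] --> forcing_of t.
Proof. by move=> tt; apply: cvg_mulmx; [exact: cvGi|exact: cvQ]. Qed.

Lemma cvg_algebraic_of t : tp <= t ->
  algebraic_of s @[s --> within J (nbhs t)] --> algebraic_of t.
Proof. by move=> tt; apply: cvg_mulmx; [exact: cvGi|exact: cv1B (cvQ tt)]. Qed.

Lemma cvg_drift_of t : tp <= t -> drift_of s @[s --> within J (nbhs t)] --> drift_of t.
Proof.
move=> tt; apply: cvg_mulmx (cvP tt); apply: cvgB; first exact: cvg_P'.
apply: cvg_mulmx; first exact: (cvg_forcing_of tt).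
by apply: cvgD; [exact: cvA'|exact: cvB].
Qed.

Section smooth_coefficients.
Variables t0 T : R.
Hypothesis t0_ge : tp <= t0.
Hypothesis sA : smooth_on t0 T A.
Hypothesis sB : smooth_on t0 T B.
Hypothesis sA' : smooth_on t0 T A'.
Hypothesis sB' : smooth_on t0 T B'.

Let tpt t : t0 <= t <= T -> tp <= t.
Proof. by move=> /andP[? _]; exact: le_trans t0_ge _. Qed.

Let bnd {m p} (X : R -> 'M[R]_(m, p)) :
  (forall t, tp <= t -> X s @[s --> within J (nbhs t)] --> X t) -> bounded_on t0 T X.
Proof.
move=> H; apply: bounded_continuous; apply: (continuous_subspaceW (@segment_ray _ tp t0 T t0_ge)).
by apply: within_continuous_cvg => t /JE; exact: H.
Qed.

Let sub t : t0 <= t <= T -> der `[t0, T] P t (P' t).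
Proof. by move=> /tpt tt; exact: der_subset (@segment_ray _ tp t0 T t0_ge) (derP tt). Qed.

(** A bootstrap. [P'] is continuous, hence bounded, so [P] is Lipschitz; then so are G^-1 and Q,
    hence [P'] by its formula, and [P] is smooth. A second round through the same formula makes
    G^-1, Q and [P'] smooth. *)
Lemma smooth_P : smooth_on t0 T P.
Proof.
have lP : lipschitz_on t0 T P by apply: (der_lipschitz (psi := P')) => //; apply: bnd; exact: cvg_P'.
have l1 := smooth_lipschitz (smooth_cst t0 T (1%:M : 'M[R]_n)).
have [lA lB] := (smooth_lipschitz sA, smooth_lipschitz sB).
have [lA' lB'] := (smooth_lipschitz sA', smooth_lipschitz sB').
have lGi : lipschitz_on t0 T Gi.
  apply: lipschitzV; [by move=> t /tpt; exact: Gu|exact: bnd|].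
  by apply: lipschitzD => //; apply: lipschitzM => //; exact: lipschitzB.
have lQ : lipschitz_on t0 T Q.
  apply: (lipschitz_eq (phi := fun t => A t *m Gi t)); last exact: lipschitzM.
  by move=> t /tpt tt; rewrite (split_AGi (S tt)).
apply: (der_smooth (psi := P')) => //.
apply: (lipschitz_eq (phi := proj_der A B P Q A' B')); first by move=> t /tpt; exact: P'E.
apply: lipschitzD; apply: lipschitzM => //.
- apply: lipschitzM; first by apply: lipschitzM => //; exact: lipschitzB.
  by apply: lipschitzB => //; apply: lipschitzM => //; exact: lipschitzM.
- exact: lipschitzM.
- exact: lipschitzB.
Qed.

Let s1 := smooth_cst t0 T (1%:M : 'M[R]_n).

Let sGi : smooth_on t0 T Gi.
Proof.
apply: smoothV; [by move=> t /tpt; exact: Gu|exact: bnd|].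
by apply: smoothD => //; apply: smoothM => //; apply: smoothB => //; exact: smooth_P.
Qed.

Let sQ : smooth_on t0 T Q.
Proof.
apply: (smooth_eq (phi := fun t => A t *m Gi t)); last exact: smoothM.
by move=> t /tpt tt; rewrite (split_AGi (S tt)).
Qed.

Let sP' : smooth_on t0 T P'.
Proof.
have sP := smooth_P.
apply: (smooth_eq (phi := proj_der A B P Q A' B')); first by move=> t /tpt; exact: P'E.
apply: smoothD; apply: smoothM => //.
- apply: smoothM; first by apply: smoothM => //; exact: smoothB.
  by apply: smoothB => //; apply: smoothM => //; exact: smoothM.
- exact: smoothM.
- exact: smoothB.
Qed.

Lemma smooth_forcing_of : smooth_on t0 T forcing_of.
Proof. exact: smoothM. Qed.

Lemma smooth_algebraic_of : smooth_on t0 T algebraic_of.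
Proof. by apply: smoothM => //; exact: smoothB. Qed.

Lemma smooth_drift_of : smooth_on t0 T drift_of.
Proof.
apply: smoothM; last exact: smooth_P.
by apply: smoothB => //; apply: smoothM; [exact: smooth_forcing_of|exact: smoothD].
Qed.

End smooth_coefficients.

(* Differentiate A x = A z, multiply by G^-1 Q1 and by G^-1 Q2, and use
   z' = P' z + P z'. *)
Lemma solution_components (f : R -> 'cV[R]_n -> 'cV[R]_n) (x : R -> 'cV[R]_n) (t0 : R) :
  tp <= t0 ->
  (forall t, t0 <= t ->
     der `[t0, +oo[ (fun s => A s *m x s) t (f t (x t) - B t *m x t)) ->
  forall t, t0 <= t -> let z s := P s *m x s in
    der `[t0, +oo[ z t (drift_of t *m z t + forcing_of t *m f t (x t)) /\
    x t - z t = algebraic_of t *m (f t (x t) - A' t *m z t).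
Proof.
move=> t0_ge dx t t0t z; have tt := le_trans t0_ge t0t.
have St := S tt; have [PP AP QA BP _] := St.
have sub : (`[t0, +oo[ `<=` J)%classic.
  by move=> s; rewrite /= !in_itv/= !andbT; exact: le_trans.
have J0t : `[t0, +oo[%classic t by rewrite /= in_itv/= andbT.
have [d0 dGi] := der_Gi tt.
(* z = G^-1 (A x) is a product of differentiable factors, although [x] itself need not be
   differentiable. *)
have [d dz] : exists d, der `[t0, +oo[ z t d.
  eexists; apply: der_eq (der_mulmx (der_subset sub dGi) (dx t t0t)) => // s.
  rewrite /= in_itv/= andbT => t0s.
  by rewrite mulmxA (split_GiA (S (le_trans t0_ge t0s))).
have E1 : A' t *m z t + A t *m d = f t (x t) - B t *m x t.
  apply: (der_unique (limit_pt_ray t0t) _ (dx t t0t)).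
  apply: der_eq (der_mulmx (der_subset sub (dA tt)) dz) => // s.
  rewrite /= in_itv/= andbT => t0s.
  by rewrite mulmxA; have [_ -> _ _ _] := S (le_trans t0_ge t0s).
have Pz s : t0 <= s -> P s *m z s = z s.
  by move=> t0s; rewrite mulmxA; have [-> _ _ _ _] := S (le_trans t0_ge t0s).
have E2 : d = P' t *m z t + P t *m d.
  apply: (der_unique (limit_pt_ray t0t) dz).
  apply: der_eq (der_mulmx (der_subset sub (derP tt)) dz) => // s.
  by rewrite /= in_itv/= andbT; exact: Pz.
have Pd : P t *m d = forcing_of t *m (f t (x t) - B t *m x t - A' t *m z t).
  rewrite -E1 [_ - A' t *m z t]addrAC subrr add0r /forcing_of -!mulmxA [Q t *m _]mulmxA QA.
  by rewrite mulmxA (split_GiA St).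
have QB : forcing_of t *m (B t *m x t) = forcing_of t *m (B t *m z t).
  rewrite /forcing_of -!mulmxA; congr (_ *m _).
  by rewrite /z !mulmxA -(mulmxA (Q t) (B t) (P t)) BP mulmxA (split_QQ St).
split.
  rewrite (_ : _ + _ = d)// {}E2 {}Pd /drift_of -mulmxA Pz// mulmxBl mulmxDr mulmxDl.
  rewrite !mulmxBr QB -/(forcing_of t) !mulmxA.
  by rewrite -addrA; congr (_ + _); rewrite addrC opprD addrA addrAC.
have E3 : algebraic_of t *m (f t (x t) - A' t *m z t) = algebraic_of t *m B t *m x t.
  have -> : f t (x t) - A' t *m z t = A t *m d + B t *m x t.
    have -> : f t (x t) = A' t *m z t + A t *m d + B t *m x t by rewrite E1 subrK.
    by rewrite addrAC [_ + A t *m d]addrC addrK.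
  rewrite mulmxDr mulmxA -[algebraic_of t *m A t]mulmxA (split_Q2A St) mulmx0 mul0mx add0r.
  by rewrite mulmxA.
by rewrite E3 /algebraic_of (split_GiQ2B St) mulmxBl mul1mx.
Qed.

End splitting_family.

(** * Regularity of the exact solution and convergence *)

Lemma segment_uniform_continuity {R : realType} {V : normedModType R} (g : R -> V) (a b e : R) :
  {within `[a, b], continuous g} -> 0 < e ->
  exists2 d, 0 < d & forall s t, a <= s <= b -> a <= t <= b -> `|s - t| < d ->
    `|g s - g t| <= e.
Proof.
move=> cg e0.
have := @compact_forall_near _ _ (0^'+ : set_system R) _ `[a, b]%classic
  (fun d t => forall s, a <= s <= b -> a <= t <= b -> `|s - t| < d -> `|g s - g t| <= e)
  (@segment_compact _ a b).
case=> [t tI|d /= d0 H].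
  have /cvgrPdist_le/(_ (e / 2)) := within_cvg cg tI.
  rewrite divr_gt0// => /(_ isT) H.
  have {}H : nbhs t [set s | `[a, b]%classic s -> `|g t - g s| <= e / 2] := H.
  have [r /= r0 Hr] := (@nbhs_ballP _ _ _ _).1 H.
  have r2 : 0 < r / 2 by rewrite divr_gt0.
  exists ([set s | `|t - s| < r / 2], [set d | d < r / 2]) => /=.
    split; first by apply/nbhs_ballP; exists (r / 2).
    exact: nbhs_right_lt.
  move=> [s' d] /= [s't dr] s sI s'I ss'.
  have gs : `|g t - g s| <= e / 2.
    apply: Hr; last by rewrite /= in_itv.
    rewrite /ball/= (_ : t - s = (t - s') - (s - s')); last by ring.
    rewrite (le_lt_trans (ler_normB _ _))//; move: s't ss' dr; clear; lra.
  have gs' : `|g t - g s'| <= e / 2.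
    apply: Hr; last by rewrite /= in_itv.
    by rewrite /ball/=; apply: lt_trans s't _; move: r0; clear; lra.
  rewrite (le_trans (ler_distD (g t) _ _))// (distrC (g s)); move: gs gs'; clear; lra.
have dp : 0 < d / 2 by rewrite divr_gt0.
exists (d / 2) => // s t sI tI st.
have Bd : ball_ Num.norm 0 d (d / 2).
  by rewrite /ball_/= sub0r normrN ger0_norm ?(ltW dp)//; move: d0; clear; lra.
by apply: (H _ Bd dp t _ s) => //; rewrite in_itv.
Qed.

Lemma sqrD_le2 {R : realDomainType} (a b : R) : (a + b) ^+ 2 <= 2 * a ^+ 2 + 2 * b ^+ 2.
Proof. by have := sqr_ge0 (a - b); nra. Qed.

Lemma sqr_combination_le {R : realDomainType} (k q a b : R) : 0 <= a <= 1 ->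
  (k * a + q * b) ^+ 2 <= (2 * k ^+ 2 + 2 * q ^+ 2) * (a + b ^+ 2).
Proof.
move=> /andP[a0 a1]; apply: le_trans (sqrD_le2 _ _) _; rewrite !exprMn.
have [k2 q2 b2] := And3 (sqr_ge0 k) (sqr_ge0 q) (sqr_ge0 b).
have aa : a ^+ 2 <= a by rewrite expr2 ler_piMl.
have p1 := ler_wpM2l k2 aa; have p2 := mulr_ge0 k2 b2; have p3 := mulr_ge0 q2 a0.
by move: (k ^+ 2) (q ^+ 2) (b ^+ 2) (a ^+ 2) p1 p2 p3 => *; nra.
Qed.

Lemma mulmx_le {R : realType} {m n p} (X : 'M[R]_(m, n)) (Y : 'M[R]_(n, p)) c d :
  `|X| <= c -> `|Y| <= d -> `|X *m Y| <= n%:R * c * d.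
Proof.
move=> Xc Yd; rewrite (le_trans (mulmx_norm _ _))// -!mulrA ler_wpM2l//.
by rewrite ler_pM.
Qed.

Lemma bounded_pos {R : realType} {m p} (a b : R) (g : R -> 'M[R]_(m, p)) : bounded_on a b g ->
  exists2 C, 0 < C & forall t, a <= t <= b -> `|g t| <= C.
Proof.
move=> [C C0 H]; exists (C + 1) => [|t tI]; first by rewrite ltr_wpDl.
by have := H t t tI tI; rewrite expr0 mulr1 => /le_trans; apply; rewrite lerDl.
Qed.

Section exact_solution.
Context {R : realType} {n : nat}.
Local Notation V := 'cV[R]_n.
Variables (t0 T : R) (M A' P Dr Fo : R -> 'M[R]_n) (f td : R -> V -> V) (x z u : R -> V).
Hypothesis sM : smooth_on t0 T M.
Hypothesis sA' : smooth_on t0 T A'.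
Hypothesis sP : smooth_on t0 T P.
Hypothesis sDr : smooth_on t0 T Dr.
Hypothesis sFo : smooth_on t0 T Fo.
Hypothesis taylor : forall r : R, exists2 C, 0 < C &
  forall s t x y, t0 <= s <= T -> t0 <= t <= T -> `|x| <= r -> `|y| <= r ->
  [/\ `|f s y - f t x - ((s - t) *: td t x + Jac (f t) x *m (y - x))| <=
        C * (`|s - t| + `|y - x|) ^+ 2,
      `|Jac (f s) y - Jac (f t) x| <= C * (`|s - t| + `|y - x|),
      `|td t x| <= C, `|Jac (f t) x| <= C & `|f t x| <= C].
Let P2 t := 1%:M - P t.
(** The derivative of u - M (f - A' z) with respect to u, which is also the matrix inverted in a
    Newton step. *)
Let S t (y : V) := 1%:M - M t *m Jac (f t) y *m P2 t.
Hypothesis S_inv : forall r : R, exists2 C, 0 < C &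
  forall t y, t0 <= t <= T -> `|y| <= r -> S t y \in unitmx /\ `|invmx (S t y)| <= C.
Let fx t := f t (x t).
Let phi t := Dr t *m z t + Fo t *m fx t.
Hypothesis cx : {within `[t0, T], continuous x}.
Hypothesis xE : forall t, t0 <= t <= T -> x t = z t + u t.
Hypothesis uP : forall t, t0 <= t <= T -> P2 t *m u t = u t.
Hypothesis uE : forall t, t0 <= t <= T -> u t = M t *m (fx t - A' t *m z t).
Hypothesis dz : forall t, t0 <= t <= T -> der `[t0, T] z t (phi t).

Let bx : bounded_on t0 T x. Proof. exact: bounded_continuous. Qed.
Let cz : {within `[t0, T], continuous z}.
Proof. by apply: (@der_continuous _ _ _ _ phi) => t; rewrite /= in_itv; exact: dz. Qed.
Let bz : bounded_on t0 T z. Proof. exact: bounded_continuous. Qed.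

Let Jx t := Jac (f t) (x t).
Let tdx t := td t (x t).
Let rem s t := fx s - fx t - ((s - t) *: tdx t + Jx t *m (x s - x t)).

Let x_bound : exists2 C, 0 < C & forall t, t0 <= t <= T -> `|x t| <= C.
Proof. exact: bounded_pos. Qed.

Let along : [/\ bounded_on t0 T fx, bounded_on t0 T Jx, bounded_on t0 T tdx,
    bounded_on t0 T (fun t => invmx (S t (x t))) &
    exists2 C, 0 < C & forall s t, t0 <= s <= T -> t0 <= t <= T ->
      `|rem s t| <= C * (`|s - t| + `|x s - x t|) ^+ 2].
Proof.
have [r r0 xr] := x_bound; have [C C0 H] := taylor r; have [C' C'0 H'] := S_inv r.
split; last (exists C => // s t sI tI; by case: (H s t (x t) (x s) sI tI (xr _ tI) (xr _ sI))).
- by apply: (bounded_bound (C := C)) => t tI; case: (H t t _ _ tI tI (xr _ tI) (xr _ tI)).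
- by apply: (bounded_bound (C := C)) => t tI; case: (H t t _ _ tI tI (xr _ tI) (xr _ tI)).
- by apply: (bounded_bound (C := C)) => t tI; case: (H t t _ _ tI tI (xr _ tI) (xr _ tI)).
- by apply: (bounded_bound (C := C')) => t tI; case: (H' t (x t) tI (xr _ tI)).
Qed.

Let lz : lipschitz_on t0 T z.
Proof.
have [bf _ _ _ _] := along.
apply: (der_lipschitz (psi := phi)) => //; apply: orderD; apply: boundedM => //.
- by case: sDr.
- by case: sFo.
Qed.

Let bu : bounded_on t0 T u.
Proof.
by apply: order_eq (orderB bx bz) _ => s t sI tI; rewrite xE// addrAC subrr add0r.
Qed.

(** The terms in which the unknown increment u s - u t does not occur. The Taylor remainder [rem],
    which depends on it quadratically, is kept apart. *)
Let W s t := M t *m (Jx t *m (z s - z t + (P2 s - P2 t) *m u s)) + (s - t) *: (M t *m tdx t)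
  + (M s - M t) *m fx s - ((M s *m A' s) *m z s - (M t *m A' t) *m z t).

(* Subtract u = M [f - A' z] at s and t, expand f(s, x_s) - f(t, x_t) to first order,
   and write u_s - u_t = P2_t (u_s - u_t) + (P2_s - P2_t) u_s inside the Jacobian. *)
Let u_increment s t : t0 <= s <= T -> t0 <= t <= T ->
  u s - u t = invmx (S t (x t)) *m (W s t + M t *m rem s t).
Proof.
move=> sI tI; have [r r0 xr] := x_bound; have [C _ H] := S_inv r.
have [Su _] := H t (x t) tI (xr t tI).
suff E : S t (x t) *m (u s - u t) = W s t + M t *m rem s t by rewrite -E mulKmx.
have us : u s - u t = M t *m (fx s - fx t) + (M s - M t) *m fx s
    - ((M s *m A' s) *m z s - (M t *m A' t) *m z t).
  rewrite (uE sI) (uE tI) !mulmxBr mulmxBl !mulmxA.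
  move: (M s *m fx s) (M s *m A' s *m z s) (M t *m fx t) (M t *m A' t *m z t) (M t *m fx s).
  by move=> a1 a2 a3 a4 a5; apply/matrixP => i j; rewrite !mxE; ring.
have fe : fx s - fx t = rem s t + ((s - t) *: tdx t + Jx t *m (x s - x t)).
  by rewrite /rem subrK.
have xe : x s - x t = (z s - z t) + (u s - u t) by rewrite !xE// opprD addrACA.
have ue : P2 t *m (u s - u t) = (u s - u t) - (P2 s - P2 t) *m u s.
  have gen (X Y : 'M[R]_n) (a b : V) : X *m a = a -> Y *m b = b ->
      Y *m (a - b) = a - b - (X - Y) *m a.
    by rewrite mulmxBr mulmxBl => -> ->; apply/matrixP => i j; rewrite !mxE; ring.
  exact: gen (uP sI) (uP tI).
rewrite /S mulmxBl mul1mx -!mulmxA ue {1}us fe xe /W -/(Jx t).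
move: (rem s t) => rst; move: (u s - u t) (z s - z t) (P2 s - P2 t) => du dz' dP.
rewrite !(mulmxDr, mulmxN) -!scalemxAr.
set a1 := M t *m rst; set a2 := M t *m (Jx t *m dz'); set a3 := M t *m (Jx t *m du).
set a4 := M t *m (Jx t *m (dP *m _)); set a5 := (s - t) *: _; set a6 := (M s - M t) *m _.
set a7 := M s *m _ *m _; set a8 := M t *m A' t *m _.
by move: a1 a2 a3 a4 a5 a6 a7 a8 => *; apply/matrixP => i j; rewrite !mxE; ring.
Qed.

Let lMs : lipschitz_on t0 T M. Proof. exact: smooth_lipschitz. Qed.
Let bM : bounded_on t0 T M. Proof. by case: sM. Qed.
Let sP2 : smooth_on t0 T P2. Proof. by apply: smoothB => //; exact: smooth_cst. Qed.
Let lN : lipschitz_on t0 T (fun t => (M t *m A' t) *m z t).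
Proof. by apply: lipschitzM => //; apply: lipschitzM => //; exact: smooth_lipschitz. Qed.

Let W_order1 : order t0 T 1 W.
Proof.
have [bf bJ btd _ _] := along; have [_ oP2] := smooth_lipschitz sP2.
have [[_ oM] [_ oN] [_ oz]] := And3 lMs lN lz.
apply: orderB => //; apply: orderD; last exact: (order_mul oM (bounded_swap bf)).
apply: orderD; last by apply: order_scale; exact: boundedM.
apply: (order_mul (k := 0) bM); apply: (order_mul (k := 0) bJ); apply: orderD => //.
exact: (order_mul oP2 (bounded_swap bu)).
Qed.

(** [rem] is quadratic in the increment d of [u], so the increment formula only gives d <= K (e +
    d^2), which controls d once d is known to be small. *)
Let quadratic_bound : exists2 K, 0 < K & forall s t, t0 <= s <= T -> t0 <= t <= T ->
  `|u s - u t| <= K * (`|s - t| + `|u s - u t| ^+ 2).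
Proof.
have [_ _ _ [CS CS0 HS] [Cr Cr0 Hr]] := along.
have [CW CW0 HW] := W_order1; have [CM CM0 HM] := bM; have [_ [Cz Cz0 Hz]] := lz.
pose L := `|T - t0|.
pose D := Cr * (2 * (1 + Cz) ^+ 2 * L + 2).
have D0 : 0 <= D.
  by rewrite mulr_ge0 ?(ltW Cr0)// addr_ge0// mulr_ge0 ?normr_ge0// mulr_ge0 ?sqr_ge0.
exists (1 + n%:R * CS * (CW + n%:R * CM * D)) => [|s t sI tI].
  have nD : 0 <= n%:R * CM * D by apply: mulr_ge0 D0; exact: mulr_ge0.
  by rewrite ltr_pwDl//; apply: mulr_ge0; [exact: mulr_ge0|exact: addr_ge0].
set e := `|s - t|; set d := `|u s - u t|.
have e0 : 0 <= e by exact: normr_ge0.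
have d0 : 0 <= d by exact: normr_ge0.
have eL : e <= L.
  rewrite /e /L [leRHS]ger0_norm; first by rewrite ler_norml; move: sI tI => /andP[? ?] /andP[? ?]; apply/andP; split; lra.
  by move: sI => /andP[? ?]; lra.
have F0 : 0 <= e + d ^+ 2 by rewrite addr_ge0// sqr_ge0.
have remD : `|rem s t| <= D * (e + d ^+ 2).
  have xd : `|x s - x t| <= Cz * e + d.
    have -> : x s - x t = (z s - z t) + (u s - u t) by rewrite !xE// opprD addrACA.
    by rewrite (le_trans (ler_normD _ _))// lerD2r; have := Hz s t sI tI; rewrite expr1.
  rewrite (le_trans (Hr s t sI tI))// /D -mulrA ler_pM2l// -/e.
  have s1 : (e + `|x s - x t|) ^+ 2 <= ((1 + Cz) * e + d) ^+ 2.
    rewrite lerXn2r ?nnegrE ?addr_ge0// ?mulr_ge0// ?addr_ge0//.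
    by move: xd; lra.
  apply: le_trans s1 _.
  have s2 : ((1 + Cz) * e + d) ^+ 2 <= 2 * ((1 + Cz) * e) ^+ 2 + 2 * d ^+ 2.
    exact: sqrD_le2.
  apply: le_trans s2 _; rewrite [leRHS]mulrDl lerD//; last first.
    by rewrite mulrDr lerDr mulr_ge0.
  have c0 : 0 <= 2 * (1 + Cz) ^+ 2 by rewrite mulr_ge0// sqr_ge0.
  rewrite exprMn mulrA -(mulrA _ L) ler_wpM2l//.
  rewrite expr2 (le_trans (ler_wpM2r e0 eL))// ler_wpM2l// ?lerDl ?sqr_ge0//.
  exact: normr_ge0.
clearbody D.
have HSt := HS t t tI tI; have HMt := HM t t tI tI; rewrite !expr0 !mulr1 in HSt HMt.
have inner : `|W s t + M t *m rem s t| <= (CW + n%:R * CM * D) * (e + d ^+ 2).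
  rewrite (le_trans (ler_normD _ _))// mulrDl lerD//.
    rewrite (le_trans (HW s t sI tI))// expr1 ler_wpM2l// lerDl sqr_ge0//.
  rewrite (le_trans (mulmx_norm _ _))// -!mulrA ler_wpM2l//.
  by rewrite ler_pM.
rewrite {1}/d u_increment// (le_trans (mulmx_norm _ _))//.
apply: (@le_trans _ _ (n%:R * CS * ((CW + n%:R * CM * D) * (e + d ^+ 2)))).
  by rewrite -!mulrA ler_wpM2l// ler_pM// mulrA.
by rewrite [leRHS]mulrDl mul1r mulrA lerDr.
Qed.

Let cu : {within `[t0, T], continuous u}.
Proof.
apply: within_continuous_cvg => t tI.
have H : (x s - z s) @[s --> within `[t0, T] (nbhs t)] --> x t - z t.
  by apply: cvgB; exact: within_cvg.
have uxz s : `[t0, T]%classic s -> u s = x s - z s.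
  by rewrite /= in_itv => sI; rewrite xE// addrAC subrr add0r.
by rewrite uxz//; exact: within_cvg_eq H.
Qed.

(** Uniform continuity makes d at most 1 / (2 K) when |s - t| < r, and K d^2 <= d / 2 is absorbed on
    the left. For distant times the bound on [u] suffices, with constant 2 Cu / r. *)
Lemma algebraic_lipschitz : lipschitz_on t0 T u.
Proof.
split=> //; have [K K0 HK] := quadratic_bound.
have K2 : 0 < (2 * K)^-1 by rewrite invr_gt0 mulr_gt0.
have [r r0 Hr] := segment_uniform_continuity cu K2.
have [Cu Cu0 Hu] := bu.
exists (2 * K + 2 * Cu / r) => [|s t sI tI].
  by rewrite addr_ge0 ?divr_ge0 ?mulr_ge0// ltW.
rewrite expr1; have [st|st] := ltP `|s - t| r; last first.
  have Cr : 2 * Cu <= (2 * Cu / r) * `|s - t|.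
    by rewrite -mulrA -mulrA ler_wpM2l// ler_peMr// mulrC ler_pdivlMr// mul1r.
  have [us ut] := (Hu s s sI sI, Hu t t tI tI); rewrite !expr0 !mulr1 in us ut.
  rewrite (le_trans (ler_normB _ _))// mulrDl.
  have K1 : 0 <= 2 * K * `|s - t| by rewrite !mulr_ge0// ltW.
  move: Cr us ut K1; lra.
have d1 := Hr s t sI tI st; have d2 := HK s t sI tI.
set d := `|u s - u t| in d1 d2 *; set e := `|s - t| in st d2 *.
have d0 : 0 <= d by exact: normr_ge0.
have Kd : K * d ^+ 2 <= d / 2.
  rewrite expr2 mulrA -[d / 2]mulrC ler_wpM2r//.
  have := ler_wpM2l (ltW K0) d1; rewrite invfM mulrCA divff ?lt0r_neq0// mulr1.
  by [].
have e0 : 0 <= 2 * Cu / r * e by rewrite mulr_ge0 ?normr_ge0// divr_ge0 ?mulr_ge0// ltW.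
move: d2 Kd e0; lra.
Qed.

Let lx : lipschitz_on t0 T x.
Proof. by apply: lipschitz_eq (lipschitzD lz algebraic_lipschitz) => t; exact: xE. Qed.

Let rem_order2 : order t0 T 2 rem.
Proof.
have [_ _ _ _ [Cr Cr0 Hr]] := along; have [_ [Cx Cx0 Hx]] := lx.
exists (Cr * (1 + Cx) ^+ 2) => [|s t sI tI]; first by rewrite mulr_ge0 ?sqr_ge0// ltW.
rewrite (le_trans (Hr s t sI tI))// -mulrA ler_pM2l// -exprMn lerXn2r ?nnegrE ?addr_ge0//.
  by rewrite mulr_ge0// addr_ge0.
by rewrite mulrDl mul1r lerD2l; have := Hx s t sI tI; rewrite expr1.
Qed.

Let fx_linear : linear_increment t0 T (fun s t => x s - x t) ->
  linear_increment t0 T (fun s t => fx s - fx t).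
Proof.
move=> l; have [_ bJ btd _ _] := along.
have := linear_incrementD (order2_linear rem_order2)
  (linear_incrementD (scale_linear btd) (linear_incrementMl bJ l)).
by move=> /linear_increment_eq; apply => s t _ _; rewrite /rem subrK.
Qed.

Let lfx : lipschitz_on t0 T fx.
Proof.
have [bf bJ btd _ _] := along; split => //; have [_ ox] := lx.
have := orderD (order_weaken (isT : (1 <= 2)%N) rem_order2)
  (orderD (order_scale btd) (order_mul bJ ox)).
by move=> /order_eq; apply => s t _ _; rewrite /rem subrK.
Qed.

Let sz : smooth_on t0 T z.
Proof.
apply: (der_smooth (psi := phi)) => //.
by apply: lipschitzD; apply: lipschitzM => //; exact: smooth_lipschitz.
Qed.

(** Once [u] is Lipschitz, [rem] is O(|s - t|^2) and all terms of [W] have linear increments; the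
    increment formula then makes [u] smooth although no derivative of [u] is ever taken. *)
Let sx : smooth_on t0 T x.
Proof.
suff su : smooth_on t0 T u by apply: smooth_eq (smoothD sz su) => t; exact: xE.
have [bf bJ btd bS _] := along; have [_ Lz] := sz; have [_ LP2] := sP2; have [_ LM] := sM.
split => //.
suff LW : linear_increment t0 T W.
  have LWr := linear_incrementD LW (order2_linear (order_mul bM rem_order2)).
  by apply: linear_increment_eq (linear_incrementMl bS LWr) _ => s t; exact: u_increment.
have sN : smooth_on t0 T (fun t => (M t *m A' t) *m z t) by apply: smoothM => //; exact: smoothM.
have [_ LN] := sN.
apply: linear_incrementB => //; apply: linear_incrementD.
  apply: linear_incrementD; last by apply: scale_linear; exact: boundedM.
  apply: linear_incrementMl => //; apply: linear_incrementMl => //.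
  by apply: linear_incrementD => //; apply: linear_incrementMr => //; exact: algebraic_lipschitz.
exact: (linear_incrementMr lfx LM).
Qed.

Let sphi : smooth_on t0 T phi.
Proof.
have [bf _ _ _ _] := along; have [_ Lx] := sx.
apply: smoothD; apply: smoothM => //.
by split => //; exact: fx_linear.
Qed.

Lemma solution_trapezoid :
  order t0 T 3 (fun s t => z s - z t - ((s - t) / 2) *: (phi t + phi s)).
Proof. exact: smooth_trapezoid. Qed.

(** The Euler and trapezoidal defects differ by half of (s - t) (phi s - phi t), of second order
    because [phi] is Lipschitz. *)
Lemma solution_euler : order t0 T 2 (fun s t => z s - z t - (s - t) *: phi t).
Proof.
have [_ o1] := smooth_lipschitz sphi.
have := orderD (order_weaken (isT : (2 <= 3)%N) solution_trapezoid)
  (orderZ 2^-1 (order_scale o1)).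
move=> /order_eq; apply => s t _ _.
by apply/matrixP => i j; rewrite !mxE; field.
Qed.

Hypothesis zP : forall t, t0 <= t <= T -> P t *m z t = z t.

Definition newton_of t (y v : V) : V := let w := P t *m y + P2 t *m v in
  v - invmx (1%:M - M t *m Jac (f t) w *m P2 t) *m (v - M t *m (f t w - A' t *m P t *m y)).

Definition rhs_of t (y v : V) : V := Dr t *m y + Fo t *m f t (P t *m y + P2 t *m v).

Let w_minus_x t y v : t0 <= t <= T ->
  P t *m y + P2 t *m v - x t = P t *m (y - z t) + P2 t *m (v - u t).
Proof. by move=> tI; rewrite xE// !mulmxBr zP// uP// opprD addrACA. Qed.

Let w_bound : exists2 r, 0 < r & forall t y v, t0 <= t <= T ->
  `|y - z t| <= 1 -> `|v - u t| <= 1 -> `|P t *m y + P2 t *m v| <= r /\ `|x t| <= r.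
Proof.
have [r r0 xr] := x_bound; have [CP CP0 HP] := bounded_pos sP.1.
have [CP2 CP20 HP2] := bounded_pos sP2.1.
exists (r + (n%:R * CP * 1 + n%:R * CP2 * 1)) => [|t y v tI y1 v1].
  by rewrite ltr_wpDr// addr_ge0// !mulr_ge0// ltW.
split; last by rewrite (le_trans (xr _ tI))// lerDl addr_ge0// !mulr_ge0// ltW.
rewrite -(subrK (x t) (_ + _)) addrC (le_trans (ler_normD _ _))// lerD ?xr//.
rewrite w_minus_x// (le_trans (ler_normD _ _))// lerD//.
  exact: mulmx_le (HP _ tI) y1.
exact: mulmx_le (HP2 _ tI) v1.
Qed.

(** f (t, x) is expanded about the current point w, not about x. The term linear in v - u then
    cancels exactly against the Newton matrix, leaving terms linear in y - z and a quadratic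
    remainder. *)
Lemma newton_estimate : exists2 C, 0 < C & forall t y v, t0 <= t <= T ->
  `|y - z t| <= 1 -> `|v - u t| <= 1 ->
  `|newton_of t y v - u t| <= C * (`|y - z t| + `|v - u t| ^+ 2).
Proof.
have [r r0 Hr] := w_bound; have [C C0 HC] := taylor r; have [CS CS0 HS] := S_inv r.
have [CP CP0 HP] := bounded_pos sP.1; have [CP2 CP20 HP2] := bounded_pos sP2.1.
have [CM CM0 HM] := bounded_pos bM; have [CA CA0 HA] := bounded_pos sA'.1.
pose kp := n%:R * CP; pose kq := n%:R * CP2.
have kp0 : 0 <= kp by rewrite mulr_ge0// ltW.
pose kr := C * (2 * kp ^+ 2 + 2 * kq ^+ 2).
pose K := n%:R * CM * (n%:R * C * kp) + n%:R * CM * kr + n%:R * CM * (n%:R * CA * kp).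
exists (1 + `|n%:R * CS * K|) => [|t y v tI y1 v1]; first by rewrite ltr_pwDl.
set w := P t *m y + P2 t *m v; have [wr xr] := Hr t y v tI y1 v1; rewrite -/w in wr.
have [Su Sb] := HS t w tI wr.
have [+ _ _ Jb _] := HC t t w (x t) tI tI wr xr.
rewrite subrr scale0r add0r normr0 add0r; set rm := f t (x t) - f t w - _ => rb.
have wx := w_minus_x y v tI; rewrite -/w in wx.
have E : newton_of t y v - u t = invmx (S t w) *m (M t *m (Jac (f t) w *m (P t *m (y - z t)))
    - M t *m rm - M t *m (A' t *m (P t *m (y - z t)))).
  rewrite /newton_of -/w -/(S t w) addrAC -[v - u t](mulKmx Su) -mulmxBr; congr (_ *m _).
  have fw : f t w - A' t *m P t *m y = (fx t - A' t *m z t) - rm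
      + (Jac (f t) w *m (P t *m (y - z t)) + Jac (f t) w *m (P2 t *m (v - u t)))
      - A' t *m (P t *m (y - z t)).
    have -> : A' t *m P t *m y = A' t *m z t + A' t *m (P t *m (y - z t)).
      by rewrite -{1}(zP tI) -mulmxDr -mulmxDr addrC subrK mulmxA.
    rewrite -(mulmxDr (Jac (f t) w)) -wx /rm -/(fx t) -[x t - w]opprB mulmxN.
    move: (Jac (f t) w *m _) => Jw.
    by apply/matrixP => i j; rewrite !mxE; ring.
  have ve : v = (v - u t) + M t *m (fx t - A' t *m z t) by rewrite -uE// subrK.
  rewrite fw [X in _ - (X - _)]ve /S mulmxBl mul1mx -!mulmxA.
  clearbody rm; move: (Jac (f t) w *m (P2 t *m (v - u t))) => p2.
  move: (Jac (f t) w *m (P t *m (y - z t))) => p1; move: (fx t - A' t *m z t) => b.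
  move: (A' t *m (P t *m (y - z t))) (v - u t) => p3 dv.
  rewrite !(mulmxDr, mulmxN).
  move: (M t *m b) (M t *m rm) (M t *m p1) (M t *m p2) (M t *m p3) => b1 b2 b3 b4 b5.
  by apply/matrixP => i j; rewrite !mxE; ring.
rewrite {}E; set dy := y - z t in wx y1 *; set dv := v - u t in wx v1 *.
have F0 : 0 <= `|dy| + `|dv| ^+ 2 by rewrite addr_ge0// sqr_ge0.
have aF : `|dy| <= `|dy| + `|dv| ^+ 2 by rewrite lerDl sqr_ge0.
set F := `|dy| + `|dv| ^+ 2 in F0 aF *.
have pF : `|P t *m dy| <= kp * F.
  by rewrite (le_trans (mulmx_le (HP _ tI) (lexx _)))// ler_wpM2l.
have rF : `|rm| <= kr * F.
  rewrite (le_trans rb)// -mulrA ler_pM2l// distrC wx.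
  have sq : `|P t *m dy + P2 t *m dv| ^+ 2 <= (kp * `|dy| + kq * `|dv|) ^+ 2.
    rewrite lerXn2r ?nnegrE// ?addr_ge0// ?mulr_ge0// ?(ltW CP0) ?(ltW CP20)//.
    rewrite (le_trans (ler_normD _ _))// lerD//.
      exact: mulmx_le (HP _ tI) (lexx _).
    exact: mulmx_le (HP2 _ tI) (lexx _).
  by apply: le_trans sq _; apply: sqr_combination_le; rewrite normr_ge0.
have inner : `|M t *m (Jac (f t) w *m (P t *m dy)) - M t *m rm - M t *m (A' t *m (P t *m dy))|
    <= K * F.
  rewrite (le_trans (ler_normB _ _))// [leRHS]mulrDl lerD//.
    rewrite (le_trans (ler_normB _ _))// [leRHS]mulrDl lerD//.
      rewrite (le_trans (mulmx_le (HM _ tI) (mulmx_le Jb pF)))//.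
      by rewrite !mulrA.
    by rewrite (le_trans (mulmx_le (HM _ tI) rF))// !mulrA.
  by rewrite (le_trans (mulmx_le (HM _ tI) (mulmx_le (HA _ tI) pF)))// !mulrA.
rewrite (le_trans (mulmx_le Sb inner))// mulrA ler_wpM2r//.
by rewrite (le_trans (ler_norm _))// lerDr.
Qed.

Lemma rhs_estimate : exists2 C, 0 < C & forall t y v, t0 <= t <= T ->
  `|y - z t| <= 1 -> `|v - u t| <= 1 ->
  `|rhs_of t y v - phi t| <= C * (`|y - z t| + `|v - u t|).
Proof.
have [r r0 Hr] := w_bound; have [C C0 HC] := taylor r.
have [CP CP0 HP] := bounded_pos sP.1; have [CP2 CP20 HP2] := bounded_pos sP2.1.
have [CD CD0 HD] := bounded_pos sDr.1; have [CF CF0 HF] := bounded_pos sFo.1.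
pose k := n%:R * CP + n%:R * CP2.
have k0 : 0 <= k by rewrite addr_ge0// mulr_ge0// ltW.
pose D := C * k ^+ 2 * 2 + n%:R * C * k.
exists (1 + `|n%:R * CD + n%:R * CF * D|) => [|t y v tI y1 v1]; first by rewrite ltr_pwDl.
set w := P t *m y + P2 t *m v; have [wr xr] := Hr t y v tI y1 v1; rewrite -/w in wr.
have [+ _ _ Jb _] := HC t t (x t) w tI tI xr wr.
rewrite subrr scale0r add0r normr0 add0r; set rm := f t w - f t (x t) - _ => rb.
have wx := w_minus_x y v tI; rewrite -/w in wx.
have E : rhs_of t y v - phi t =
    Dr t *m (y - z t) + Fo t *m (rm + Jac (f t) (x t) *m (w - x t)).
  by rewrite /rm subrK /rhs_of -/w /phi !mulmxBr opprD addrACA.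
rewrite {}E; set dy := y - z t in wx y1 *; set dv := v - u t in wx v1 *.
set F := `|dy| + `|dv|.
have F0 : 0 <= F by rewrite addr_ge0.
have F2 : F <= 2 by rewrite /F; move: y1 v1; lra.
have wF : `|w - x t| <= k * F.
  rewrite wx (le_trans (ler_normD _ _))// [leRHS]mulrDl lerD//.
    rewrite (le_trans (mulmx_le (HP _ tI) (lexx _)))// ler_wpM2l ?lerDl// mulr_ge0// ltW//.
  rewrite (le_trans (mulmx_le (HP2 _ tI) (lexx _)))// ler_wpM2l ?lerDr// mulr_ge0// ltW//.
have inner : `|rm + Jac (f t) (x t) *m (w - x t)| <= D * F.
  rewrite (le_trans (ler_normD _ _))// [leRHS]mulrDl lerD//.
    rewrite (le_trans rb)// -2!mulrA ler_pM2l//.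
    have sq : `|w - x t| ^+ 2 <= (k * F) ^+ 2 by rewrite lerXn2r ?nnegrE// mulr_ge0.
    apply: le_trans sq _; rewrite exprMn ler_wpM2l ?sqr_ge0// expr2 ler_wpM2r//.
  by rewrite (le_trans (mulmx_le Jb wF))// !mulrA.
rewrite (@le_trans _ _ ((n%:R * CD + n%:R * CF * D) * F))//.
  rewrite (le_trans (ler_normD _ _))// [leRHS]mulrDl lerD//.
    by rewrite (le_trans (mulmx_le (HD _ tI) (lexx _)))// ler_wpM2l ?lerDl// mulr_ge0// ltW.
  by rewrite (le_trans (mulmx_le (HF _ tI) inner))// !mulrA.
by rewrite ler_wpM2r// (le_trans (ler_norm _))// lerDr.
Qed.

Lemma second_order_convergence : t0 < T ->
  exists K h0, 0 < h0 /\ forall N, (0 < N)%N -> let h := (T - t0) / N%:R in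
    h <= h0 -> forall zs us : nat -> V,
    let node (i : nat) := t0 + i%:R * h in
    zs 0%N = z t0 -> us 0%N = u t0 ->
    (forall i, (i < N)%N ->
      let zt := zs i + h *: rhs_of (node i) (zs i) (us i) in
      let ut := newton_of (node i.+1) zt (us i) in
      zs i.+1 = zs i + (h / 2) *: (rhs_of (node i) (zs i) (us i) + rhs_of (node i.+1) zt ut) /\
      us i.+1 = newton_of (node i.+1) (zs i.+1) (us i)) ->
    forall i, (i <= N)%N ->
      `|P (node i) *m zs i + P2 (node i) *m us i - x (node i)| <= K * h ^+ 2.
Proof.
move=> t0T; have [C1 C10 H1] := rhs_estimate; have [C2 C20 H2] := newton_estimate.
have [C3 C30 H3] := algebraic_lipschitz.2; have [C4 C40 H4] := solution_euler.
have [C5 C50 H5] := solution_trapezoid.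
have [CP CP0 HP] := bounded_pos sP.1; have [CP2 CP20 HP2] := bounded_pos sP2.1.
pose C := 1 + C1 + C2 + C3 + C4 + C5.
have le (c e : R) : 0 <= e -> c <= C -> c * e <= C * e by move=> ? ?; rewrite ler_wpM2r.
have p0 (a b : R) : 0 <= a -> 0 <= b -> 0 <= a + b by exact: addr_ge0.
have [] := @heun_newton_convergence R n z u phi rhs_of newton_of t0 T C t0T.
- by rewrite /C; move: (ltW C10) (ltW C20) C30 C40 C50; lra.
- move=> t y v tI y1 v1; apply: le_trans (H1 t y v tI y1 v1) _; apply: le; first exact: p0.
  by rewrite /C; move: (ltW C10) (ltW C20) C30 C40 C50; lra.
- move=> t y v tI y1 v1; apply: le_trans (H2 t y v tI y1 v1) _; apply: le.
    by apply: p0 => //; exact: sqr_ge0.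
  by rewrite /C; move: (ltW C10) (ltW C20) C30 C40 C50; lra.
- move=> s t sI tI; apply: le_trans (H3 s t sI tI) _; rewrite expr1; apply: le => //.
  by rewrite /C; move: (ltW C10) (ltW C20) C30 C40 C50; lra.
- move=> s t sI tI; apply: le_trans (H4 s t sI tI) _; apply: le; first exact: exprn_ge0.
  by rewrite /C; move: (ltW C10) (ltW C20) C30 C40 C50; lra.
- move=> s t sI tI; apply: le_trans (H5 s t sI tI) _; apply: le; first exact: exprn_ge0.
  by rewrite /C; move: (ltW C10) (ltW C20) C30 C40 C50; lra.
move=> K [h0 [h00 H]]; exists (n%:R * CP * K + n%:R * CP2 * K), h0; split => //.
move=> N N0 h hh0 zs us node zs0 us0 step i iN.
have h_ge0 : 0 <= h by rewrite divr_ge0// subr_ge0 ltW.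
have nodeI : t0 <= node i <= T.
  rewrite /node lerDl mulr_ge0//= -lerBrDl /h mulrCA ger_pMr ?subr_gt0//.
  by rewrite ler_pdivrMr ?ltr0n// mul1r ler_nat.
have [Hz Hu] := H N N0 hh0 zs us zs0 us0 step i iN.
rewrite w_minus_x// (le_trans (ler_normD _ _))// [leRHS]mulrDl lerD//.
  by rewrite (le_trans (mulmx_le (HP _ nodeI) Hz))// mulrA.
by rewrite (le_trans (mulmx_le (HP2 _ nodeI) Hu))// mulrA.
Qed.

End exact_solution.

(** * From the operator on subspaces to the Newton matrix *)

Section restricted_operators.
Context {R : realType} {n : nat}.
Local Notation V := 'cV[R]_n.

Lemma unitmx_kernel (S : 'M[R]_n) : (forall v : V, S *m v = 0 -> v = 0) -> S \in unitmx.
Proof.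
move=> H; rewrite -unitmx_tr -row_free_unit -kermx_eq0; apply/rowV0P => v /sub_kermxP vS.
by apply: trmx_inj; rewrite trmx0; apply: H; rewrite -[S]trmxK -trmx_mul vS trmx0.
Qed.

(** [Phi] uses the Jacobian of Q2 f, the method that of f. The two are compared along lines, where
    derivatives are unique. *)
Lemma Jac_mulmx (M : 'M[R]_n) (g : V -> V) y : differentiable g y ->
  Jac (fun x => M *m g x) y = M *m Jac g y.
Proof.
move=> dg; have cM : continuous (mulmx M : V -> V).
  by move=> x; apply: (@cvg_mulmx _ _ (nbhs x) _ _ _ _ (fun=> M) id); [exact: cvg_cst|exact: cvg_id].
have dM : differentiable (mulmx M : V -> V) (g y) by exact: linear_differentiable.
have dh : differentiable (fun x => M *m g x) y := differentiable_comp dg dM.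
have col_eq (d : V) : Jac (fun x => M *m g x) y *m d = M *m (Jac g y *m d).
  have yE : y = 0 *: d + y by rewrite scale0r add0r.
  apply: (der_unique (limit_pt_ray (lexx (0 : R))) (g := fun r => M *m g (r *: d + y))).
    have := @der_along _ _ (fun x => M *m g x) y d `[0, +oo[ 0.
    by rewrite -yE; apply.
  have := @der_along _ _ g y d `[0, +oo[ 0; rewrite -yE => /(_ dg) dg'.
  have := der_mulmx (der_cst `[0, +oo[ 0 M) dg'.
  by rewrite mul0mx add0r.
apply/matrixP => i j; have := congr1 (fun v : V => v i 0) (col_eq (delta_mx j 0)).
by rewrite mulmxA -!colE !mxE.
Qed.

Lemma range_mxP (M : 'M[R]_n) v : reflect (exists w, v = M *m w) (v \in range_mx M).
Proof.
apply: (iffP memv_imgP) => [[w _ ->]|[w ->]]; first by exists w; rewrite lfunE.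
by exists w; rewrite ?memvf// lfunE.
Qed.

Lemma range_projP (P : 'M[R]_n) v : P *m P = P -> (v \in range_mx P) = (P *m v == v).
Proof.
move=> PP; apply/range_mxP/eqP => [[w ->]|vP]; first by rewrite mulmxA PP.
by exists v.
Qed.

Lemma restrict_mxE (X Y : {vspace V}) (N : 'M[R]_n) (v : subvs_of X) :
  N *m vsval v \in Y -> vsval (restrict_mx X Y N v) = N *m vsval v.
Proof. by move=> NY; rewrite lfunE/= vsprojK. Qed.

Section phi.
Variables (A B P Q J : 'M[R]_n).
Hypothesis S : splitting A B P Q.
Let P2 := 1%:M - P.
Let Q2 := 1%:M - Q.
Let Gi := invmx (A + B *m P2).
Let X2 := range_mx P2.
Let Y2 := range_mx Q2.
Let N := (Q2 *m J - B) *m P2.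

Lemma restricted_in_Y2 (v : V) : N *m v \in Y2.
Proof.
apply/range_mxP; exists (J *m (P2 *m v) - B *m v).
have -> : N = Q2 *m J *m P2 - Q2 *m B by rewrite /N (mulmxBl (Q2 *m J)) (split_BP2 S).
by rewrite (mulmxBl (Q2 *m J *m P2)) (mulmxBr Q2) !mulmxA.
Qed.

(** A kernel vector v lies in X2, because G^-1 Q2 = P2 G^-1, and satisfies G v = Q2 J v. On X2 the
    matrix G coincides with B, so (Q2 J - B) v = 0 and injectivity of the restricted operator gives
    v = 0. *)
Lemma newton_matrix_unit : injective (restrict_mx X2 Y2 N) ->
  1%:M - Gi *m Q2 *m J *m P2 \in unitmx.
Proof.
move=> inj; apply: unitmx_kernel => v.
rewrite mulmxBl mul1mx => /subr0_eq vE.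
have P2v : P2 *m v = v.
  by rewrite {1}vE !mulmxA (split_P2Gi S) -(mulmxA Gi) (split_Q2Q2 S) -vE.
have vX : v \in X2 by rewrite range_projP ?(split_P2P2 S)// P2v.
have Nv : N *m v = 0.
  have : (A + B *m P2) *m v = Q2 *m (J *m v).
    by rewrite {1}vE -!mulmxA mulKVmx ?P2v//; case: S.
  rewrite -{1}P2v mulmxA (split_GP2 S) -!mulmxA P2v => E.
  by rewrite (mulmxBl (Q2 *m J)) -mulmxA E subrr.
have := inj (vsproj X2 v) 0; rewrite linear0 => H.
have : vsproj X2 v = 0.
  apply: H; apply: subvs_inj; rewrite restrict_mxE ?restricted_in_Y2// vsprojK// Nv.
by move=> /(congr1 vsval); rewrite vsprojK// linear0.
Qed.
End phi.
End restricted_operators.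

Section dae_data.
Context {R : realType} {n : nat}.
Local Notation V := 'cV[R]_n.
Variables (A B : R -> 'M[R]_n) (C1 C2 : R -> R) (f : R -> V -> V) (tp : R).
Hypothesis f_diff : forall t x, tp <= t -> differentiable (f t) x.
Hypothesis A_C1 : Ck_time 1 `[tp, +oo[ A.
Hypothesis B_C1 : Ck_time 1 `[tp, +oo[ B.
Hypothesis C2_C1 : Ck_time 1 `[tp, +oo[ C2.
Hypothesis C2_gt0 : forall t, tp <= t -> 0 < C2 t.
Hypothesis resolvent_bound : forall t (lam : R[i]), tp <= t ->
     real_complex R (C2 t) <= `|lam| ->
     pencil A B t lam \in unitmx /\ opnormC (invmx (pencil A B t lam)) <= C1 t.
Local Notation J := (`[tp, +oo[%classic).
Local Notation A' := (ddt J A).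
Local Notation B' := (ddt J B).
Local Notation P := (P1 A B C2).
Local Notation Q := (Q1 A B C2).
Local Notation P' := (ddt J P).

Lemma dae_splitting t : tp <= t -> splitting (A t) (B t) (P t) (Q t).
Proof. exact: (spectral_splitting C2_gt0 resolvent_bound). Qed.

Let JE t : tp <= t -> J t. Proof. by rewrite /= in_itv/= andbT. Qed.

Lemma dae_derA t : tp <= t -> der J A t (A' t).
Proof. by move=> /JE; case: (Ck_time_der A_C1) => + _; exact. Qed.

Lemma dae_derB t : tp <= t -> der J B t (B' t).
Proof. by move=> /JE; case: (Ck_time_der B_C1) => + _; exact. Qed.

Lemma dae_contA' : {within J, continuous A'}.
Proof. by case: (Ck_time_der A_C1) => _; exact: Ck_time_continuous. Qed.

Lemma dae_contB' : {within J, continuous B'}.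
Proof. by case: (Ck_time_der B_C1) => _; exact: Ck_time_continuous. Qed.

Lemma dae_contP : {within J, continuous P}.
Proof.
by apply: (P1_continuous C2_gt0 resolvent_bound); apply: Ck_time_continuous; eassumption.
Qed.

Lemma dae_P'E t : tp <= t -> P' t = proj_der A B P Q A' B' t.
Proof.
move=> tt; have : der J P t (proj_der A B P Q A' B' t).
  apply: der_projector (JE tt); last exact: dae_contP.
  - by move=> s; rewrite /= in_itv/= andbT; exact: dae_splitting.
  - by move=> s; rewrite /= in_itv/= andbT; exact: dae_derA.
  - by move=> s; rewrite /= in_itv/= andbT; exact: dae_derB.
by move=> /(der_ddt (limit_pt_ray tt))[].
Qed.

Lemma newton_unit t (y : V) (v : subvs_of (X2 A B C2 t)) (x : V) : tp <= t ->
  x = y + vsval v -> bijective (Phi (A := A) (B := B) (C2 := C2) f y v) ->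
  1%:M - algebraic_of A B P Q t *m Jac (f t) x *m (1%:M - P t) \in unitmx.
Proof.
move=> tt -> /bij_inj; rewrite /Phi Jac_mulmx; last exact: f_diff.
exact: (newton_matrix_unit (dae_splitting tt)).
Qed.

End dae_data.

Lemma cvg_fst_within {R : realType} {U W : topologicalType} (J : set R) (D : set (R * W))
    (g : R -> U) (p : R * W) (l : U) : (forall q, D q -> J q.1) ->
  g s @[s --> within J (nbhs p.1)] --> l -> (fun q => g q.1) @ within D (nbhs p) --> l.
Proof.
move=> DJ H; apply: cvg_comp H => X HX.
have HX' : nbhs p.1 [set s | J s -> X s] := HX.
have : nbhs p [set q | J q.1 -> X q.1] by exact: (cvg_fst HX').
by move=> HX2; have H3 : nbhs p [set q | D q -> X q.1] by apply: filterS HX2 => q + /DJ; exact.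
Qed.

Lemma cvg_one_sub {R : realType} {T : Type} (F : set_system T) {FF : Filter F} {n}
    (X : T -> 'M[R]_n) (M : 'M[R]_n) :
  X @ F --> M -> (fun t => 1%:M - X t) @ F --> 1%:M - M.
Proof. by move=> H; apply: cvgB => //; exact: cvg_cst. Qed.

(** * Convergence of the method for the given equation *)

Section numerical_method.
Context {R : realType} {n : nat}.
Local Notation V := 'cV[R]_n.
Variables (A B : R -> 'M[R]_n) (C1 C2 : R -> R) (f : R -> V -> V) (tp : R).
Hypothesis f_diff : forall t x, tp <= t -> differentiable (f t) x.
Hypothesis dfdx_cont : {within `[tp, +oo[ `*` [set: 'cV[R]_n],
               continuous (fun p : R * 'cV[R]_n => Jac (f p.1) p.2)}.
Hypothesis A_C1 : Ck_time 1 `[tp, +oo[ A.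
Hypothesis B_C1 : Ck_time 1 `[tp, +oo[ B.
Hypothesis C2_C1 : Ck_time 1 `[tp, +oo[ C2.
Hypothesis C2_gt0 : forall t, tp <= t -> 0 < C2 t.
Hypothesis resolvent_bound : forall t (lam : R[i]), tp <= t ->
     real_complex R (C2 t) <= `|lam| ->
     pencil A B t lam \in unitmx /\ opnormC (invmx (pencil A B t lam)) <= C1 t.
Local Notation J := (`[tp, +oo[%classic).
Local Notation A' := (ddt J A).
Local Notation B' := (ddt J B).
Local Notation P := (P1 A B C2).
Local Notation Q := (Q1 A B C2).
Local Notation P' := (ddt J P).
Variables (t0 T : R) (x0 : V).
Hypothesis t0_ge : tp <= t0.
Hypothesis T_gt : t0 < T.
Hypothesis Phi_inv : forall t (z u : V), t0 <= t <= T ->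
  bijective (@Phi R n A B C2 f t (P t *m z) (vsproj (X2 A B C2 t) (P2 A B C2 t *m u))).
Hypothesis A_C3 : Ck_time 3 `[t0, T] A.
Hypothesis B_C3 : Ck_time 3 `[t0, T] B.
Hypothesis f_C2 : Ck_time_space 2 (`[t0, T] `*` [set: V]) f.

Let St := dae_splitting C2_gt0 resolvent_bound.
Let dA := dae_derA A_C1.
Let dB := dae_derB B_C1.
Let cA' := dae_contA' A_C1.
Let cB' := dae_contB' B_C1.
Let cP := dae_contP A_C1 B_C1 C2_C1 C2_gt0 resolvent_bound.
Let P'E := dae_P'E A_C1 B_C1 C2_C1 C2_gt0 resolvent_bound.
Local Notation M := (algebraic_of A B P Q).
Local Notation Dr := (drift_of A B A' P Q P').
Local Notation Fo := (forcing_of A B P Q).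

Let tpt t : t0 <= t <= T -> tp <= t.
Proof. by move=> /andP[? _]; exact: le_trans t0_ge _. Qed.

Let smooth_C3 (g : R -> 'M[R]_n) : Ck_time 3 `[t0, T] g ->
  (forall t, tp <= t -> der J g t (ddt J g t)) -> smooth_on t0 T g /\ smooth_on t0 T (ddt J g).
Proof.
move=> /Ck_time_der[d1 /Ck_time_smooth s1] dg; split.
  apply: (der_smooth (psi := ddt `[t0, T] g)); first exact: smooth_lipschitz.
  by move=> t tI; apply: d1; rewrite /= in_itv.
by apply: smooth_eq s1 => t tI; rewrite (@ddt_segment _ _ tp t0 T _ _ t0_ge T_gt tI)//; exact/dg/tpt.
Qed.

(** The Newton matrix is invertible at every point, and its inverse is continuous in time and space;
    compactness of [t0, T] times a ball gives the uniform bound. *)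
Let S_inv (r : R) : exists2 C, 0 < C & forall t (y : V), t0 <= t <= T -> `|y| <= r ->
  1%:M - M t *m Jac (f t) y *m (1%:M - P t) \in unitmx /\
  `|invmx (1%:M - M t *m Jac (f t) y *m (1%:M - P t))| <= C.
Proof.
have unit t (y : V) : t0 <= t <= T -> 1%:M - M t *m Jac (f t) y *m (1%:M - P t) \in unitmx.
  (* Every y equals P1 y + P2 y, so the hypothesis on [Phi] with z = u = y reaches all points. *)
  move=> tI; have PyX : P2 A B C2 t *m y \in X2 A B C2 t by apply/range_mxP; exists y.
  apply: (newton_unit f_diff C2_gt0 resolvent_bound (tpt tI) _ (Phi_inv y y tI)).
  by rewrite vsprojK// /P2 mulmxBl mul1mx addrC subrK.
pose K : set (R * V) := (`[t0, T] `*` [set y | `|y| <= r])%classic.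
have KJ q : K q -> J q.1 by move=> [q1 _]; exact: (@segment_ray _ tp t0 T t0_ge _ q1).
have compactK : compact K.
  by apply: compact_setX; [exact: segment_compact|exact: compact_ball_mx].
have cS : {within K, continuous (fun q : R * V =>
    invmx (1%:M - M q.1 *m Jac (f q.1) q.2 *m (1%:M - P q.1)))}.
  apply/subspace_continuousP => q Kq; have [qI _] := Kq; rewrite /= in_itv/= in qI.
  apply: (cvg_invmx (unit _ q.2 qI)).
  have cM : (fun p => M p.1) @ within K (nbhs q) --> M q.1.
    by apply: (cvg_fst_within KJ); exact: (cvg_algebraic_of St dA dB cP P'E (tpt qI)).
  have cPq : (fun p => P p.1) @ within K (nbhs q) --> P q.1.
    by apply: (cvg_fst_within KJ); apply: within_cvg => //; exact: KJ.
  have cJ : (fun p : R * V => Jac (f p.1) p.2) @ within K (nbhs q) --> Jac (f q.1) q.2.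
    have KD : K `<=` (J `*` [set: V]) by move=> p Kp; split => //; exact: KJ.
    have /subspace_continuousP H := continuous_subspaceW KD dfdx_cont; exact: (H q Kq).
  exact: cvg_one_sub (cvg_mulmx (cvg_mulmx cM cJ) (cvg_one_sub cPq)).
have [C C0 HC] := compact_continuous_bounded compactK cS.
exists C => // t y tI yr; split; first exact: unit.
by apply: (HC (t, y)); split => //=; rewrite in_itv.
Qed.

Let taylor (r : R) := C2_taylor (fun t x tI => f_diff x (tpt tI)) f_C2 r.

Let state_x N i : (method_state A B C2 f tp t0 T x0 N i).2 =
  P (node t0 T N i) *m (method_state A B C2 f tp t0 T x0 N i).1.1 +
  P2 A B C2 (node t0 T N i) *m (method_state A B C2 f tp t0 T x0 N i).1.2.
Proof.
case: i => [|i] /=; last by case: (method_state _ _ _ _ _ _ _ _ _ i) => [[z u] x].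
have [PP _ _ _ _] := St t0_ge.
rewrite /node mul0r addr0 !mulmxA PP /P2 (split_P2P2 (St t0_ge)).
by rewrite mulmxBl mul1mx addrC subrK.
Qed.

Let euler_alg (D : 'M[R]_n) (z b : V) (k : R) :
  (1%:M + k *: D) *m z + k *: b = z + k *: (D *m z + b).
Proof. by rewrite mulmxDl mul1mx -scalemxAl -addrA -scalerDr. Qed.

Let heun_alg (D : 'M[R]_n) (z a b c : V) (k : R) :
  (1%:M + k *: D) *m z + k *: a + k *: (b + c) = z + k *: ((D *m z + b) + (a + c)).
Proof.
by rewrite mulmxDl mul1mx -scalemxAl -2!addrA -!scalerDr; congr (_ + _ *: _); rewrite addrACA !addrA.
Qed.

Lemma numerical_convergence (x : R -> V) : is_solution A B f `[t0, +oo[ x -> x t0 = x0 ->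
  (fun N : nat => max_error A B C2 f tp t0 T x0 N x) =O_\oo (fun N : nat => mesh t0 T N ^+ 2).
Proof.
move=> [cx Ax_C1 eqx] x_t0.
have dx t : t0 <= t -> der `[t0, +oo[ (fun s => A s *m x s) t (f t (x t) - B t *m x t).
  move=> t0t; have tJ : `[t0, +oo[%classic t by rewrite /= in_itv/= andbT.
  have [/(_ t tJ) d1 _] := Ck_time_der Ax_C1.
  by rewrite -(eqx t tJ) addrK.
have comp := solution_components St dA dB cP P'E t0_ge dx.
have [sA sA'] := smooth_C3 A_C3 dA; have [sB sB'] := smooth_C3 B_C3 dB.
have sub : (`[t0, T] `<=` `[t0, +oo[)%classic by exact: (@segment_ray _ t0 t0 T (lexx t0)).
have PP t : t0 <= t <= T -> P t *m P t = P t by move=> /tpt /St[].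
have xE t : t0 <= t <= T -> x t = P t *m x t + (x t - P t *m x t) by rewrite subrKC.
have uP t : t0 <= t <= T -> (1%:M - P t) *m (x t - P t *m x t) = x t - P t *m x t.
  move=> tI; rewrite mulmxBr mulmxA (split_P2P (St (tpt tI))) mul0mx subr0.
  by rewrite mulmxBl mul1mx.
have uE t : t0 <= t <= T ->
    x t - P t *m x t = M t *m (f t (x t) - A' t *m (P t *m x t)).
  by move=> /andP[/comp[_]].
have dz t : t0 <= t <= T -> der `[t0, T] (fun s => P s *m x s) t
    (Dr t *m (P t *m x t) + Fo t *m f t (x t)).
  by move=> /andP[/comp[+ _] _]; exact: der_subset.
have zP t : t0 <= t <= T -> P t *m (P t *m x t) = P t *m x t.
  by move=> tI; rewrite mulmxA PP.
have [K [h0 [h00 H]]] := second_order_convergence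
  (smooth_algebraic_of St dA dB cA' cB' cP P'E t0_ge sA sB sA' sB') sA'
  (smooth_P St dA dB cA' cB' cP P'E t0_ge sA sB sA' sB')
  (smooth_drift_of St dA dB cA' cB' cP P'E t0_ge sA sB sA' sB')
  (smooth_forcing_of St dA dB cA' cB' cP P'E t0_ge sA sB sA' sB')
  taylor S_inv (continuous_subspaceW sub cx) xE uP uE dz zP T_gt.
(* The factor [n%:R] passes from the max norm to the Euclidean norm; the summand 1 keeps the
   constant positive. *)
apply/eqO_exP; exists (1 + n%:R * `|K|) => //.
near=> N.
have N0 : (0 < N)%N by near: N; exact: nbhs_infty_gt.
have hh0 : mesh t0 T N <= h0.
  rewrite /mesh ler_pdivrMr ?ltr0n// mulrC -ler_pdivrMr//; near: N.
  exact: nbhs_infty_ger.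
pose st := method_state A B C2 f tp t0 T x0 N.
have err i : (i <= N)%N -> `|x (node t0 T N i) - method_x A B C2 f tp t0 T x0 N i|
    <= K * mesh t0 T N ^+ 2.
  rewrite /method_x state_x distrC.
  apply: (H N N0 hh0 (fun i => (st i).1.1) (fun i => (st i).1.2)).
  - by rewrite /st /= x_t0.
  - by rewrite /st /= x_t0 /P2 mulmxBl mul1mx.
  - move=> {}i iN /=; have sx := state_x N i.
    rewrite -/(st i) in sx; rewrite /st /= -/(st i).
    case: (st i) sx => [[z u] y] /= yE; rewrite yE.
    by rewrite heun_alg !euler_alg; split; exact.
have m0 : 0 <= n%:R * `|K| * mesh t0 T N ^+ 2 by rewrite mulr_ge0 ?sqr_ge0// mulr_ge0.
have e0 : 0 <= max_error A B C2 f tp t0 T x0 N x <= n%:R * `|K| * mesh t0 T N ^+ 2.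
  rewrite /max_error big_nat_cond.
  apply: (big_ind (fun v => 0 <= v <= n%:R * `|K| * mesh t0 T N ^+ 2)).
  - by rewrite lexx.
  - by move=> a b /andP[a0 a1] /andP[b0 b1]; rewrite le_max a0 ge_max a1.
  - move=> i /andP[/andP[_ iN] _]; rewrite /enorm sqrtr_ge0/=.
    rewrite (le_trans (enorm_le _))// -mulrA ler_wpM2l//.
    by rewrite (le_trans (err i iN))// ler_wpM2r ?sqr_ge0// ler_norm.
move: e0 => /andP[e0 e1].
rewrite ger0_norm// [`|mesh _ _ _ ^+ 2|]ger0_norm ?sqr_ge0// (le_trans e1)//.
by rewrite ler_wpM2r ?sqr_ge0// lerDr.
Unshelve. all: by end_near. Qed.
End numerical_method.

(** * Solvability of the algebraic part *)

Section basis_invertibility.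
Context {R : realType}.

(* s nonzero orthogonal idempotents in dimension s are the coordinate projectors of a
   basis: take a nonzero vector in the range of each. *)
Lemma resolution_coordinates (Z : vectType R) (s : nat) (Theta : 'I_s -> 'End(Z)) :
  s = \dim {: Z} -> additive_resolution Theta ->
  exists e : s.-tuple Z, forall k y, Theta k y = coord e k y *: e`_k.
Proof.
move=> sdim [nz orth total].
have ex k : exists v, Theta k v != 0.
  apply: contrapT => H; move/eqP: (nz k); apply; apply/lfunP => v; rewrite zero_lfunE.
  by apply/eqP/negPn/negP => v0; apply: H; exists v.
pose v k := projT1 (cid (ex k)).
have v0 k : Theta k (v k) != 0 by rewrite /v; case: cid.
pose e := [tuple Theta k (v k) | k < s].
have eE (k : 'I_s) : e`_k = Theta k (v k) by rewrite -(tnth_nth 0) tnth_mktuple.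
have Te (j k : 'I_s) : Theta j e`_k = if j == k then e`_k else 0.
  rewrite eE -[LHS]comp_lfunE orth; case: ifP => [/eqP->//|_].
  by rewrite zero_lfunE.
have fe : free e.
  apply/freeP => a sum0 k; have := congr1 (Theta k) sum0.
  rewrite linear0 linear_sum (bigD1 k)//= big1 ?addr0 => [|j jk].
    rewrite linearZ/= Te eqxx => /eqP; rewrite scaler_eq0 => /orP[/eqP//|].
    by rewrite eE (negbTE (v0 k)).
  by rewrite linearZ/= Te eq_sym (negbTE jk) scaler0.
have be : basis_of {: Z} e.
  by rewrite basisEfree fe subvf size_tuple sdim leqnn.
exists e => k y; rewrite {1}(coord_basis be (memvf y)) linear_sum (bigD1 k)//= big1.
  by rewrite addr0 linearZ/= Te eqxx.
by move=> j jk; rewrite linearZ/= Te eq_sym (negbTE jk) scaler0.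
Qed.

Lemma der_linear {n : nat} (l : {linear 'cV[R]_n -> R}) (J : set R) (g : R -> 'cV[R]_n) t d :
  der J g t d -> der J (fun s => l (g s)) t (l d).
Proof.
move=> dg; pose r : 'rV[R]_n := \row_i l (delta_mx i 0).
have lE w : l w = (r *m w) 0 0.
  rewrite mxE [in LHS](_ : w = \sum_i w i 0 *: (delta_mx i 0 : 'cV[R]_n)).
    by rewrite linear_sum; apply: eq_bigr => i _; rewrite linearZ/= mxE mulrC.
  apply/matrixP => i j; rewrite (ord1 j) summxE (bigD1 i)//= big1 ?addr0 => [|k ki].
    by rewrite !mxE !eqxx mulr1.
  by rewrite !mxE eq_sym (negbTE ki) mulr0.
have := der_entry 0 0 (der_mulmx (der_cst J t r) dg).
rewrite mul0mx add0r -lE; congr (der _ _ _ _); apply/funext => s.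
by rewrite lE.
Qed.

End basis_invertibility.

Section consistency.
Context {R : realType} {n : nat}.
Local Notation V := 'cV[R]_n.

(** Since G is invertible and G^-1 Q2 B = P2, multiplication by G^-1 solves the consistency
    condition for P2 x. *)
Lemma consistency_iff (A B P Q A' : 'M[R]_n) (x y : V) : splitting A B P Q ->
  (1%:M - Q) *m (A' *m P *m x + B *m x - y) = 0 <->
  (1%:M - P) *m x = invmx (A + B *m (1%:M - P)) *m (1%:M - Q) *m (y - A' *m (P *m x)).
Proof.
move=> S; set Gi := invmx _; have Gu : A + B *m (1%:M - P) \in unitmx by case: S.
have E : Gi *m ((1%:M - Q) *m (A' *m P *m x + B *m x - y)) =
    (1%:M - P) *m x - Gi *m (1%:M - Q) *m (y - A' *m (P *m x)).
  have -> : (1%:M - P) *m x = Gi *m (1%:M - Q) *m B *m x by rewrite (split_GiQ2B S).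
  rewrite -!mulmxA -!mulmxBr; congr (_ *m (_ *m _)).
  by rewrite opprB [RHS]addrCA addrA.
split=> [H|H]; first by apply/eqP; rewrite -subr_eq0 -E H mulmx0.
by rewrite -[LHS](mulKVmx Gu) -/Gi E H subrr mulmx0.
Qed.

Lemma restricted_apply (X Jf B P2 : 'M[R]_n) (v : V) : P2 *m v = v ->
  (X *m Jf - B) *m P2 *m v = X *m (Jf *m v) - B *m v.
Proof. by move=> Pv; rewrite -[LHS]mulmxA Pv mulmxBl mulmxA. Qed.

End consistency.

(** * Unique solvability of the algebraic equation under either form of the first condition *)

Section roots.
Context {R : realType} {n : nat}.
Local Notation V := 'cV[R]_n.
Variables (A B : R -> 'M[R]_n) (C1 C2 : R -> R) (f : R -> V -> V) (tp : R).
Hypothesis f_diff : forall t x, tp <= t -> differentiable (f t) x.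
Hypothesis C2_gt0 : forall t, tp <= t -> 0 < C2 t.
Hypothesis resolvent_bound : forall t (lam : R[i]), tp <= t ->
     real_complex R (C2 t) <= `|lam| ->
     pencil A B t lam \in unitmx /\ opnormC (invmx (pencil A B t lam)) <= C1 t.
Local Notation J := (`[tp, +oo[%classic).
Local Notation A' := (ddt J A).
Local Notation P := (P1 A B C2).
Local Notation Q := (Q1 A B C2).
Local Notation M := (algebraic_of A B P Q).
Local Notation L := (consistency_manifold A B C2 f tp).
Local Notation X1 := (X1 A B C2).
Local Notation X2 := (X2 A B C2).

Let St := dae_splitting C2_gt0 resolvent_bound.

Lemma mem_X1 t v : tp <= t -> (v \in X1 t) = (P t *m v == v).
Proof. by move=> /St[PP _ _ _ _]; exact: range_projP. Qed.

Lemma mem_X2 t v : tp <= t -> (v \in X2 t) = ((1%:M - P t) *m v == v).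
Proof. by move=> /St S; apply: range_projP; exact: split_P2P2 S. Qed.

Lemma consistencyP t x : tp <= t -> L (t, x) <->
  (1%:M - P t) *m x = M t *m (f t x - A' t *m (P t *m x)).
Proof.
move=> tt; rewrite /consistency_manifold/=; have := consistency_iff (A' t) x (f t x) (St tt).
by move=> [H1 H2]; split=> [[_ /H1]|/H2].
Qed.

(* Rolle's theorem in each coordinate of the resolution. *)
Lemma basis_invertible_unique t xp1 (x1 x2 : subvs_of (X2 t)) : tp <= t -> P t *m xp1 = xp1 ->
  L (t, xp1 + vsval x1) -> L (t, xp1 + vsval x2) ->
  basis_invertible (Phi (A := A) (B := B) (C2 := C2) f xp1) (segment x1 x2) -> x1 = x2.
Proof.
move=> tt Px L1 L2 [Th [res bij]].
have [e eE] := resolution_coordinates erefl res.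
have S := St tt.
pose Q2 := 1%:M - Q t; pose d : V := vsval x2 - vsval x1.
pose y s := s *: d + (xp1 + vsval x1).
pose psi s := Q2 *m f t (y s) - B t *m (y s).
(* At a consistent point Q2 f - B x is determined by the component [xp1] alone, so [psi] takes the
   same value at both ends of the segment. *)
have zero w : P t *m w = xp1 -> L (t, w) ->
    Q2 *m f t w - B t *m w = Q2 *m (A' t *m xp1) - B t *m xp1.
  move=> Pw [_] /=; rewrite -/Q2 => /eqP; rewrite mulmxBr subr_eq0 => /eqP <-.
  rewrite mulmxDr -mulmxA Pw -addrA; congr (_ + _).
  rewrite mulmxA -(split_BP2 S) -mulmxA mulmxBl mul1mx Pw mulmxBr.
  by rewrite addrAC subrr add0r.
have P2x (w : subvs_of (X2 t)) : (1%:M - P t) *m vsval w = vsval w.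
  by apply/eqP; rewrite -mem_X2//; exact: subvsP.
have Pw (w : subvs_of (X2 t)) : P t *m (xp1 + vsval w) = xp1.
  by rewrite mulmxDr Px -[vsval w]P2x mulmxA (split_PP2 S) mul0mx addr0.
have dpsi s : der `[0, 1] psi s (Q2 *m (Jac (f t) (y s) *m d) - B t *m d).
  have dy : der `[0, 1] y s d.
    have := derD (der_scale (der_id `[0, 1] s) (der_cst `[0, 1] s d)) (der_cst `[0, 1] s (xp1 + vsval x1)).
    by rewrite scaler0 !addr0 scale1r.
  have df := @der_along _ _ (f t) (xp1 + vsval x1) d `[0, 1] s (f_diff _ tt).
  have := derB (der_mulmx (der_cst `[0, 1] s Q2) df) (der_mulmx (der_cst `[0, 1] s (B t)) dy).
  by rewrite !mul0mx !add0r.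
have y0 : y 0 = xp1 + vsval x1 by rewrite /y scale0r add0r.
have y1 : y 1 = xp1 + vsval x2 by rewrite /y scale1r /d addrCA subrK.
have psi01 : psi 1 = psi 0 by rewrite /psi y0 y1 !zero.
(* Each coordinate has its own intermediate point. This is why one needs invertibility of the sum
   with a separate argument [w k] in each summand. *)
have mid (k : 'I_(\dim {: subvs_of (Y2 A B C2 t)})) : exists c, 0 <= c <= 1 /\
    coord e k (vsproj (Y2 A B C2 t) (Q2 *m (Jac (f t) (y c) *m d) - B t *m d)) = 0.
  pose l : {linear V -> R} := (coord e k \o vsproj (Y2 A B C2 t)).
  have dl s := der_linear l (dpsi s).
  have cl := der_continuous (fun (s : R) (_ : `[0, 1]%classic s) => dl s).
  have [c /andP[c0 c1]] := MVT_der ltr01 (fun s _ => dl s) cl.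
  rewrite psi01 subrr subr0 mulr1 => /esym lc; exists c; split => //.
  by rewrite !ltW.
pose c k := projT1 (cid (mid k)).
have ck k : 0 <= c k <= 1 by exact: (projT2 (cid (mid k))).1.
pose w k := (1 - c k) *: x1 + c k *: x2.
have wJ k : segment x1 x2 (w k).
  have cI : `[0, 1]%classic (c k) by rewrite /= in_itv; exact: ck.
  exists (c k); first exact: cI.
  exact: erefl.
have yw k : y (c k) = xp1 + vsval (w k).
  have -> : vsval (w k) = (1 - c k) *: vsval x1 + c k *: vsval x2.
    by rewrite /w linearP linearZ.
  rewrite /y /d.
  by apply/matrixP => i j; rewrite !mxE; ring.
have kill k : Th k (Phi (A := A) (B := B) (C2 := C2) f xp1 (w k) (x2 - x1)) = 0.
  rewrite eE; have -> : coord e k (Phi (A := A) (B := B) (C2 := C2) f xp1 (w k) (x2 - x1)) = 0.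
    rewrite -[Phi _ _ _ _]vsvalK /Phi Jac_mulmx; last exact: f_diff.
    rewrite restrict_mxE; last exact: (@restricted_in_Y2 _ _ _ _ _ _ (Jac (f t) (xp1 + vsval (w k))) S (vsval (x2 - x1))).
    have <- := (projT2 (cid (mid k))).2; rewrite -/(c k) yw.
    have -> : vsval (x2 - x1) = d by rewrite /d linearB.
    congr (coord e k (vsproj _ _)).
    have Pd : P2 A B C2 t *m d = d by rewrite /P2 mulmxBr !P2x.
    exact: (restricted_apply _ _ _ Pd).
  by rewrite scale0r.
have [g gK _] := bij w wJ.
apply/eqP; rewrite eq_sym -subr_eq0; apply/eqP; apply: (can_inj gK).
apply: (etrans _ (esym (linear0 _))).
rewrite sum_lfunE; apply: big1 => k _.
apply: (etrans (comp_lfunE _ _ _)); exact: kill.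
Qed.

(** Posed for arbitrary z and u in R^n, with the projections built in, so that the solution map is
    defined on a full space; the equation itself forces u into X2. *)
Definition algebraic_root t (z u : V) :=
  u = M t *m (f t (P t *m z + (1%:M - P t) *m u) - A' t *m (P t *m z)).

(** On a degenerate segment all arguments coincide and the projectors add up to the identity, so the
    second form of the condition yields the invertibility required in the first. *)
Lemma basis_invertible_bijective t xp1 (x1 : subvs_of (X2 t)) :
  basis_invertible (Phi (A := A) (B := B) (C2 := C2) f xp1) (segment x1 x1) ->
  bijective (Phi (A := A) (B := B) (C2 := C2) f xp1 x1).
Proof.
move=> [Th [[_ _ tot] bij]].
have x1J : segment x1 x1 x1.
  by exists 0; rewrite /= ?in_itv/= ?lexx ?ler01// subr0 scale1r scale0r addr0.
apply: (eq_bij (bij (fun=> x1) (fun=> x1J))) => y.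
apply: (etrans (sum_lfunE _ _ _ _)).
apply: (etrans (eq_bigr _ (fun k _ => comp_lfunE _ _ y))).
apply: (etrans (esym (sum_lfunE _ _ _ _))).
apply: (etrans (congr1 (fun h : 'End(_) => h _) tot)); exact: id_lfunE.
Qed.

Hypothesis cond1 :
    ((forall t xp1, tp <= t -> xp1 \in X1 t ->
        exists! xp2, xp2 \in X2 t /\ L (t, xp1 + xp2))
     /\
     (forall t xp1 (xp2 : subvs_of (X2 t)), tp <= t -> xp1 \in X1 t ->
        L (t, xp1 + vsval xp2) ->
        bijective (Phi (A := A) (B := B) (C2 := C2) f xp1 xp2)))
    \/
    ((forall t xp1, tp <= t -> xp1 \in X1 t ->
        exists xp2, xp2 \in X2 t /\ L (t, xp1 + xp2))
     /\
     (forall t xp1 (x1 x2 : subvs_of (X2 t)), tp <= t -> xp1 \in X1 t ->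
        L (t, xp1 + vsval x1) -> L (t, xp1 + vsval x2) ->
        basis_invertible (Phi (A := A) (B := B) (C2 := C2) f xp1) (segment x1 x2))).

(** All that the sequel uses of the first condition; after this point its two forms need not be
    distinguished. *)
Lemma algebraic_rootP t z : tp <= t ->
  [/\ exists u, algebraic_root t z u,
      forall u u', algebraic_root t z u -> algebraic_root t z u' -> u = u',
      forall u, algebraic_root t z u -> (1%:M - P t) *m u = u,
      forall u, algebraic_root t z u -> L (t, P t *m z + u) &
      forall u, algebraic_root t z u ->
        1%:M - M t *m Jac (f t) (P t *m z + (1%:M - P t) *m u) *m (1%:M - P t) \in unitmx].
Proof.
move=> tt; have S := St tt; have [PP _ _ _ _] := S.
have rootX u : algebraic_root t z u -> (1%:M - P t) *m u = u.
  rewrite /algebraic_root => ->; rewrite [LHS]mulmxA [in LHS]/algebraic_of [in LHS]mulmxA.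
  by rewrite (split_P2Gi S) -(mulmxA (invmx _)) (split_Q2Q2 S).
have PP2 u : (1%:M - P t) *m u = u -> P t *m u = 0.
  by move=> <-; rewrite mulmxA (split_PP2 S) mul0mx.
have rootL u : (1%:M - P t) *m u = u -> L (t, P t *m z + u) <-> algebraic_root t z u.
  move=> Pu; apply: (iff_trans (consistencyP _ tt)).
  rewrite /algebraic_root Pu !mulmxDr Pu (PP2 _ _ Pu) mulmx0 addr0 (mulmxA (P t)) PP.
  by rewrite (mulmxA _ (P t) z) (split_P2P S) mul0mx add0r.
have zX : P t *m z \in X1 t by rewrite mem_X1// mulmxA PP.
have lift u : (1%:M - P t) *m u = u -> exists w : subvs_of (X2 t), vsval w = u.
  by move=> Pu; exists (vsproj (X2 t) u); rewrite vsprojK// mem_X2// Pu.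
split=> //; last 2 first.
- by move=> u ru; apply/rootL => //; exact: rootX.
- move=> u ru; have [w wu] := lift u (rootX u ru).
  apply: (newton_unit f_diff C2_gt0 resolvent_bound tt (y := P t *m z) (v := w)).
    by rewrite wu rootX.
  have Lw : L (t, P t *m z + vsval w) by rewrite wu; apply/rootL => //; exact: rootX.
  case: cond1 => [[_ H]|[_ H]]; first exact: H.
  by apply: basis_invertible_bijective; exact: H.
- case: cond1 => [[H _]|[H _]].
    have [u [[uX Lu] _]] := H t _ tt zX; exists u.
    by apply/rootL => //; apply/eqP; rewrite -mem_X2.
  have [u [uX Lu]] := H t _ tt zX; exists u.
  by apply/rootL => //; apply/eqP; rewrite -mem_X2.
- move=> u u' ru ru'.
  have Lu : L (t, P t *m z + u) by apply/rootL => //; exact: rootX.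
  have Lu' : L (t, P t *m z + u') by apply/rootL => //; exact: rootX.
  case: cond1 => [[H _]|[_ H]].
    have [v [_ vu]] := H t _ tt zX.
    by rewrite -(vu u) ?(vu u')//; split; rewrite ?mem_X2 ?rootX.
  have [w wu] := lift u (rootX u ru); have [w' wu'] := lift u' (rootX u' ru').
  rewrite -wu -wu'; congr vsval; rewrite -wu in Lu; rewrite -wu' in Lu'.
  apply: (basis_invertible_unique tt _ Lu Lu'); first by rewrite mulmxA PP.
  exact: H.
Qed.

End roots.

Lemma cvg_within_comp {X Y Z : topologicalType} (D : set X) (E : set Y) (phi : X -> Y)
    (h : Y -> Z) (x : X) (l : Z) : (forall x', D x' -> E (phi x')) ->
  phi @ within D (nbhs x) --> phi x -> h @ within E (nbhs (phi x)) --> l ->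
  (fun x' => h (phi x')) @ within D (nbhs x) --> l.
Proof.
move=> DE cphi ch U HU; have HE : nbhs (phi x) [set y | E y -> U (h y)] := ch U HU.
have HD : nbhs x [set x' | D x' -> E (phi x') -> U (h (phi x'))] := cphi _ HE.
have : nbhs x [set x' | D x' -> U (h (phi x'))].
  by apply: filterS HD => x' H Dx'; apply: H => //; exact: DE.
exact.
Qed.

Lemma cvg_at_within {X Y : topologicalType} (D : set X) (g : X -> Y) (x : X) :
  g @ nbhs x --> g x -> g @ within D (nbhs x) --> g x.
Proof.
move=> H U HU; have : nbhs x [set x' | D x' -> U (g x')].
  have H' : nbhs x [set x' | U (g x')] := H U HU.
  by apply: (@filterS _ (nbhs x) _ _ _ _ H') => x' Ux' _.
by move=> HD; exact: HD.
Qed.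

Lemma cvg_triple {R : numFieldType} {X Y Z : pseudoMetricType R} (q : (X * Y) * Z) :
  [/\ (fun q' : (X * Y) * Z => q'.1.1) @ nbhs q --> q.1.1,
      (fun q' : (X * Y) * Z => q'.1.2) @ nbhs q --> q.1.2 &
      (fun q' : (X * Y) * Z => q'.2) @ nbhs q --> q.2].
Proof.
by split=> U /nbhs_ballP[e e0 He]; apply/nbhs_ballP; exists e => // q' [[? ?] ?]; apply: He.
Qed.

Lemma half_fraction_le {R : realFieldType} (w r : R) : 0 <= w -> 0 <= r ->
  w * (r / (2 * (w + 1))) <= r / 2.
Proof.
move=> w0 r0; have w1 : 0 < w + 1 by rewrite ltr_wpDl.
have -> : w * (r / (2 * (w + 1))) = (r / 2) * (w / (w + 1)) by field; rewrite gt_eqF.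
by rewrite -[leRHS]mulr1 ler_wpM2l ?divr_ge0// ler_pdivrMr// mul1r lerDl.
Qed.

Lemma convex_lt {R : realFieldType} (s a b r : R) : 0 <= s <= 1 -> a < r -> b < r ->
  s * a + (1 - s) * b < r.
Proof.
move=> /andP[s0 s1] ar br; pose m := Num.max a b.
have am : a <= m by rewrite le_max lexx.
have bm : b <= m by rewrite le_max lexx orbT.
have mr : m < r by rewrite gt_max ar br.
have h1 := ler_wpM2l s0 am.
have s1' : 0 <= 1 - s by rewrite subr_ge0.
have h2 := ler_wpM2l s1' bm.
by clearbody m; move: h1 h2 mr; clear; lra.
Qed.

Lemma segment_norm_le {R : realType} {V : normedModType R} (x y : V) (s r : R) :
  0 <= s <= 1 -> `|x| <= r -> `|y| <= r -> `|s *: (x - y) + y| <= r.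
Proof.
move=> /andP[s0 s1] xr yr.
have -> : s *: (x - y) + y = s *: x + (1 - s) *: y.
  by rewrite scalerBr scalerBl scale1r addrAC -addrA.
have s1' : 0 <= 1 - s by rewrite subr_ge0.
rewrite (le_trans (ler_normD _ _))// !normrZ (ger0_norm s0) (ger0_norm s1').
have h1 := ler_wpM2l s0 xr; have h2 := ler_wpM2l s1' yr.
by move: h1 h2; clear; lra.
Qed.

Lemma norm_ball {R : realType} {V : normedModType R} (x y : V) (e : R) : `|y - x| < e -> ball x e y.
Proof. by rewrite -ball_normE /ball_/= distrC. Qed.

Lemma within_dist_le {X : topologicalType} {R : realType} {V : normedModType R} (D : set X)
    (g : X -> V) (x : X) (l : V) (e : R) : g @ within D (nbhs x) --> l -> 0 < e ->
  nbhs x [set x' | D x' -> `|g x' - l| <= e].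
Proof.
move=> /cvgrPdist_le /(_ e) H e0; have {H} H := H e0.
have {}H : nbhs x [set x' | D x' -> `|l - g x'| <= e] := H.
by apply: filterS H => x' H Dx'; rewrite distrC H.
Qed.

Lemma bounded_near {X : topologicalType} {R : realType} {V : normedModType R} (D : set X)
    (g : X -> V) (x : X) (l : V) : g @ within D (nbhs x) --> l ->
  nbhs x [set x' | D x' -> `|g x'| <= `|l| + 1].
Proof.
move=> H; have := within_dist_le H ltr01; apply: filterS => x' + Dx' => /(_ Dx') H'.
by rewrite -(subrK l (g x')) addrC (le_trans (ler_normD _ _))// lerD2l.
Qed.

Lemma cvg_add {R : realType} {V : normedModType R} {T : Type} (F : set_system T) {FF : Filter F}
    (X Y : T -> V) (x y : V) :
  X @ F --> x -> Y @ F --> y -> (fun t => X t + Y t) @ F --> x + y.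
Proof. exact: cvgD. Qed.

Lemma cvg_sub {R : realType} {V : normedModType R} {T : Type} (F : set_system T) {FF : Filter F}
    (X Y : T -> V) (x y : V) :
  X @ F --> x -> Y @ F --> y -> (fun t => X t - Y t) @ F --> x - y.
Proof. exact: cvgB. Qed.

(** * Continuity and local Lipschitz dependence of the algebraic component *)

Section implicit_function.
Context {R : realType} {n : nat}.
Local Notation V := 'cV[R]_n.
Variables (tp : R) (M A' P : R -> 'M[R]_n) (f : R -> V -> V).
Local Notation J := (`[tp, +oo[%classic).
Hypothesis cM : forall t, tp <= t -> M s @[s --> within J (nbhs t)] --> M t.
Hypothesis cA' : forall t, tp <= t -> A' s @[s --> within J (nbhs t)] --> A' t.
Hypothesis cP : forall t, tp <= t -> P s @[s --> within J (nbhs t)] --> P t.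
Hypothesis f_cont : {within J `*` [set: V], continuous (fun p : R * V => f p.1 p.2)}.
Hypothesis f_diff : forall t x, tp <= t -> differentiable (f t) x.
Hypothesis dfdx_cont : {within J `*` [set: V], continuous (fun p : R * V => Jac (f p.1) p.2)}.
Let P2 t := 1%:M - P t.
Let arg t (z u : V) := P t *m z + P2 t *m u.
Let F t (z u : V) := u - M t *m (f t (arg t z u) - A' t *m (P t *m z)).
Variable eta : R -> V -> V.
Hypothesis eta_root : forall t z, tp <= t -> F t z (eta t z) = 0.
Hypothesis eta_unique : forall t z u, tp <= t -> F t z u = 0 -> u = eta t z.
Hypothesis S_unit : forall t z, tp <= t ->
  1%:M - M t *m Jac (f t) (arg t z (eta t z)) *m P2 t \in unitmx.

Let Q := ((R * V) * V)%type.
Let DQ : set Q := [set q | tp <= q.1.1].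

Let cvg_time (g : R -> 'M[R]_n) (q : Q) : g s @[s --> within J (nbhs q.1.1)] --> g q.1.1 ->
  (fun q' : Q => g q'.1.1) @ within DQ (nbhs q) --> g q.1.1.
Proof.
move=> H; apply: (@cvg_within_comp _ _ _ DQ J (fun q' : Q => q'.1.1) g q _ _ _ H).
  by move=> q'; rewrite /DQ/= in_itv/= andbT.
by apply: cvg_at_within; case: (cvg_triple q).
Qed.

Let cvg_z (q : Q) : (fun q' : Q => q'.1.2) @ within DQ (nbhs q) --> q.1.2.
Proof. by apply: cvg_at_within; case: (cvg_triple q). Qed.

Let cvg_u (q : Q) : (fun q' : Q => q'.2) @ within DQ (nbhs q) --> q.2.
Proof. by apply: cvg_at_within; case: (cvg_triple q). Qed.

Let cvg_arg (q : Q) : DQ q ->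
  (fun q' : Q => arg q'.1.1 q'.1.2 q'.2) @ within DQ (nbhs q) --> arg q.1.1 q.1.2 q.2.
Proof.
move=> Dq; have c1 := cvg_time (cP Dq).
exact: (cvg_add (cvg_mulmx c1 (@cvg_z q)) (cvg_mulmx (cvg_one_sub c1) (@cvg_u q))).
Qed.

Let cvg_along {U : topologicalType} (h : R * V -> U) (q : Q) : DQ q ->
  {within J `*` [set: V], continuous h} ->
  (fun q' : Q => h (q'.1.1, arg q'.1.1 q'.1.2 q'.2)) @ within DQ (nbhs q) -->
    h (q.1.1, arg q.1.1 q.1.2 q.2).
Proof.
move=> Dq ch; apply: (@cvg_within_comp _ _ _ DQ (J `*` [set: V])
  (fun q' : Q => (q'.1.1, arg q'.1.1 q'.1.2 q'.2)) h q).
- by move=> q' Dq'; split => //; rewrite /= in_itv/= andbT.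
- apply: cvg_pairl; last exact: cvg_arg.
  by apply: cvg_at_within; case: (cvg_triple q).
- move/subspace_continuousP: ch; apply; split => //.
  by rewrite /= in_itv/= andbT.
Qed.

Let cvg_F (q : Q) : DQ q ->
  (fun q' : Q => F q'.1.1 q'.1.2 q'.2) @ within DQ (nbhs q) --> F q.1.1 q.1.2 q.2.
Proof.
move=> Dq; exact: (cvg_sub (@cvg_u q) (cvg_mulmx (cvg_time (cM Dq))
  (cvg_sub (cvg_along Dq f_cont) (cvg_mulmx (cvg_time (cA' Dq))
    (cvg_mulmx (cvg_time (cP Dq)) (@cvg_z q)))))).
Qed.

(** Newton's map with the derivative frozen at the centre, u |-> u - S0^-1 F(t, z, u), is a
    half-contraction near (t0, z0, u0). Its fixed point is a root, and global uniqueness of roots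
    identifies it with [eta], which was only chosen pointwise; hence [eta] is continuous there. *)
Lemma eta_local t0 z0 : tp <= t0 -> exists K d, [/\ 0 <= K, 0 < d,
    forall r, 0 < r -> exists2 d', 0 < d' & forall t z, tp <= t -> `|t - t0| < d' ->
      `|z - z0| < d' -> `|eta t z - eta t0 z0| <= r &
    forall t z z', tp <= t -> `|t - t0| < d -> `|z - z0| < d -> `|z' - z0| < d ->
      `|eta t z - eta t z'| <= K * `|z - z'|].
Proof.
move=> tt0; set u0 := eta t0 z0; pose q0 : Q := (t0, z0, u0).
have Dq0 : DQ q0 by [].
pose J0 := Jac (f t0) (arg t0 z0 u0); pose S0 := 1%:M - M t0 *m J0 *m P2 t0.
have S0u : S0 \in unitmx by exact: S_unit.
pose m := `|M t0| + 1; pose p := `|P2 t0| + 1; pose p1 := `|P t0| + 1; pose a := `|A' t0| + 1.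
pose si := `|invmx S0|; pose N : R := n%:R.
pose k0_ := N * si * (N * m * (N * p * N) + N).
have [m0 pp0 p10 a0] : [/\ 0 <= m, 0 <= p, 0 <= p1 & 0 <= a].
  by split; rewrite addr_ge0.
have N0 : 0 <= N by rewrite /N.
have si0 : 0 <= si by exact: normr_ge0.
have [k0 k0E k00] : exists2 k0, k0 = k0_ & 0 <= k0.
  exists k0_ => //.
  by apply: mulr_ge0; [exact: mulr_ge0|apply: addr_ge0 => //; apply: mulr_ge0; [exact: mulr_ge0|apply: mulr_ge0 => //; exact: mulr_ge0]].
(* The contraction factor found below is k0 e, where e bounds the variation of the Jacobian and of M
   J0 P2; this choice makes it at most 1/2. *)
pose e := (2 * (k0 + 1))^-1.
have k1 : 0 < k0 + 1 by move: k00; lra.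
have e0 : 0 < e by rewrite invr_gt0; exact: mulr_gt0.
have k0e : k0 * e <= 2^-1.
  rewrite /e invfM mulrCA -[leRHS]mulr1 ler_wpM2l// ler_pdivrMr// mul1r lerDl//.
clearbody e.
have cM0 := @cvg_time M q0 (cM tt0); have cP0 := @cvg_time P q0 (cP tt0).
have cA0 := @cvg_time A' q0 (cA' tt0).
have cMJ : (fun q : Q => M q.1.1 *m J0 *m P2 q.1.1) @ within DQ (nbhs q0) -->
    M t0 *m J0 *m P2 t0.
  exact: (cvg_mulmx (cvg_mulmx cM0 (cvg_cst J0)) (cvg_one_sub cP0)).
have cP20 : (fun q : Q => P2 q.1.1) @ within DQ (nbhs q0) --> P2 t0.
  exact: (cvg_one_sub cP0).
have near1 : nbhs q0 [set q : Q | DQ q -> [/\ `|Jac (f q.1.1) (arg q.1.1 q.1.2 q.2) - J0| <= e,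
   `|M q.1.1 *m J0 *m P2 q.1.1 - M t0 *m J0 *m P2 t0| <= e,
   `|M q.1.1| <= m & [/\ `|P2 q.1.1| <= p, `|P q.1.1| <= p1 & `|A' q.1.1| <= a]]].
  have H1 := within_dist_le (cvg_along Dq0 dfdx_cont) e0.
  have H2 := within_dist_le cMJ e0.
  have H3 := bounded_near cM0.
  have H4 := bounded_near cP20.
  have H5 := bounded_near cP0.
  have H6 := bounded_near cA0.
  have FF : Filter (nbhs q0) := nbhs_filter q0.
  have H := @filterI _ _ FF _ _ (@filterI _ _ FF _ _ H1 H2)
    (@filterI _ _ FF _ _ (@filterI _ _ FF _ _ H3 H4) (@filterI _ _ FF _ _ H5 H6)).
  apply: (@filterS _ _ FF _ _ _ H) => q [[h1 h2] [[h3 h4] [h5 h6]]] Dq.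
  split; [exact: h1|exact: h2|exact: h3|split; [exact: h4|exact: h5|exact: h6]].
have [d /= d0 Hd] := (@nbhs_ballP _ _ _ _).1 near1.
have in_ball (t : R) (z u : V) : `|t - t0| < d -> `|z - z0| < d -> `|u - u0| < d ->
    ball q0 d ((t, z), u).
  by move=> ht hz hu; split; [split|]; apply: norm_ball.
have conv (x y c : V) (s r : R) : 0 <= s <= 1 -> `|x - c| < r -> `|y - c| < r ->
    `|s *: (x - y) + y - c| < r.
  move=> /andP[s0 s1] hx hy.
  have -> : s *: (x - y) + y - c = s *: (x - c) + (1 - s) *: (y - c).
    by apply/matrixP => i j; rewrite !mxE; ring.
  rewrite (le_lt_trans (ler_normD _ _))// !normrZ (ger0_norm s0) ger0_norm ?subr_ge0//.
  by apply: convex_lt; rewrite ?s0.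
have F_diff t (z u v : V) : tp <= t -> `|t - t0| < d -> `|z - z0| < d -> `|u - u0| < d ->
    `|v - u0| < d -> `|S0 *m (u - v) - (F t z u - F t z v)| <= e * (N * m * (N * p * N) + N) * `|u - v|.
  move=> tt ht hz hu hv.
  have JM := @jacobian_mean_value _ _ (f t) J0 (arg t z u) (arg t z v) e (fun w => f_diff w tt).
  have argB : arg t z u - arg t z v = P2 t *m (u - v).
    by rewrite /arg mulmxBr opprD addrACA subrr add0r.
  have {}JM : `|f t (arg t z u) - f t (arg t z v) - J0 *m (P2 t *m (u - v))| <=
      N * e * `|P2 t *m (u - v)|.
    rewrite -argB; apply: JM => s sI.
    have -> : s *: (arg t z u - arg t z v) + arg t z v = arg t z (s *: (u - v) + v).
      by rewrite argB /arg (mulmxDr (P2 t) (s *: (u - v))) -scalemxAr addrCA.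
    have [h _ _ _] := Hd _ (in_ball t z (s *: (u - v) + v) ht hz (conv _ _ _ _ _ sI hu hv)) tt.
    exact: h.
  have [_ MJb Mb [P2b _ _]] := Hd _ (in_ball t z u ht hz hu) tt.
  have -> : S0 *m (u - v) - (F t z u - F t z v) =
      M t *m (f t (arg t z u) - f t (arg t z v) - J0 *m (P2 t *m (u - v)))
      + (M t *m J0 *m P2 t - M t0 *m J0 *m P2 t0) *m (u - v).
    rewrite /F /S0 mulmxBl mul1mx (mulmxBl (M t *m J0 *m P2 t)) -!mulmxA.
    rewrite (mulmxBr (M t) (_ - _)) !(mulmxBr (M t)).
    set a1 := M t *m f t _; set a2 := M t *m f t _; set a3 := M t *m (A' t *m _).
    set a4 := M t *m (J0 *m _); set a5 := M t0 *m _.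
    by move: a1 a2 a3 a4 a5 => *; apply/matrixP => i j; rewrite !mxE; ring.
  rewrite (le_trans (ler_normD _ _))// mulrDr mulrDl lerD//; last first.
    by rewrite (le_trans (mulmx_le MJb (lexx _)))// [e * N]mulrC.
  have h1 := mulmx_le P2b (lexx `|u - v|).
  have h2 := le_trans JM (ler_wpM2l (mulr_ge0 N0 (ltW e0)) h1).
  rewrite (le_trans (mulmx_le Mb h2))// -/N -/p le_eqVlt; apply/orP; left; apply/eqP; ring.
have contr t (z u v : V) : tp <= t -> `|t - t0| < d -> `|z - z0| < d -> `|u - u0| < d ->
    `|v - u0| < d ->
    `|(u - invmx S0 *m F t z u) - (v - invmx S0 *m F t z v)| <= 2^-1 * `|u - v|.
  move=> tt ht hz hu hv.
  have -> : (u - invmx S0 *m F t z u) - (v - invmx S0 *m F t z v) =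
      invmx S0 *m (S0 *m (u - v) - (F t z u - F t z v)).
    move: (F t z u) (F t z v) => Fu Fv.
    rewrite (mulmxBr (invmx S0) (S0 *m _)) mulKmx// (mulmxBr (invmx S0) Fu).
    by move: (invmx S0 *m Fu) (invmx S0 *m Fv) => *; apply/matrixP => i j; rewrite !mxE; ring.
  rewrite (le_trans (mulmx_le (lexx _) (F_diff t z u v tt ht hz hu hv)))//.
  rewrite -/si -/N !mulrA ler_wpM2r// (le_trans _ k0e)// k0E /k0_.
  rewrite le_eqVlt; apply/orP; left; apply/eqP; ring.
pose d2 := d / 2.
have d20 : 0 < d2 by rewrite divr_gt0.
have d2d : d2 < d by rewrite /d2 ltr_pdivrMr// ltr_pMr// ltr1n.
have close r : 0 < r -> r <= d2 -> exists2 d', 0 < d' & forall t z, tp <= t ->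
    `|t - t0| < d' -> `|z - z0| < d' -> `|eta t z - u0| <= r.
  move=> r0 rd2; have F00 : F t0 z0 u0 = 0 by exact: eta_root.
  (* With this bound on F(t, z, u0) the first step S0^-1 F(t, z, u0) is at most r / 2, as the fixed
     point lemma demands. *)
  pose e2 := r / (2 * (N * si + 1)).
  have s1 : 0 < N * si + 1 by have := mulr_ge0 N0 si0; lra.
  have e20 : 0 < e2 by apply: divr_gt0 => //; exact: mulr_gt0.
  have := within_dist_le (@cvg_F q0 Dq0) e20.
  move=> /(@nbhs_ballP _ _ _ _)[d3 /= d30 Hd3].
  exists (Num.min d d3); first by rewrite lt_min d0.
  move=> t z tt; rewrite !lt_min => /andP[ht ht3] /andP[hz hz3].
  have Fb : `|F t z u0| <= e2.
    have B : ball q0 d3 ((t, z), u0).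
      by split; [split|]; apply: norm_ball; rewrite //= subrr normr0.
    by have := Hd3 _ B tt; rewrite /= F00 subr0.
  have [||u ur Tu] := @contraction_fixed_point _ _ _ (fun u => u - invmx S0 *m F t z u) u0 r.
  - move=> x y hx hy; apply: contr => //; apply: le_lt_trans d2d; exact: le_trans rd2.
  - rewrite addrAC subrr add0r normrN (le_trans (mulmx_le (lexx _) Fb))// -/si -/N.
    exact: half_fraction_le (mulr_ge0 N0 si0) (ltW r0).
  have F0 : F t z u = 0.
    have : invmx S0 *m F t z u = 0 by apply/eqP; rewrite -oppr_eq0 -(subrK u (- _)) addrC addrA Tu addrN.
    by move=> /(congr1 (mulmx S0)); rewrite mulKVmx// mulmx0.
  by rewrite -(eta_unique tt F0).
have [d' d'0 Hd'] := close _ d20 (lexx _).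
pose KF := N * m * (N * e * (N * p1) + N * `|J0| * (N * p1) + N * a * (N * p1)).
have Np1 : 0 <= N * p1 by exact: mulr_ge0.
have KF0 : 0 <= KF.
  have h1 := mulr_ge0 (mulr_ge0 N0 (ltW e0)) Np1.
  have h2 := mulr_ge0 (mulr_ge0 N0 (normr_ge0 J0)) Np1.
  have h3 := mulr_ge0 (mulr_ge0 N0 a0) Np1.
  by apply: mulr_ge0; [exact: mulr_ge0|exact: addr_ge0 (addr_ge0 h1 h2) h3].
(* For u = eta t z and u' = eta t z' the contraction gives |u - u'| <= |u - u'| / 2 + |S0^-1 F(t, z,
   u')|, and F(t, z, u') is O(|z - z'|) because F(t, z', u') = 0. *)
exists (2 * (N * si * KF)), (Num.min d d'); split.
- by apply: mulr_ge0 => //; apply: mulr_ge0 => //; exact: mulr_ge0.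
- by rewrite lt_min d0.
- move=> r r0; have [rd|dr] := leP r d2; first exact: close.
  have [d3 d30 H3] := close _ d20 (lexx _); exists d3 => // t z tt ht hz.
  exact: le_trans (H3 t z tt ht hz) (ltW dr).
move=> t z z' tt; rewrite !lt_min => /andP[ht ht'] /andP[hz hz'] /andP[hy hy'].
have u_in := le_lt_trans (Hd' t z tt ht' hz') d2d.
have u'_in := le_lt_trans (Hd' t z' tt ht' hy') d2d.
set u := eta t z in u_in *; set u' := eta t z' in u'_in *.
have := contr t z u u' tt ht hz u_in u'_in.
rewrite (eta_root z tt) mulmx0 subr0.
have FE : F t z u' = - (M t *m ((f t (arg t z u') - f t (arg t z' u') - J0 *m (P t *m (z - z')))
    + J0 *m (P t *m (z - z')) - A' t *m (P t *m (z - z')))).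
  have Fz' : F t z' u' = 0 by exact: eta_root.
  rewrite -[LHS]subr0 -Fz' /F subrK.
  rewrite (_ : f t (arg t z u') - f t (arg t z' u') - A' t *m (P t *m (z - z')) =
    (f t (arg t z u') - A' t *m (P t *m z)) - (f t (arg t z' u') - A' t *m (P t *m z'))).
    rewrite (mulmxBr (M t) (_ - _)).
    move: (M t *m _) (M t *m _) => b1 b2.
    by apply/matrixP => i j; rewrite !mxE; ring.
  rewrite (mulmxBr (P t)) (mulmxBr (A' t)).
  move: (A' t *m _) (A' t *m _) (f t _) (f t _) => b1 b2 b3 b4.
  by apply/matrixP => i j; rewrite !mxE; ring.
have [_ _ Mb [_ Pb Ab]] := Hd _ (in_ball t z u' ht hz u'_in) tt.
have w1 : `|P t *m (z - z')| <= N * p1 * `|z - z'| by exact: mulmx_le Pb (lexx _).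
have JM : `|f t (arg t z u') - f t (arg t z' u') - J0 *m (P t *m (z - z'))| <=
    N * e * (N * p1 * `|z - z'|).
  have argB : arg t z u' - arg t z' u' = P t *m (z - z').
    by rewrite /arg mulmxBr opprD addrACA subrr addr0.
  apply: le_trans (ler_wpM2l (mulr_ge0 N0 (ltW e0)) w1); rewrite -argB.
  apply: (@jacobian_mean_value _ _ (f t) J0 _ _ e (fun w => f_diff w tt)) => s sI.
  have -> : s *: (arg t z u' - arg t z' u') + arg t z' u' = arg t (s *: (z - z') + z') u'.
    by rewrite argB /arg (mulmxDr (P t) (s *: _)) -scalemxAr addrA.
  have [h _ _ _] := Hd _ (in_ball t (s *: (z - z') + z') u' ht (conv _ _ _ _ _ sI hz hy) u'_in) tt.
  exact: h.
have Fb : `|F t z u'| <= KF * `|z - z'|.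
  rewrite FE normrN.
  have h : `|f t (arg t z u') - f t (arg t z' u') - J0 *m (P t *m (z - z')) + J0 *m (P t *m (z - z'))
      - A' t *m (P t *m (z - z'))| <=
      N * e * (N * p1 * `|z - z'|) + N * `|J0| * (N * p1 * `|z - z'|) + N * a * (N * p1 * `|z - z'|).
    apply: le_trans (ler_normB _ _) _; apply: lerD; last exact: mulmx_le Ab w1.
    by apply: le_trans (ler_normD _ _) _; apply: lerD => //; exact: mulmx_le (lexx _) w1.
  apply: le_trans (mulmx_le Mb h) _.
  by rewrite /KF le_eqVlt; apply/orP; left; apply/eqP; ring.
have Sb := mulmx_le (lexx si : `|invmx S0| <= si) Fb.
rewrite opprB => H.
have tri : `|u - u'| <= `|u - (u' - invmx S0 *m F t z u')| + `|invmx S0 *m F t z u'|.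
  have -> : u - u' = (u - (u' - invmx S0 *m F t z u')) - invmx S0 *m F t z u'.
    by move: (invmx S0 *m _) => b; apply/matrixP => i j; rewrite !mxE; ring.
  exact: ler_normB.
have {}Sb : `|invmx S0 *m F t z u'| <= N * si * KF * `|z - z'| by rewrite -[leRHS]mulrA.
have {}H : `|u - (u' - invmx S0 *m F t z u')| <= 2^-1 * `|u - u'| by rewrite opprB.
by move: tri H Sb; move: (`|u - u'|) (`|invmx S0 *m _|) (`|u - _|) => b1 b2 b3 *; rewrite -mulrA; lra.
Qed.


Lemma eta_continuous : {within J `*` [set: V], continuous (fun p : R * V => eta p.1 p.2)}.
Proof.
apply/subspace_continuousP => -[t z] [/= tJ _].
have tt : tp <= t by move: tJ; rewrite in_itv/= andbT.
have [K [d [_ _ H _]]] := eta_local z tt.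
apply/cvgrPdist_le => e e0; have [d' d'0 Hd'] := H e e0.
have Hn : nbhs ((t, z) : R * V) [set p : R * V | (J `*` [set: V]) p ->
    `|eta t z - eta p.1 p.2| <= e].
  apply/nbhs_ballP; exists d' => // -[s y] [/= b1 b2] [/= sJ _].
  rewrite distrC; apply: Hd'.
  - by move: sJ; rewrite in_itv/= andbT.
  - by move: b1; rewrite -ball_normE /ball_/= distrC.
  - by move: b2; rewrite -ball_normE /ball_/= distrC.
exact: Hn.
Qed.

Let K (T r : R) : set (R * V) := (`[tp, T] `*` [set z | `|z| <= r])%classic.
Let compactK T r : compact (K T r).
Proof. by apply: compact_setX; [exact: segment_compact|exact: compact_ball_mx]. Qed.
Let KJ T r : K T r `<=` J `*` [set: V].
Proof. by move=> [t z] [/= + _]; rewrite in_itv/= => /andP[tt _]; split; rewrite //= in_itv/= andbT. Qed.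
Let inK T r t (z : V) : tp <= t <= T -> `|z| <= r -> K T r (t, z).
Proof. by move=> tI zr; split; rewrite //= in_itv. Qed.

Let bounded_on_K {U : normedModType R} (h : R * V -> U) T r :
  {within J `*` [set: V], continuous h} ->
  exists2 B, 0 < B & forall t z, tp <= t <= T -> `|z| <= r -> `|h (t, z)| <= B.
Proof.
move=> ch; have [B B0 HB] := compact_continuous_bounded (@compactK T r)
  (continuous_subspaceW (@KJ T r) ch).
by exists B => // t z tI zr; apply: HB; exact: inK.
Qed.

(** Near each point of the compact set the local constant serves for close arguments; for arguments
    at distance at least d / 2 the bound B on [eta] gives the constant 4 B / d. Letting the constant
    tend to infinity makes the covering argument pick one for all points. *)
Lemma eta_lipschitz T r : exists L, forall t z z', tp <= t <= T -> `|z| <= r -> `|z'| <= r ->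
  `|eta t z - eta t z'| <= L * `|z - z'|.
Proof.
have [B B0 HB] := @bounded_on_K _ _ T r eta_continuous.
have near_point (p : R * V) : K T r p ->
    \forall p' \near p & L \near +oo, K T r p' -> forall z', `|z'| <= r ->
      `|eta p'.1 p'.2 - eta p'.1 z'| <= L * `|p'.2 - z'|.
  case: p => t0 z0 Kp; have [tJ _] := KJ Kp; have tt0 : tp <= t0 by move: tJ; rewrite /= in_itv/= andbT.
  have [K0 [d [K00 d0 _ H]]] := eta_local z0 tt0.
  have d2 : 0 < d / 2 by rewrite divr_gt0.
  exists (ball ((t0, z0) : R * V) (d / 2), [set L | Num.max K0 (4 * B / d) <= L]) => /=.
    split; first exact: nbhsx_ballx.
    exact: nbhs_pinfty_ge (num_real _).
  move=> [[t z] L] /= [[/= b1 b2] HL] [/= tI zr] z' z'r.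
  rewrite in_itv/= in tI; have /andP[tt _] := tI.
  move: HL; rewrite ge_max => /andP[KL BL].
  move: b1 b2; rewrite -!ball_normE /ball_/= distrC => b1; rewrite distrC => b2.
  have dd : d / 2 < d by rewrite ltr_pdivrMr// ltr_pMr// ltr1n.
  have [zd|zd] := ltP `|z' - z0| d.
    apply: le_trans (H t z z' tt (lt_trans b1 dd) (lt_trans b2 dd) zd) _.
    by rewrite ler_wpM2r.
  have far : d / 2 <= `|z - z'|.
    have := ler_distD z z' z0; rewrite [`|z' - z|]distrC; move: zd b2.
    move: (`|z' - z0|) (`|z - z0|) (`|z - z'|) => x1 x2 x3; lra.
  have h : 4 * B / d * (d / 2) <= L * `|z - z'|.
    apply: ler_pM => //; first by rewrite divr_ge0 ?mulr_ge0// ltW.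
    exact: ltW.
  have [h1 h2] := (HB t z tI zr, HB t z' tI z'r).
  rewrite (le_trans (ler_normB _ _))//; move: h; rewrite /= in h1 h2.
  have -> : 4 * B / d * (d / 2) = 2 * B by field; rewrite gt_eqF.
  by move: h1 h2; lra.
have := @compact_forall_near _ _ (+oo%R : set_system R) _ (K T r) _ (@compactK T r) near_point.
move=> H; have [L HL] := filter_ex (H _); exists L => t z z' tI zr z'r.
by have := HL (t, z) (inK tI zr) (inK tI zr) z' z'r.
Qed.

Variables Dr Fo : R -> 'M[R]_n.
Hypothesis cDr : forall t, tp <= t -> Dr s @[s --> within J (nbhs t)] --> Dr t.
Hypothesis cFo : forall t, tp <= t -> Fo s @[s --> within J (nbhs t)] --> Fo t.

Definition reduced_rhs t z := Dr t *m z + Fo t *m f t (P t *m z + (1%:M - P t) *m eta t z).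

Let cvg_time2 (g : R -> 'M[R]_n) (q : R * V) : (J `*` [set: V]) q ->
  (forall t, tp <= t -> g s @[s --> within J (nbhs t)] --> g t) ->
  (fun q' : R * V => g q'.1) @ within (J `*` [set: V]) (nbhs q) --> g q.1.
Proof.
move=> [qJ _] cg; apply: (@cvg_fst_within _ _ _ J); first by move=> q' [].
by apply: cg; move: qJ; rewrite /= in_itv/= andbT.
Qed.

Let cvg_z2 (q : R * V) : (fun q' : R * V => q'.2) @ within (J `*` [set: V]) (nbhs q) --> q.2.
Proof. by apply: cvg_at_within; exact: cvg_snd. Qed.

Let cvg_eta (q : R * V) : (J `*` [set: V]) q ->
  (fun q' : R * V => eta q'.1 q'.2) @ within (J `*` [set: V]) (nbhs q) --> eta q.1 q.2.
Proof. by have /subspace_continuousP := eta_continuous; exact. Qed.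

Lemma arg_continuous : {within J `*` [set: V], continuous (fun p : R * V => arg p.1 p.2 (eta p.1 p.2))}.
Proof.
apply/subspace_continuousP => q Jq.
exact: (cvg_add (cvg_mulmx (cvg_time2 Jq cP) (@cvg_z2 q))
  (cvg_mulmx (cvg_one_sub (cvg_time2 Jq cP)) (cvg_eta Jq))).
Qed.

Lemma reduced_rhs_continuous :
  {within J `*` [set: V], continuous (fun p : R * V => reduced_rhs p.1 p.2)}.
Proof.
apply/subspace_continuousP => q Jq.
have cf : (fun p : R * V => f p.1 (arg p.1 p.2 (eta p.1 p.2))) @ within (J `*` [set: V]) (nbhs q)
    --> f q.1 (arg q.1 q.2 (eta q.1 q.2)).
  apply: (@cvg_within_comp _ _ _ (J `*` [set: V]) (J `*` [set: V])
    (fun p : R * V => (p.1, arg p.1 p.2 (eta p.1 p.2))) (fun p : R * V => f p.1 p.2) q).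
  - by move=> p [].
  - apply: cvg_pairl; first by apply: cvg_at_within; exact: cvg_fst.
    by have /subspace_continuousP := arg_continuous; exact.
  - by move/subspace_continuousP: f_cont; apply; case: Jq.
exact: (cvg_add (cvg_mulmx (cvg_time2 Jq cDr) (@cvg_z2 q)) (cvg_mulmx (cvg_time2 Jq cFo) cf)).
Qed.

Let bounded_time (g : R -> 'M[R]_n) T :
  (forall t, tp <= t -> g s @[s --> within J (nbhs t)] --> g t) ->
  exists2 B, 0 < B & forall t, tp <= t <= T -> `|g t| <= B.
Proof.
move=> cg; apply: bounded_pos; apply: bounded_continuous.
apply: (continuous_subspaceW (@segment_ray _ tp tp T (lexx _))).
by apply: within_continuous_cvg => t tJ; apply: cg; move: tJ; rewrite /= in_itv/= andbT.
Qed.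

Lemma reduced_rhs_lipschitz T r : exists L, forall t z z', tp <= t <= T -> `|z| <= r ->
  `|z'| <= r -> `|reduced_rhs t z - reduced_rhs t z'| <= L * `|z - z'|.
Proof.
have [L HL] := eta_lipschitz T r.
have [CD CD0 HD] := bounded_time T cDr; have [CF CF0 HF] := bounded_time T cFo.
have [CP CP0 HP] := bounded_time T cP.
have [CP2 CP20 HP2] := bounded_time T (fun t tt => cvg_one_sub (cP tt)).
have [ra ra0 Hra] := @bounded_on_K _ _ T r arg_continuous.
have [CJ CJ0 HJ] := @bounded_on_K _ _ T ra dfdx_cont.
pose N : R := n%:R.
exists (N * CD + N * CF * (N * CJ * (N * CP + N * CP2 * L))) => t z z' tI zr z'r.
have /andP[tt _] := tI.
have df : `|f t (arg t z (eta t z)) - f t (arg t z' (eta t z'))| <=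
    N * CJ * `|arg t z (eta t z) - arg t z' (eta t z')|.
  have := @jacobian_mean_value _ _ (f t) 0 (arg t z (eta t z)) (arg t z' (eta t z')) CJ
    (fun w => f_diff w tt).
  rewrite mul0mx subr0; apply => s /andP[s0 s1]; rewrite subr0; apply: (HJ t _ tI).
  by apply: segment_norm_le; [rewrite s0|exact: (Hra t z)|exact: (Hra t z')].
have da : `|arg t z (eta t z) - arg t z' (eta t z')| <= (N * CP + N * CP2 * L) * `|z - z'|.
  rewrite /arg opprD addrACA -!mulmxBr (le_trans (ler_normD _ _))// mulrDl lerD//.
    exact: mulmx_le (HP _ tI) (lexx _).
  apply: le_trans (mulmx_le (HP2 _ tI) (HL t z z' tI zr z'r)) _.
  by rewrite mulrA.
rewrite /reduced_rhs -/(arg t z _) -/(arg t z' _) opprD addrACA -!mulmxBr.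
rewrite (le_trans (ler_normD _ _))// mulrDl lerD//.
  exact: mulmx_le (HD _ tI) (lexx _).
have h3 := le_trans df (ler_wpM2l (mulr_ge0 (ler0n _ n) (ltW CJ0)) da).
apply: le_trans (mulmx_le (HF _ tI) h3) _.
by rewrite -/N le_eqVlt; apply/orP; left; apply/eqP; ring.
Qed.

End implicit_function.

(** * Global solutions *)

Section hitting_times.
Context {R : realType}.

Lemma der_of_little_o {V : normedModType R} (J : set R) (g : R -> V) t d :
  (forall e, 0 < e -> nbhs t [set s | J s -> `|g s - g t - (s - t) *: d| <= e * `|s - t|]) ->
  der J g t d.
Proof.
move=> H; exists (fun s => if s == t then d else (s - t)^-1 *: (g s - g t)).
  move=> s _; have [->|st] := eqVneq s t; first by rewrite !subrr scale0r.
  by rewrite scalerA divff ?subr_eq0// scale1r.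
apply/cvgrPdist_le => e e0.
have Hn : nbhs t [set s | J s ->
    `|d - (if s == t then d else (s - t)^-1 *: (g s - g t))| <= e].
  apply: filterS (H e e0) => s Hs Js /=; case: (eqVneq s t) => [_|st].
    by rewrite subrr normr0 ltW.
  have st0 : 0 < `|s - t| by rewrite normr_gt0 subr_eq0.
  rewrite -(ler_pM2r st0) (le_trans _ (Hs Js))// mulrC -normrZ -normrN -scalerN opprB scalerBr.
  by rewrite scalerA divff ?subr_eq0// scale1r.
exact: Hn.
Qed.

Lemma der_little_o {V : normedModType R} (J : set R) (g : R -> V) t d (e : R) : der J g t d -> 0 < e ->
  nbhs t [set s | J s -> `|g s - g t - (s - t) *: d| <= e * `|s - t|].
Proof.
move=> [sigma E c] e0; have := within_dist_le c e0; apply: filterS => s Hs Js.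
by rewrite E// -scalerBr normrZ mulrC ler_wpM2r// Hs.
Qed.

Lemma der_local {V : normedModType R} (J J' : set R) (g g' : R -> V) t d :
  nbhs t [set s | J s -> J' s /\ g s = g' s] -> g t = g' t -> der J' g' t d -> der J g t d.
Proof.
move=> Hn gt dg'; apply: der_of_little_o => e e0.
have H := der_little_o dg' e0.
apply: filterS (filterI Hn H) => s [h1 h2] Js; have [J's gs] := h1 Js.
by rewrite gs gt; exact: h2.
Qed.

(** [tau] is the infimum of the times with h >= c: before it h < c, and continuity excludes both h
    tau < c and h tau > c. *)
Lemma first_hitting (h : R -> R) (a b c : R) : a <= b -> {within `[a, b], continuous h} ->
  h a <= c -> c <= h b ->
  exists2 tau, a <= tau <= b & h tau = c /\ forall s, a <= s <= tau -> h s <= c.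
Proof.
move=> ab ch ha hb; pose E : set R := [set t | a <= t <= b /\ c <= h t].
have Eb : E b by rewrite /E/= ab lexx.
have hE : has_inf E by split; [exists b|exists a => t [/andP[]]].
pose tau := inf E.
have at_ : a <= tau by apply: lb_le_inf; [exists b|move=> t [/andP[]]].
have tb : tau <= b by exact: ge_inf hE.2 _ Eb.
have below s : a <= s -> s < tau -> h s < c.
  move=> as_ st; rewrite ltNge; apply/negP => cs.
  have Es : E s by split=> //; rewrite as_ (le_trans (ltW st)).
  by have := ge_inf hE.2 Es; rewrite leNgt st.
have tI : `[a, b]%classic tau by rewrite /= in_itv/= at_ tb.
have near e : 0 < e -> exists2 d, 0 < d & forall s, a <= s <= b -> `|s - tau| < d -> `|h s - h tau| <= e.
  move=> e0; have /(@nbhs_ballP _ _ _ _)[d /= d0 Hd] := within_dist_le (within_cvg ch tI) e0.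
  exists d => // s sI sd; apply: Hd; last by rewrite /= in_itv.
  exact: norm_ball.
have htau_ge : c <= h tau.
  rewrite leNgt; apply/negP => hc.
  have e0 : 0 < (c - h tau) / 2 by rewrite divr_gt0// subr_gt0.
  have [d d0 Hd] := near _ e0.
  have [s [sI cs] sd] := inf_adherent d0 hE.
  have taus : tau <= s by apply: (ge_inf hE.2); split.
  have : `|h s - h tau| <= (c - h tau) / 2.
    apply: Hd => //; rewrite ger0_norm ?subr_ge0// ltrBlDl; exact: sd.
  by move=> /(le_trans (ler_norm _)); move: hc cs; clear; lra.
have htau_le : h tau <= c.
  have [<-//|ta] := eqVneq a tau.
  have {}ta : a < tau by rewrite lt_neqAle ta.
  rewrite leNgt; apply/negP => hc.
  have e0 : 0 < (h tau - c) / 2 by rewrite divr_gt0// subr_gt0.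
  have [d d0 Hd] := near _ e0.
  pose s := Num.max a (tau - d / 2).
  have d2 : 0 < d / 2 by rewrite divr_gt0.
  have s_lt : s < tau by rewrite gt_max ta ltrBlDr ltrDl.
  have as_ : a <= s by rewrite le_max lexx.
  have sd : tau - d / 2 <= s by rewrite le_max lexx orbT.
  have := below s as_ s_lt.
  have : `|h s - h tau| <= (h tau - c) / 2.
    apply: Hd; first by rewrite as_ (le_trans (ltW s_lt)).
    by rewrite ler0_norm ?subr_le0 ?(ltW s_lt)//; move: d0 sd; clearbody s; clear; lra.
  by rewrite ler_norml => /andP[+ _]; move: hc; clear; lra.
exists tau; first by rewrite at_ tb.
split=> [|s /andP[as_]]; first by apply: le_anti; rewrite htau_le.
by rewrite le_eqVlt => /orP[/eqP->//|/below H]; exact/ltW/H.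
Qed.

(** Time reversal: [first_hitting] for s |-> - h (a + b - s). *)
Lemma last_hitting (h : R -> R) (a b c : R) : a <= b -> {within `[a, b], continuous h} ->
  h a <= c -> c <= h b ->
  exists2 tau, a <= tau <= b & h tau = c /\ forall s, tau <= s <= b -> c <= h s.
Proof.
move=> ab ch ha hb; pose k s := - h (a + b - s).
have ck : {within `[a, b], continuous k}.
  apply: within_continuous_cvg => t tI; apply: cvgN.
  have tI' : `[a, b]%classic (a + b - t).
    by move: tI; rewrite /= !in_itv/= => /andP[? ?]; apply/andP; split; lra.
  apply: (@cvg_within_comp _ _ _ `[a, b]%classic `[a, b]%classic (fun s : R => a + b - s) h t _ _ _ (within_cvg ch tI')).
    by move=> s; rewrite /= !in_itv/= => /andP[? ?]; apply/andP; split; lra.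
  by apply: cvg_at_within; apply: cvgB; [exact: cvg_cst|exact: cvg_id].
have [||tau /andP[at_ tb] [kt H]] := @first_hitting k a b (- c) ab ck.
- by rewrite /k lerN2 (_ : a + b - a = b) //; ring.
- by rewrite /k lerN2 (_ : a + b - b = a) //; ring.
exists (a + b - tau); first by apply/andP; split; lra.
split; first exact: oppr_inj.
move=> s /andP[s1 s2]; have sI : a <= a + b - s <= tau by apply/andP; split; lra.
have := H _ sI; rewrite /k lerN2 (_ : a + b - (a + b - s) = s) //; ring.
Qed.

End hitting_times.

Section global_solution.
Context {R : realType} {n : nat}.
Local Notation V := 'cV[R]_n.

(** Entrywise truncation, the identity on the ball of radius r in the max norm. Composition with it
    turns a locally Lipschitz right-hand side into a globally Lipschitz one. *)
Definition clamp_col (r : R) (z : V) : V := \col_i clamp (- r) r (z i 0).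

Lemma clamp_col_norm r z : 0 <= r -> `|clamp_col r z| <= r.
Proof.
move=> r0; apply: mx_norm_le => // i j; rewrite mxE ler_norml.
by apply: clamp_in; rewrite ge0_cp.
Qed.

Lemma clamp_col_id r z : `|z| <= r -> clamp_col r z = z.
Proof.
move=> zr; apply/matrixP => i j; rewrite mxE (ord1 j) clamp_id// -ler_norml.
exact: le_trans (le_mx_norm _ _ _) zr.
Qed.

Lemma clamp_col_lipschitz r y z : `|clamp_col r y - clamp_col r z| <= `|y - z|.
Proof.
apply: mx_norm_le => // i j; rewrite !mxE (le_trans (clamp_lipschitz _ _ _ _))//.
by have := le_mx_norm (y - z) i 0; rewrite !mxE.
Qed.

Variables (tp t0 : R) (g : R -> V -> V) (z0 : V).
Local Notation J := (`[tp, +oo[%classic).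
Hypothesis t0_ge : tp <= t0.
Hypothesis g_cont : {within J `*` [set: V], continuous (fun p : R * V => g p.1 p.2)}.
Hypothesis g_lip : forall T r, exists L, forall t z z', tp <= t <= T -> `|z| <= r ->
  `|z'| <= r -> `|g t z - g t z'| <= L * `|z - z'|.
Let sol tau (z : R -> V) := z t0 = z0 /\
  forall t, t0 <= t <= tau -> der `[t0, tau] z t (g t (z t)).
Hypothesis a_priori : forall T, exists B, forall tau z, t0 <= tau <= T -> sol tau z ->
  forall t, t0 <= t <= tau -> `|z t| <= B.

(** The radius r exceeds the a priori bound B. Up to the first time at which the norm reaches r the
    truncation is inactive, so the curve solves the original equation and its norm is at most B < r:
    that time never comes. *)
Let local_solution T : t0 <= T -> exists z, sol T z.
Proof.
move=> tT; have [B HB] := a_priori T; pose r := `|B| + `|z0| + 1.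
have r0 : 0 <= r by rewrite !addr_ge0.
have [L HL] := g_lip T r.
pose gt t y := g (clamp t0 T t) (clamp_col r y).
have gtc : continuous (fun p : R * V => gt p.1 p.2).
  move=> p; pose phi (p : R * V) := (clamp t0 T p.1, clamp_col r p.2).
  have inJ q : (J `*` [set: V]) (phi q).
    split => //=; rewrite in_itv/= andbT (le_trans t0_ge)//.
    by have /andP[] := clamp_in q.1 tT.
  have cphi : phi @ nbhs p --> phi p.
    apply: cvg_pairl; apply/cvgrPdist_le => e e0; apply/nbhs_ballP; exists e => //= q [b1 b2].
      move: b1; rewrite -ball_normE /ball_/= => b1.
      exact: le_trans (clamp_lipschitz _ _ _ _) (ltW b1).
    move: b2; rewrite -ball_normE /ball_/= => b2.
    exact: le_trans (clamp_col_lipschitz _ _ _) (ltW b2).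
  move=> U HU; have /subspace_continuousP/(_ (phi p) (inJ p)) H := g_cont.
  have {}H : nbhs (phi p) [set q | (J `*` [set: V]) q -> U (g q.1 q.2)] := H U HU.
  have {}H : nbhs p [set q | (J `*` [set: V]) (phi q) -> U (g (phi q).1 (phi q).2)] := cphi _ H.
  have : nbhs p [set q | U (gt q.1 q.2)] by apply: filterS H => q; apply.
  exact.
have [|z [cz zt0 dz]] := @picard_lindelof R n gt t0 T `|L| z0 tT gtc.
  move=> t y z; have /andP[c1 c2] := clamp_in t tT.
  rewrite (le_trans (HL _ _ _ _ (clamp_col_norm _ r0) (clamp_col_norm _ r0)))//.
    by rewrite (le_trans t0_ge c1).
  rewrite (le_trans (ler_wpM2r (normr_ge0 _) (ler_norm L)))// ler_wpM2l//.
  exact: clamp_col_lipschitz.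
have stay t : t0 <= t <= T -> `|z t| <= r.
  move=> /andP[t0t tT']; rewrite leNgt; apply/negP => rz.
  have cn : {within `[t0, t], continuous (fun s => `|z s|)}.
    by apply: continuous_subspaceT => s; apply: cvg_norm; exact: cz.
  have h0 : `|z t0| <= r by rewrite zt0 /r -addrA addrCA lerDl addr_ge0.
  have [tau /andP[t0tau taut] [ztau Hs]] := first_hitting t0t cn h0 (ltW rz).
  have tauT : tau <= T by exact: le_trans tT'.
  have st : sol tau z.
    split=> // s /andP[t0s stau]; have sI : t0 <= s <= T by rewrite t0s (le_trans stau).
    have := dz s sI; rewrite /gt clamp_id// clamp_col_id; last by apply: Hs; rewrite t0s.
    apply: der_subset => x; rewrite /= !in_itv/= => /andP[-> xt]; exact: le_trans tauT.
  have := HB tau z _ st tau; rewrite t0tau tauT lexx => /(_ isT isT).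
  rewrite ztau /r; have := ler_norm B; have := normr_ge0 z0.
  move: (`|B|) (`|z0|) => b1 b2; lra.
exists z; split=> // t tI.
by have := dz t tI; rewrite /gt clamp_id// clamp_col_id// stay.
Qed.

Let sol_unique T z z' : sol T z -> sol T z' -> forall t, t0 <= t <= T -> z t = z' t.
Proof.
move=> [zt0 dz] [z't0 dz'] t tI; have /andP[t0t tT] := tI.
have cont y : (forall t, t0 <= t <= T -> der `[t0, T] y t (g t (y t))) ->
    {within `[t0, T], continuous y}.
  move=> dy; apply: (@der_continuous _ _ _ _ (fun t => g t (y t))) => s.
  by rewrite /= in_itv; exact: dy.
have [r r0 Hr] := bounded_pos (bounded_continuous (cont z dz)).
have [r' r'0 Hr'] := bounded_pos (bounded_continuous (cont z' dz')).
have [L HL] := g_lip T (r + r').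
apply/eqP; rewrite -subr_eq0; apply/eqP.
apply: (@gronwall_zero _ _ _ (fun s => z s - z' s) (fun s => g s (z s) - g s (z' s)) t0 T L) => //.
- by move=> s sI; apply: derB; [exact: dz|exact: dz'].
- by rewrite zt0 z't0 subrr.
move=> s sI; apply: HL.
- by move: sI => /andP[? ->]; rewrite (le_trans t0_ge).
- by rewrite (le_trans (Hr s sI))// lerDl ltW.
- by rewrite (le_trans (Hr' s sI))// lerDr ltW.
Qed.

(** Solutions on [t0, t0 + m] agree by uniqueness; at time t the one whose m is the archimedean
    bound of t - t0 is taken, and near t it can be replaced by a single one. *)
Lemma global_solution : exists z : R -> V, z t0 = z0 /\
  forall t, t0 <= t -> der `[t0, +oo[ z t (g t (z t)).
Proof.
have le_t0 (m : nat) : t0 <= t0 + m%:R by rewrite lerDl.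
pose zz m := projT1 (cid (local_solution (le_t0 m))).
have zzP m : sol (t0 + m%:R) (zz m) := projT2 (cid (local_solution (le_t0 m))).
pose N t := Num.bound (t - t0).
have NP t : t0 <= t -> t < t0 + (N t)%:R.
  by move=> t0t; rewrite -ltrBlDl archi_boundP// subr_ge0.
have agree m k t : t0 <= t -> t <= t0 + m%:R -> t <= t0 + k%:R -> zz m t = zz k t.
  move=> t0t tm tk; have restrict j : t <= t0 + j%:R -> sol t (zz j).
    move=> tj; have [e0 dj] := zzP j; split=> // s /andP[t0s st].
    apply: der_subset (dj s _); last by rewrite t0s (le_trans st).
    by move=> x; rewrite /= !in_itv/= => /andP[-> xt]; exact: le_trans tj.
  by apply: (sol_unique (restrict m tm) (restrict k tk)); rewrite t0t lexx.
exists (fun t => zz (N t) t); split.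
  by have [-> _] := zzP (N t0).
move=> t t0t; pose m := N t; have tm := NP t t0t.
have [_ dm] := zzP m.
apply: (@der_local _ _ `[t0, +oo[ `[t0, t0 + m%:R] _ (zz m)); last 2 first.
- by [].
- by apply: dm; rewrite t0t ltW.
have : \forall s \near t, s < t0 + m%:R by apply: lt_nbhsl.
apply: filterS => s sm; rewrite /= !in_itv/= andbT => t0s; rewrite t0s ltW//; split=> //.
by apply: agree => //; [exact/ltW/NP|exact: ltW].
Qed.

End global_solution.

(** * A priori bound *)

Section scalar_tools.
Context {R : realType}.

Lemma der_comp (J : set R) (H v : R -> R) t a d : J t -> der setT H (v t) a -> der J v t d ->
  der J (fun s => H (v s)) t (d * a).
Proof.
move=> Jt [sH EH cH] dv; have [sv Ev cv] := dv.
exists (fun s => sv s * sH (v s)) => [s Js|].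
  by rewrite EH// Ev//; exact: esym (mulrA _ _ _).
suff cs : (fun s => sH (v s)) @ within J (nbhs t) --> a by exact: (cvgM cv cs).
move=> U HU; have HU' : nbhs (v t) [set y | setT y -> U (sH y)] := cH U HU.
have vt := der_cvg dv.
have : nbhs t [set s | J s -> U (sH (v s))].
  have h : nbhs t [set s | J s -> setT (v s) -> U (sH (v s))] := vt _ HU'.
  by apply: filterS h => s h Js; exact: h.
exact.
Qed.

(** If a primitive H of 1 / U stayed bounded it would converge, being monotone, and the fundamental
    theorem on [v0, oo) would give the integral a finite value. To the left of v0 the integrand is
    continued by a constant, so that H has a two-sided derivative at v0. *)
Lemma primitive_unbounded (U : R -> R) (v0 : R) : 0 < v0 ->
  {within `]0, +oo[, continuous U} -> (forall v, 0 < v -> 0 < U v) ->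
  (\int[lebesgue_measure]_(v in `[v0, +oo[) ((U v)^-1)%:E = +oo)%E ->
  exists H : R -> R, (forall v, v0 <= v -> der setT H v (U v)^-1) /\
    forall vm c, v0 <= vm -> exists2 v2, vm < v2 & c < H v2 - H vm.
Proof.
move=> v00 cU U0 int_oo; pose h v := (U (Num.max v0 v))^-1.
have max_gt0 v : 0 < Num.max v0 v by rewrite lt_max v00.
have ch : continuous h.
  move=> v; apply: cvgV; first by rewrite gt_eqF// U0.
  have c0 : {within `[v0, +oo[, continuous U}.
    apply: continuous_subspaceW cU => x; rewrite /= !in_itv/= !andbT; exact: lt_le_trans.
  exact: within_max c0 v.
have hE v : v0 <= v -> h v = (U v)^-1 by move=> vv; rewrite /h max_r.
have h0 v : 0 < h v by rewrite invr_gt0 U0.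
pose H x := (\int[lebesgue_measure]_(t in `[v0 - 1, x]) h t)%R.
have dH v : v0 <= v -> der setT H v (h v).
  move=> vv; have v1 : v < v + 1 by rewrite ltrDl.
  have av : v0 - 1 < v by rewrite (lt_le_trans _ vv)// ltrBlDr ltrDl.
  have hint : lebesgue_measure.-integrable `[v0 - 1, v + 1] (EFin \o h).
    apply: continuous_compact_integrable; first exact: segment_compact.
    exact: continuous_subspaceT.
  have [D E] := continuous_FTC1_closed v1 hint av (ch v).
  by apply: is_derive_der; apply: (DeriveDef D); rewrite -derive1E E.
exists H; split=> [v vv|vm c vvm]; first by rewrite -hE//; exact: dH.
apply: contrapT => noex.
have Hle v2 : vm <= v2 -> H v2 <= H vm + `|c|.
  rewrite le_eqVlt => /orP[/eqP<-|v2m]; first by rewrite lerDl.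
  rewrite leNgt; apply/negP => lt; apply: noex; exists v2 => //.
  by rewrite (le_lt_trans (ler_norm c))// ltrBrDl.
have Hmono x y : v0 <= x -> x <= y -> H x <= H y.
  move=> vx xy; apply: (@der_nondecreasing _ H h) => // t /andP[xt ty].
    by apply: der_subset (dH t (le_trans vx xt)).
  exact: ltW.
(* [F] is [H] made constant to the left of [v0], hence monotone on the whole line. *)
pose F x := H (Num.max v0 x).
have Fmono : nondecreasing_fun F.
  move=> x y xy; apply: Hmono; first by rewrite le_max lexx.
  by rewrite ge_max !le_max lexx xy orbT.
have ubF : has_ubound (range F).
  exists (H vm + `|c|) => _ [x _ <-]; apply: le_trans (Hle (Num.max vm x) _); last by rewrite le_max lexx.
  apply: Hmono; first by rewrite le_max lexx.
  by rewrite ge_max !le_max vvm lexx orbT.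
have cF := nondecreasing_cvgr Fmono ubF.
have cont_h : {within `[v0, +oo[, continuous h} by exact: continuous_subspaceT.
have dF x : v0 < x -> is_derive x 1 F (h x).
  move=> vx; apply: (der_is_derive (J := `[v0, +oo[)).
    have : \forall s \near x, v0 < s by exact: lt_nbhsr.
    by apply: filterS => s vs; rewrite /= in_itv/= andbT ltW.
  apply: der_eq (der_subset _ (dH x (ltW vx))) => //.
    by rewrite /= in_itv/= andbT ltW.
  by move=> s; rewrite /= in_itv/= andbT => vs; rewrite /F max_r.
have := @ge0_continuous_FTC2y _ h F v0 (sup (range F)) _ cont_h cF _ _ _.
rewrite (_ : (\int[lebesgue_measure]_(x in `[v0, +oo[) (h x)%:E)%E = +oo%E); last first.
  rewrite -int_oo; apply: eq_integral => v; rewrite inE/= in_itv/= andbT => vv.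
  by rewrite hE.
move=> contra; suff : (+oo = (sup (range F))%:E - (F v0)%:E)%E by [].
apply: contra.
- by move=> x _; exact: ltW.
- by move=> x /dF[].
- apply: cvg_at_right_filter.
  have H1 : F s @[s --> nbhs v0] --> F v0.
    have cH : H s @[s --> within setT (nbhs (Num.max v0 v0))] --> H (Num.max v0 v0).
      by apply: der_cvg; apply: dH; rewrite le_max lexx.
    have cm : Num.max v0 s @[s --> nbhs v0] --> Num.max v0 v0.
      rewrite maxxx; apply/cvgrPdist_le => e e0; apply/nbhs_ballP; exists e => //= s.
      rewrite /ball/= => vs; case: (leP v0 s) => _; first exact: ltW.
      by rewrite subrr normr0 ltW.
    move=> W HW; have HW' : nbhs (Num.max v0 v0) [set y | setT y -> W (H y)] := cH W HW.
    have h2 : nbhs v0 [set s | setT (Num.max v0 s) -> W (H (Num.max v0 s))] := cm _ HW'.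
    by apply: filterS h2 => s; exact.
  exact: H1.
- move=> x; rewrite in_itv/= andbT => vx.
  by have [_ <-] := dF x vx; rewrite derive1E.
Qed.

End scalar_tools.

Section chain_rule.
Context {R : realType} {n : nat}.
Local Notation V := 'cV[R]_n.
Variables (tp rho : R) (W : R -> V -> R).
Local Notation D := ((`[tp, +oo[ : set R) `*` (exterior rho : set V))%classic.
Hypothesis W_C1 : Ck_time_space 1 D W.
Let w (p : R * V) := W p.1 p.2.
Let Wt t z := derive_in D w (t, z) (1, 0).
Let Wz t z : V := \col_j derive_in D w (t, z) (0, delta_mx j 0).

(** The derivatives of [W] are relative to a closed set, so the chain rule is proved from
    [coordinate_increment]. The strict inequality on the norm keeps the box around (t, z t) inside
    the domain; in time the box lies between t and s. *)
Lemma der_along_curve (a b t : R) (z : R -> V) (d : V) : tp <= a -> a <= t <= b ->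
  rho < enorm (z t) -> der `[a, b] z t d ->
  der `[a, b] (fun s => W s (z s)) t (Wt t (z t) + dotv (Wz t (z t)) d).
Proof.
move=> tpa tI zt dz.
have [_ H1] := W_C1.
have dW (o : option 'I_n) q : D q -> pder D w q (cdir o) (derive_in D w q (cdir o)).
  by move=> Dq; case: (H1 _ (cdirP o)) => + _ => /(_ q Dq) /derivable_in_pder.
have cW (o : option 'I_n) : {within D, continuous (fun q => derive_in D w q (cdir o))}.
  by case: (H1 _ (cdirP o)) => _ [].
have tJ : tp <= t by move: tI => /andP[at_ _]; exact: le_trans at_.
have D0 : D (t, z t) by split; rewrite /= ?in_itv/= ?andbT// /exterior/= ltW.
pose L o := derive_in D w (t, z t) (cdir o).
apply: der_of_little_o => e e0.
pose N : R := n%:R.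
(* [m] collects the coefficients of e1 |s - t| in the final estimate: the length of the coordinate
   path and the partial derivatives that multiply the remainder of z. *)
pose m := N * (`|d| + 1) + 1 + \sum_j `|L (Some j)|.
have m0 : 0 < m.
  rewrite /m -addrA addrCA ltr_pwDl// addr_ge0// ?sumr_ge0//.
  by rewrite mulr_ge0// addr_ge0.
pose e1 := Num.min 1 (e / (2 * m)).
have e10 : 0 < e1 by rewrite lt_min ltr01 divr_gt0// mulr_gt0.
have e1m : e1 * m <= e / 2.
  rewrite (@le_trans _ _ (e / (2 * m) * m))//; first by rewrite ler_pM2r// ge_min lexx orbT.
  by rewrite invfM mulrA mulfVK// gt_eqF.
have nearL : nbhs (t, z t) [set q : R * V | rho < enorm q.2 /\
    forall o, D q -> `|derive_in D w q (cdir o) - L o| <= e1].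
  have n1 : nbhs (t, z t) [set q : R * V | rho < enorm q.2].
    have h1 : nbhs (z t) [set y | rho < enorm y] := @enorm_continuous R n (z t) _ (lt_nbhsr zt).
    exact: (cvg_snd h1).
  have n2 o : nbhs (t, z t) [set q : R * V | D q -> `|derive_in D w q (cdir o) - L o| <= e1].
    apply: within_dist_le => //.
    by have /subspace_continuousP := cW o; exact.
  have n3 : nbhs (t, z t) [set q : R * V | forall o, D q -> `|derive_in D w q (cdir o) - L o| <= e1].
    exact: (@filter_forall _ _ _ (nbhs (t, z t)) _ n2).
  exact: filterI n1 n3.
have [r /= r0 Hr] := (@nbhs_ballP _ _ _ _).1 nearL.
have Hz := der_little_o dz e10.
have Hs : nbhs t [set s : R | `|s - t| < r / (`|d| + 1)].
  apply/nbhs_ballP; exists (r / (`|d| + 1)) => /=; first by rewrite divr_gt0// ltr_wpDl.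
  by move=> s; rewrite /ball/= distrC.
apply: filterS (filterI Hz Hs) => s [hz hs] sI; have {}hz := hz sI; rewrite /= in hs.
have d1 : 0 < `|d| + 1 by rewrite ltr_wpDl.
have zs : `|z s - z t| <= (`|d| + 1) * `|s - t|.
  rewrite -(subrK ((s - t) *: d) (z s - z t)) (le_trans (ler_normD _ _))// normrZ.
  have : e1 * `|s - t| <= `|s - t| by rewrite ler_piMl// ge_min lexx.
  by move: hz; rewrite mulrDl mul1r [_ * `|d|]mulrC; lra.
have zr : `|z s - z t| < r.
  by rewrite (le_lt_trans zs)// mulrC -ltr_pdivlMr.
have sr : `|s - t| < r.
  rewrite (lt_le_trans hs)// ler_pdivrMr// ler_peMr ?(ltW r0)// lerDr//.
have := @coordinate_increment _ _ D w (fun p => derive_in D w p (1, 0))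
  (fun j p => derive_in D w p (0, delta_mx j 0)) s t (z s) (z t) (L None) (fun j => L (Some j)) e1.
move=> inc.
have {}inc : `|w (s, z s) - w (t, z t) - ((s - t) * L None + \sum_j (z s j 0 - z t j 0) * L (Some j))| <=
    e1 * (`|s - t| + \sum_j `|z s j 0 - z t j 0|).
  apply: inc => s' y' bs by_.
  have b1 : `|s' - t| < r by exact: le_lt_trans (btw_dist bs) sr.
  have b2 : `|y' - z t| < r.
    apply: le_lt_trans zr; apply: mx_norm_le => // i j; rewrite (ord1 j) !mxE.
    rewrite (le_trans (btw_dist (by_ i)))//.
    by have := le_mx_norm (z s - z t) i 0; rewrite !mxE.
  have [ext Ho] := Hr (s', y') (conj (norm_ball b1) (norm_ball b2)).
  have s'J : tp <= s'.
    move: sI tI; rewrite /= in_itv/= => /andP[as_ sb] /andP[at_ tb].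
    have /andP[h _] := @btw_in _ _ _ _ a b bs (introT andP (conj at_ tb)) (introT andP (conj as_ sb)).
    exact: le_trans h.
  have Dq : D (s', y') by split; rewrite /= ?in_itv/= ?andbT// /exterior/= ltW.
  split=> //.
  - exact: dW None _ Dq.
  - by move=> j; exact: dW (Some j) _ Dq.
  - exact: Ho None Dq.
  - by move=> j; exact: Ho (Some j) Dq.
have sumz : \sum_j `|z s j 0 - z t j 0| <= N * ((`|d| + 1) * `|s - t|).
  have := sum_norm_le (z s - z t); under eq_bigr do rewrite !mxE.
  by move=> /le_trans; apply; rewrite ler_wpM2l.
have dotE : dotv (Wz t (z t)) d = \sum_j d j 0 * L (Some j).
  by rewrite /dotv; apply: eq_bigr => j _; rewrite mxE mulrC.
have lin : `|\sum_j (z s j 0 - z t j 0) * L (Some j) - (s - t) * \sum_j d j 0 * L (Some j)| <=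
    e1 * `|s - t| * \sum_j `|L (Some j)|.
  rewrite mulr_sumr -sumrB mulr_sumr (le_trans (ler_norm_sum _ _ _))// ler_sum// => j _.
  rewrite mulrA -mulrBl normrM ler_wpM2r// (le_trans _ hz)//.
  by have := le_mx_norm (z s - z t - (s - t) *: d) j 0; rewrite !mxE.
rewrite dotE -/(L None).
change (`|w (s, z s) - w (t, z t) - (s - t) * (L None + \sum_j d j 0 * L (Some j))| <= e * `|s - t|).
have -> : w (s, z s) - w (t, z t) - (s - t) * (L None + \sum_j d j 0 * L (Some j)) =
    (w (s, z s) - w (t, z t) - ((s - t) * L None + \sum_j (z s j 0 - z t j 0) * L (Some j)))
    + (\sum_j (z s j 0 - z t j 0) * L (Some j) - (s - t) * \sum_j d j 0 * L (Some j)) by ring.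
rewrite (le_trans (ler_normD _ _))//.
have h1 : e1 * (`|s - t| + \sum_j `|z s j 0 - z t j 0|) <=
    e1 * (`|s - t| + N * ((`|d| + 1) * `|s - t|)) by rewrite ler_pM2l// lerD2l.
have h2 : e1 * m * `|s - t| <= e * `|s - t|.
  by rewrite ler_wpM2r// (le_trans e1m)// ler_pdivrMr// ler_pMr// ler1n.
have h3 : e1 * m * `|s - t| = e1 * (`|s - t| + N * ((`|d| + 1) * `|s - t|))
    + e1 * `|s - t| * \sum_j `|L (Some j)| by rewrite /m; ring.
by move: inc lin h1 h2; rewrite h3; lra.
Qed.

End chain_rule.

Section lyapunov.
Context {R : realType} {n : nat}.
Local Notation V := 'cV[R]_n.
Variables (tp rho : R) (k U : R -> R) (W : R -> V -> R) (v0 : R).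
Local Notation D := ((`[tp, +oo[ : set R) `*` (exterior rho : set V))%classic.
Let Wt t z := derive_in D (fun p : R * V => W p.1 p.2) (t, z) (1, 0).
Let Wz t z : V := \col_j derive_in D (fun p : R * V => W p.1 p.2) (t, z) (0, delta_mx j 0).
Hypothesis ck : {within `[tp, +oo[, continuous k}.
Hypothesis cU : {within `]0, +oo[, continuous U}.
Hypothesis U0 : forall v, 0 < v -> 0 < U v.
Hypothesis W_C1 : Ck_time_space 1 D W.
Hypothesis v0_gt0 : 0 < v0.
Hypothesis int_oo : (\int[lebesgue_measure]_(v in `[v0, +oo[) ((U v)^-1)%:E = +oo)%E.
Hypothesis coercive : forall a b : R, tp <= a -> a < b -> forall M : R, exists K : R,
  forall t z, a <= t < b -> exterior rho z -> K <= enorm z -> M <= W t z.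

(* If |z| were to get large, W(t, z(t)) would cross [vm, v2] while |z| >= rho1, and the
   primitive of 1/U would grow by at most kM (T - t0) on the way. *)
Lemma lyapunov_bound (t0 T : R) (z0 : V) : tp <= t0 -> exists B, forall tau (z d : R -> V),
  t0 <= tau <= T -> z t0 = z0 ->
  (forall t, t0 <= t <= tau -> der `[t0, tau] z t (d t)) ->
  (forall t, t0 <= t <= tau -> rho <= enorm (z t) ->
     Wt t (z t) + dotv (Wz t (z t)) (d t) <= k t * U (W t (z t))) ->
  forall t, t0 <= t <= tau -> `|z t| <= B.
Proof.
(* The curve starts within norm [rho1], and beyond [rho1] it is strictly outside the ball of radius
   [rho], as the chain rule requires. *)
move=> t0_ge; pose rho1 := Num.max rho (enorm z0) + 1.
have rho1_gt : rho < rho1 by rewrite ltr_pwDr// le_max lexx.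
have z0_rho1 : enorm z0 <= rho1 by rewrite (@le_trans _ _ (Num.max rho (enorm z0)))// ?le_max ?lexx ?orbT// lerDl.
have cW : {within D, continuous (fun p : R * V => W p.1 p.2)} by case: W_C1.
pose K : set (R * V) := ((`[t0, T] `*` [set z | `|z| <= rho1]) `&` [set p : R * V | rho <= enorm p.2])%classic.
have compactK : compact K.
  apply: compact_closedI.
    by apply: compact_setX; [exact: segment_compact|exact: compact_ball_mx].
  have cE : continuous (fun p : R * V => enorm p.2).
    move=> p U' HU; have HU' : nbhs p.2 [set y | U' (enorm y)] := @enorm_continuous R n p.2 _ HU.
    exact: (cvg_snd HU').
  apply: (@closed_comp _ _ (fun p : R * V => enorm p.2) [set x | rho <= x]).
    by move=> p _; exact: cE.
  exact: closed_ge.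
have KD : K `<=` D.
  move=> [t z] [[/= + _] zr]; rewrite in_itv/= => /andP[t0t _].
  by split=> //; rewrite /= in_itv/= andbT (le_trans t0_ge).
have [vm0 vm0_gt0 HK] := compact_continuous_bounded compactK (continuous_subspaceW KD cW).
(* [vm] dominates W on a compact set containing all points of Euclidean norm [rho1], and is at least
   v0, from where on the primitive H has derivative 1 / U. *)
pose vm := vm0 + v0.
have v0vm : v0 <= vm by rewrite lerDr ltW.
have vm_gt0 : 0 < vm by exact: lt_le_trans v0vm.
have [kM kM0 HkM] := compact_continuous_bounded (@segment_compact _ t0 T)
  (continuous_subspaceW (@segment_ray _ tp t0 T t0_ge) ck).
have [H [dH Hunb]] := primitive_unbounded v0_gt0 cU U0 int_oo.
(* From [vm] to [v2] the primitive grows by more than kM (T - t0), too much for the time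
   available. *)
have [v2 vmv2 Hv2] := Hunb vm (kM * (T - t0)) v0vm.
have [Tt0|t0T] := ltP T t0.
  exists 0 => tau z d /andP[h1 h2]; by have := le_trans h1 h2; rewrite leNgt Tt0.
have t0T1 : t0 < T + 1 by rewrite (le_lt_trans t0T)// ltrDl.
have [Kb HKb] := coercive t0_ge t0T1 v2.
exists (Num.max Kb rho1) => tau z d /andP[t0tau tauT] zt0 dz ineq t1 /andP[t0t1 t1tau].
rewrite leNgt; apply/negP; rewrite gt_max => /andP[Kz rz].
have zn := norm_le_enorm (z t1).
have cz : {within `[t0, tau], continuous z}.
  by apply: (@der_continuous _ _ _ _ d) => t; rewrite /= in_itv; exact: dz.
have sub (a b a' b' : R) : a' <= a -> b <= b' -> (`[a, b] `<=` `[a', b'])%classic.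
  by move=> h1 h2 x; rewrite /= !in_itv/= => /andP[? ?]; apply/andP; split; lra.
have cen : {within `[t0, t1], continuous (fun s => enorm (z s))}.
  apply: within_continuous_cvg => t tI.
  have tI' : `[t0, tau]%classic t by exact: sub tI.
  apply: (@cvg_within_comp _ _ _ `[t0, t1]%classic setT z (@enorm R n)) => //.
    by apply: (within_cvg (continuous_subspaceW (sub _ _ _ _ (lexx t0) t1tau) cz)).
  by apply: cvg_at_within; exact: enorm_continuous.
have e0 : enorm (z t0) <= rho1 by rewrite zt0.
have e1 : rho1 <= enorm (z t1) by rewrite (le_trans (ltW rz)).
(* After its last passage through norm [rho1] the curve stays where W can be differentiated along
   it. *)
have [sig /andP[t0s st1] [zsig Hsig]] := last_hitting t0t1 cen e0 e1.
pose v s := W s (z s).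
have ext s : sig <= s <= t1 -> rho < enorm (z s).
  by move=> sI; exact: lt_le_trans (Hsig s sI).
have dv (a b s : R) : sig <= a -> b <= t1 -> a <= s <= b ->
    der `[a, b] v s (Wt s (z s) + dotv (Wz s (z s)) (d s)).
  move=> sa bt sI; have /andP[as_ sb] := sI.
  apply: (der_along_curve W_C1) => //.
  - by rewrite (le_trans t0_ge)// (le_trans t0s).
  - by apply: ext; rewrite (le_trans sa as_) (le_trans sb bt).
  - apply: der_subset (dz s _); last by rewrite (le_trans t0s (le_trans sa as_)) (le_trans sb (le_trans bt t1tau)).
    by apply: sub; [exact: le_trans sa|exact: le_trans t1tau].
have cv (a b : R) : sig <= a -> b <= t1 -> {within `[a, b], continuous v}.
  move=> sa bt; apply: (@der_continuous _ _ _ _ (fun s => Wt s (z s) + dotv (Wz s (z s)) (d s))) => s.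
  by rewrite /= in_itv; exact: dv.
have vsig : v sig <= vm.
  have : `|W sig (z sig)| <= vm0.
    apply: (HK (sig, z sig)); split; last by rewrite /= zsig ltW.
    split; first by rewrite /= in_itv/= t0s (le_trans st1 (le_trans t1tau tauT)).
    by rewrite /= (le_trans (norm_le_enorm _))// zsig.
  by move=> /(le_trans (ler_norm _)) h; rewrite /v (le_trans h)// lerDl ltW.
have vt1 : v2 <= v t1.
  apply: HKb.
  - by rewrite t0t1/= (le_lt_trans (le_trans t1tau tauT))// ltrDl.
  - by rewrite /exterior/= ltW// ext// st1 lexx.
  - by rewrite (le_trans (ltW Kz)).
have vsig2 : v sig <= v2 by rewrite (le_trans vsig)// ltW.
have [t2 /andP[st2 t2t1] [vt2 Ht2]] := first_hitting st1 (cv _ _ (lexx _) (lexx _)) vsig2 vt1.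
have vmt2 : vm <= v t2 by rewrite vt2 ltW.
(* Between the last passage through [vm] and the first one through [v2] the values of W stay above
   v0. *)
have [s2 /andP[ss2 s2t2] [vs2 Hs2]] := last_hitting st2 (cv _ _ (lexx _) t2t1) vsig vmt2.
(* By the Lyapunov inequality H (v s) has derivative at most k s <= kM, so [w] is nondecreasing;
   this contradicts the choice of [v2]. *)
pose w s := kM * s - H (v s).
have dw s : s2 <= s <= t2 -> der `[s2, t2] w s
    (kM - (Wt s (z s) + dotv (Wz s (z s)) (d s)) * (U (v s))^-1).
  move=> sI; apply: derB.
    have := derM (der_cst `[s2, t2] s (kM : R)) (der_id `[s2, t2] s).
    by rewrite mul0r add0r mulr1.
  apply: der_comp; first by rewrite /= in_itv.
    by apply: dH; apply: le_trans v0vm _; exact: Hs2.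
  exact: dv.
have w_mono : w s2 <= w t2.
  apply: (der_nondecreasing s2t2 dw) => s sI; have /andP[s2s st2'] := sI.
  have vs : vm <= v s by exact: Hs2.
  have Uv : 0 < U (v s) by rewrite U0// (lt_le_trans vm_gt0).
  have sI0 : t0 <= s <= tau.
    by rewrite (le_trans t0s (le_trans ss2 s2s)) (le_trans st2' (le_trans t2t1 t1tau)).
  have h1 : Wt s (z s) + dotv (Wz s (z s)) (d s) <= k s * U (v s).
    apply: ineq => //; apply: ltW; apply: ext.
    by rewrite (le_trans ss2 s2s) (le_trans st2' t2t1).
  rewrite subr_ge0 ler_pdivrMr// (le_trans h1)// ler_pM2r//.
  have /andP[a1 a2] := sI0.
  have ks : `|k s| <= kM by apply: HkM; rewrite /= in_itv/= a1 (le_trans a2 tauT).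
  exact: le_trans (ler_norm _) ks.
move: w_mono; rewrite /w vs2 vt2 => w_mono.
have : kM * (t2 - s2) <= kM * (T - t0).
  rewrite ler_pM2l// lerB// ?(le_trans t0s ss2)//.
  exact: le_trans t2t1 (le_trans t1tau tauT).
rewrite mulrBr; move: w_mono Hv2; lra.
Qed.

End lyapunov.

(** * From the reduced equation back to the original one *)

Section reduction.
Context {R : realType} {n : nat}.
Local Notation V := 'cV[R]_n.
Variables (A B A' B' P Q P' : R -> 'M[R]_n) (tp : R).
Local Notation J := (`[tp, +oo[%classic).
Hypothesis St : forall t, tp <= t -> splitting (A t) (B t) (P t) (Q t).
Hypothesis dA : forall t, tp <= t -> der J A t (A' t).
Hypothesis dB : forall t, tp <= t -> der J B t (B' t).
Hypothesis cA' : {within J, continuous A'}.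
Hypothesis cB' : {within J, continuous B'}.
Hypothesis cP : {within J, continuous P}.
Hypothesis P'E : forall t, tp <= t -> P' t = proj_der A B P Q A' B' t.
Local Notation M := (algebraic_of A B P Q).
Local Notation Dr := (drift_of A B A' P Q P').
Local Notation Fo := (forcing_of A B P Q).

Let dP := derP St dA dB cP P'E.

Lemma der_proj_split t : tp <= t -> P' t = P' t *m P t + P t *m P' t.
Proof.
move=> tt; apply: (der_unique (limit_pt_ray tt) (dP tt)).
apply: der_eq (der_mulmx (dP tt) (dP tt)) => [|s]; first by rewrite /= in_itv/= andbT.
by rewrite /= in_itv/= andbT => /St[].
Qed.

(** Comes from (1 - P) G^-1 = G^-1 (1 - Q) and from P' = P' P + P P'; it supplies the equation
    satisfied by (1 - P) z. *)
Lemma complement_drift t : tp <= t ->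
  (1%:M - P t) *m Dr t = P' t *m P t /\ (1%:M - P t) *m Fo t = 0.
Proof.
move=> tt; have S := St tt; have [PP _ _ _ _] := S.
have PF : (1%:M - P t) *m Fo t = 0.
  rewrite /forcing_of mulmxA (split_P2Gi S) -mulmxA (mulmxBl _ (Q t)) mul1mx (split_QQ S).
  by rewrite subrr mulmx0.
split=> //; rewrite /drift_of -/(Fo t) mulmxA mulmxBr [X in _ - X]mulmxA PF mul0mx subr0.
have -> : (1%:M - P t) *m P' t = P' t *m P t.
  by rewrite mulmxBl mul1mx {1}(der_proj_split tt) addrK.
by rewrite -mulmxA PP.
Qed.

(** The defect y = (1 - P) z solves the homogeneous linear equation y' = - P' y, whatever the
    forcing, and vanishes initially. *)
Lemma range_invariant (t0 tau : R) (z y : R -> V) : tp <= t0 ->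
  (forall t, t0 <= t <= tau -> der `[t0, tau] z t (Dr t *m z t + Fo t *m y t)) ->
  P t0 *m z t0 = z t0 -> forall t, t0 <= t <= tau -> P t *m z t = z t.
Proof.
move=> t0_ge dz Pz0 t tI.
have tpt s : t0 <= s <= tau -> tp <= s by move=> /andP[? _]; exact: le_trans t0_ge _.
have bP' : bounded_on t0 tau P'.
  apply: bounded_continuous; apply: (continuous_subspaceW (@segment_ray _ tp t0 tau t0_ge)).
  apply: within_continuous_cvg => s; rewrite /= in_itv/= andbT => ts.
  exact: (cvg_P' St dA dB cA' cB' cP P'E ts).
have [C C0 HC] := bounded_pos bP'.
have : (1%:M - P t) *m z t = 0.
  apply: (@gronwall_zero _ _ _ (fun s => (1%:M - P s) *m z s)
    (fun s => - (P' s *m ((1%:M - P s) *m z s))) t0 tau (n%:R * C)) => //.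
  - move=> s sI; have ts := tpt s sI; have [PD PF] := complement_drift ts.
    have dPs := der_subset (@segment_ray _ tp t0 tau t0_ge) (dP ts).
    have := der_mulmx (derB (der_cst `[t0, tau] s (1%:M : 'M[R]_n)) dPs) (dz s sI).
    congr (der _ _ _ _).
    rewrite mulmxDr (mulmxA (1%:M - P s) (Fo s)) PF mul0mx addr0 (mulmxA (1%:M - P s) (Dr s)) PD.
    rewrite sub0r mulNmx (mulmxBl 1%:M (P s)) mul1mx mulmxBr opprB mulmxA addrC.
    by [].
  - by rewrite mulmxBl mul1mx Pz0 subrr.
  - by move=> s sI; rewrite normrN; exact: mulmx_le (HC s sI) (lexx _).
by rewrite mulmxBl mul1mx => /eqP; rewrite subr_eq0 => /eqP.
Qed.

(** From A = G P and P P' P = 0 one gets A (Dr z + Fo w) = Q (w - (A' + B) z), and from G P2 = B P2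
    one gets B u = (1 - Q) (w - A' z). The two add up by Q B z = B z. *)
Lemma reduced_equation t (z u w : V) : tp <= t -> P t *m z = z -> (1%:M - P t) *m u = u ->
  u = M t *m (w - A' t *m z) ->
  A' t *m z + A t *m (Dr t *m z + Fo t *m w) = w - B t *m (z + u).
Proof.
move=> tt Pz Pu uE; have S := St tt; have [PP AP QA BP Gu] := S.
have PPP z' : P t *m (P' t *m (P t *m z')) = 0.
  have h : P t *m P' t *m P t = P t *m P' t *m P t + P t *m P' t *m P t.
    by rewrite {1}(der_proj_split tt) mulmxDr mulmxDl -!mulmxA PP (mulmxA (P t) (P t)) PP.
  have {}h : P t *m P' t *m P t = 0.
    by have := congr1 (fun Y => Y - P t *m P' t *m P t) h; rewrite subrr addrK.
  by rewrite !mulmxA h mul0mx.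
set Gt := A t + B t *m (1%:M - P t) in Gu.
have GFo : Gt *m Fo t = Q t by rewrite /forcing_of mulmxA mulmxV// mul1mx.
have GM : Gt *m M t = 1%:M - Q t by rewrite /algebraic_of mulmxA mulmxV// mul1mx.
have PFo : P t *m Fo t = Fo t.
  have [_] := complement_drift tt; rewrite mulmxBl mul1mx => /eqP.
  by rewrite subr_eq0 => /eqP.
have Drz : Dr t *m z = P' t *m (P t *m z) - Fo t *m ((A' t + B t) *m z).
  by rewrite /drift_of -/(Fo t) -mulmxA Pz mulmxBl mulmxA.
have AD : A t *m (Dr t *m z + Fo t *m w) = Q t *m (w - (A' t + B t) *m z).
  rewrite -{1}(split_GP S) -/Gt -mulmxA -[in RHS]GFo -[RHS]mulmxA; congr (Gt *m _).
  rewrite Drz !mulmxDr PPP add0r mulmxN !(mulmxA (P t) (Fo t)) PFo mulmxN.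
  by rewrite addrC.
have Bu : B t *m u = (1%:M - Q t) *m (w - A' t *m z).
  by rewrite -{1}Pu mulmxA -(split_GP2 S) -/Gt -mulmxA Pu {1}uE mulmxA GM.
have QBz : Q t *m (B t *m z) = B t *m z by rewrite mulmxA -BP -mulmxA Pz.
rewrite AD (mulmxDr (B t)) Bu (mulmxDl (A' t)) (mulmxBr (Q t)) (mulmxDr (Q t)) QBz.
rewrite (mulmxBl 1%:M (Q t)) mul1mx (mulmxBr (Q t)).
move: (A' t *m z) (B t *m z) => a b; move: (Q t *m a) (Q t *m w) => qa qw.
by apply/matrixP => i j; rewrite !mxE; ring.
Qed.

(** A x = A z because A (1 - P) = 0; hence A x is continuously differentiable although u is only
    continuous. *)
Lemma reduced_solution (f : R -> V -> V) (z u : R -> V) (t0 : R) : tp <= t0 ->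
  {within J `*` [set: V], continuous (fun p : R * V => f p.1 p.2)} ->
  let x t := z t + u t in
  {within `[t0, +oo[, continuous x} ->
  (forall t, t0 <= t -> der `[t0, +oo[ z t (Dr t *m z t + Fo t *m f t (x t))) ->
  (forall t, t0 <= t -> P t *m z t = z t) ->
  (forall t, t0 <= t -> (1%:M - P t) *m u t = u t) ->
  (forall t, t0 <= t -> u t = M t *m (f t (x t) - A' t *m z t)) ->
  is_solution A B f `[t0, +oo[ x.
Proof.
move=> t0_ge cf x cx dz Pz Pu uE.
have J0 t : t0 <= t -> `[t0, +oo[%classic t by rewrite /= in_itv/= andbT.
have J0E t : `[t0, +oo[%classic t -> t0 <= t by rewrite /= in_itv/= andbT.
have sub : (`[t0, +oo[ `<=` J)%classic.
  by move=> s; rewrite /= !in_itv/= !andbT; exact: le_trans.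
have dAx t : t0 <= t -> der `[t0, +oo[ (fun s => A s *m x s) t (f t (x t) - B t *m x t).
  move=> t0t; have tt := le_trans t0_ge t0t.
  rewrite -(reduced_equation tt (Pz t t0t) (Pu t t0t) (uE t t0t)).
  apply: der_eq (der_mulmx (der_subset sub (dA tt)) (dz t t0t)) => [|s /J0E t0s].
    exact: J0.
  by rewrite /x mulmxDr -(Pu s t0s) mulmxA (split_AP2 (St (le_trans t0_ge t0s))) mul0mx addr0.
have ddtE t : t0 <= t -> ddt `[t0, +oo[ (fun s => A s *m x s) t = f t (x t) - B t *m x t.
  by move=> t0t; have [] := der_ddt (limit_pt_ray t0t) (dAx t t0t).
split=> //.
- split; first by apply: (@der_continuous _ _ _ _ (fun t => f t (x t) - B t *m x t)) => t /J0E; exact: dAx.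
  move=> _ ->; split=> [t /J0E t0t|].
    by have [] := der_ddt (limit_pt_ray t0t) (dAx t t0t).
  split=> //; apply: within_continuous_cvg => t /J0E t0t; have tt := le_trans t0_ge t0t.
  rewrite -/(ddt _ _ _) ddtE//.
  apply: (within_cvg_eq (g := fun t => f t (x t) - B t *m x t)).
    by move=> s /J0E; exact: ddtE.
  have cxt : x s @[s --> within `[t0, +oo[ (nbhs t)] --> x t by apply: within_cvg => //; exact: J0.
  have cBt : B s @[s --> within `[t0, +oo[ (nbhs t)] --> B t by exact: der_cvg (der_subset sub (dB tt)).
  have cft : (fun s => f s (x s)) @ within `[t0, +oo[ (nbhs t) --> f t (x t).
    apply: (@cvg_within_comp _ _ _ `[t0, +oo[%classic (J `*` [set: V]) (fun s : R => (s, x s))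
      (fun p : R * V => f p.1 p.2)).
    - by move=> s /sub Js; split.
    - by apply: cvg_pairl => //; apply: cvg_at_within; exact: cvg_id.
    - by move/subspace_continuousP: cf; apply; split => //=; rewrite in_itv/= andbT.
  exact: (cvg_sub cft (cvg_mulmx cBt cxt)).
- by move=> t /J0E t0t; rewrite ddtE// subrK.
Qed.

End reduction.

Lemma reduced_rhs_range {R : realType} {n : nat} (P : R -> 'M[R]_n) f eta Dr Fo t z :
  P t *m z = z -> (1%:M - P t) *m eta t z = eta t z ->
  reduced_rhs P f eta Dr Fo t z = Dr t *m z + Fo t *m f t (z + eta t z).
Proof. by rewrite /reduced_rhs => -> ->. Qed.

Lemma drift_of_range {R : realType} {n : nat} (A B A' P Q P' : R -> 'M[R]_n) t (z : 'cV[R]_n) :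
  P t *m z = z -> drift_of A B A' P Q P' t *m z =
  (P' t - invmx (A t + B t *m (1%:M - P t)) *m Q t *m (A' t + B t)) *m z.
Proof. by move=> Pz; rewrite /drift_of -mulmxA Pz. Qed.

Theorem theorem3p2 (R : realType) (n : nat) (tp : R)
  (A B : R -> 'M[R]_n) (f : R -> 'cV[R]_n -> 'cV[R]_n) (C1 C2 : R -> R)
  (tp_ge0 : 0 <= tp)
  (f_cont : {within `[tp, +oo[ `*` [set: 'cV[R]_n],
               continuous (fun p : R * 'cV[R]_n => f p.1 p.2)})
  (f_diff : forall t x, tp <= t -> differentiable (f t) x)
  (dfdx_cont : {within `[tp, +oo[ `*` [set: 'cV[R]_n],
               continuous (fun p : R * 'cV[R]_n => Jac (f p.1) p.2)})
  (A_C1 : Ck_time 1 `[tp, +oo[ A)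
  (B_C1 : Ck_time 1 `[tp, +oo[ B)
  (reg : forall t, tp <= t -> regular_pencil A B t)
  (C1_gt0 : forall t, tp <= t -> 0 < C1 t)
  (C2_gt0 : forall t, tp <= t -> 0 < C2 t)
  (C2_C1 : Ck_time 1 `[tp, +oo[ C2)
  (resolvent_bound : forall t (lam : R[i]), tp <= t ->
     real_complex R (C2 t) <= `|lam| ->
     pencil A B t lam \in unitmx /\
     opnormC (invmx (pencil A B t lam)) <= C1 t) :
  let P1 := P1 A B C2 in
  let P2 := P2 A B C2 in
  let Q1 := Q1 A B C2 in
  let X1 := X1 A B C2 in
  let X2 := X2 A B C2 in
  let G := G A B C2 in
  let Phi := Phi (A := A) (B := B) (C2 := C2) f in
  let L := consistency_manifold A B C2 f tp in
  let A' := ddt `[tp, +oo[ A in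
  let P1' := ddt `[tp, +oo[ P1 in
  forall
  (cond1 :
    ((forall t xp1, tp <= t -> xp1 \in X1 t ->
        exists! xp2, xp2 \in X2 t /\ L (t, xp1 + xp2))
     /\
     (forall t xp1 (xp2 : subvs_of (X2 t)), tp <= t -> xp1 \in X1 t ->
        L (t, xp1 + vsval xp2) ->
        bijective (Phi t xp1 xp2)))
    \/
    ((forall t xp1, tp <= t -> xp1 \in X1 t ->
        exists xp2, xp2 \in X2 t /\ L (t, xp1 + xp2))
     /\
     (forall t xp1 (x1 x2 : subvs_of (X2 t)), tp <= t -> xp1 \in X1 t ->
        L (t, xp1 + vsval x1) -> L (t, xp1 + vsval x2) ->
        basis_invertible (Phi t xp1) (segment x1 x2))))
  (cond2 :
    exists (k U : R -> R) (rho : R) (V : R -> 'cV[R]_n -> R),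
      let D := `[tp, +oo[ `*` exterior rho in
      let V_t t z := derive_in D (fun p => V p.1 p.2) (t, z) (1, 0) in
      let V_z t z : 'cV[R]_n :=
        \col_j derive_in D (fun p => V p.1 p.2) (t, z) (0, delta_mx j 0) in
      {within `[tp, +oo[, continuous k} /\
      {within `]0, +oo[, continuous U} /\
      (forall v, 0 < v -> 0 < U v) /\
      0 < rho /\
      Ck_time_space 1 D V /\
      (exists W : 'cV[R]_n -> R,
         [/\ {within exterior rho, continuous W},
             forall z, exterior rho z -> 0 < W z
           & forall t z, tp <= t -> exterior rho z -> W z <= V t z]) /\
      (exists2 v0 : R, 0 < v0 &
         (\int[lebesgue_measure]_(v in `[v0, +oo[) ((U v)^-1)%:E = +oo)%E) /\
      (forall a b : R, tp <= a -> a < b -> forall M : R, exists K : R,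
         forall t z, a <= t < b -> exterior rho z -> K <= enorm z ->
           M <= V t z) /\
      (forall t xp1 xp2, tp <= t -> xp1 \in X1 t -> xp2 \in X2 t ->
         L (t, xp1 + xp2) -> rho <= enorm xp1 ->
         V_t t xp1
         + dotv (V_z t xp1)
             ((P1' t - invmx (G t) *m Q1 t *m (A' t + B t)) *m xp1
              + invmx (G t) *m Q1 t *m f t (xp1 + xp2))
         <= k t * U (V t xp1)))
  (t0 T : R) (x0 : 'cV[R]_n)
  (t0_ge : tp <= t0) (T_gt : t0 < T)
  (Phi_inv : forall t (z u : 'cV[R]_n), t0 <= t <= T ->
     bijective (Phi t (P1 t *m z) (vsproj (X2 t) (P2 t *m u))))
  (A_C3 : Ck_time 3 `[t0, T] A)
  (B_C3 : Ck_time 3 `[t0, T] B)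
  (C2_C3 : Ck_time 3 `[t0, T] C2)
  (f_C2 : Ck_time_space 2 (`[t0, T] `*` [set: 'cV[R]_n]) f)
  (x0_consistent : L (t0, x0)),
  (exists x : R -> 'cV[R]_n, is_solution A B f `[t0, +oo[ x /\ x t0 = x0) /\
  (forall x : R -> 'cV[R]_n, is_solution A B f `[t0, +oo[ x -> x t0 = x0 ->
     (fun N : nat => max_error A B C2 f tp t0 T x0 N x)
       =O_\oo (fun N : nat => mesh t0 T N ^+ 2)).
Proof.
move=> P1 P2 Q1 X1 X2 G Phi L A' P1' cond1 cond2 t0 T x0 t0_ge T_gt Phi_inv A_C3 B_C3 C2_C3 f_C2 x0_L.
split; last exact: (numerical_convergence f_diff dfdx_cont A_C1 B_C1 C2_C1 C2_gt0 resolvent_bound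
  t0_ge T_gt Phi_inv A_C3 B_C3 f_C2).
have St := dae_splitting C2_gt0 resolvent_bound.
have dA := dae_derA A_C1; have dB := dae_derB B_C1.
have cA' := dae_contA' A_C1; have cB' := dae_contB' B_C1.
have cP := dae_contP A_C1 B_C1 C2_C1 C2_gt0 resolvent_bound.
have P'E := dae_P'E A_C1 B_C1 C2_C1 C2_gt0 resolvent_bound.
have rootP := algebraic_rootP f_diff C2_gt0 resolvent_bound cond1.
pose M := algebraic_of A B P1 Q1.
have ex t z (tt : tp <= t) : exists u, algebraic_root A B C2 f tp t z u.
  by have [] := rootP t z tt.
(* The value 0 before [tp] is a convention; a root is chosen only at times where one is known to
   exist. *)
pose eta t z := if pselect (tp <= t) is left le_t then projT1 (cid (ex t z le_t)) else 0.
have etaR t z : tp <= t -> algebraic_root A B C2 f tp t z (eta t z).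
  by move=> tt; rewrite /eta; case: pselect => // tt'; exact: (projT2 (cid (ex t z tt'))).
have eta_root t z : tp <= t -> eta t z - M t *m (f t (P1 t *m z + (1%:M - P1 t) *m eta t z)
    - A' t *m (P1 t *m z)) = 0.
  by move=> tt; apply/eqP; rewrite subr_eq0; apply/eqP; exact: etaR.
have eta_unique t z u : tp <= t -> u - M t *m (f t (P1 t *m z + (1%:M - P1 t) *m u)
    - A' t *m (P1 t *m z)) = 0 -> u = eta t z.
  move=> tt /eqP; rewrite subr_eq0 => /eqP uE; have [_ H _ _ _] := rootP t z tt.
  by apply: H; [exact: uE|exact: etaR].
have S_unit t z : tp <= t -> 1%:M - M t *m Jac (f t) (P1 t *m z + (1%:M - P1 t) *m eta t z)
    *m (1%:M - P1 t) \in unitmx.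
  by move=> tt; have [_ _ _ _ H] := rootP t z tt; apply: H; exact: etaR.
have cM t : tp <= t -> M s @[s --> within `[tp, +oo[ (nbhs t)] --> M t.
  by move=> tt; exact: (cvg_algebraic_of St dA dB cP P'E tt).
have tJ t : tp <= t -> `[tp, +oo[%classic t by rewrite /= in_itv/= andbT.
have cA't t : tp <= t -> A' s @[s --> within `[tp, +oo[ (nbhs t)] --> A' t.
  by move=> tt; exact: (within_cvg cA' (tJ t tt)).
have cPt t : tp <= t -> P1 s @[s --> within `[tp, +oo[ (nbhs t)] --> P1 t.
  by move=> tt; exact: (within_cvg cP (tJ t tt)).
pose Dr := drift_of A B A' P1 Q1 P1'; pose Fo := forcing_of A B P1 Q1.
have cDr t : tp <= t -> Dr s @[s --> within `[tp, +oo[ (nbhs t)] --> Dr t.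
  by move=> tt; exact: (cvg_drift_of St dA dB cA' cB' cP P'E tt).
have cFo t : tp <= t -> Fo s @[s --> within `[tp, +oo[ (nbhs t)] --> Fo t.
  by move=> tt; exact: (cvg_forcing_of St dA dB cP P'E tt).
pose g := reduced_rhs P1 f eta Dr Fo.
have cg := reduced_rhs_continuous cM cA't cPt f_cont f_diff dfdx_cont eta_root eta_unique S_unit cDr cFo.
have lg := reduced_rhs_lipschitz cM cA't cPt f_cont f_diff dfdx_cont eta_root eta_unique S_unit cDr cFo.
have ceta := eta_continuous cM cA't cPt f_cont f_diff dfdx_cont eta_root eta_unique S_unit.
have PPt0 : P1 t0 *m (P1 t0 *m x0) = P1 t0 *m x0.
  have [PP _ _ _ _] := St t0 t0_ge.
  exact: etrans (mulmxA _ _ _) (congr1 (mulmx^~ x0) PP).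
have etaX t z : tp <= t -> (1%:M - P1 t) *m eta t z = eta t z.
  by move=> tt; have [_ _ H _ _] := rootP t z tt; apply: H; exact: etaR.
have [] := @global_solution R n tp t0 g (P1 t0 *m x0) t0_ge cg lg.
  move=> T'.
  have [k [U [rho [W /= [ck [cU [U0 [_ [W_C1 [_ [[v0 v00 int_oo] [coercive ineq]]]]]]]]]]]] := cond2.
  have [B' HB] := lyapunov_bound ck cU U0 W_C1 v00 int_oo coercive T' (P1 t0 *m x0) t0_ge.
  exists B' => tau z tauI [zt0 dz].
  have Pz : forall t, t0 <= t <= tau -> P1 t *m z t = z t.
    apply: (range_invariant St dA dB cA' cB' cP P'E t0_ge (y := fun t => f t (P1 t *m z t
      + (1%:M - P1 t) *m eta t (z t)))); first exact: dz.
    by rewrite zt0.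
  apply: (HB tau z (fun t => g t (z t))) => // t tI rz.
  have tt : tp <= t by move: tI => /andP[h _]; exact: le_trans t0_ge h.
  have [_ _ _ HL _] := rootP t (z t) tt.
  (* The point z + eta is consistent, so the Lyapunov inequality is available with xp1 = z t and xp2
     = eta t (z t). *)
  have := ineq t (z t) (eta t (z t)) tt.
  rewrite (mem_X1 C2_gt0 resolvent_bound _ tt) (mem_X2 C2_gt0 resolvent_bound _ tt).
  rewrite (Pz t tI) (etaX t (z t) tt) !eqxx => /(_ isT isT).
  rewrite -{1}(Pz t tI) => /(_ (HL _ (etaR t (z t) tt)) rz).
  have -> : g t (z t) = (P1' t - invmx (G t) *m Q1 t *m (A' t + B t)) *m z t
      + invmx (G t) *m Q1 t *m f t (z t + eta t (z t)).
    apply: (etrans (reduced_rhs_range f Dr Fo (Pz t tI) (etaX t (z t) tt))).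
    exact: (congr1 (+%R^~ _) (drift_of_range A B A' Q1 P1' (Pz t tI))).
  exact.
move=> z [zt0 dz].
have Pz t : t0 <= t -> P1 t *m z t = z t.
  move=> t0t; apply: (range_invariant St dA dB cA' cB' cP P'E t0_ge (tau := t) (y := fun t => f t (P1 t *m z t
      + (1%:M - P1 t) *m eta t (z t)))).
  - move=> s sI; apply: der_subset (dz s _); last by move: sI => /andP[].
    by move=> r; rewrite /= !in_itv/= andbT => /andP[].
  - by rewrite zt0.
  - by rewrite t0t lexx.
pose u t := eta t (z t).
have tpt t : t0 <= t -> tp <= t by exact: le_trans.
exists (fun t => z t + u t); split; last first.
  (* Consistency of [x0] says that P2 x0 is a root for P1 x0; by uniqueness it is the value of
     [eta], and the two components add up to [x0]. *)
  rewrite zt0 /u zt0 -(eta_unique t0 (P1 t0 *m x0) ((1%:M - P1 t0) *m x0)) //.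
    by rewrite mulmxBl mul1mx addrC subrK.
  have := (consistencyP f C2_gt0 resolvent_bound x0 t0_ge).1 x0_L.
  have xE : P1 t0 *m (P1 t0 *m x0) + (1%:M - P1 t0) *m ((1%:M - P1 t0) *m x0) = x0.
    have P2E : (1%:M - P1 t0) *m ((1%:M - P1 t0) *m x0) = (1%:M - P1 t0) *m x0.
      exact: etrans (mulmxA _ _ _) (congr1 (mulmx^~ x0) (split_P2P2 (St t0 t0_ge))).
    by rewrite PPt0 P2E mulmxBl mul1mx addrC subrK.
  by move=> E; rewrite xE PPt0 E subrr.
apply: (reduced_solution St dA dB cP P'E t0_ge f_cont (z := z) (u := u)).
- have cz t : t0 <= t -> z s @[s --> within `[t0, +oo[ (nbhs t)] --> z t.
    by move=> /dz; exact: der_cvg.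
  apply: within_continuous_cvg => t; rewrite /= in_itv/= andbT => t0t.
  have cu : u s @[s --> within `[t0, +oo[ (nbhs t)] --> u t.
    apply: (@cvg_within_comp _ _ _ `[t0, +oo[%classic (`[tp, +oo[ `*` [set: 'cV[R]_n])
      (fun s : R => (s, z s)) (fun p : R * 'cV[R]_n => eta p.1 p.2)).
    + by move=> s; rewrite /= in_itv/= andbT => /tpt ts; split => //; exact: tJ.
    + by apply: cvg_pairl; [apply: cvg_at_within; exact: cvg_id|exact: cz].
    + by move/subspace_continuousP: ceta; apply; split => //; exact/tJ/tpt.
  exact: (cvg_add (cz t t0t) cu).
- move=> t t0t; have := dz t t0t.
  by rewrite /g (reduced_rhs_range f Dr Fo (Pz t t0t) (etaX t (z t) (tpt t t0t))).
- exact: Pz.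
- by move=> t /tpt tt; exact: etaX.
- move=> t t0t; have := etaR t (z t) (tpt t t0t).
  by rewrite /algebraic_root (Pz t t0t) (etaX t (z t) (tpt t t0t)).
Qed.
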